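(* Let $G=\mathrm{SL}(2,\mathbb{R})$, $f\in C_c^\infty(G)$, $g\in G$, and let $y>0$ with $y\notin\mathbb{Z}$. For $\zeta\in\mathbb{C}$ with $\Im\zeta>0$, the resolvent $\mathrm{R}(\zeta^2+1)$ of the positive Laplace operator (projected to the continuous spectrum, normalized as in the context) satisfies $$\begin{aligned}\left(\mathrm{R}(\zeta^2+1)f\right)(g)=\;&\frac12\int_{\mathbb{R}-iy}\frac{1}{\lambda-\zeta}\left(\Theta^0_{i\lambda}\ast f\right)(g)\tanh\left(\frac{\pi\lambda}{2}\right)d\lambda+\frac12\int_{\mathbb{R}-iy}\frac{1}{\lambda-\zeta}\left(\Theta^1_{i\lambda}\ast f\right)(g)\coth\left(\frac{\pi\lambda}{2}\right)d\lambda\\&+\frac{i}{\zeta}\left(\Theta^1_0\ast f\right)(g)+2i\sum_{\substack{l\in\mathbb{Z},\ l\ge1\\ l<y}}\frac{1}{il+\zeta}\left(\Theta^{\delta(l)}_l\ast f\right)(g).\end{aligned}$$ This formula gives a meromorphic continuation of the resolvent to the half-plane $\{\zeta\in\mathbb{C}\mid\Im\zeta>-y\}$ above $\mathbb{R}-iy$, with simple poles at $\zeta=-il$, where $l\in\mathbb{Z}$, $0\le l<y$. Letting $y\to+\infty$ and setting $S=\{(z,\zeta)\in\mathbb{C}^2\mid z=\zeta^2+1\}$, the resolvent extends meromorphically from $S^+=\{(z,\zeta)\in S\mid\Im(\zeta)>0\}$ to $S$, with simple poles at the points $(1-l^2,-il)$, $l\in\mathbb{Z}$, $l\ge0$. These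 poles are the resonances of the Laplace operator.
   Context: Let $M=\{\pm I_2\}$, $A=\{\mathrm{diag}(t,t^{-1})\mid t>0\}$, $N$ the upper triangular unipotent subgroup of $G$. Write $\hat M=\{0,1\}$, with $0$ the trivial and $1$ the non-trivial character. For $\lambda\in\mathbb{C}$ and $\delta\in\hat M$, $\pi^\delta_{i\lambda}$ is the principal series representation of $G$ acting by right translation on the Hilbert completion of the space of smooth $f:G\to\mathbb{C}$ satisfying $f(manx)=t^{1+i\lambda}\delta(m)f(x)$ for $m\in M$, $a=\mathrm{diag}(t,t^{-1})\in A$, $n\in N$, $x\in G$. $\Theta^\delta_{i\lambda}$ denotes its character, and $(\Theta^\delta_{i\lambda}\ast f)(g)=\int_G\Theta^\delta_{i\lambda}(x)f(gx)\,dx$ with $dx$ a Haar measure. $\Theta^\delta_l$ means $\Theta^\delta_{i\lambda}$ with $i\lambda=l$. For an integer $l$, $\delta(l)=0$ if $l$ is odd and $\delta(l)=1$ if $l$ is even. The Casimir operator is $\Omega=\begin{pmatrix}1&0\\0&-1\end{pmatrix}^2+\begin{pmatrix}0&1\\1&0\end{pmatrix}^2-\begin{pmatrix}0&1\\-1&0\end{pmatrix}^2$ in the universal enveloping algebra of $\mathfrak{sl}(2,\mathbb{R})$; it satisfies $\pi^\delta_{i\lambda}(\Omega)=-(\lambda^2+1)\mathrm{Id}$. The positive Laplace operator is $-\Omega$ acting on $C_c^\infty(G)$ by left (or right) translation. The resolvent $(-\Omega-z)^{-1}$ is considered only through its projection to the continuous part of the Harish-Chandra--Plancherel formula, and up to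 a multiplicative constant. Thus, for $\zeta\in\mathbb{C}$ with $\Im\zeta>0$ and $z=\zeta^2+1$, $$\left(\mathrm{R}(\zeta^2+1)f\right)(g)=\int_0^\infty(\lambda^2-\zeta^2)^{-1}\left(\Theta^0_{i\lambda}\ast f\right)(g)\,\lambda\tanh\left(\frac{\pi\lambda}{2}\right)d\lambda+\int_0^\infty(\lambda^2-\zeta^2)^{-1}\left(\Theta^1_{i\lambda}\ast f\right)(g)\,\lambda\coth\left(\frac{\pi\lambda}{2}\right)d\lambda.$$ The variable $\zeta=\sqrt{z-1}$ is taken with the branch of the square root for which $\sqrt{-1}=i$. The resonances are the poles of the meromorphic continuation of this resolvent across the (continuous) spectrum. *)

(* Defs.v *)
From Stdlib Require Import Reals ZArith Lra.
From Coquelicot Require Import Coquelicot.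

Open Scope R_scope.
Open Scope C_scope.

(** * Complex functions of one variable *)

Definition Cexp (z : C) : C :=
  ((exp (Re z) * cos (Im z))%R, (exp (Re z) * sin (Im z))%R).
Definition Csinh (z : C) : C := (Cexp z - Cexp (- z)) / 2.
Definition Ccosh (z : C) : C := (Cexp z + Cexp (- z)) / 2.
Definition Ctanh (z : C) : C := Csinh z / Ccosh z.
Definition Ccoth (z : C) : C := Ccosh z / Csinh z.

(** [t ^ s] for [t > 0] and a complex exponent. *)
Definition Rpow_C (t : R) (s : C) : C := Cexp (s * ln t).

(** Complex differentiability on a neighbourhood of [p]. *)
Definition holomorphic_at (F : C -> C) (p : C) : Prop :=
  locally p (fun w : C =>
    ex_derive (K := C_AbsRing) (V := C_NormedModule) F w).

(** Only the values on a punctured neighbourhood matter: the value of [F] at a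
    pole is irrelevant. *)
Definition pole_of_order_at_most (n : nat) (F : C -> C) (p : C) : Prop :=
  exists H : C -> C, holomorphic_at H p /\
    locally p (fun w : C => w <> p -> F w = H w / (w - p) ^ n).

Definition pole_of_order (n : nat) (F : C -> C) (p : C) : Prop :=
  exists H : C -> C, holomorphic_at H p /\ H p <> 0 /\
    locally p (fun w : C => w <> p -> F w = H w / (w - p) ^ n).

(** * The group SL(2,R) *)

Record SL2 : Type := mkSL2 {
  m11 : R; m12 : R; m21 : R; m22 : R;
  SL2_det : (m11 * m22 - m12 * m21 = 1)%R }.

Definition R4 : Type := (R * R * R * R)%type.

Definition coords (x : SL2) : R4 := (m11 x, m12 x, m21 x, m22 x).

Lemma SL2_mul_det (x y : SL2) :
  ((m11 x * m11 y + m12 x * m21 y) * (m21 x * m12 y + m22 x * m22 y)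
   - (m11 x * m12 y + m12 x * m22 y) * (m21 x * m11 y + m22 x * m21 y) = 1)%R.
Proof.
  transitivity ((m11 x * m22 x - m12 x * m21 x)
                * (m11 y * m22 y - m12 y * m21 y))%R; [ring|].
  rewrite !SL2_det; ring.
Qed.

Definition SL2_mul (x y : SL2) : SL2 := mkSL2 _ _ _ _ (SL2_mul_det x y).

Lemma SL2_pm_det (e : bool) :
  ((if e then -1 else 1) * (if e then -1 else 1) - 0 * 0 = 1)%R.
Proof. destruct e; ring. Qed.

(** [M = {+1, -1}]: [elt_m true] is minus the identity. *)
Definition elt_m (e : bool) : SL2 := mkSL2 _ _ _ _ (SL2_pm_det e).

Lemma SL2_diag_det (t : posreal) : (t * / t - 0 * 0 = 1)%R.
Proof. field; apply Rgt_not_eq, cond_pos. Qed.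

Definition elt_a (t : posreal) : SL2 := mkSL2 _ _ _ _ (SL2_diag_det t).

Lemma SL2_unip_det (u : R) : (1 * 1 - u * 0 = 1)%R.
Proof. ring. Qed.

Definition elt_n (u : R) : SL2 := mkSL2 _ _ _ _ (SL2_unip_det u).

Lemma SL2_rot_det (th : R) : (cos th * cos th - sin th * - sin th = 1)%R.
Proof. generalize (sin2_cos2 th); unfold Rsqr; lra. Qed.

(** The maximal compact subgroup [SO(2)]. *)
Definition elt_k (th : R) : SL2 := mkSL2 _ _ _ _ (SL2_rot_det th).

(** The topology of SL(2,R) is induced by that of [R4]. *)
Definition SL2_ball (x : SL2) (e : R) (y : SL2) : Prop :=
  ball (coords x) e (coords y).

Definition SL2_UniformSpace_mixin : UniformSpace.mixin_of SL2 :=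
  UniformSpace.Mixin SL2 (elt_m false) SL2_ball
    (fun x e => ball_center (coords x) e)
    (fun x y e => ball_sym (coords x) (coords y) e)
    (fun x y z e1 e2 => ball_triangle (coords x) (coords y) (coords z) e1 e2).

Canonical SL2_UniformSpace : UniformSpace :=
  UniformSpace.Pack SL2 SL2_UniformSpace_mixin SL2.

(** SL(2,R) is closed in [R4], so a subset is relatively compact iff its
    matrix entries are bounded. *)
Definition compactly_supported {V : AbelianGroup} (f : SL2 -> V) : Prop :=
  exists B : R, forall x : SL2, f x <> zero ->
    (Rabs (m11 x) <= B /\ Rabs (m12 x) <= B /\
     Rabs (m21 x) <= B /\ Rabs (m22 x) <= B)%R.

(** * Smooth functions *)

Fixpoint Ck_on (k : nat) (U : R4 -> Prop) (F : R4 -> C) : Prop :=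
  (forall p, U p -> continuous (U := C_UniformSpace) F p) /\
  match k with
  | O => True
  | S k' =>
    exists F1 F2 F3 F4 : R4 -> C,
      (forall a b c d : R, U (a, b, c, d) ->
        is_derive (V := C_R_NormedModule)
          (fun s : R => F (s, b, c, d)) a (F1 (a, b, c, d)) /\
        is_derive (V := C_R_NormedModule)
          (fun s : R => F (a, s, c, d)) b (F2 (a, b, c, d)) /\
        is_derive (V := C_R_NormedModule)
          (fun s : R => F (a, b, s, d)) c (F3 (a, b, c, d)) /\
        is_derive (V := C_R_NormedModule)
          (fun s : R => F (a, b, c, s)) d (F4 (a, b, c, d))) /\
      Ck_on k' U F1 /\ Ck_on k' U F2 /\ Ck_on k' U F3 /\ Ck_on k' U F4
  end.

(** SL(2,R) is an embedded submanifold of [R4]: a function on it is smooth iff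
    it is locally the restriction of a smooth function on an open set. *)
Definition smooth (f : SL2 -> C) : Prop :=
  forall x : SL2, exists (U : R4 -> Prop) (F : R4 -> C),
    open U /\ U (coords x) /\ (forall k, Ck_on k U F) /\
    (forall y : SL2, U (coords y) -> f y = F (coords y)).

Definition Cc_infty (f : SL2 -> C) : Prop :=
  smooth f /\ compactly_supported (V := C_AbelianGroup) f.

(** * Haar measure *)

Definition Cc (F : SL2 -> R) : Prop :=
  (forall x : SL2, continuous (U := R_UniformSpace) F x) /\
  compactly_supported (V := R_AbelianGroup) F.

(** A Radon measure is given by its positive linear functional on continuous
    functions with compact support; values of [mu] on other functions are
    irrelevant.  SL(2,R) is unimodular, so that left and right Haar measures
    coincide. *)
Definition is_haar (mu : (SL2 -> R) -> R) : Prop :=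
  (forall F H, Cc F -> Cc H -> mu (fun x => F x + H x)%R = (mu F + mu H)%R) /\
  (forall (c : R) F, Cc F -> mu (fun x => c * F x)%R = (c * mu F)%R) /\
  (forall F, Cc F -> (forall x, 0 <= F x)%R -> (0 <= mu F)%R) /\
  (forall (g : SL2) F, Cc F -> mu (fun x => F (SL2_mul g x)) = mu F) /\
  (forall (g : SL2) F, Cc F -> mu (fun x => F (SL2_mul x g)) = mu F) /\
  (exists F, Cc F /\ mu F <> 0%R).

Definition haar_int (mu : (SL2 -> R) -> R) (F : SL2 -> C) : C :=
  (mu (fun x => Re (F x)), mu (fun x => Im (F x))).

(** * Principal series and their characters *)

(** The dual of [M]: [M0] is trivial, [M1] is not. *)
Inductive Mhat : Set := M0 | M1.

Definition M_char (delta : Mhat) (e : bool) : C :=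
  match delta, e with
  | M1, true => - (1)
  | _, _ => 1
  end.

(** Smooth vectors of the principal series with parameters [delta] and
    [s = i lambda]. *)
Definition principal_series (delta : Mhat) (s : C) (phi : SL2 -> C) : Prop :=
  smooth phi /\
  forall (e : bool) (t : posreal) (u : R) (x : SL2),
    phi (SL2_mul (SL2_mul (SL2_mul (elt_m e) (elt_a t)) (elt_n u)) x)
    = Rpow_C t (1 + s) * M_char delta e * phi x.

(** The inner product of [L^2(K)], with respect to which the space of smooth
    vectors is completed. *)
Definition inner (phi psi : SL2 -> C) : C :=
  / (2 * PI) *
  RInt (V := C_R_CompleteNormedModule)
    (fun th : R => phi (elt_k th) * Cconj (psi (elt_k th))) 0 (2 * PI)%R.

(** Right translation, and its integrated form: the integral of
    [F y] times the translate by [y]. *)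
Definition ps_act (y : SL2) (phi : SL2 -> C) : SL2 -> C :=
  fun x => phi (SL2_mul x y).

Definition ps_op (mu : (SL2 -> R) -> R) (F : SL2 -> C) (phi : SL2 -> C)
  : SL2 -> C :=
  fun x => haar_int mu (fun y => F y * ps_act y phi x).

(** Orthonormal bases of the Hilbert completion that consist of smooth vectors.
    In the incomplete space of smooth vectors, totality has to be expressed by
    Parseval's identity: a maximal orthonormal family need not be total. *)
Definition orthonormal_basis (delta : Mhat) (s : C) (e : nat -> SL2 -> C)
  : Prop :=
  (forall j, principal_series delta s (e j)) /\
  (forall i j, inner (e i) (e j) = if Nat.eqb i j then 1 else 0) /\
  (forall phi, principal_series delta s phi ->
     is_series (fun j => (Cmod (inner phi (e j)) ^ 2)%R) (Re (inner phi phi))).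

Definition is_trace (delta : Mhat) (s : C)
    (T : (SL2 -> C) -> (SL2 -> C)) (tau : C) : Prop :=
  forall e, orthonormal_basis delta s e ->
    is_series (V := C_R_NormedModule) (fun j => inner (T (e j)) (e j)) tau.

(** The distribution [Theta] is the (Harish-Chandra) character of the principal
    series with parameters [delta] and [s = i lambda]. *)
Definition is_character (mu : (SL2 -> R) -> R) (delta : Mhat) (s : C)
    (Theta : (SL2 -> C) -> C) : Prop :=
  forall F, Cc_infty F -> is_trace delta s (ps_op mu F) (Theta F).

(** [char_conv Theta f g] is the integral of [Theta x * f (g x)], read as the
    value of the distribution [Theta] on a left translate of [f]. *)
Definition char_conv (Theta : (SL2 -> C) -> C) (f : SL2 -> C) (g : SL2) : C :=
  Theta (fun x => f (SL2_mul g x)).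

Definition delta_of (l : Z) : Mhat := if Z.odd l then M0 else M1.

(** * The resolvent and its continuation *)

(** Here [Theta delta s] is the character with [s = i lambda]. *)
Definition char_family : Type := Mhat -> C -> (SL2 -> C) -> C.

Definition resolvent_integrand0 (Theta : char_family) (f : SL2 -> C) (g : SL2)
    (zeta : C) (lam : R) : C :=
  / (lam ^ 2 - zeta ^ 2) * char_conv (Theta M0 (Ci * lam)) f g
  * (lam * Ctanh (PI * lam / 2)).

Definition resolvent_integrand1 (Theta : char_family) (f : SL2 -> C) (g : SL2)
    (zeta : C) (lam : R) : C :=
  / (lam ^ 2 - zeta ^ 2) * char_conv (Theta M1 (Ci * lam)) f g
  * (lam * Ccoth (PI * lam / 2)).

Definition ex_RInt_half_line (h : R -> C) : Prop :=
  ex_RInt_gen (V := C_R_NormedModule) h (at_right 0) (Rbar_locally p_infty).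
Definition RInt_half_line (h : R -> C) : C :=
  RInt_gen (V := C_R_CompleteNormedModule) h
    (at_right 0) (Rbar_locally p_infty).

(** [resolvent Theta f g zeta] is the value at [g] of the resolvent at the
    point [zeta ^ 2 + 1] applied to [f], for [Im zeta > 0]. *)
Definition resolvent (Theta : char_family) (f : SL2 -> C) (g : SL2) (zeta : C)
  : C :=
  RInt_half_line (resolvent_integrand0 Theta f g zeta)
  + RInt_half_line (resolvent_integrand1 Theta f g zeta).

(** Integrals over the horizontal line [R - i y]. *)
Definition ex_int_line (y : R) (h : C -> C) : Prop :=
  ex_RInt_gen (V := C_R_NormedModule) (fun x : R => h (x - Ci * y))
    (Rbar_locally m_infty) (Rbar_locally p_infty).
Definition int_line (y : R) (h : C -> C) : C :=
  RInt_gen (V := C_R_CompleteNormedModule) (fun x : R => h (x - Ci * y))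
    (Rbar_locally m_infty) (Rbar_locally p_infty).

Definition contour_integrand0 (Theta : char_family) (f : SL2 -> C) (g : SL2)
    (zeta lam : C) : C :=
  / (lam - zeta) * char_conv (Theta M0 (Ci * lam)) f g * Ctanh (PI * lam / 2).

Definition contour_integrand1 (Theta : char_family) (f : SL2 -> C) (g : SL2)
    (zeta lam : C) : C :=
  / (lam - zeta) * char_conv (Theta M1 (Ci * lam)) f g * Ccoth (PI * lam / 2).

(** Since [y < up y], the condition [l < y] is the only upper bound on [l]. *)
Definition residue_sum (Theta : char_family) (y : R) (f : SL2 -> C) (g : SL2)
    (zeta : C) : C :=
  sum_n_m (G := C_AbelianGroup)
    (fun l : nat => (
       if Rlt_dec (INR l) y then
         / (Ci * INR l + zeta)
         * char_conv (Theta (delta_of (Z.of_nat l)) (INR l)) f g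
       else RtoC 0)%C)
    1 (Z.to_nat (up y)).

Definition shifted_formula (Theta : char_family) (y : R) (f : SL2 -> C)
    (g : SL2) (zeta : C) : C :=
  / 2 * int_line y (contour_integrand0 Theta f g zeta)
  + / 2 * int_line y (contour_integrand1 Theta f g zeta)
  + Ci / zeta * char_conv (Theta M1 0) f g
  + 2 * Ci * residue_sum Theta y f g zeta.

(** * Meromorphic families *)

(** A family is indexed by a test function [f] and a group element [g].  A
    simple pole of the family is at most a simple pole of each member; as the
    residue of a given member may vanish, it has to be attained for some [f],
    at every [g]. *)
Definition family_holomorphic_at (Phi : (SL2 -> C) -> SL2 -> C -> C) (p : C)
  : Prop :=
  forall f g, Cc_infty f -> holomorphic_at (Phi f g) p.

Definition family_simple_pole (Phi : (SL2 -> C) -> SL2 -> C -> C) (p : C)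
  : Prop :=
  (forall f g, Cc_infty f -> pole_of_order_at_most 1 (Phi f g) p) /\
  (forall g, exists f, Cc_infty f /\ pole_of_order 1 (Phi f g) p).

Definition meromorphic_with_simple_poles
    (Phi : (SL2 -> C) -> SL2 -> C -> C) (U P : C -> Prop) : Prop :=
  forall p, U p ->
    (P p -> family_simple_pole Phi p) /\
    (~ P p -> family_holomorphic_at Phi p).

(** The Riemann surface [z = zeta ^ 2 + 1], points being pairs [(z, zeta)].  It
    is the graph of a holomorphic function of [zeta], so that [zeta] is a global
    holomorphic coordinate on it. *)
Definition surf (p : C * C) : Prop := fst p = snd p ^ 2 + 1.
Definition surf_plus (p : C * C) : Prop := surf p /\ (0 < Im (snd p))%R.
Definition surf_chart (zeta : C) : C * C := (zeta ^ 2 + 1, zeta).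

Definition surf_family : Type := (SL2 -> C) -> SL2 -> C * C -> C.

Definition in_chart (Rt : surf_family) : (SL2 -> C) -> SL2 -> C -> C :=
  fun f g zeta => Rt f g (surf_chart zeta).

Definition surf_meromorphic_with_simple_poles
    (Rt : surf_family) (P : C * C -> Prop) : Prop :=
  forall p, surf p ->
    (P p -> family_simple_pole (in_chart Rt) (snd p)) /\
    (~ P p -> family_holomorphic_at (in_chart Rt) (snd p)).

(** The resonances are the poles of the continuation [Rt] of the resolvent. *)
Definition is_resonance (Rt : surf_family) (p : C * C) : Prop :=
  surf p /\
  exists f g n, Cc_infty f /\ (1 <= n)%nat /\
    pole_of_order n (in_chart Rt f g) (snd p).

(* Main.v *)
Require Import Defs.
From Stdlib Require Import Reals ZArith Lra Lia Psatz.
From Stdlib Require Import FunctionalExtensionality ProofIrrelevance ClassicalEpsilon Classical.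
From Coquelicot Require Import Coquelicot.
Open Scope R_scope.
Open Scope C_scope.

(** For fixed [f], [g] and [delta], consider [T lam = (Theta delta (i lam) * f) g].
    The statement is a residue computation for integrals of
    [T lam * K lam / (lam - zeta)], where [K] is one of the two hyperbolic
    densities; it needs [T] to be entire, even and decaying on horizontal strips.

    These properties ([amplitude]) are derived from the definition of the character
    as a trace.  In the basis of [K]-types, the diagonal coefficients of the
    operator of [F] are the Fourier coefficients of a function on the circle
    ([diagonal_coefficient]); since the series of these converges by hypothesis, its
    sum is the value of the function at [0] ([fourier_sum_value]).  That this basis
    is an orthonormal basis is Parseval's identity, which is Fourier inversion for
    an autocorrelation ([basis_orthonormal]).  The resulting trace formula
    ([character_value]) expresses the character as an integral over the group of a
    function of the [A N]-part alone.  On such functions Haar measure is a multiple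
    of [exp (- 2 tau) du dtau], by uniqueness of invariant functionals on the line
    ([haar_iwasawa]); hence the character of parameter [s] is the integral of
    [exp (s tau) * A tau], where [A] is the Abel transform of the average of [F]
    over [K] ([haar_abel]).  [A] is Lipschitz of compact support, and even because
    the Weyl group acts by conjugation in [K] ([ut_conj]).  So [T] is entire and
    even; on strips it is [O(1 / (1 + |Re lam|))], because a translation of [A] by
    half a period of the exponential changes the sign of the integrand
    ([laplace_oscillation]).

    Both densities are odd.  The integrand of the resolvent over the half-line is
    therefore the even part of the contour integrand, and its integral is half of
    the principal value over the real line ([half_line_formula]).  The line of
    integration is then moved down.  Near a pole [a = - i l] of [K], the integrand is
    [p lam / (lam - a)] with [p] holomorphic; after subtraction of
    [p a / (lam - a)] the integral over a segment changes only by the integrals over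
    the vertical sides ([segment_shift]), which tend to [0], while the subtracted
    part contributes the residue ([one_pole], [tends_cauchy_kernel]).  The pole at
    [0] lies on the real line and counts for one half.

    As a function of [zeta] the integral over [R - i y] is holomorphic above that
    line ([line_int_derive]), so the formula is a holomorphic function plus
    finitely many simple fractions, and shows the poles.  Its value does not depend
    on [y] ([shifted_formula_indep]), which glues the continuations for all [y].  No
    residue vanishes identically in [f]: for a bump at the identity that is
    invariant under conjugation by [K], the function [A] is non-negative and not
    zero ([bump_character]), and translates of it serve at every [g]. *)

(** * Complex numbers, derivatives and integrals *)

Notation is_Cderive := (is_derive (K := C_AbsRing) (V := C_NormedModule)).
Notation Ccontinuous := (continuous (U := C_UniformSpace) (T := C_UniformSpace)).
Notation RCcontinuous := (continuous (U := C_UniformSpace) (T := R_UniformSpace)).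
Notation Rcts := (continuous (U := R_UniformSpace)).
Notation Ccts := (continuous (U := C_UniformSpace)).
Notation R2continuous := (continuous (U := R_UniformSpace)
  (T := prod_UniformSpace R_UniformSpace R_UniformSpace)).
Notation R2Ccontinuous := (continuous (U := C_UniformSpace)
  (T := prod_UniformSpace R_UniformSpace R_UniformSpace)).
Notation Cnear := (locally (T := C_UniformSpace)).
Notation is_CInt := (is_RInt (V := C_R_NormedModule)).
(** A constant with values in [C], and not in the carrier of a structure, for
    the sake of [ring] and [field]. *)
Definition CInt (f : R -> C) (a b : R) : C :=
  RInt (V := C_R_CompleteNormedModule) f a b.
Notation is_RCderive := (is_derive (K := R_AbsRing) (V := C_R_NormedModule)).

Ltac clear_denominator H k :=
  first [apply (Rmult_lt_compat_r k) in H|apply (Rmult_le_compat_r k) in H]; [|lra];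
  unfold Rdiv in H at 1; rewrite Rmult_assoc, Rinv_l in H by lra.

Lemma Ceq (x y : C) : Re x = Re y -> Im x = Im y -> x = y.
Proof. destruct x, y; simpl; intros; subst; reflexivity. Qed.

Lemma Cmod_le_abs (z : C) : (Cmod z <= Rabs (Re z) + Rabs (Im z))%R.
Proof.
replace z with (RtoC (Re z) + Ci * RtoC (Im z)) at 1
  by (apply Ceq; simpl; ring).
eapply Rle_trans; [apply Cmod_triangle|].
rewrite Cmod_mult, Cmod_Ci, !Cmod_R; lra.
Qed.

Lemma im_le_Cmod (z : C) : (Rabs (Im z) <= Cmod z)%R.
Proof. eapply Rle_trans; [|apply Rmax_Cmod]. apply Rmax_r. Qed.

Lemma Cmod_minus_sym (a b : C) : Cmod (a - b) = Cmod (b - a).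
Proof. replace (a - b) with (- (b - a)) by ring. apply Cmod_opp. Qed.

Lemma Cmod_triangle_rev (a b : C) : (Cmod a - Cmod b <= Cmod (a - b))%R.
Proof.
assert (H := Cmod_triangle (a - b) b).
replace (a - b + b) with a in H by ring. lra.
Qed.

Lemma Cmod_minus_le (a b : C) : (Cmod (a - b) <= Cmod a + Cmod b)%R.
Proof.
replace (a - b) with (a + - b) by ring.
eapply Rle_trans; [apply Cmod_triangle|]. rewrite Cmod_opp; lra.
Qed.

Lemma Cmod_pos_neq (z : C) : (0 < Cmod z)%R -> z <> 0.
Proof. intros H ->. rewrite Cmod_0 in H; lra. Qed.

Lemma Cmult_integral_contr (a b : C) : a <> 0 -> b <> 0 -> a * b <> 0.
Proof.
intros Ha Hb. apply Cmod_pos_neq. rewrite Cmod_mult.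
apply Rmult_lt_0_compat; apply Cmod_gt_0; assumption.
Qed.

Lemma RtoC_neq (x : R) : x <> 0%R -> RtoC x <> 0.
Proof. intros H E. apply H. injection E; auto. Qed.

(** ** Continuity and derivatives in terms of the modulus *)

Lemma ball_C_lt (x y : C) (e : R) :
  ball (M := C_UniformSpace) x e y -> (Cmod (y - x) < 2 * e)%R.
Proof.
intros [H1 H2]. change (Rabs (fst y - fst x) < e)%R in H1.
change (Rabs (snd y - snd x) < e)%R in H2.
eapply Rle_lt_trans; [apply Cmod_le_abs|].
change (Rabs (fst y - fst x) + Rabs (snd y - snd x) < 2 * e)%R. lra.
Qed.

Lemma ball_C_of_lt (x y : C) (e : R) :
  (Cmod (y - x) < e)%R -> ball (M := C_UniformSpace) x e y.
Proof. intros H. apply C_NormedModule_mixin_compat1. exact H. Qed.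

Lemma locally_Cmod (z : C) (P : C -> Prop) :
  Cnear z P <->
  exists d : R, (0 < d)%R /\ forall w, (Cmod (w - z) < d)%R -> P w.
Proof.
split.
- intros [d H]. exists d. split; [apply cond_pos|].
  intros w Hw. apply H. apply ball_C_of_lt, Hw.
- intros (d & Hd & H). assert (Hd2 : (0 < d / 2)%R) by lra.
  exists (mkposreal _ Hd2). intros w Hw. apply H.
  apply ball_C_lt in Hw. simpl in Hw. lra.
Qed.

Lemma Ccontinuous_iff (T : UniformSpace) (f : T -> C) (x : T) :
  Ccts f x <->
  forall e, (0 < e)%R -> locally x (fun y => (Cmod (f y - f x) < e)%R).
Proof.
split.
- intros H e He.
  apply (H (fun z => (Cmod (z - f x) < e)%R)).
  apply locally_Cmod. exists e; split; auto.
- intros H P HP. apply locally_Cmod in HP. destruct HP as (d & Hd & HP).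
  unfold filtermap. eapply filter_imp; [|apply (H d Hd)].
  intros y Hy; simpl in Hy. apply HP, Hy.
Qed.

Lemma is_Cderive_iff (f : C -> C) (z l : C) :
  is_Cderive f z l <->
  forall e, (0 < e)%R -> exists d, (0 < d)%R /\ forall w, (Cmod (w - z) < d)%R ->
    (Cmod (f w - f z - (w - z) * l) <= e * Cmod (w - z))%R.
Proof.
split.
- intros [_ H] e He.
  destruct (H z (fun P HP => HP) (mkposreal e He)) as [d Hd].
  exists d. split; [apply cond_pos|]. intros w Hw. apply (Hd w). exact Hw.
- intros H. split; [apply is_linear_scal_l|].
  intros x Hx.
  apply (is_filter_lim_locally_unique (V := AbsRing_NormedModule C_AbsRing)) in Hx.
  subst x. intros e. destruct (H e (cond_pos e)) as (d & Hd & Hd').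
  exists (mkposreal d Hd). intros w Hw. apply (Hd' w). exact Hw.
Qed.

Lemma is_RCderive_iff (f : R -> C) (z : R) (l : C) :
  is_RCderive f z l <->
  forall e, (0 < e)%R -> exists d, (0 < d)%R /\ forall w, (Rabs (w - z) < d)%R ->
    (Cmod (f w - f z - (w - z)%R * l) <= e * Rabs (w - z))%R.
Proof.
assert (E : forall w, norm (minus (minus (f w) (f z)) (scal (minus w z) l)
  : C_R_NormedModule) = Cmod (f w - f z - (w - z)%R * l)).
{ intros w. rewrite <- Cmod_norm. f_equal. apply Ceq;
  unfold minus, plus, opp, scal; simpl; unfold plus, opp, scal, mult; simpl;
  unfold mult, plus, opp; simpl; ring. }
split.
- intros [_ H] e He.
  destruct (H z (fun P HP => HP) (mkposreal e He)) as [d Hd].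
  exists d. split; [apply cond_pos|]. intros w Hw. rewrite <- E.
  apply (Hd w). exact Hw.
- intros H. split; [apply is_linear_scal_l|].
  intros x Hx.
  apply (is_filter_lim_locally_unique (V := AbsRing_NormedModule R_AbsRing)) in Hx.
  subst x.
  intros e. destruct (H e (cond_pos e)) as (d & Hd & Hd').
  exists (mkposreal d Hd). intros w Hw. specialize (Hd' w Hw).
  rewrite <- E in Hd'. exact Hd'.
Qed.

Lemma is_RCderive_pair (f : R -> C) (x : R) (l : C) :
  is_RCderive f x l <->
  is_derive (fun t => Re (f t)) x (Re l) /\ is_derive (fun t => Im (f t)) x (Im l).
Proof.
assert (Ex : forall (g : R -> R) (m : R), is_derive g x m <->
  forall e, (0 < e)%R -> exists d, (0 < d)%R /\ forall w, (Rabs (w - x) < d)%R ->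
  (Rabs (g w - g x - (w - x) * m) <= e * Rabs (w - x))%R).
{ intros g m. split.
  - intros [_ H] e He.
    destruct (H x (fun P HP => HP) (mkposreal e He)) as [d Hd].
    exists d. split; [apply cond_pos|]. intros w Hw. apply (Hd w). exact Hw.
  - intros H. split; [apply is_linear_scal_l|].
    intros y Hy.
    apply (is_filter_lim_locally_unique (V := AbsRing_NormedModule R_AbsRing)) in Hy.
    subst y.
    intros e. destruct (H e (cond_pos e)) as (d & Hd & Hd').
    exists (mkposreal d Hd). intros w Hw. apply (Hd' w Hw). }
rewrite is_RCderive_iff, !Ex. split.
- intros H; split; intros e He; destruct (H e He) as (d & Hd & Hd');
    exists d; split; auto; intros w Hw; specialize (Hd' w Hw);
    (eapply Rle_trans; [|exact Hd']).
  + eapply Rle_trans; [|apply re_le_Cmod]. apply Req_le. f_equal. unfold Re, Im; simpl. ring.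
  + eapply Rle_trans; [|apply im_le_Cmod]. apply Req_le. f_equal. unfold Re, Im; simpl. ring.
- intros [H1 H2] e He.
  destruct (H1 (e / 2)%R ltac:(lra)) as (d1 & Hd1 & Hd1').
  destruct (H2 (e / 2)%R ltac:(lra)) as (d2 & Hd2 & Hd2').
  exists (Rmin d1 d2). split; [apply Rmin_glb_lt; auto|]. intros w Hw.
  specialize (Hd1' w (Rlt_le_trans _ _ _ Hw (Rmin_l _ _))).
  specialize (Hd2' w (Rlt_le_trans _ _ _ Hw (Rmin_r _ _))).
  eapply Rle_trans; [apply Cmod_le_abs|].
  replace (Re (f w - f x - (w - x)%R * l))
    with (Re (f w) - Re (f x) - (w - x) * Re l)%R by (unfold Re, Im; simpl; ring).
  replace (Im (f w - f x - (w - x)%R * l))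
    with (Im (f w) - Im (f x) - (w - x) * Im l)%R by (unfold Re, Im; simpl; ring).
  lra.
Qed.

Lemma is_Cderive_plus (f g : C -> C) (z l m : C) : is_Cderive f z l -> is_Cderive g z m ->
  is_Cderive (fun w => f w + g w) z (l + m).
Proof. intros; apply (is_derive_plus (V := C_NormedModule) f g z l m); auto. Qed.

Lemma is_Cderive_minus (f g : C -> C) (z l m : C) : is_Cderive f z l -> is_Cderive g z m ->
  is_Cderive (fun w => f w - g w) z (l - m).
Proof. intros; apply (is_derive_minus (V := C_NormedModule) f g z l m); auto. Qed.

(** [C_NormedModule] and the ring [C_AbsRing] seen as a module over itself carry
    different uniform structures; derivatives with values in either agree. *)
Lemma is_Cderive_ring (f : C -> C) (z l : C) :
  is_Cderive f z l <-> is_derive (K := C_AbsRing) (V := AbsRing_NormedModule C_AbsRing) f z l.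
Proof.
rewrite is_Cderive_iff. split.
- intros H. split; [apply is_linear_scal_l|].
  intros x Hx.
  apply (is_filter_lim_locally_unique (V := AbsRing_NormedModule C_AbsRing)) in Hx.
  subst x. intros e. destruct (H e (cond_pos e)) as (d & Hd & Hd').
  exists (mkposreal d Hd). intros w Hw. apply (Hd' w). exact Hw.
- intros [_ H] e He.
  destruct (H z (fun P HP => HP) (mkposreal e He)) as [d Hd].
  exists d. split; [apply cond_pos|]. intros w Hw. apply (Hd w). exact Hw.
Qed.

Lemma is_Cderive_mult (f g : C -> C) (z l m : C) : is_Cderive f z l -> is_Cderive g z m ->
  is_Cderive (fun w => f w * g w) z (l * g z + f z * m).
Proof.
rewrite !is_Cderive_ring. intros.
apply (is_derive_mult (K := C_AbsRing) f g z l m); auto.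
intros; apply Cmult_comm.
Qed.

Lemma is_Cderive_const (c z : C) : is_Cderive (fun _ => c) z (RtoC 0).
Proof. apply (is_derive_const (V := C_NormedModule)). Qed.

Lemma is_Cderive_id (z : C) : is_Cderive (fun w => w) z (RtoC 1).
Proof. apply is_Cderive_ring, (is_derive_id (K := C_AbsRing)). Qed.

Lemma is_Cderive_comp (f g : C -> C) (z l m : C) : is_Cderive f (g z) l -> is_Cderive g z m ->
  is_Cderive (fun w => f (g w)) z (m * l).
Proof.
intros Hf Hg. apply (is_derive_comp (V := C_NormedModule) f g z l m); auto.
apply is_Cderive_ring, Hg.
Qed.

Lemma is_Cderive_eq (f : C -> C) (z l m : C) : l = m -> is_Cderive f z l -> is_Cderive f z m.
Proof. intros ->; auto. Qed.

Lemma is_Cderive_scal (c : C) (f : C -> C) (z l : C) : is_Cderive f z l ->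
  is_Cderive (fun w => c * f w) z (c * l).
Proof.
intros H. eapply is_Cderive_eq; [|apply is_Cderive_mult;
  [apply is_Cderive_const|exact H]]. simpl; ring.
Qed.

Lemma is_Cderive_ext_loc (f g : C -> C) (z l : C) :
  Cnear z (fun w => f w = g w) ->
  is_Cderive f z l -> is_Cderive g z l.
Proof.
intros HL H. apply locally_Cmod in HL. destruct HL as (d0 & Hd0 & HL).
rewrite is_Cderive_iff in *. intros e He.
destruct (H e He) as (d & Hd & H').
exists (Rmin d d0). split; [apply Rmin_glb_lt; auto|]. intros w Hw.
rewrite <- (HL w) by (eapply Rlt_le_trans; [exact Hw|apply Rmin_r]).
rewrite <- (HL z).
- apply H'. eapply Rlt_le_trans; [exact Hw|apply Rmin_l].
- replace (z - z) with (RtoC 0) by ring. rewrite Cmod_0; lra.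
Qed.

Lemma is_Cderive_continuous (f : C -> C) (z l : C) : is_Cderive f z l -> Ccontinuous f z.
Proof.
intros H. rewrite is_Cderive_iff in H. apply Ccontinuous_iff. intros e He.
destruct (H 1%R Rlt_0_1) as (d & Hd & H').
apply locally_Cmod.
assert (Hm := Cmod_ge_0 l).
assert (Hp : (0 < e / (Cmod l + 1))%R) by (apply Rdiv_lt_0_compat; lra).
exists (Rmin d (e / (Cmod l + 1)))%R.
split; [apply Rmin_glb_lt; auto|].
intros w Hw.
specialize (H' w (Rlt_le_trans _ _ _ Hw (Rmin_l _ _))).
assert (Hw2 := Rlt_le_trans _ _ _ Hw (Rmin_r _ _)).
replace (f w - f z) with ((f w - f z - (w - z) * l) + (w - z) * l) by ring.
eapply Rle_lt_trans; [apply Cmod_triangle|]. rewrite Cmod_mult.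
clear_denominator Hw2 (Cmod l + 1)%R. lra.
Qed.

Lemma is_Cderive_inv (z : C) : z <> 0 -> is_Cderive Cinv z (- (/ z * / z)).
Proof.
intros Hz. apply is_Cderive_iff. intros e He.
assert (Hm := proj1 (Cmod_gt_0 z) Hz).
set (m := Cmod z) in *.
assert (Hp : (0 < e * (m * m * m) / 2)%R).
{ assert (0 < m * m * m)%R by (repeat apply Rmult_lt_0_compat; auto).
  apply Rdiv_lt_0_compat; [apply Rmult_lt_0_compat|]; lra. }
exists (Rmin (m / 2) (e * (m * m * m) / 2)).
split; [apply Rmin_glb_lt; lra|].
intros w Hw.
assert (Hw1 := Rlt_le_trans _ _ _ Hw (Rmin_l _ _)).
assert (Hw2 := Rlt_le_trans _ _ _ Hw (Rmin_r _ _)).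
assert (Hwm : (m / 2 < Cmod w)%R).
{ assert (H := Cmod_triangle_rev z w). rewrite Cmod_minus_sym in H.
  fold m in H. lra. }
assert (Hw0 : w <> 0) by (apply Cmod_pos_neq; lra).
replace (/ w - / z - (w - z) * - (/ z * / z))
  with ((w - z) * (w - z) / (w * z * z)) by (field; auto).
rewrite Cmod_div by (repeat apply Cmult_integral_contr; auto).
rewrite !Cmod_mult. fold m.
assert (Hpos : (0 < Cmod w * m * m)%R) by (repeat apply Rmult_lt_0_compat; lra).
apply Rle_trans with (Cmod (w - z) * (e * (m * m * m) / 2) / (Cmod w * m * m))%R.
- apply Rmult_le_compat_r; [left; apply Rinv_0_lt_compat; auto|].
  apply Rmult_le_compat_l; [apply Cmod_ge_0|lra].
- replace (Cmod (w - z) * (e * (m * m * m) / 2) / (Cmod w * m * m))%R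
    with ((e * Cmod (w - z)) * (m / 2 / Cmod w))%R by (field; lra).
  rewrite <- (Rmult_1_r (e * Cmod (w - z))) at 2.
  apply Rmult_le_compat_l.
  + apply Rmult_le_pos; [lra|apply Cmod_ge_0].
  + apply Rmult_le_reg_r with (Cmod w); [lra|]. unfold Rdiv.
    rewrite Rmult_assoc, Rinv_l by lra. lra.
Qed.

Lemma is_Cderive_Cinv (f : C -> C) (z l : C) : f z <> 0 -> is_Cderive f z l ->
  is_Cderive (fun w => / f w) z (- l * (/ f z * / f z)).
Proof.
intros Hz H. eapply is_Cderive_eq;
  [|apply (is_Cderive_comp Cinv f z); [apply is_Cderive_inv, Hz|exact H]].
ring.
Qed.

Lemma is_RCderive_line (f : C -> C) (p d : C) (x : R) (l : C) :
  is_Cderive f (p + x * d) l -> is_RCderive (fun t : R => f (p + t * d)) x (d * l).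
Proof.
intros H. rewrite is_Cderive_iff in H. apply is_RCderive_iff. intros e He.
assert (Hd := Cmod_ge_0 d).
assert (He' : (0 < e / (Cmod d + 1))%R) by (apply Rdiv_lt_0_compat; lra).
destruct (H _ He') as (r & Hr & H').
exists (r / (Cmod d + 1))%R. split; [apply Rdiv_lt_0_compat; lra|].
intros w Hw.
assert (E : p + w * d - (p + x * d) = (w - x)%R * d)
  by (rewrite RtoC_minus; ring).
specialize (H' (p + w * d)). rewrite E, Cmod_mult, Cmod_R in H'.
assert (Hw' : (Rabs (w - x) * (Cmod d + 1) < r)%R).
{ clear_denominator Hw (Cmod d + 1)%R. lra. }
assert (Ha := Rabs_pos (w - x)).
assert (Hw'' : (Rabs (w - x) * Cmod d < r)%R) by nra.
specialize (H' Hw'').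
replace (f (p + w * d) - f (p + x * d) - (w - x)%R * (d * l))
  with (f (p + w * d) - f (p + x * d) - (w - x)%R * d * l) by ring.
eapply Rle_trans; [exact H'|].
replace (e / (Cmod d + 1) * (Rabs (w - x) * Cmod d))%R
  with (e * Rabs (w - x) * (Cmod d / (Cmod d + 1)))%R by (field; lra).
rewrite <- (Rmult_1_r (e * Rabs (w - x))) at 2.
apply Rmult_le_compat_l; [nra|].
apply Rmult_le_reg_r with (Cmod d + 1)%R; [lra|]. unfold Rdiv.
rewrite Rmult_assoc, Rinv_l by lra. lra.
Qed.

(** ** Continuity of complex-valued functions *)

Lemma Ccont_pair (T : UniformSpace) (f : T -> C) (x : T) :
  Ccts f x <->
  Rcts (fun t => Re (f t)) x /\
  Rcts (fun t => Im (f t)) x.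
Proof.
split.
- intros H; split; apply (continuous_comp f); auto;
    [apply continuous_fst|apply continuous_snd].
- intros [H1 H2].
  apply continuous_ext with (fun t => (Re (f t), Im (f t))).
  { intros t; destruct (f t); reflexivity. }
  apply (continuous_comp_2 (fun t => Re (f t)) (fun t => Im (f t))
    (fun a b => (a, b) : C_UniformSpace)); auto.
  apply continuous_ext with (fun z : R * R => z);
    [intros []; reflexivity|apply continuous_id].
Qed.

Lemma Ccont_plus (T : UniformSpace) (f g : T -> C) x :
  Ccts f x -> Ccts g x ->
  Ccts (fun t => f t + g t) x.
Proof. intros; apply (continuous_plus (V := C_R_NormedModule) f g); auto. Qed.

Lemma Ccont_minus (T : UniformSpace) (f g : T -> C) x :
  Ccts f x -> Ccts g x ->
  Ccts (fun t => f t - g t) x.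
Proof. intros; apply (continuous_minus (V := C_R_NormedModule) f g); auto. Qed.

Lemma Ccont_mult (T : UniformSpace) (f g : T -> C) x :
  Ccts f x -> Ccts g x ->
  Ccts (fun t => f t * g t) x.
Proof.
rewrite !Ccont_pair. intros [H1 H2] [H3 H4]. split.
- apply (continuous_minus (V := R_NormedModule)
    (fun t => Re (f t) * Re (g t))%R (fun t => Im (f t) * Im (g t))%R);
  apply (continuous_mult (K := R_AbsRing)); auto.
- apply (continuous_plus (V := R_NormedModule)
    (fun t => Re (f t) * Im (g t))%R (fun t => Im (f t) * Re (g t))%R);
  apply (continuous_mult (K := R_AbsRing)); auto.
Qed.

Lemma Ccont_const (T : UniformSpace) (c : C) (x : T) :
  Ccts (fun _ => c) x.
Proof. apply continuous_const. Qed.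

Lemma Ccont_RtoC (T : UniformSpace) (f : T -> R) x :
  Rcts f x ->
  Ccts (fun t => RtoC (f t)) x.
Proof. intros H. apply Ccont_pair. split; [exact H|apply continuous_const]. Qed.

Lemma Ccont_conj (T : UniformSpace) (f : T -> C) x :
  Ccts f x ->
  Ccts (fun t => Cconj (f t)) x.
Proof.
rewrite !Ccont_pair. intros [H1 H2]; split; [exact H1|].
apply (continuous_opp (V := R_NormedModule) (fun t => Im (f t))); auto.
Qed.

Lemma Ccont_mod (T : UniformSpace) (f : T -> C) x :
  Ccts f x ->
  Rcts (fun t => Cmod (f t)) x.
Proof.
intros H. apply continuous_ext with (fun t => norm (f t : C_R_NormedModule)).
{ intros t. symmetry. apply Cmod_norm. }
apply (continuous_comp f (fun z : C_R_NormedModule => norm z)); auto.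
exact (filterlim_norm (V := C_R_NormedModule) (f x)).
Qed.

Lemma Ccont_inv (T : UniformSpace) (f : T -> C) x :
  f x <> 0 -> Ccts f x ->
  Ccts (fun t => / f t) x.
Proof.
intros H0 H. apply (continuous_comp f Cinv); auto.
apply (is_Cderive_continuous _ _ _ (is_Cderive_inv _ H0)).
Qed.

Lemma Ccont_pow (T : UniformSpace) (f : T -> C) x n :
  Ccts f x ->
  Ccts (fun t => f t ^ n) x.
Proof.
intros H. induction n as [|n IH]; simpl.
- apply Ccont_const.
- apply Ccont_mult; auto.
Qed.

Lemma continuous_Rle_abs (T : UniformSpace) (f : T -> R) (x : T) :
  Rcts f x <->
  forall e, (0 < e)%R -> locally x (fun y => (Rabs (f y - f x) < e)%R).
Proof.
split.
- intros H e He. apply (H (fun z => (Rabs (z - f x) < e)%R)).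
  exists (mkposreal e He). intros y Hy; exact Hy.
- intros H P [d HP]. unfold filtermap.
  eapply filter_imp; [|apply (H d (cond_pos d))].
  intros y Hy. apply HP, Hy.
Qed.

(** ** Integrals of continuous complex functions *)

Lemma ex_CInt (f : R -> C) a b : (forall x, RCcontinuous f x) ->
  ex_RInt (V := C_R_NormedModule) f a b.
Proof.
intros H. apply (ex_RInt_continuous (V := C_R_CompleteNormedModule)).
intros; apply H.
Qed.

Lemma CInt_correct (f : R -> C) a b : (forall x, RCcontinuous f x) ->
  is_CInt f a b (CInt f a b).
Proof.
intros H. apply (RInt_correct (V := C_R_CompleteNormedModule)), ex_CInt, H.
Qed.

Lemma CInt_unique (f : R -> C) a b l : is_CInt f a b l -> CInt f a b = l.
Proof. apply (is_RInt_unique (V := C_R_CompleteNormedModule)). Qed.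

Lemma CInt_pair (f : R -> C) a b : (forall x, RCcontinuous f x) ->
  CInt f a b = (RInt (fun t => Re (f t)) a b, RInt (fun t => Im (f t)) a b).
Proof.
intros H. apply CInt_unique.
apply (is_RInt_fct_extend_pair (U := R_NormedModule) (V := R_NormedModule));
  apply (RInt_correct (V := R_CompleteNormedModule)),
    (ex_RInt_continuous (V := R_CompleteNormedModule)); intros z _;
  destruct (proj1 (Ccont_pair _ _ _) (H z)); auto.
Qed.

Lemma CInt_ext (f g : R -> C) a b :
  (forall x, (Rmin a b < x < Rmax a b)%R -> f x = g x) -> CInt f a b = CInt g a b.
Proof. intros H. apply (RInt_ext (V := C_R_CompleteNormedModule)), H. Qed.

Lemma CInt_plus (f g : R -> C) a b : (forall x, RCcontinuous f x) ->
  (forall x, RCcontinuous g x) ->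
  CInt (fun t => f t + g t) a b = CInt f a b + CInt g a b.
Proof.
intros. apply (RInt_plus (V := C_R_CompleteNormedModule)); apply ex_CInt; auto.
Qed.

Lemma CInt_minus (f g : R -> C) a b : (forall x, RCcontinuous f x) ->
  (forall x, RCcontinuous g x) ->
  CInt (fun t => f t - g t) a b = CInt f a b - CInt g a b.
Proof.
intros. apply (RInt_minus (V := C_R_CompleteNormedModule)); apply ex_CInt; auto.
Qed.

Lemma CInt_scal (c : C) (f : R -> C) a b : (forall x, RCcontinuous f x) ->
  CInt (fun t => c * f t) a b = c * CInt f a b.
Proof.
intros H.
assert (H' : forall x, RCcontinuous (fun t => c * f t) x)
  by (intros; apply Ccont_mult; [apply Ccont_const|apply H]).
rewrite !CInt_pair by auto.
assert (HR : forall z, continuous (fun t => Re (f t)) z) by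
  (intros z; apply (proj1 (Ccont_pair _ _ _) (H z))).
assert (HI : forall z, continuous (fun t => Im (f t)) z) by
  (intros z; apply (proj1 (Ccont_pair _ _ _) (H z))).
assert (ER : forall k, ex_RInt (fun t => k * Re (f t))%R a b).
{ intros k. apply (ex_RInt_continuous (V := R_CompleteNormedModule)).
  intros z _. apply (continuous_scal_r (V := R_NormedModule) k (fun t => Re (f t))), HR. }
assert (EI : forall k, ex_RInt (fun t => k * Im (f t))%R a b).
{ intros k. apply (ex_RInt_continuous (V := R_CompleteNormedModule)).
  intros z _. apply (continuous_scal_r (V := R_NormedModule) k (fun t => Im (f t))), HI. }
assert (SR : forall k, RInt (fun t => k * Re (f t))%R a b = (k * RInt (fun t => Re (f t)) a b)%R).
{ intros k. apply (RInt_scal (V := R_CompleteNormedModule) (fun t => Re (f t))).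
  apply ex_RInt_continuous; intros; apply HR. }
assert (SI : forall k, RInt (fun t => k * Im (f t))%R a b = (k * RInt (fun t => Im (f t)) a b)%R).
{ intros k. apply (RInt_scal (V := R_CompleteNormedModule) (fun t => Im (f t))).
  apply ex_RInt_continuous; intros; apply HI. }
apply Ceq; simpl.
- rewrite <- SR, <- SI.
  rewrite <- (RInt_minus (V := R_CompleteNormedModule)) by auto.
  apply RInt_ext; intros; reflexivity.
- rewrite <- SR, <- SI.
  rewrite <- (RInt_plus (V := R_CompleteNormedModule)) by auto.
  apply RInt_ext; intros; unfold plus; simpl; reflexivity.
Qed.

Lemma CInt_bound (f : R -> C) (g : R -> R) a b : (a <= b)%R ->
  (forall x, RCcontinuous f x) -> (forall x, continuous g x) ->
  (forall x, (a <= x <= b)%R -> (Cmod (f x) <= g x)%R) ->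
  (Cmod (CInt f a b) <= RInt g a b)%R.
Proof.
intros Hab Hf Hg H. rewrite Cmod_norm.
apply (norm_RInt_le (V := C_R_NormedModule) f g a b); auto.
- intros x Hx. rewrite <- Cmod_norm. auto.
- apply CInt_correct, Hf.
- apply (RInt_correct (V := R_CompleteNormedModule)), ex_RInt_continuous.
  intros; apply Hg.
Qed.

Lemma CInt_bound_const (f : R -> C) (M : R) a b : (a <= b)%R ->
  (forall x, RCcontinuous f x) ->
  (forall x, (a <= x <= b)%R -> (Cmod (f x) <= M)%R) ->
  (Cmod (CInt f a b) <= (b - a) * M)%R.
Proof.
intros Hab Hf H. rewrite Cmod_norm.
apply (norm_RInt_le_const (V := C_R_NormedModule) f a b); auto.
- intros x Hx. rewrite <- Cmod_norm. auto.
- apply CInt_correct, Hf.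
Qed.

Lemma CInt_Chasles (f : R -> C) a b c : (forall x, RCcontinuous f x) ->
  CInt f a b + CInt f b c = CInt f a c.
Proof.
intros. apply (RInt_Chasles (V := C_R_CompleteNormedModule)); apply ex_CInt; auto.
Qed.

Lemma CInt_const (c : C) a b : CInt (fun _ => c) a b = (b - a)%R * c.
Proof.
unfold CInt. rewrite (RInt_const (V := C_R_CompleteNormedModule)).
apply Ceq; unfold scal; simpl; unfold scal, mult; simpl; unfold mult; simpl; ring.
Qed.

Lemma CInt_FTC (f df : R -> C) a b : (forall x, is_RCderive f x (df x)) ->
  (forall x, RCcontinuous df x) -> CInt df a b = f b - f a.
Proof.
intros H Hc. apply CInt_unique.
apply (is_RInt_derive (V := C_R_CompleteNormedModule) f df a b); auto.
Qed.

Lemma CInt_comp_lin (f : R -> C) (u v a b : R) : (forall x, RCcontinuous f x) ->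
  u * CInt (fun t => f (u * t + v)%R) a b = CInt f (u * a + v)%R (u * b + v)%R.
Proof.
intros H.
assert (H' : forall x, RCcontinuous (fun t => f (u * t + v)%R) x).
{ intros x. apply (continuous_comp (fun t => (u * t + v)%R) f); [|apply H].
  apply (continuous_plus (V := R_NormedModule) (fun t => u * t)%R (fun _ => v)).
  - apply (continuous_scal_r (V := R_NormedModule) u (fun t => t)), continuous_id.
  - apply continuous_const. }
rewrite <- CInt_scal by auto.
unfold CInt at 2. rewrite <- (RInt_comp_lin (V := C_R_CompleteNormedModule)) by (apply ex_CInt, H).
apply CInt_ext. intros x _. apply Ceq; unfold scal; simpl;
  unfold scal, mult; simpl; unfold mult; simpl; ring.
Qed.

Lemma CInt_swap (f : R -> C) a b : (forall x, RCcontinuous f x) ->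
  CInt f a b = - CInt f b a.
Proof.
intros H. assert (E := CInt_Chasles f a b a H).
assert (Z : CInt f a a = RtoC 0)
  by apply (RInt_point (V := C_R_CompleteNormedModule)).
rewrite Z in E.
replace (CInt f a b) with (CInt f a b + CInt f b a - CInt f b a) by ring.
rewrite E; ring.
Qed.

(** Real and imaginary parts are bounded separately, whence the factor 2.
    Differentiability is only asked in the interior: below, an integral over a
    moving segment is only continuous when the segment meets a pole. *)
Lemma RC_mean_value (f df : R -> C) (a b D : R) : (a <= b)%R ->
  (forall x, (a <= x <= b)%R -> RCcontinuous f x) ->
  (forall x, (a < x < b)%R -> is_RCderive f x (df x) /\ (Cmod (df x) <= D)%R) ->
  (Cmod (f b - f a) <= 2 * D * (b - a))%R.
Proof.
intros Hab Hc Hd.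
assert (HD : (a < b)%R -> (0 <= D)%R).
{ intros H. destruct (Hd ((a + b) / 2)%R ltac:(lra)) as [_ H'].
  eapply Rle_trans; [apply Cmod_ge_0|exact H']. }
assert (Hgen : forall (g : R -> R) (dg : R -> R),
  (forall x, (a <= x <= b)%R -> continuous g x) ->
  (forall x, (a < x < b)%R -> is_derive g x (dg x) /\ (Rabs (dg x) <= D)%R) ->
  (Rabs (g b - g a) <= D * (b - a))%R).
{ intros g dg Hgc Hgd.
  destruct (Req_dec a b) as [->|Hne].
  { rewrite Rminus_diag, Rabs_R0. rewrite Rminus_diag. lra. }
  assert (Hlt : (a < b)%R) by lra.
  destruct (MVT_gen g a b (fun x => if Rlt_dec a x then
     if Rlt_dec x b then dg x else 0 else 0)%R) as (c & Hc1 & Hc2).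
  - rewrite Rmin_left, Rmax_right by lra. intros x Hx.
    destruct (Rlt_dec a x); [|lra]. destruct (Rlt_dec x b); [|lra].
    apply Hgd; lra.
  - rewrite Rmin_left, Rmax_right by lra. intros x Hx.
    apply continuity_pt_filterlim. apply Hgc; lra.
  - rewrite Hc2, Rabs_mult, (Rabs_pos_eq (b - a)) by lra.
    apply Rmult_le_compat_r; [lra|].
    destruct (Rlt_dec a c); [destruct (Rlt_dec c b)|];
      [apply Hgd; lra|rewrite Rabs_R0; auto|rewrite Rabs_R0; auto]. }
eapply Rle_trans; [apply Cmod_le_abs|].
assert (H1 : (Rabs (Re (f b - f a)) <= D * (b - a))%R).
{ apply (Hgen (fun t => Re (f t)) (fun t => Re (df t))).
  - intros x Hx. apply (proj1 (Ccont_pair _ _ _) (Hc x Hx)).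
  - intros x Hx. destruct (Hd x Hx) as [Hd1 Hd2]. split.
    + apply (proj1 (is_RCderive_pair _ _ _) Hd1).
    + eapply Rle_trans; [apply re_le_Cmod|exact Hd2]. }
assert (H2 : (Rabs (Im (f b - f a)) <= D * (b - a))%R).
{ apply (Hgen (fun t => Im (f t)) (fun t => Im (df t))).
  - intros x Hx. apply (proj1 (Ccont_pair _ _ _) (Hc x Hx)).
  - intros x Hx. destruct (Hd x Hx) as [Hd1 Hd2]. split.
    + apply (proj1 (is_RCderive_pair _ _ _) Hd1).
    + eapply Rle_trans; [apply im_le_Cmod|exact Hd2]. }
lra.
Qed.

(** * The complex exponential *)

Lemma exp_mono x y : (x <= y)%R -> (exp x <= exp y)%R.
Proof.
intros [H| ->]; [left; apply exp_increasing, H|apply Rle_refl].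
Qed.

Definition cis (t : R) : C := (cos t, sin t).

Lemma Cexp_plus a b : Cexp (a + b) = Cexp a * Cexp b.
Proof.
unfold Cexp. apply Ceq; unfold Re, Im; simpl;
rewrite exp_plus, ?cos_plus, ?sin_plus; ring.
Qed.

Lemma Cexp_0 : Cexp 0 = 1.
Proof. apply Ceq; unfold Cexp, Re, Im; simpl; rewrite exp_0, ?cos_0, ?sin_0; ring. Qed.

Lemma Cexp_neq_0 z : Cexp z <> 0.
Proof.
intros H. assert (E := Cexp_plus z (- z)).
replace (z + - z) with (RtoC 0) in E by ring.
rewrite Cexp_0, H in E. apply (RtoC_neq 1); [lra|]. rewrite E; ring.
Qed.

Lemma Cexp_opp z : Cexp (- z) = / Cexp z.
Proof.
assert (E := Cexp_plus z (- z)).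
replace (z + - z) with (RtoC 0) in E by ring. rewrite Cexp_0 in E.
assert (H := Cexp_neq_0 z).
replace (Cexp (- z)) with (/ Cexp z * (Cexp z * Cexp (- z))) by (field; auto).
rewrite <- E; ring.
Qed.

Lemma Cmod_cis t : Cmod (cis t) = 1%R.
Proof.
unfold Cmod, cis. simpl. replace (_ + _)%R with 1%R.
- apply sqrt_1.
- generalize (sin2_cos2 t); unfold Rsqr; lra.
Qed.

Lemma Cexp_polar z : Cexp z = exp (Re z) * cis (Im z).
Proof. apply Ceq; unfold Cexp, cis, Re, Im; simpl; ring. Qed.

Lemma Cmod_Cexp z : Cmod (Cexp z) = exp (Re z).
Proof.
rewrite Cexp_polar, Cmod_mult, Cmod_cis, Cmod_R, Rabs_pos_eq;
  [ring|left; apply exp_pos].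
Qed.

Lemma Cexp_RtoC (x : R) : Cexp x = RtoC (exp x).
Proof. apply Ceq; unfold Cexp, Re, Im; simpl; rewrite ?cos_0, ?sin_0; ring. Qed.

Lemma cis_plus a b : cis (a + b) = cis a * cis b.
Proof.
apply Ceq; unfold cis, Re, Im; simpl; rewrite ?cos_plus, ?sin_plus; ring.
Qed.

Lemma cis_0 : cis 0 = 1.
Proof. unfold cis. rewrite cos_0, sin_0; reflexivity. Qed.

Lemma cis_opp t : cis (- t) = Cconj (cis t).
Proof. unfold cis, Cconj; simpl. rewrite cos_neg, sin_neg; reflexivity. Qed.

Lemma cis_conj t : cis t * Cconj (cis t) = 1.
Proof. rewrite <- cis_opp, <- cis_plus, Rplus_opp_r. apply cis_0. Qed.

Lemma cis_pow t n : cis t ^ n = cis (INR n * t).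
Proof.
induction n as [|n IH].
- simpl. rewrite Rmult_0_l, cis_0; reflexivity.
- rewrite S_INR. simpl (_ ^ S n). rewrite IH, <- cis_plus. f_equal; ring.
Qed.

Lemma cis_period t (k : nat) : cis (t + 2 * INR k * PI) = cis t.
Proof. unfold cis. rewrite cos_period, sin_period; reflexivity. Qed.

Lemma is_RCderive_Cexp_line (w : C) (t : R) :
  is_RCderive (fun t : R => Cexp (t * w)) t (w * Cexp (t * w)).
Proof.
apply is_RCderive_pair. unfold Cexp, Re, Im; simpl.
split; auto_derive; auto; unfold Rminus; ring.
Qed.

Lemma is_RCderive_continuous (f : R -> C) (x : R) (l : C) :
  is_RCderive f x l -> RCcontinuous f x.
Proof.
intros H. apply (ex_derive_continuous (V := C_R_NormedModule)).
exists l; exact H.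
Qed.

Lemma Cexp_minus_1 w : (Cmod (Cexp w - 1) <= 2 * Cmod w * exp (Cmod w))%R.
Proof.
assert (H := RC_mean_value (fun t : R => Cexp (t * w))
  (fun t => w * Cexp (t * w)) 0 1 (Cmod w * exp (Cmod w)) Rle_0_1).
simpl in H. rewrite Cmult_1_l, Cmult_0_l, Cexp_0 in H.
replace (2 * Cmod w * exp (Cmod w))%R
  with (2 * (Cmod w * exp (Cmod w)) * (1 - 0))%R by ring.
apply H.
- intros x _. eapply is_RCderive_continuous, is_RCderive_Cexp_line.
- intros x Hx. split; [apply is_RCderive_Cexp_line|].
  rewrite Cmod_mult, Cmod_Cexp. apply Rmult_le_compat_l; [apply Cmod_ge_0|].
  apply exp_mono. assert (Hr := re_le_Cmod (x * w)).
  rewrite Cmod_mult, Cmod_R, (Rabs_pos_eq x) in Hr by lra.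
  assert (Hm := Cmod_ge_0 w). assert (Hq := Rle_abs (Re (x * w))).
  apply Rle_trans with (x * Cmod w)%R; [lra|nra].
Qed.

Lemma Cexp_minus_1_minus w :
  (Cmod (Cexp w - 1 - w) <= 4 * Cmod w ^ 2 * exp (Cmod w))%R.
Proof.
assert (H := RC_mean_value (fun t : R => Cexp (t * w) - t * w)
  (fun t => w * (Cexp (t * w) - 1)) 0 1
  (2 * Cmod w ^ 2 * exp (Cmod w)) Rle_0_1).
simpl in H. rewrite !Cmult_1_l, !Cmult_0_l, Cexp_0 in H.
replace (Cexp w - w - (1 - 0)) with (Cexp w - 1 - w) in H by ring.
assert (Hd : forall x : R, is_RCderive (fun t : R => Cexp (t * w) - t * w) x
   (w * (Cexp (x * w) - 1))).
{ intros x. replace (w * (Cexp (x * w) - 1)) with (w * Cexp (x * w) - w) by ring.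
  apply (is_derive_minus (V := C_R_NormedModule));
    [apply is_RCderive_Cexp_line|].
  apply is_RCderive_pair; unfold Re, Im; simpl; split; auto_derive; auto; ring. }
eapply Rle_trans; [apply H|right; ring].
- intros x _. eapply is_RCderive_continuous, Hd.
- intros x Hx. split; [apply Hd|].
  rewrite Cmod_mult.
  assert (Hb := Cexp_minus_1 (x * w)). rewrite Cmod_mult, Cmod_R, (Rabs_pos_eq x) in Hb by lra.
  assert (Hm := Cmod_ge_0 w).
  assert (He : (exp (x * Cmod w) <= exp (Cmod w))%R) by (apply exp_mono; nra).
  assert (Hp := exp_pos (x * Cmod w)).
  assert (Hb2 : (2 * (x * Cmod w) * exp (x * Cmod w) <= 2 * Cmod w * exp (Cmod w))%R).
  { apply Rmult_le_compat; nra. }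
  apply Rle_trans with (Cmod w * (2 * Cmod w * exp (Cmod w)))%R; [|right; ring].
  apply Rmult_le_compat_l; lra.
Qed.

Lemma is_Cderive_Cexp z : is_Cderive Cexp z (Cexp z).
Proof.
apply is_Cderive_iff. intros e He.
set (M := (4 * exp 1 * exp (Re z))%R).
assert (HM : (0 < M)%R).
{ unfold M. repeat apply Rmult_lt_0_compat; try apply exp_pos; lra. }
exists (Rmin 1 (e / M)). split; [apply Rmin_glb_lt; [lra|apply Rdiv_lt_0_compat; lra]|].
intros w Hw.
assert (Hw1 := Rlt_le_trans _ _ _ Hw (Rmin_l _ _)).
assert (Hw2 := Rlt_le_trans _ _ _ Hw (Rmin_r _ _)).
replace w with (z + (w - z)) at 1 by ring. rewrite Cexp_plus.
replace (Cexp z * Cexp (w - z) - Cexp z - (w - z) * Cexp z)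
  with (Cexp z * (Cexp (w - z) - 1 - (w - z))) by ring.
rewrite Cmod_mult, Cmod_Cexp. set (r := Cmod (w - z)) in *.
assert (Hr : (0 <= r)%R) by apply Cmod_ge_0.
assert (Hb := Cexp_minus_1_minus (w - z)). fold r in Hb.
assert (He1 : (exp r <= exp 1)%R) by (apply exp_mono; lra).
assert (Hp := exp_pos (Re z)).
apply Rle_trans with (exp (Re z) * (4 * r ^ 2 * exp 1))%R.
- apply Rmult_le_compat_l; [lra|]. eapply Rle_trans; [exact Hb|].
  apply Rmult_le_compat_l; [nra|exact He1].
- replace (exp (Re z) * (4 * r ^ 2 * exp 1))%R with (M * r * r)%R
    by (unfold M; ring).
  apply Rmult_le_compat_r; [exact Hr|].
  clear_denominator Hw2 M. lra.
Qed.

Lemma Ccont_Cexp (T : UniformSpace) (f : T -> C) x :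
  Ccts f x ->
  Ccts (fun t => Cexp (f t)) x.
Proof.
intros H. apply (continuous_comp f Cexp); auto.
apply (is_Cderive_continuous _ _ _ (is_Cderive_Cexp _)).
Qed.

Lemma Rcont_id x : Rcts (fun t : R => t) x.
Proof. apply continuous_id. Qed.

Lemma Rcont_plus (T : UniformSpace) (f g : T -> R) x :
  Rcts f x -> Rcts g x ->
  Rcts (fun t => f t + g t)%R x.
Proof. apply (continuous_plus (V := R_NormedModule) f g). Qed.

Lemma Rcont_minus (T : UniformSpace) (f g : T -> R) x :
  Rcts f x -> Rcts g x ->
  Rcts (fun t => f t - g t)%R x.
Proof. apply (continuous_minus (V := R_NormedModule) f g). Qed.

Lemma Rcont_mult (T : UniformSpace) (f g : T -> R) x :
  Rcts f x -> Rcts g x ->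
  Rcts (fun t => f t * g t)%R x.
Proof. apply (continuous_mult (K := R_AbsRing) f g). Qed.

Lemma Rcont_const (T : UniformSpace) (c : R) (x : T) :
  Rcts (fun _ => c) x.
Proof. apply continuous_const. Qed.

Lemma Rcont_comp (T : UniformSpace) (f : T -> R) (g : R -> R) x :
  Rcts f x -> continuity_pt g (f x) ->
  Rcts (fun t => g (f t)) x.
Proof.
intros H1 H2. apply (continuous_comp f g); auto.
apply continuity_pt_filterlim, H2.
Qed.

Lemma Ccont_cis (T : UniformSpace) (f : T -> R) x :
  Rcts f x ->
  Ccts (fun t => cis (f t)) x.
Proof.
intros H. apply Ccont_pair. split; simpl.
- apply (Rcont_comp _ f cos); auto. apply continuity_cos.
- apply (Rcont_comp _ f sin); auto. apply continuity_sin.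
Qed.

Lemma cis_lip a b : (Cmod (cis a - cis b) <= 2 * Rabs (a - b))%R.
Proof.
assert (Hl : forall g dg, (forall t, is_derive g t (dg t)) ->
  (forall t, Rabs (dg t) <= 1)%R -> (Rabs (g a - g b) <= Rabs (a - b))%R).
{ intros g dg H1 H2. assert (H := bounded_variation g dg 1 b a).
  rewrite Rmult_1_l in H. apply H. intros t _; split; auto. }
eapply Rle_trans; [apply Cmod_le_abs|].
assert (H1 : (Rabs (cos a - cos b) <= Rabs (a - b))%R).
{ apply (Hl cos (fun t => - sin t)%R).
  - intros; auto_derive; auto; ring.
  - intros t. rewrite Rabs_Ropp. apply Rabs_le, SIN_bound. }
assert (H2 : (Rabs (sin a - sin b) <= Rabs (a - b))%R).
{ apply (Hl sin cos).
  - intros; auto_derive; auto; ring.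
  - intros t. apply Rabs_le, COS_bound. }
apply Rle_trans with (Rabs (cos a - cos b) + Rabs (sin a - sin b))%R; [right; reflexivity|lra].
Qed.

Lemma CInt_cis (k : R) : k <> 0%R -> cis (k * (2 * PI)) = 1 ->
  CInt (fun x => cis (k * x)) 0 (2 * PI) = 0.
Proof.
intros Hk Hp.
rewrite (CInt_FTC (fun x => cis (k * x) * (- Ci / k))).
- rewrite Hp, Rmult_0_r, cis_0. ring.
- intros x. apply is_RCderive_pair. unfold cis, Re, Im; simpl.
  split; auto_derive; auto; field; auto.
- intros x. apply Ccont_cis. apply Rcont_mult; [apply Rcont_const|apply Rcont_id].
Qed.

(** * Positive functionals commute with Riemann integrals *)

Section PositiveFunctional.

Variable X : Type.
Variable P : (X -> R) -> Prop.
Variable Lam : (X -> R) -> R.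

(** [P] is the space of functions on which the functional is meaningful: the
    hypotheses are those of a Radon measure, and also hold for the Riemann
    integral on a segment. *)
Record positive_functional : Prop := {
  pf_plus_dom : forall f g, P f -> P g -> P (fun x => f x + g x)%R;
  pf_scal_dom : forall c f, P f -> P (fun x => c * f x)%R;
  pf_plus : forall f g, P f -> P g -> Lam (fun x => f x + g x)%R = (Lam f + Lam g)%R;
  pf_scal : forall (c : R) f, P f -> Lam (fun x => c * f x)%R = (c * Lam f)%R;
  pf_pos : forall f, P f -> (forall x, 0 <= f x)%R -> (0 <= Lam f)%R
}.

Hypothesis HL : positive_functional.

Lemma pf_minus_dom f g : P f -> P g -> P (fun x => f x - g x)%R.
Proof.
intros Hf Hg. replace (fun x => f x - g x)%R with (fun x => f x + (-1) * g x)%R.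
- apply (pf_plus_dom HL _ _ Hf), (pf_scal_dom HL), Hg.
- apply functional_extensionality; intros; ring.
Qed.

Lemma pf_minus f g : P f -> P g -> Lam (fun x => f x - g x)%R = (Lam f - Lam g)%R.
Proof.
intros Hf Hg. replace (fun x => f x - g x)%R with (fun x => f x + (-1) * g x)%R.
- rewrite (pf_plus HL), (pf_scal HL); auto; [ring|]. apply (pf_scal_dom HL), Hg.
- apply functional_extensionality; intros; ring.
Qed.

Lemma pf_mono f g : P f -> P g -> (forall x, f x <= g x)%R -> (Lam f <= Lam g)%R.
Proof.
intros Hf Hg H. assert (H' := pf_pos HL (fun x => g x - f x)%R).
rewrite pf_minus in H' by auto.
assert (0 <= Lam g - Lam f)%R; [|lra].
apply H'; [apply pf_minus_dom; auto|]. intros x. specialize (H x). lra.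
Qed.

Lemma pf_abs f g : P f -> P g -> (forall x, Rabs (f x) <= g x)%R ->
  (Rabs (Lam f) <= Lam g)%R.
Proof.
intros Hf Hg H. apply Rabs_le. split.
- replace (- Lam g)%R with ((-1) * Lam g)%R by ring.
  rewrite <- (pf_scal HL) by auto. apply pf_mono; auto.
  + apply (pf_scal_dom HL), Hg.
  + intros x. specialize (H x). generalize (Rabs_maj2 (f x)). lra.
- apply pf_mono; auto. intros x. specialize (H x).
  generalize (Rle_abs (f x)). lra.
Qed.

Definition pfC_dom (H : X -> C) : Prop :=
  P (fun x => Re (H x)) /\ P (fun x => Im (H x)).

Definition pfC (H : X -> C) : C := (Lam (fun x => Re (H x)), Lam (fun x => Im (H x))).

Lemma pfC_plus_dom f g : pfC_dom f -> pfC_dom g -> pfC_dom (fun x => f x + g x).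
Proof.
intros [H1 H2] [H3 H4]; split.
- apply (pf_plus_dom HL _ _ H1 H3).
- apply (pf_plus_dom HL _ _ H2 H4).
Qed.

Lemma pfC_minus_dom f g : pfC_dom f -> pfC_dom g -> pfC_dom (fun x => f x - g x).
Proof.
intros [H1 H2] [H3 H4]; split.
- apply (pf_minus_dom _ _ H1 H3).
- apply (pf_minus_dom _ _ H2 H4).
Qed.

Lemma pfC_scal_dom c f : pfC_dom f -> pfC_dom (fun x => c * f x).
Proof.
intros [H1 H2]; split.
- apply (pf_minus_dom (fun x => Re c * Re (f x))%R (fun x => Im c * Im (f x))%R);
  apply (pf_scal_dom HL); auto.
- apply (pf_plus_dom HL (fun x => Re c * Im (f x))%R (fun x => Im c * Re (f x))%R);
  apply (pf_scal_dom HL); auto.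
Qed.

Lemma pfC_plus f g : pfC_dom f -> pfC_dom g ->
  pfC (fun x => f x + g x) = pfC f + pfC g.
Proof.
intros [H1 H2] [H3 H4]. apply Ceq; simpl.
- apply (pf_plus HL _ _ H1 H3).
- apply (pf_plus HL _ _ H2 H4).
Qed.

Lemma pfC_minus f g : pfC_dom f -> pfC_dom g ->
  pfC (fun x => f x - g x) = pfC f - pfC g.
Proof.
intros [H1 H2] [H3 H4]. apply Ceq; simpl.
- apply (pf_minus _ _ H1 H3).
- apply (pf_minus _ _ H2 H4).
Qed.

Lemma pfC_scal c f : pfC_dom f -> pfC (fun x => c * f x) = c * pfC f.
Proof.
intros [H1 H2].
assert (S : forall k g, P g -> P (fun x => k * g x)%R) by
  (intros; apply (pf_scal_dom HL); auto).
apply Ceq; simpl.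
- rewrite <- !(pf_scal HL), <- pf_minus by auto. reflexivity.
- rewrite <- !(pf_scal HL), <- (pf_plus HL) by auto. reflexivity.
Qed.

(** Real and imaginary parts are bounded separately, whence the factor 2. *)
Lemma pfC_bound H chi : pfC_dom H -> P chi -> (forall x, Cmod (H x) <= chi x)%R ->
  (Cmod (pfC H) <= 2 * Lam chi)%R.
Proof.
intros [H1 H2] Hc Hb. eapply Rle_trans; [apply Cmod_le_abs|].
assert (Rabs (Lam (fun x => Re (H x))) <= Lam chi)%R.
{ apply pf_abs; auto. intros x. eapply Rle_trans; [apply re_le_Cmod|auto]. }
assert (Rabs (Lam (fun x => Im (H x))) <= Lam chi)%R.
{ apply pf_abs; auto. intros x. eapply Rle_trans; [apply im_le_Cmod|auto]. }
simpl. lra.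
Qed.

Variable F : X -> R -> C.
Variable chi : X -> R.
Hypothesis Hchi : P chi.
Hypothesis HF : forall t, pfC_dom (fun x => F x t).
Hypothesis Hlip : forall x t t', (Cmod (F x t - F x t') <= chi x * Rabs (t - t'))%R.

Lemma lip_RCcontinuous (f : R -> C) (K : R) :
  (forall t t', (Cmod (f t - f t') <= K * Rabs (t - t'))%R) ->
  forall t, RCcontinuous f t.
Proof.
intros H t. apply Ccontinuous_iff. intros e He.
assert (HK : (0 < e / (Rabs K + 1))%R).
{ apply Rdiv_lt_0_compat; auto. generalize (Rabs_pos K); lra. }
exists (mkposreal _ HK). intros y Hy. change (Rabs (y - t) < e / (Rabs K + 1))%R in Hy.
eapply Rle_lt_trans; [apply H|].
assert (HK' := Rle_abs K). assert (Hp := Rabs_pos K). assert (Hp' := Rabs_pos (y - t)).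
clear_denominator Hy (Rabs K + 1)%R. nra.
Qed.

(** Both sides, as functions of the upper bound of integration, have the same
    derivative: the difference quotients converge uniformly relative to [chi]. *)
Lemma pfC_fubini (a b : R) :
  (forall w, pfC_dom (fun x => CInt (F x) a w)) ->
  pfC (fun x => CInt (F x) a b) = CInt (fun t => pfC (fun x => F x t)) a b.
Proof.
intros HI.
assert (Hc : forall x t, RCcontinuous (F x) t).
{ intros x. apply (lip_RCcontinuous _ (chi x)). apply Hlip. }
assert (Hchi0 : (0 <= Lam chi)%R).
{ apply (pf_pos HL); auto. intros x. assert (H := Hlip x 1 0).
  rewrite Rminus_0_r, Rabs_R1, Rmult_1_r in H.
  eapply Rle_trans; [apply Cmod_ge_0|exact H]. }
assert (HC : forall t, RCcontinuous (fun t => pfC (fun x => F x t)) t).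
{ apply (lip_RCcontinuous _ (2 * Lam chi)). intros t t'.
  rewrite <- pfC_minus by auto.
  rewrite Rmult_assoc, (Rmult_comm (Lam chi)), <- (pf_scal HL) by auto.
  apply pfC_bound; [apply pfC_minus_dom; auto|apply (pf_scal_dom HL); auto|].
  intros x. rewrite Rmult_comm. apply Hlip. }
rewrite (CInt_FTC (fun w => pfC (fun x => CInt (F x) a w))
  (fun t => pfC (fun x => F x t))); auto.
- assert (Z : pfC (fun x => CInt (F x) a a) = 0).
  { assert (E : (fun x => CInt (F x) a a) = (fun x => 0 * CInt (F x) a b)).
    { apply functional_extensionality; intros x. rewrite Cmult_0_l.
      apply (RInt_point (V := C_R_CompleteNormedModule)). }
    rewrite E, pfC_scal by auto. ring. }
  rewrite Z. ring.
- intros w. apply is_RCderive_iff. intros e He.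
  exists (e / (2 * Lam chi + 1))%R. split; [apply Rdiv_lt_0_compat; lra|].
  intros w' Hw.
  rewrite <- pfC_minus, <- pfC_scal, <- pfC_minus; auto using pfC_scal_dom, pfC_minus_dom.
  apply Rle_trans with (2 * Lam (fun x => (Rabs (w' - w) * Rabs (w' - w)) * chi x)%R)%R.
  + apply pfC_bound.
    * apply pfC_minus_dom; [apply pfC_minus_dom; auto|apply pfC_scal_dom; auto].
    * apply (pf_scal_dom HL); auto.
    * intros x.
      assert (E : CInt (F x) a w' - CInt (F x) a w - (w' - w)%R * F x w =
        CInt (fun t => F x t - F x w) w w').
      { rewrite CInt_minus, CInt_const, <- (CInt_Chasles (F x) a w w'); auto.
        - ring.
        - intros; apply Ccont_const. }
      rewrite E, Cmod_norm, Rmult_assoc.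
      eapply (norm_RInt_le_const_abs (V := C_R_NormedModule)); cycle 1.
      -- apply CInt_correct. intros; apply Ccont_minus; [apply Hc|apply Ccont_const].
      -- intros t Ht. rewrite <- Cmod_norm. eapply Rle_trans; [apply Hlip|].
         rewrite Rmult_comm. apply Rmult_le_compat_r.
         ++ assert (H := Hlip x 1 0). rewrite Rminus_0_r, Rabs_R1, Rmult_1_r in H.
            eapply Rle_trans; [apply Cmod_ge_0|exact H].
         ++ revert Ht. unfold Rmin, Rmax. destruct (Rle_dec w w');
              intros Ht; unfold Rabs; repeat destruct Rcase_abs; lra.
  + rewrite (pf_scal HL) by auto.
    clear_denominator Hw (2 * Lam chi + 1)%R.
    assert (Hp := Rabs_pos (w' - w)). nra.
Qed.

End PositiveFunctional.

Lemma RInt_positive_functional (a b : R) : (a <= b)%R ->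
  positive_functional R (fun f => forall x, continuous f x) (fun f => RInt f a b).
Proof.
intros Hab.
assert (E : forall f : R -> R, (forall x, continuous f x) -> ex_RInt f a b).
{ intros f Hf. apply (ex_RInt_continuous (V := R_CompleteNormedModule)).
  intros; apply Hf. }
split.
- intros f g Hf Hg x. apply Rcont_plus; auto.
- intros c f Hf x. apply Rcont_mult; [apply Rcont_const|apply Hf].
- intros f g Hf Hg. apply (RInt_plus (V := R_CompleteNormedModule)); auto.
- intros c f Hf. apply (RInt_scal (V := R_CompleteNormedModule)); auto.
- intros f Hf Hp. apply RInt_ge_0; auto.
Qed.

Lemma CInt_fubini (F : R -> R -> C) (K a b c d : R) : (c <= d)%R -> (a <= b)%R ->
  (forall x x' t, (Cmod (F x t - F x' t) <= K * Rabs (x - x'))%R) ->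
  (forall x t t', (Cmod (F x t - F x t') <= K * Rabs (t - t'))%R) ->
  CInt (fun x => CInt (F x) a b) c d = CInt (fun t => CInt (fun x => F x t) c d) a b.
Proof.
intros Hcd Hab Hx Ht.
assert (Cx : forall t x, RCcontinuous (fun x => F x t) x).
{ intros t. apply (lip_RCcontinuous _ K). intros; apply Hx. }
assert (Ct : forall x t, RCcontinuous (F x) t).
{ intros x. apply (lip_RCcontinuous _ K). intros; apply Ht. }
assert (CI : forall w x, RCcontinuous (fun x => CInt (F x) a w) x).
{ intros w. apply (lip_RCcontinuous _ (Rabs (w - a) * K)). intros x x'.
  rewrite <- CInt_minus by auto. rewrite Cmod_norm, Rmult_assoc.
  eapply (norm_RInt_le_const_abs (V := C_R_NormedModule)); cycle 1.
  - apply CInt_correct. intros; apply Ccont_minus; auto.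
  - intros t _. rewrite <- Cmod_norm. apply Hx. }
assert (D : forall H : R -> C, (forall x, RCcontinuous H x) ->
  pfC_dom R (fun f => forall x, continuous f x) H).
{ intros H HH; split; intros x; apply (proj1 (Ccont_pair _ _ _) (HH x)). }
assert (E := pfC_fubini R _ _ (RInt_positive_functional c d Hcd) F (fun _ => K)
  (fun x => continuous_const K x) (fun t => D _ (Cx t)) Ht a b (fun w => D _ (CI w))).
unfold pfC in E. rewrite (CInt_pair (fun x => CInt (F x) a b)) by apply CI.
eapply eq_trans; [exact E|]. apply CInt_ext. intros t _. symmetry. apply CInt_pair, Cx.
Qed.

Lemma Rcont_lin (u v x : R) : continuous (fun t => u * t + v)%R x.
Proof.
apply Rcont_plus; [apply Rcont_mult; [apply Rcont_const|apply Rcont_id]|].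
apply Rcont_const.
Qed.

Lemma CInt_shift (f : R -> C) (v a b : R) : (forall x, RCcontinuous f x) ->
  CInt (fun t => f (t + v)%R) a b = CInt f (a + v)%R (b + v)%R.
Proof.
intros H. assert (E := CInt_comp_lin f 1 v a b H).
rewrite Cmult_1_l, !Rmult_1_l in E. rewrite <- E.
apply CInt_ext; intros; rewrite Rmult_1_l; reflexivity.
Qed.

Lemma CInt_period_shift (f : R -> C) (v T : R) : (forall x, RCcontinuous f x) ->
  (forall x, f (x + T)%R = f x) ->
  CInt (fun t => f (t + v)%R) 0 T = CInt f 0 T.
Proof.
intros H HT. rewrite CInt_shift by auto.
rewrite Rplus_0_l.
rewrite <- (CInt_Chasles f v 0 (T + v)), <- (CInt_Chasles f 0 T (T + v)) by auto.
assert (E := CInt_shift f T 0 v H).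
rewrite (CInt_ext (fun t => f (t + T)%R) f) in E by auto.
rewrite Rplus_0_l, (Rplus_comm v T) in E. rewrite <- E.
rewrite (CInt_swap f v 0) by auto. ring.
Qed.

(** * Fourier series at a point where they converge *)

Fixpoint csum (f : nat -> C) (n : nat) : C :=
  match n with O => RtoC 0 | S m => csum f m + f m end.

Lemma csum_ext f g n : (forall k, (k < n)%nat -> f k = g k) -> csum f n = csum g n.
Proof.
induction n as [|n IH]; intros H; simpl; auto.
rewrite IH, H; auto.
Qed.

Lemma csum_plus f g n : csum (fun k => f k + g k) n = csum f n + csum g n.
Proof. induction n as [|n IH]; simpl; [ring|rewrite IH; ring]. Qed.

Lemma csum_scal c f n : csum (fun k => c * f k) n = c * csum f n.
Proof. induction n as [|n IH]; simpl; [ring|rewrite IH; ring]. Qed.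

Lemma csum_scal_r c f n : csum (fun k => f k * c) n = csum f n * c.
Proof. induction n as [|n IH]; simpl; [ring|rewrite IH; ring]. Qed.

Lemma csum_conj f n : Cconj (csum f n) = csum (fun k => Cconj (f k)) n.
Proof.
induction n as [|n IH]; simpl.
- apply Ceq; unfold Re, Im, Cconj; simpl; ring.
- rewrite <- IH. apply Ceq; unfold Re, Im, Cconj; simpl; ring.
Qed.

Lemma csum_const c n : csum (fun _ => c) n = INR n * c.
Proof.
induction n as [|n IH]; [simpl; ring|]. rewrite S_INR, RtoC_plus.
simpl csum. rewrite IH. ring.
Qed.

Lemma csum_S_l f n : csum f (S n) = f O + csum (fun k => f (S k)) n.
Proof.
induction n as [|n IH]; [simpl; ring|].
change (csum f (S (S n))) with (csum f (S n) + f (S n)).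
rewrite IH. simpl. ring.
Qed.

Lemma csum_cont (T : UniformSpace) (f : nat -> T -> C) n x :
  (forall k, Ccts (f k) x) ->
  Ccts (fun t => csum (fun k => f k t) n) x.
Proof.
intros H. induction n as [|n IH]; simpl; [apply Ccont_const|].
apply Ccont_plus; auto.
Qed.

Lemma CInt_csum (f : nat -> R -> C) n a b : (forall k x, RCcontinuous (f k) x) ->
  CInt (fun x => csum (fun k => f k x) n) a b = csum (fun k => CInt (f k) a b) n.
Proof.
intros H. induction n as [|n IH]; simpl.
- rewrite CInt_const. ring.
- rewrite CInt_plus, IH; auto. intros x. apply csum_cont; auto.
Qed.

(** Only [p - q] matters; two natural numbers are kept because the basis
    vectors below have two exponents. *)
Definition fcoef (kappa : R -> C) (p q : nat) : C :=
  / (2 * PI) * CInt (fun x => kappa x * cis (2 * (INR p - INR q) * x)) 0 (2 * PI).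

Definition dirichlet (n : nat) (x : R) : C := csum (fun j => cis (2 * INR j * x)) n.

Definition fejer (n : nat) (x : R) : C := dirichlet n x * Cconj (dirichlet n x).

(** [0, -1, 1, -2, 2, ...] as differences of two natural numbers. *)
Definition enum_pair (j : nat) : nat * nat :=
  if Nat.even j then (Nat.div2 j, O) else (O, Nat.div2 (S j)).

Lemma fejer_expand n x :
  fejer n x = csum (fun j => csum (fun k => cis (2 * (INR j - INR k) * x)) n) n.
Proof.
unfold fejer. unfold dirichlet at 1. rewrite <- csum_scal_r.
apply csum_ext. intros j _. unfold dirichlet. rewrite csum_conj, <- csum_scal.
apply csum_ext. intros k _. rewrite <- cis_opp, <- cis_plus. f_equal; ring.
Qed.

Lemma cont_cis_lin (k x : R) : RCcontinuous (fun t => cis (k * t)) x.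
Proof. apply Ccont_cis, Rcont_mult; [apply Rcont_const|apply Rcont_id]. Qed.

Lemma CInt_cis_nat (p q : nat) :
  CInt (fun x => cis (2 * (INR p - INR q) * x)) 0 (2 * PI)
  = if Nat.eqb p q then RtoC (2 * PI) else 0.
Proof.
destruct (Nat.eqb_spec p q) as [->|Hne].
- rewrite (CInt_ext _ (fun _ => 1)).
  + rewrite CInt_const, Rminus_0_r. ring.
  + intros x _. rewrite Rminus_diag, Rmult_0_r, Rmult_0_l. apply cis_0.
- apply CInt_cis.
  + intros H. apply Hne, INR_eq. lra.
  + rewrite <- cis_0.
    assert (E : cis (2 * (INR p - INR q) * (2 * PI) + 2 * INR (2 * q) * PI) =
                cis (0 + 2 * INR (2 * p) * PI)).
    { f_equal. rewrite !mult_INR. simpl. ring. }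
    rewrite !cis_period in E. exact E.
Qed.

Lemma csum_delta n j : csum (fun k => if Nat.eqb j k then RtoC (2 * PI) else 0) n
  = if Nat.ltb j n then RtoC (2 * PI) else 0.
Proof.
induction n as [|n IH]; [reflexivity|].
simpl csum. rewrite IH.
destruct (Nat.ltb_spec j n), (Nat.ltb_spec j (S n)), (Nat.eqb_spec j n);
  try lia; ring.
Qed.

Lemma fejer_mass n : CInt (fejer n) 0 (2 * PI) = INR n * (2 * PI).
Proof.
rewrite (CInt_ext _ _ _ _ (fun x _ => fejer_expand n x)).
rewrite CInt_csum.
2: { intros k x. apply csum_cont. intros j. apply cont_cis_lin. }
rewrite (csum_ext _ (fun _ => RtoC (2 * PI))).
- rewrite csum_const, RtoC_mult. reflexivity.
- intros j Hj. rewrite CInt_csum by (intros; apply cont_cis_lin).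
  rewrite (csum_ext _ (fun k => if Nat.eqb j k then RtoC (2 * PI) else 0))
    by (intros; apply CInt_cis_nat).
  rewrite csum_delta. destruct (Nat.ltb_spec j n); [reflexivity|lia].
Qed.

Lemma fejer_Re n x : Re (fejer n x) = (Cmod (dirichlet n x) ^ 2)%R.
Proof. unfold fejer. assert (E := Cmod2_conj (dirichlet n x)). rewrite <- E. reflexivity. Qed.

Lemma fejer_cont n x : RCcontinuous (fejer n) x.
Proof.
unfold fejer, dirichlet.
assert (H : RCcontinuous (fun x => csum (fun j => cis (2 * INR j * x)) n) x)
  by (apply csum_cont; intros; apply cont_cis_lin).
apply Ccont_mult; [exact H|apply Ccont_conj, H].
Qed.

Lemma Cmod_cis_double (x : R) : Cmod (cis (2 * x) - 1) = (2 * Rabs (sin x))%R.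
Proof.
replace (cis (2 * x) - 1) with (2 * Ci * RtoC (sin x) * cis x).
- rewrite !Cmod_mult, Cmod_Ci, Cmod_cis, !Cmod_R, (Rabs_pos_eq 2) by lra. ring.
- unfold cis. apply Ceq; unfold Re, Im; simpl; rewrite ?cos_2a_sin, ?sin_2a; ring.
Qed.

(** A telescoping sum: the product of [exp (2 i x) - 1] and the kernel is [exp
    (2 i n x) - 1]. *)
Lemma dirichlet_sin n x : (Rabs (sin x) * Cmod (dirichlet n x) <= 1)%R.
Proof.
assert (E : (cis (2 * x) - 1) * dirichlet n x = cis (2 * INR n * x) - 1).
{ unfold dirichlet. induction n as [|n IH].
  - simpl. rewrite Rmult_0_r, Rmult_0_l, cis_0. ring.
  - rewrite S_INR. simpl csum.
    replace (2 * (INR n + 1) * x)%R with (2 * INR n * x + 2 * x)%R by ring.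
    rewrite cis_plus, Cmult_plus_distr_l, IH. ring. }
apply (f_equal Cmod) in E. rewrite Cmod_mult, Cmod_cis_double in E.
assert (H := Cmod_minus_le (cis (2 * INR n * x)) 1).
rewrite Cmod_cis, Cmod_1 in H. lra.
Qed.

(** Since [|kappa - kappa 0| <= L |sin|] compensates the size of the Dirichlet
    kernel, [L |D_n|] is an upper bound for the error, and its mean is at most
    [L sqrt n] because the mean of [|D_n|^2] is [n]. *)
Lemma fejer_estimate (kappa : R -> C) (L : R) (n : nat) :
  (0 < n)%nat -> (0 <= L)%R -> (forall x, RCcontinuous kappa x) ->
  (forall x, (Cmod (kappa x - kappa 0) <= L * Rabs (sin x))%R) ->
  (Cmod (csum (fun j => csum (fun k => fcoef kappa j k) n) n - INR n * kappa 0)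
    <= L * sqrt (INR n))%R.
Proof.
intros Hn HL Hc Hlip.
assert (HPI := PI_RGT_0).
assert (Hn' : (0 < INR n)%R) by (apply lt_0_INR; auto).
assert (Hsq : (0 < sqrt (INR n))%R) by (apply sqrt_lt_R0; auto).
assert (E : csum (fun j => csum (fun k => fcoef kappa j k) n) n - INR n * kappa 0 =
  / (2 * PI) * CInt (fun x => (kappa x - kappa 0) * fejer n x) 0 (2 * PI)).
{ rewrite (CInt_ext _ (fun x => kappa x * fejer n x - kappa 0 * fejer n x))
    by (intros; ring).
  rewrite CInt_minus, CInt_scal, fejer_mass.
  2: apply fejer_cont.
  2: intros; apply Ccont_mult; [apply Hc|apply fejer_cont].
  2: intros; apply Ccont_mult; [apply Ccont_const|apply fejer_cont].
  rewrite (CInt_ext (fun x => kappa x * fejer n x) (fun x => csum (fun j =>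
    csum (fun k => kappa x * cis (2 * (INR j - INR k) * x)) n) n)).
  2: { intros x _. rewrite fejer_expand, <- csum_scal. apply csum_ext; intros.
       rewrite <- csum_scal. reflexivity. }
  assert (K : forall j k x,
    RCcontinuous (fun x => kappa x * cis (2 * (INR j - INR k) * x)) x)
    by (intros; apply Ccont_mult; [apply Hc|apply cont_cis_lin]).
  rewrite CInt_csum by (intros; apply csum_cont; intros; apply K).
  unfold fcoef.
  rewrite (csum_ext (fun j => CInt _ 0 (2 * PI)) (fun j => csum (fun k =>
    CInt (fun x => kappa x * cis (2 * (INR j - INR k) * x)) 0 (2 * PI)) n))
    by (intros; apply CInt_csum; intros; apply K).
  rewrite (csum_ext (fun j => csum (fun k => / (2 * PI) * _) n)
    (fun j => / (2 * PI) * csum (fun k =>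
    CInt (fun x => kappa x * cis (2 * (INR j - INR k) * x)) 0 (2 * PI)) n))
    by (intros; apply csum_scal).
  rewrite csum_scal. field. apply RtoC_neq; lra. }
rewrite E, Cmod_mult, Cmod_inv, <- RtoC_mult, Cmod_R, Rabs_pos_eq;
  [|lra|rewrite <- RtoC_mult; apply RtoC_neq; lra].
set (a := sqrt (INR n)) in *.
assert (Ha : (a * a = INR n)%R) by (apply sqrt_sqrt; lra).
assert (CF : forall x, continuous (fun x => Re (fejer n x)) x)
  by (intros x; apply (proj1 (Ccont_pair _ _ _) (fejer_cont n x))).
assert (EF : RInt (fun x => Re (fejer n x)) 0 (2 * PI) = (INR n * (2 * PI))%R).
{ assert (M := fejer_mass n). rewrite CInt_pair in M by apply fejer_cont.
  apply (f_equal Re) in M. simpl in M. etransitivity; [exact M|].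
  unfold Re; simpl. ring. }
assert (B : (Cmod (CInt (fun x => ((kappa x - kappa 0) * fejer n x)%C) 0 (2 * PI)) <=
  RInt (fun x => (L / (2 * a)) * Re (fejer n x) + L * a / 2)%R 0 (2 * PI))%R).
{ apply CInt_bound; [lra| | |].
  - intros x. apply Ccont_mult; [|apply fejer_cont].
    apply Ccont_minus; [apply Hc|apply Ccont_const].
  - intros x. apply Rcont_plus; [|apply Rcont_const].
    apply Rcont_mult; [apply Rcont_const|apply CF].
  - intros x _. rewrite Cmod_mult. unfold fejer at 1. rewrite Cmod_mult, Cmod_conj.
    rewrite fejer_Re. set (d := Cmod (dirichlet n x)).
    assert (Hd : (0 <= d)%R) by apply Cmod_ge_0.
    assert (Hs := dirichlet_sin n x). fold d in Hs.
    assert (Hp := Rabs_pos (sin x)).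
    apply Rle_trans with (L * d)%R.
    + apply Rle_trans with (L * Rabs (sin x) * (d * d))%R.
      * apply Rmult_le_compat_r; [nra|apply Hlip].
      * replace (L * Rabs (sin x) * (d * d))%R
          with (L * d * (Rabs (sin x) * d))%R by ring.
        rewrite <- (Rmult_1_r (L * d)) at 2. apply Rmult_le_compat_l; [nra|exact Hs].
    + replace (L / (2 * a) * d ^ 2 + L * a / 2)%R
        with (L * ((d * d + a * a) / (2 * a)))%R by (field; lra).
      apply Rmult_le_compat_l; auto.
      apply Rmult_le_reg_r with (2 * a)%R; [lra|].
      unfold Rdiv. rewrite Rmult_assoc, Rinv_l by lra.
      generalize (Rle_0_sqr (d - a)). unfold Rsqr. lra. }
rewrite (RInt_plus (V := R_CompleteNormedModule)) in B.
2: apply (ex_RInt_continuous (V := R_CompleteNormedModule)); intros;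
  apply Rcont_mult; [apply Rcont_const|apply CF].
2: apply (ex_RInt_continuous (V := R_CompleteNormedModule)); intros;
  apply Rcont_const.
rewrite (RInt_scal (V := R_CompleteNormedModule)), RInt_const in B.
2: apply (ex_RInt_continuous (V := R_CompleteNormedModule)); intros; apply CF.
rewrite EF in B. unfold plus, scal in B; simpl in B. unfold mult in B; simpl in B.
apply Rmult_le_reg_l with (2 * PI)%R; [lra|].
rewrite <- Rmult_assoc, Rinv_r, Rmult_1_l by lra.
eapply Rle_trans; [exact B|]. right. rewrite <- Ha. field. lra.
Qed.

Lemma fcoef_shift kappa j k m :
  fcoef kappa (j + m) (k + m) = fcoef kappa j k.
Proof.
unfold fcoef. f_equal. apply CInt_ext. intros x _. rewrite !plus_INR.
do 2 f_equal. ring.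
Qed.

(** The symmetric partial sums of the Fourier series at [0]. *)
Definition fpartial (kappa : R -> C) (n : nat) : C :=
  fcoef kappa 0 0 + csum (fun m => fcoef kappa 0 (S m) + fcoef kappa (S m) 0) n.

Lemma csum_rev f n : csum (fun k => f (n - 1 - k)%nat) n = csum f n.
Proof.
revert f. induction n as [|n IH]; intros f; [reflexivity|].
rewrite csum_S_l. simpl csum. replace (S n - 1 - 0)%nat with n by lia.
rewrite <- (IH f). rewrite Cplus_comm. f_equal.
apply csum_ext. intros k Hk. f_equal. lia.
Qed.

(** The double sum is rearranged by the last value of the larger index: step
    [n] adds the terms with [max j k = n], which depend on [j - k] only. *)
Lemma fejer_sum_partial kappa n :
  csum (fun j => csum (fun k => fcoef kappa j k) n) n = csum (fpartial kappa) n.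
Proof.
induction n as [|n IH]; [reflexivity|].
simpl csum. rewrite csum_plus, IH. unfold fpartial at 3.
rewrite csum_plus.
rewrite <- (csum_rev (fun k => fcoef kappa 0 (S k))).
rewrite <- (csum_rev (fun k => fcoef kappa (S k) 0)).
rewrite (csum_ext (fun k => fcoef kappa 0 (S (n - 1 - k))) (fun k => fcoef kappa k n)).
2: { intros k Hk. rewrite <- (fcoef_shift kappa 0 (S (n - 1 - k)) k). f_equal; lia. }
rewrite (csum_ext (fun k => fcoef kappa (S (n - 1 - k)) 0) (fun k => fcoef kappa n k)).
2: { intros k Hk. rewrite <- (fcoef_shift kappa (S (n - 1 - k)) 0 k). f_equal; lia. }
replace (fcoef kappa n n) with (fcoef kappa 0 0)
  by (symmetry; apply (fcoef_shift kappa 0 0 n)).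
ring.
Qed.

Lemma cesaro_fpartial (kappa : R -> C) (L : R) :
  (0 <= L)%R -> (forall x, RCcontinuous kappa x) ->
  (forall x, (Cmod (kappa x - kappa 0) <= L * Rabs (sin x))%R) ->
  forall n, (0 < n)%nat ->
  (Cmod (csum (fpartial kappa) n / INR n - kappa 0) <= L / sqrt (INR n))%R.
Proof.
intros HL Hc Hlip n Hn.
assert (H := fejer_estimate kappa L n Hn HL Hc Hlip).
rewrite fejer_sum_partial in H.
assert (Hn' : (0 < INR n)%R) by (apply lt_0_INR; auto).
assert (Hsq : (0 < sqrt (INR n))%R) by (apply sqrt_lt_R0; auto).
replace (csum (fpartial kappa) n / INR n - kappa 0)
  with ((csum (fpartial kappa) n - INR n * kappa 0) * / INR n)
  by (field; apply RtoC_neq; lra).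
rewrite Cmod_mult, Cmod_inv, Cmod_R, Rabs_pos_eq by (try apply RtoC_neq; lra).
apply Rle_trans with (L * sqrt (INR n) * / INR n)%R.
- apply Rmult_le_compat_r; [left; apply Rinv_0_lt_compat; auto|exact H].
- right. rewrite <- (sqrt_sqrt (INR n)) at 2 by lra. field. lra.
Qed.

Fixpoint rsum (f : nat -> R) (n : nat) : R :=
  match n with O => 0%R | S m => (rsum f m + f m)%R end.

Lemma csum_Re f n : Re (csum f n) = rsum (fun k => Re (f k)) n.
Proof. induction n as [|n IH]; [reflexivity|]. simpl. rewrite <- IH. reflexivity. Qed.

Lemma csum_Im f n : Im (csum f n) = rsum (fun k => Im (f k)) n.
Proof. induction n as [|n IH]; [reflexivity|]. simpl. rewrite <- IH. reflexivity. Qed.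

Lemma rsum_cesaro (u : nat -> R) (l : R) : is_lim_seq u l ->
  is_lim_seq (fun n => rsum u n / INR n)%R l.
Proof.
intros H. apply is_lim_seq_incr_1.
apply is_lim_seq_Reals in H. assert (H' := Cesaro_1 u l H).
apply is_lim_seq_Reals in H'. apply (proj1 (is_lim_seq_incr_1 _ _)) in H'.
eapply is_lim_seq_ext; [|exact H']. intros n. simpl pred.
assert (E : sum_f_R0 u n = rsum u (S n)).
{ clear. induction n as [|n IH]; [simpl; ring|].
  simpl rsum in *. simpl sum_f_R0. rewrite <- IH. reflexivity. }
cbv beta. rewrite <- E. reflexivity.
Qed.

Lemma lim_inv_sqrt (L : R) : is_lim_seq (fun n => L / sqrt (INR n))%R 0.
Proof.
apply is_lim_seq_Reals. intros e He.
destruct (INR_unbounded ((Rabs L / e + 1) ^ 2)) as [N HN].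
exists (S N). intros n Hn. unfold Rdist. rewrite Rminus_0_r.
assert (Hn' : (INR N <= INR n)%R) by (apply le_INR; lia).
assert (Hq : (0 <= Rabs L / e)%R).
{ apply Rmult_le_pos; [apply Rabs_pos|left; apply Rinv_0_lt_compat; lra]. }
assert (Hs : (Rabs L / e + 1 <= sqrt (INR n))%R).
{ rewrite <- (sqrt_pow2 (Rabs L / e + 1)) by lra. apply sqrt_le_1; nra. }
unfold Rdiv. rewrite Rabs_mult, Rabs_inv, (Rabs_pos_eq (sqrt _)) by apply sqrt_pos.
apply Rmult_lt_reg_r with (sqrt (INR n)); [lra|].
rewrite Rmult_assoc, Rinv_l by lra.
apply Rlt_le_trans with (e * (Rabs L / e + 1))%R.
- unfold Rdiv. rewrite Rmult_plus_distr_l.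
  replace (e * (Rabs L * / e))%R with (Rabs L) by (field; lra). lra.
- apply Rmult_le_compat_l; lra.
Qed.

Lemma cesaro_limits (kappa : R -> C) (L : R) :
  (0 <= L)%R -> (forall x, RCcontinuous kappa x) ->
  (forall x, (Cmod (kappa x - kappa 0) <= L * Rabs (sin x))%R) ->
  is_lim_seq (fun n => rsum (fun m => Re (fpartial kappa m)) n / INR n)%R (Re (kappa 0)) /\
  is_lim_seq (fun n => rsum (fun m => Im (fpartial kappa m)) n / INR n)%R (Im (kappa 0)).
Proof.
intros HL Hc Hlip. assert (H := cesaro_fpartial kappa L HL Hc Hlip).
assert (G : forall (u : nat -> R) (l : R),
  (forall n, (0 < n)%nat -> (Rabs (u n - l) <= L / sqrt (INR n))%R) ->
  is_lim_seq u l).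
{ intros u l Hu. apply is_lim_seq_incr_1.
  assert (Z := proj1 (is_lim_seq_incr_1 _ _) (lim_inv_sqrt L)).
  apply is_lim_seq_le_le with (fun n => l - L / sqrt (INR (S n)))%R
    (fun n => l + L / sqrt (INR (S n)))%R.
  - intros n. assert (Hu' := Hu (S n) ltac:(lia)).
    apply Rabs_le_between in Hu'. lra.
  - replace (Finite l) with (Finite (l - 0)%R) by (f_equal; ring).
    apply is_lim_seq_minus'; [apply is_lim_seq_const|exact Z].
  - replace (Finite l) with (Finite (l + 0)%R) by (f_equal; ring).
    apply is_lim_seq_plus'; [apply is_lim_seq_const|exact Z]. }
split; apply G; intros n Hn;
  assert (Hn' : INR n <> 0%R) by (apply not_0_INR; lia);
  (eapply Rle_trans; [|apply (H n Hn)]).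
- rewrite <- csum_Re. eapply Rle_trans; [|apply re_le_Cmod]. right. f_equal.
  unfold Re; simpl. field. auto.
- rewrite <- csum_Im. eapply Rle_trans; [|apply im_le_Cmod]. right. f_equal.
  unfold Im; simpl. field. auto.
Qed.

Lemma enum_pair_even m : enum_pair (2 * m) = (m, O).
Proof.
unfold enum_pair. rewrite Nat.even_mul. simpl Nat.even. simpl orb.
rewrite Nat.div2_double. reflexivity.
Qed.

Lemma enum_pair_odd m : enum_pair (S (2 * m)) = (O, S m).
Proof.
unfold enum_pair. rewrite Nat.even_succ, Nat.odd_mul. simpl Nat.odd. simpl andb.
replace (S (S (2 * m))) with (2 * S m)%nat by lia.
rewrite Nat.div2_double. reflexivity.
Qed.

Lemma sum_n_enum (kappa : R -> C) (n : nat) :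
  sum_n (G := C_R_NormedModule)
    (fun j => fcoef kappa (fst (enum_pair j)) (snd (enum_pair j))) (2 * n)
  = fpartial kappa n.
Proof.
induction n as [|n IH].
- rewrite sum_O. unfold fpartial. change (enum_pair (2 * 0)) with (0, 0)%nat.
  simpl. ring.
- replace (2 * S n)%nat with (S (S (2 * n))) by lia.
  rewrite !sum_Sn, IH. rewrite enum_pair_odd.
  replace (S (S (2 * n))) with (2 * S n)%nat by lia. rewrite enum_pair_even.
  unfold fpartial. simpl csum. lazymatch goal with |- plus (plus ?a ?b) ?c = ?d =>
    change (@eq C (a + b + c) d) end.
  cbn [fst snd]. ring.
Qed.

(** A Fourier series that converges at [0] converges to the value of the
    function: its Cesaro means do. *)
Lemma fourier_sum_value (kappa : R -> C) (L : R) (tau : C) :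
  (0 <= L)%R -> (forall x, RCcontinuous kappa x) ->
  (forall x, (Cmod (kappa x - kappa 0) <= L * Rabs (sin x))%R) ->
  is_series (V := C_R_NormedModule)
    (fun j => fcoef kappa (fst (enum_pair j)) (snd (enum_pair j))) tau ->
  tau = kappa 0.
Proof.
intros HL Hc Hlip Hs.
assert (Hp : filterlim (fpartial kappa) eventually
  (Cnear tau)).
{ apply filterlim_ext with (fun n => sum_n (G := C_R_NormedModule)
    (fun j => fcoef kappa (fst (enum_pair j)) (snd (enum_pair j))) (2 * n)).
  - intros n. apply sum_n_enum.
  - apply (filterlim_comp _ _ _ (fun n => (2 * n)%nat) _ _ eventually); [|exact Hs].
    apply eventually_subseq. intros n; lia. }
destruct (cesaro_limits kappa L HL Hc Hlip) as [CR CI].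
assert (PR : is_lim_seq (fun n => Re (fpartial kappa n)) (Re tau)).
{ apply (filterlim_comp _ _ _ (fpartial kappa) (fun z : C => Re z) _ _ _ Hp).
  apply (continuous_fst (U := R_UniformSpace) (V := R_UniformSpace)). }
assert (PI' : is_lim_seq (fun n => Im (fpartial kappa n)) (Im tau)).
{ apply (filterlim_comp _ _ _ (fpartial kappa) (fun z : C => Im z) _ _ _ Hp).
  apply (continuous_snd (U := R_UniformSpace) (V := R_UniformSpace)). }
apply rsum_cesaro in PR. apply rsum_cesaro in PI'.
apply Ceq.
- apply is_lim_seq_unique in PR. apply is_lim_seq_unique in CR. congruence.
- apply is_lim_seq_unique in PI'. apply is_lim_seq_unique in CI. congruence.
Qed.

Lemma rsum_ge_tail (u : nat -> R) (n : nat) : (forall k, (0 <= u k)%R) ->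
  (forall k, (u k <= u (S k))%R) -> (INR n * u n <= rsum u (n + n))%R.
Proof.
intros H0 H1.
assert (Hm : forall k j, (u k <= u (k + j)%nat)%R).
{ intros k j. induction j as [|j IH]; [rewrite Nat.add_0_r; lra|].
  rewrite Nat.add_succ_r. specialize (H1 (k + j)%nat). lra. }
assert (Hs : forall k, (0 <= rsum u k)%R).
{ induction k as [|k IH]; simpl; [lra|]. specialize (H0 k). lra. }
assert (G : forall j, (INR j * u n <= rsum u (n + j))%R).
{ induction j as [|j IH].
  - rewrite Nat.add_0_r. simpl. specialize (Hs n). lra.
  - rewrite Nat.add_succ_r, S_INR. simpl. specialize (Hm n j). lra. }
apply G.
Qed.

(** Positive coefficients: the Cesaro means bound the partial sums, so that the
    series converges. *)
Lemma fourier_sum_pos (kappa : R -> C) (L : R) (r : nat -> R) :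
  (0 <= L)%R -> (forall x, RCcontinuous kappa x) ->
  (forall x, (Cmod (kappa x - kappa 0) <= L * Rabs (sin x))%R) ->
  (forall j, (0 <= r j)%R) ->
  (forall j, fcoef kappa (fst (enum_pair j)) (snd (enum_pair j)) = RtoC (r j)) ->
  is_series r (Re (kappa 0)).
Proof.
intros HL Hc Hlip Hr Hf.
destruct (cesaro_limits kappa L HL Hc Hlip) as [CR _].
set (s := fun n => sum_n r n).
assert (Hinc : forall n, (s n <= s (S n))%R).
{ intros n. unfold s. rewrite sum_Sn. unfold plus; simpl. specialize (Hr (S n)). lra. }
assert (Hmono : forall n m, (n <= m)%nat -> (s n <= s m)%R).
{ intros n m H. induction H; [lra|]. specialize (Hinc m). lra. }
assert (Hs0 : forall n, (0 <= s n)%R).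
{ intros n. apply Rle_trans with (s O); [|apply Hmono; lia].
  unfold s. rewrite sum_O. apply Hr. }
assert (Es : forall n, Re (fpartial kappa n) = s (2 * n)%nat).
{ intros n. rewrite <- sum_n_enum. unfold s.
  rewrite (functional_extensionality _ _ Hf).
  induction (2 * n)%nat as [|k IH]; [rewrite !sum_O; reflexivity|].
  rewrite !sum_Sn. unfold plus; simpl. rewrite <- IH. reflexivity. }
set (u := fun m => Re (fpartial kappa m)) in *.
assert (Hu0 : forall k, (0 <= u k)%R) by (intros; unfold u; rewrite Es; auto).
assert (Hu1 : forall k, (u k <= u (S k))%R).
{ intros k; unfold u; rewrite !Es. apply Hmono; lia. }
assert (HB : exists B, forall n, (u n <= B)%R).
{ assert (Hbd : exists M, forall n, (Rabs (rsum u n / INR n) <= M)%R).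
  { apply is_lim_seq_Reals in CR.
    destruct (maj_by_pos _ (exist _ _ CR)) as (M & _ & HM). exists M. exact HM. }
  destruct Hbd as [M HM]. exists (2 * M)%R. intros n.
  destruct n as [|n].
  - apply Rle_trans with (u 1%nat); [apply Hu1|].
    assert (H2 := rsum_ge_tail u 1 Hu0 Hu1).
    specialize (HM 2%nat). simpl in *. apply Rabs_le_between in HM. lra.
  - assert (H2 := rsum_ge_tail u (S n) Hu0 Hu1).
    specialize (HM (S n + S n)%nat). apply Rabs_le_between in HM.
    destruct HM as [_ HM]. rewrite plus_INR in HM.
    assert (Hp : (0 < INR (S n))%R) by (apply lt_0_INR; lia).
    apply Rmult_le_reg_l with (INR (S n)); [exact Hp|].
    apply Rle_trans with (1 := H2).
    clear_denominator HM (INR (S n) + INR (S n))%R. lra. }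
destruct HB as [B HB].
assert (Hlim : ex_finite_lim_seq s).
{ apply ex_finite_lim_seq_incr with B; [apply Hinc|].
  intros n. apply Rle_trans with (s (2 * n)%nat); [apply Hmono; lia|].
  rewrite <- Es. apply HB. }
destruct Hlim as [l Hl].
assert (Hul : is_lim_seq u l).
{ apply is_lim_seq_ext with (fun n => s (2 * n)%nat);
    [intros; symmetry; apply Es|].
  apply (is_lim_seq_subseq s l (fun n => (2 * n)%nat)); [|exact Hl].
  apply eventually_subseq. intros n; lia. }
apply rsum_cesaro in Hul.
apply is_lim_seq_unique in Hul. apply is_lim_seq_unique in CR.
assert (E : l = Re (kappa 0)) by congruence.
rewrite <- E. exact Hl.
Qed.

(** * Metric and topology of SL(2,R) *)

Lemma SL2_eq (x y : SL2) : m11 x = m11 y -> m12 x = m12 y -> m21 x = m21 y ->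
  m22 x = m22 y -> x = y.
Proof.
destruct x, y; simpl; intros; subst. f_equal. apply proof_irrelevance.
Qed.

Lemma SL2_mul_assoc x y z : SL2_mul (SL2_mul x y) z = SL2_mul x (SL2_mul y z).
Proof. apply SL2_eq; simpl; ring. Qed.

Definition SL2_one : SL2 := elt_m false.

Lemma SL2_mul_1_l x : SL2_mul SL2_one x = x.
Proof. apply SL2_eq; simpl; ring. Qed.

Lemma SL2_mul_1_r x : SL2_mul x SL2_one = x.
Proof. apply SL2_eq; simpl; ring. Qed.

Lemma SL2_inv_det (x : SL2) : (m22 x * m11 x - (- m12 x) * (- m21 x) = 1)%R.
Proof. rewrite <- (SL2_det x) at 1. ring. Qed.

Definition SL2_inv (x : SL2) : SL2 := mkSL2 _ _ _ _ (SL2_inv_det x).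

Lemma SL2_mul_inv_l x : SL2_mul (SL2_inv x) x = SL2_one.
Proof. assert (H := SL2_det x). apply SL2_eq; simpl; lra. Qed.

Lemma elt_k_plus a b : SL2_mul (elt_k a) (elt_k b) = elt_k (a + b).
Proof. apply SL2_eq; simpl; rewrite ?cos_plus, ?sin_plus; ring. Qed.

Lemma elt_k_0 : elt_k 0 = SL2_one.
Proof. apply SL2_eq; simpl; rewrite ?cos_0, ?sin_0; ring. Qed.

Lemma elt_k_PI : elt_k PI = elt_m true.
Proof. apply SL2_eq; simpl; rewrite ?cos_PI, ?sin_PI; ring. Qed.

Lemma elt_k_period t : elt_k (t + 2 * PI) = elt_k t.
Proof.
assert (E := cos_period t 1). assert (E' := sin_period t 1).
simpl INR in *. rewrite Rmult_1_r in *.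
apply SL2_eq; simpl; rewrite ?E, ?E'; reflexivity.
Qed.

(** The sum of the absolute values of the entries is submultiplicative, so
    that translations are Lipschitz for the corresponding distance. *)
Definition mnorm (x : SL2) : R :=
  (Rabs (m11 x) + Rabs (m12 x) + Rabs (m21 x) + Rabs (m22 x))%R.

Definition mdist (x y : SL2) : R :=
  (Rabs (m11 x - m11 y) + Rabs (m12 x - m12 y) + Rabs (m21 x - m21 y)
   + Rabs (m22 x - m22 y))%R.

Lemma mnorm_pos x : (0 <= mnorm x)%R.
Proof.
unfold mnorm. generalize (Rabs_pos (m11 x)) (Rabs_pos (m12 x))
 (Rabs_pos (m21 x)) (Rabs_pos (m22 x)). lra.
Qed.

Lemma mdist_pos x y : (0 <= mdist x y)%R.
Proof.
unfold mdist. generalize (Rabs_pos (m11 x - m11 y)) (Rabs_pos (m12 x - m12 y))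
 (Rabs_pos (m21 x - m21 y)) (Rabs_pos (m22 x - m22 y)). lra.
Qed.

Lemma mdist_sym x y : mdist x y = mdist y x.
Proof.
unfold mdist.
rewrite (Rabs_minus_sym (m11 x)), (Rabs_minus_sym (m12 x)),
 (Rabs_minus_sym (m21 x)), (Rabs_minus_sym (m22 x)). reflexivity.
Qed.

Lemma mdist_refl x : mdist x x = 0%R.
Proof. unfold mdist. rewrite !Rminus_diag, !Rabs_R0. ring. Qed.

Lemma Rabs_minus_tri (a b c : R) : (Rabs (a - c) <= Rabs (a - b) + Rabs (b - c))%R.
Proof.
replace (a - c)%R with ((a - b) + (b - c))%R by ring. apply Rabs_triang.
Qed.

Lemma mdist_tri x y z : (mdist x z <= mdist x y + mdist y z)%R.
Proof.
unfold mdist.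
generalize (Rabs_minus_tri (m11 x) (m11 y) (m11 z))
  (Rabs_minus_tri (m12 x) (m12 y) (m12 z)) (Rabs_minus_tri (m21 x) (m21 y) (m21 z))
  (Rabs_minus_tri (m22 x) (m22 y) (m22 z)). lra.
Qed.

Lemma mnorm_mdist x y : (Rabs (mnorm x - mnorm y) <= mdist x y)%R.
Proof.
assert (H : forall a b, (Rabs a - Rabs b <= Rabs (a - b))%R) by apply Rabs_triang_inv.
assert (G : forall u v, (mnorm u - mnorm v <= mdist u v)%R).
{ intros u v. unfold mnorm, mdist.
  generalize (H (m11 u) (m11 v)) (H (m12 u) (m12 v)) (H (m21 u) (m21 v))
    (H (m22 u) (m22 v)). lra. }
apply Rabs_le. assert (G1 := G x y). assert (G2 := G y x).
rewrite mdist_sym in G2. lra.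
Qed.

Lemma Rabs_lin2 (a b c d : R) :
  (Rabs (a * b + c * d) <= Rabs a * Rabs b + Rabs c * Rabs d)%R.
Proof. rewrite <- !Rabs_mult. apply Rabs_triang. Qed.

Lemma l1_mul_bound (a b c d a' b' c' d' : R) :
  (Rabs (a * a' + b * c') + Rabs (a * b' + b * d') + Rabs (c * a' + d * c')
   + Rabs (c * b' + d * d') <=
   (Rabs a + Rabs b + Rabs c + Rabs d) * (Rabs a' + Rabs b' + Rabs c' + Rabs d'))%R.
Proof.
generalize (Rabs_lin2 a a' b c') (Rabs_lin2 a b' b d') (Rabs_lin2 c a' d c')
  (Rabs_lin2 c b' d d').
generalize (Rabs_pos a) (Rabs_pos b) (Rabs_pos c) (Rabs_pos d) (Rabs_pos a')
  (Rabs_pos b') (Rabs_pos c') (Rabs_pos d').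
generalize (Rabs a) (Rabs b) (Rabs c) (Rabs d) (Rabs a') (Rabs b') (Rabs c')
  (Rabs d'). intros.
assert (0 <= r * r5 + r * r6 + r0 * r3 + r0 * r4 + r1 * r5 + r1 * r6 + r2 * r3 + r2 * r4
  + 0)%R
  by (repeat apply Rplus_le_le_0_compat; try apply Rmult_le_pos; lra).
assert (0 <= r * r5)%R by (apply Rmult_le_pos; lra).
nra.
Qed.

Lemma mnorm_mul x y : (mnorm (SL2_mul x y) <= mnorm x * mnorm y)%R.
Proof. unfold mnorm; simpl. apply l1_mul_bound. Qed.

Lemma mdist_mul_l x y z : (mdist (SL2_mul x y) (SL2_mul x z) <= mnorm x * mdist y z)%R.
Proof.
unfold mnorm, mdist; simpl.
eapply Rle_trans; [|apply l1_mul_bound]. right.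
repeat (f_equal; [|f_equal; ring]). f_equal; ring.
Qed.

Lemma mdist_mul_r x y z : (mdist (SL2_mul y x) (SL2_mul z x) <= mdist y z * mnorm x)%R.
Proof.
unfold mnorm, mdist; simpl.
eapply Rle_trans; [|apply l1_mul_bound]. right.
repeat (f_equal; [|f_equal; ring]). f_equal; ring.
Qed.

Lemma mnorm_k t : (mnorm (elt_k t) <= 4)%R.
Proof.
unfold mnorm; simpl. rewrite Rabs_Ropp.
assert (Rabs (cos t) <= 1)%R by (apply Rabs_le, COS_bound).
assert (Rabs (sin t) <= 1)%R by (apply Rabs_le, SIN_bound).
lra.
Qed.

Lemma mdist_k a b : (mdist (elt_k a) (elt_k b) <= 4 * Cmod (cis a - cis b))%R.
Proof.
assert (H1 := re_le_Cmod (cis a - cis b)). assert (H2 := im_le_Cmod (cis a - cis b)).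
unfold mdist; simpl.
change (Rabs (cos a - cos b) <= Cmod (cis a - cis b))%R in H1.
change (Rabs (sin a - sin b) <= Cmod (cis a - cis b))%R in H2.
replace (- sin a - - sin b)%R with (- (sin a - sin b))%R by ring.
rewrite Rabs_Ropp. lra.
Qed.

Lemma mnorm_conj_k t x :
  (mnorm (SL2_mul (SL2_mul (elt_k (- t)) x) (elt_k t)) <= 16 * mnorm x)%R.
Proof.
eapply Rle_trans; [apply mnorm_mul|].
assert (H := mnorm_mul (elt_k (- t)) x).
assert (H1 := mnorm_k t). assert (H2 := mnorm_k (- t)).
assert (P1 := mnorm_pos (elt_k t)). assert (P2 := mnorm_pos (elt_k (- t))).
assert (P3 := mnorm_pos x).
assert (P4 := mnorm_pos (SL2_mul (elt_k (- t)) x)).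
assert (mnorm (SL2_mul (elt_k (- t)) x) <= 4 * mnorm x)%R by nra.
nra.
Qed.

Lemma conj_k_inv t x :
  SL2_mul (SL2_mul (elt_k (- (- t))) (SL2_mul (SL2_mul (elt_k (- t)) x) (elt_k t)))
    (elt_k (- t)) = x.
Proof.
rewrite !SL2_mul_assoc, elt_k_plus.
rewrite <- !SL2_mul_assoc, elt_k_plus, !SL2_mul_assoc.
replace (t + - t)%R with 0%R by ring. replace (- - t + - t)%R with 0%R by ring.
rewrite elt_k_0, SL2_mul_1_r, SL2_mul_1_l. reflexivity.
Qed.

Lemma mnorm_conj_k_rev t x :
  (mnorm x <= 16 * mnorm (SL2_mul (SL2_mul (elt_k (- t)) x) (elt_k t)))%R.
Proof.
rewrite <- (conj_k_inv t x) at 1. apply mnorm_conj_k.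
Qed.

Lemma locally_SL2 (x : SL2) (P : SL2 -> Prop) :
  locally x P <-> exists d, (0 < d)%R /\ forall y, (mdist x y < d)%R -> P y.
Proof.
split.
- intros [d H]. exists d. split; [apply cond_pos|]. intros y Hy. apply H.
  unfold mdist in Hy.
  generalize (Rabs_pos (m11 x - m11 y)) (Rabs_pos (m12 x - m12 y))
   (Rabs_pos (m21 x - m21 y)) (Rabs_pos (m22 x - m22 y)). intros.
  repeat split; simpl; unfold ball; simpl; unfold AbsRing_ball, abs, minus, plus, opp;
    simpl; fold (Rminus (m11 y) (m11 x)) (Rminus (m12 y) (m12 x))
      (Rminus (m21 y) (m21 x)) (Rminus (m22 y) (m22 x));
    rewrite Rabs_minus_sym; lra.
- intros (d & Hd & H). assert (Hd4 : (0 < d / 4)%R) by lra.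
  exists (mkposreal _ Hd4). intros y [[[H1 H2] H3] H4]. apply H.
  change (Rabs (m11 y - m11 x) < d / 4)%R in H1.
  change (Rabs (m12 y - m12 x) < d / 4)%R in H2.
  change (Rabs (m21 y - m21 x) < d / 4)%R in H3.
  change (Rabs (m22 y - m22 x) < d / 4)%R in H4.
  rewrite mdist_sym. unfold mdist. lra.
Qed.

Lemma SL2_map_cont (phi : SL2 -> SL2) (K : R) (x : SL2) :
  (forall y, (mdist (phi x) (phi y) <= K * mdist x y)%R) -> continuous phi x.
Proof.
intros H P HP. apply locally_SL2 in HP. destruct HP as (d & Hd & HP).
apply locally_SL2.
assert (HK := Rabs_pos K). assert (HK' := Rle_abs K).
exists (d / (Rabs K + 1))%R. split; [apply Rdiv_lt_0_compat; lra|].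
intros y Hy. apply HP. eapply Rle_lt_trans; [apply H|].
assert (Hp := mdist_pos x y).
clear_denominator Hy (Rabs K + 1)%R. nra.
Qed.

Lemma SL2_mul_l_cont g x : continuous (SL2_mul g) x.
Proof. apply (SL2_map_cont _ (mnorm g)). intros; apply mdist_mul_l. Qed.

Lemma SL2_lip_cont (f : SL2 -> R) (K : R) (x : SL2) :
  (forall y, (Rabs (f y - f x) <= K * mdist x y)%R) -> Rcts f x.
Proof.
intros H. apply continuous_Rle_abs. intros e He. apply locally_SL2.
assert (HK := Rabs_pos K). assert (HK' := Rle_abs K).
exists (e / (Rabs K + 1))%R. split; [apply Rdiv_lt_0_compat; lra|].
intros y Hy. eapply Rle_lt_trans; [apply H|].
assert (Hp := mdist_pos x y).
clear_denominator Hy (Rabs K + 1)%R. nra.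
Qed.

Ltac entry_cont := intros x; apply (SL2_lip_cont _ 1); intros y; unfold mdist;
  generalize (Rabs_pos (m11 x - m11 y)) (Rabs_pos (m12 x - m12 y))
     (Rabs_pos (m21 x - m21 y)) (Rabs_pos (m22 x - m22 y)); intros;
  rewrite Rabs_minus_sym; lra.

Lemma m11_cont : forall x, Rcts m11 x.
Proof. entry_cont. Qed.
Lemma m12_cont : forall x, Rcts m12 x.
Proof. entry_cont. Qed.
Lemma m21_cont : forall x, Rcts m21 x.
Proof. entry_cont. Qed.
Lemma m22_cont : forall x, Rcts m22 x.
Proof. entry_cont. Qed.
Lemma mnorm_cont : forall x, Rcts mnorm x.
Proof.
intros x; apply (SL2_lip_cont _ 1); intros y. rewrite Rmult_1_l, mdist_sym.
apply mnorm_mdist.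
Qed.

Lemma SL2_lip_Ccont (f : SL2 -> C) (K : R) :
  (forall x y, (Cmod (f x - f y) <= K * mdist x y)%R) ->
  forall x, Ccts f x.
Proof.
intros H x. apply Ccont_pair. split; apply (SL2_lip_cont _ K); intros y;
  (eapply Rle_trans; [|rewrite mdist_sym; apply (H y x)]).
- apply (re_le_Cmod (f y - f x)).
- apply (im_le_Cmod (f y - f x)).
Qed.

(** Compactness of the sets of matrices of bounded norm, in the form of a
    Lebesgue number for a gauge. *)
Lemma SL2_lebesgue_number (good : SL2 -> R -> Prop) (B : R) :
  (forall x, exists d, (0 < d)%R /\ good x d) ->
  exists d, (0 < d)%R /\ forall y, (mnorm y <= B)%R ->
    exists x r, good x r /\ (d <= r)%R /\ (mdist x y < r)%R.
Proof.
intros Hg.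
pose (r11 := fun p : R4 => fst (fst (fst p))).
pose (r12 := fun p : R4 => snd (fst (fst p))).
pose (r21 := fun p : R4 => snd (fst p)).
pose (r22 := fun p : R4 => snd p).
assert (C11 : forall p : R4, Rcts r11 p).
{ intros p. apply (continuous_comp (fun p : R4 => fst (fst p)) fst);
  [apply (continuous_comp (fun p : R4 => fst p) fst)|]; apply continuous_fst. }
assert (C12 : forall p : R4, Rcts r12 p).
{ intros p. apply (continuous_comp (fun p : R4 => fst (fst p)) snd);
  [apply (continuous_comp (fun p : R4 => fst p) fst); apply continuous_fst
  |apply continuous_snd]. }
assert (C21 : forall p : R4, Rcts r21 p).
{ intros p. apply (continuous_comp (fun p : R4 => fst p) snd);
  [apply continuous_fst|apply continuous_snd]. }
assert (C22 : forall p : R4, Rcts r22 p)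
  by (intros p; apply continuous_snd).
assert (HG : forall t : Compactness.Tn 4 R, exists d : posreal,
  forall y : SL2, close_n 4 d (m11 y, (m12 y, (m21 y, (m22 y, tt)))) t ->
  exists x r, good x r /\ (d <= r)%R /\ (mdist x y < r)%R).
{ intros (a & b & c & d & []).
  destruct (Req_dec (a * d - b * c) 1) as [E|E].
  - destruct (Hg (mkSL2 a b c d E)) as (r & Hr & Hgr).
    assert (Hr4 : (0 < r / 4)%R) by lra.
    exists (mkposreal _ Hr4). intros y (H1 & H2 & H3 & H4 & _). simpl in *.
    exists (mkSL2 a b c d E), r. repeat split; auto; [lra|].
    rewrite mdist_sym. unfold mdist; simpl. lra.
  - assert (HL : locally (T := prod_UniformSpace (prod_UniformSpace (prod_UniformSpace
       R_UniformSpace R_UniformSpace) R_UniformSpace) R_UniformSpace) (a, b, c, d)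
      (fun p : R4 => (Rabs ((r11 p * r22 p - r12 p * r21 p) - (a * d - b * c))
         < Rabs (a * d - b * c - 1))%R)).
    { assert (Hc : Rcts
        (fun p : R4 => r11 p * r22 p - r12 p * r21 p)%R (a, b, c, d))
        by (apply Rcont_minus; apply Rcont_mult; auto).
      rewrite continuous_Rle_abs in Hc. apply (Hc (Rabs (a * d - b * c - 1))).
      apply Rabs_pos_lt. lra. }
    destruct HL as [r Hr]. exists r. intros y (H1 & H2 & H3 & H4 & _). exfalso.
    assert (H := Hr (coords y)).
    assert (Hb : (Rabs ((m11 y * m22 y - m12 y * m21 y) - (a * d - b * c))
      < Rabs (a * d - b * c - 1))%R) by (apply H; repeat split; assumption).
    rewrite SL2_det, Rabs_minus_sym in Hb. lra. }
pose (gauge := fun t => proj1_sig (constructive_indefinite_description _ (HG t))).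
assert (Hgauge : forall t y, close_n 4 (gauge t) (m11 y, (m12 y, (m21 y, (m22 y, tt)))) t ->
  exists x r, good x r /\ (gauge t <= r)%R /\ (mdist x y < r)%R).
{ intros t. exact (proj2_sig (constructive_indefinite_description _ (HG t))). }
destruct (compactness_value 4 (- B, (- B, (- B, (- B, tt))))%R
  (B, (B, (B, (B, tt)))) gauge) as [d Hd].
exists d. split; [apply cond_pos|]. intros y Hy.
assert (Hb : bounded_n 4 (- B, (- B, (- B, (- B, tt))))%R (B, (B, (B, (B, tt))))
   (m11 y, (m12 y, (m21 y, (m22 y, tt))))).
{ unfold mnorm in Hy.
  generalize (Rabs_pos (m11 y)) (Rabs_pos (m12 y)) (Rabs_pos (m21 y))
    (Rabs_pos (m22 y)). intros.
  assert (K : forall u, (Rabs u <= B)%R -> (- B <= u <= B)%R)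
    by (intros u; apply Rabs_le_between).
  refine (conj (K _ _) (conj (K _ _) (conj (K _ _) (conj (K _ _) I)))); lra. }
apply Hd, NNPP in Hb. destruct Hb as (t & _ & Hc & Hdt).
destruct (Hgauge t y Hc) as (x & r & H1 & H2 & H3).
exists x, r. repeat split; auto. lra.
Qed.

Lemma RC_lip (h dh : R -> C) (D x y : R) :
  (forall t, (Rabs (t - x) <= Rabs (y - x))%R ->
     is_RCderive h t (dh t) /\ (Cmod (dh t) <= D)%R) ->
  (Cmod (h y - h x) <= 2 * D * Rabs (y - x))%R.
Proof.
intros H. destruct (Rle_dec x y) as [Hxy|Hxy].
- rewrite (Rabs_pos_eq (y - x)) by lra. apply (RC_mean_value h dh); auto.
  + intros t Ht. eapply is_RCderive_continuous, H.
    rewrite !Rabs_pos_eq by lra. lra.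
  + intros t Ht. apply H. rewrite !Rabs_pos_eq by lra. lra.
- rewrite Cmod_minus_sym, Rabs_minus_sym, (Rabs_pos_eq (x - y)) by lra.
  assert (G : forall t, (y <= t <= x)%R -> (Rabs (t - x) <= Rabs (y - x))%R).
  { intros t Ht. rewrite (Rabs_minus_sym t), (Rabs_minus_sym y), !Rabs_pos_eq; lra. }
  apply (RC_mean_value h dh); [lra| |].
  + intros t Ht. eapply is_RCderive_continuous, H, G, Ht.
  + intros t Ht. apply H, G. lra.
Qed.

Lemma Ccont_locally_bound (T : UniformSpace) (f : T -> C) x :
  Ccts f x ->
  locally x (fun y => (Cmod (f y) <= Cmod (f x) + 1)%R).
Proof.
intros H. rewrite Ccontinuous_iff in H.
eapply filter_imp; [|apply (H 1%R Rlt_0_1)]. intros y Hy.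
assert (H' := Cmod_triangle_rev (f y) (f x)). lra.
Qed.

(** The function is locally the restriction of a function on a box of [R4];
    there, a segment is replaced by four segments that are parallel to the
    axes, along which the partial derivatives are bounded. *)
Lemma smooth_locally_lipschitz (f : SL2 -> C) : smooth f -> forall x, exists r L,
  (0 < r)%R /\ (0 <= L)%R /\ forall y z, (mdist x y < r)%R -> (mdist x z < r)%R ->
  (Cmod (f y - f z) <= L * mdist y z)%R.
Proof.
intros Hf x. destruct (Hf x) as (U & F & HU & Hx & HCk & Heq).
destruct (HCk 1%nat) as (_ & F1 & F2 & F3 & F4 & Hd & H1 & H2 & H3 & H4).
simpl in H1, H2, H3, H4.
set (p := coords x) in *.
set (M := (Cmod (F1 p) + Cmod (F2 p) + Cmod (F3 p) + Cmod (F4 p) + 1)%R).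
assert (HL : locally p (fun q : R4 => U q /\ (Cmod (F1 q) <= M)%R /\
  (Cmod (F2 q) <= M)%R /\ (Cmod (F3 q) <= M)%R /\ (Cmod (F4 q) <= M)%R)).
{ assert (B1 := Ccont_locally_bound _ _ _ (proj1 H1 p Hx)).
  assert (B2 := Ccont_locally_bound _ _ _ (proj1 H2 p Hx)).
  assert (B3 := Ccont_locally_bound _ _ _ (proj1 H3 p Hx)).
  assert (B4 := Ccont_locally_bound _ _ _ (proj1 H4 p Hx)).
  generalize (Cmod_ge_0 (F1 p)) (Cmod_ge_0 (F2 p)) (Cmod_ge_0 (F3 p))
    (Cmod_ge_0 (F4 p)). intros.
  repeat apply filter_and; [apply HU, Hx| | | |];
  [eapply filter_imp; [|exact B1]|eapply filter_imp; [|exact B2]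
  |eapply filter_imp; [|exact B3]|eapply filter_imp; [|exact B4]];
  intros q Hq; unfold M; simpl in Hq; lra. }
destruct HL as [r Hr].
assert (Hr' : forall a b c d, (Rabs (a - m11 x) < r)%R -> (Rabs (b - m12 x) < r)%R ->
  (Rabs (c - m21 x) < r)%R -> (Rabs (d - m22 x) < r)%R ->
  U (a, b, c, d) /\ (Cmod (F1 (a, b, c, d)) <= M)%R /\
  (Cmod (F2 (a, b, c, d)) <= M)%R /\ (Cmod (F3 (a, b, c, d)) <= M)%R /\
  (Cmod (F4 (a, b, c, d)) <= M)%R).
{ intros. apply Hr. repeat split; assumption. }
exists (r / 3)%R, (2 * M)%R.
assert (HM : (0 <= M)%R).
{ unfold M. generalize (Cmod_ge_0 (F1 p)) (Cmod_ge_0 (F2 p)) (Cmod_ge_0 (F3 p))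
    (Cmod_ge_0 (F4 p)). lra. }
split; [generalize (cond_pos r); lra|]. split; [lra|].
intros y z Hy Hz.
assert (Q : forall u, (mdist x u < r / 3)%R -> (Rabs (m11 u - m11 x) < r / 3)%R /\
  (Rabs (m12 u - m12 x) < r / 3)%R /\ (Rabs (m21 u - m21 x) < r / 3)%R /\
  (Rabs (m22 u - m22 x) < r / 3)%R).
{ intros u. rewrite mdist_sym. unfold mdist.
  generalize (Rabs_pos (m11 u - m11 x)) (Rabs_pos (m12 u - m12 x))
   (Rabs_pos (m21 u - m21 x)) (Rabs_pos (m22 u - m22 x)). lra. }
assert (S : forall u0 u v t : R, (Rabs (u - u0) < r / 3)%R -> (Rabs (v - u0) < r / 3)%R ->
  (Rabs (t - u) <= Rabs (v - u))%R -> (Rabs (t - u0) < r)%R).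
{ intros u0 u v t. unfold Rabs; repeat destruct Rcase_abs; lra. }
assert (W : forall u, (u < r / 3)%R -> (u < r)%R) by (generalize (cond_pos r); intros; lra).
destruct (Q y Hy) as (y1 & y2 & y3 & y4). destruct (Q z Hz) as (z1 & z2 & z3 & z4).
assert (Uy : U (coords y)) by (apply Hr'; auto).
assert (Uz : U (coords z)) by (apply Hr'; auto).
rewrite (Heq y Uy), (Heq z Uz). unfold coords, mdist.
set (a := m11 y) in *; set (b := m12 y) in *; set (c := m21 y) in *; set (d := m22 y) in *.
set (a' := m11 z) in *; set (b' := m12 z) in *; set (c' := m21 z) in *; set (d' := m22 z) in *.
assert (E1 : (Cmod (F (a, b, c, d) - F (a', b, c, d)) <= 2 * M * Rabs (a - a'))%R).
{ apply (RC_lip (fun s => F (s, b, c, d)) (fun s => F1 (s, b, c, d))).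
  intros t Ht. assert (K := Hr' t b c d (S _ _ _ _ z1 y1 Ht) (W _ y2) (W _ y3) (W _ y4)).
  split; [apply (Hd t b c d)|]; apply K. }
assert (E2 : (Cmod (F (a', b, c, d) - F (a', b', c, d)) <= 2 * M * Rabs (b - b'))%R).
{ apply (RC_lip (fun s => F (a', s, c, d)) (fun s => F2 (a', s, c, d))).
  intros t Ht. assert (K := Hr' a' t c d (W _ z1) (S _ _ _ _ z2 y2 Ht) (W _ y3) (W _ y4)).
  split; [apply (Hd a' t c d)|]; apply K. }
assert (E3 : (Cmod (F (a', b', c, d) - F (a', b', c', d)) <= 2 * M * Rabs (c - c'))%R).
{ apply (RC_lip (fun s => F (a', b', s, d)) (fun s => F3 (a', b', s, d))).
  intros t Ht. assert (K := Hr' a' b' t d (W _ z1) (W _ z2) (S _ _ _ _ z3 y3 Ht) (W _ y4)).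
  split; [apply (Hd a' b' t d)|]; apply K. }
assert (E4 : (Cmod (F (a', b', c', d) - F (a', b', c', d')) <= 2 * M * Rabs (d - d'))%R).
{ apply (RC_lip (fun s => F (a', b', c', s)) (fun s => F4 (a', b', c', s))).
  intros t Ht. assert (K := Hr' a' b' c' t (W _ z1) (W _ z2) (W _ z3) (S _ _ _ _ z4 y4 Ht)).
  split; [apply (Hd a' b' c' t)|]; apply K. }
replace (F (a, b, c, d) - F (a', b', c', d')) with
  ((F (a, b, c, d) - F (a', b, c, d)) + (F (a', b, c, d) - F (a', b', c, d)) +
   (F (a', b', c, d) - F (a', b', c', d)) + (F (a', b', c', d) - F (a', b', c', d')))
  by ring.
eapply Rle_trans; [apply Cmod_triangle|].
eapply Rle_trans; [apply Rplus_le_compat_r, Cmod_triangle|].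
eapply Rle_trans; [apply Rplus_le_compat_r, Rplus_le_compat_r, Cmod_triangle|].
lra.
Qed.

(** Close points are compared by the local Lipschitz constants, which a
    Lebesgue number makes uniform; for points at a distance it suffices that
    the function is bounded. *)
Lemma smooth_lipschitz_bounded (f : SL2 -> C) (B : R) : smooth f -> exists L,
  (0 <= L)%R /\ forall y z, (mnorm y <= B)%R -> (mnorm z <= B)%R ->
  (Cmod (f y - f z) <= L * mdist y z)%R.
Proof.
intros Hf.
(* The gauge at [x] also controls the size of [f] and its Lipschitz constant
   near [x], by its inverse. *)
set (good := fun x r => (forall y, (mdist x y < 2 * r)%R -> (Cmod (f y) <= / r)%R) /\
  forall y z, (mdist x y < 2 * r)%R -> (mdist x z < 2 * r)%R ->
    (Cmod (f y - f z) <= / r * mdist y z)%R).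
destruct (SL2_lebesgue_number good B) as (d & Hd & HB).
{ intros x. destruct (smooth_locally_lipschitz f Hf x) as (r & L & Hr & HL & H).
  set (m := (L + Cmod (f x) + L * r + 1)%R).
  assert (Hc := Cmod_ge_0 (f x)).
  assert (Hm : (1 <= m)%R) by (unfold m; nra).
  exists (Rmin (r / 2) (/ m)).
  assert (Hi : (0 < / m)%R) by (apply Rinv_0_lt_compat; lra).
  assert (Hp : (0 < Rmin (r / 2) (/ m))%R) by (apply Rmin_glb_lt; lra).
  assert (Him : (m <= / Rmin (r / 2) (/ m))%R).
  { rewrite <- (Rinv_inv m) at 1. apply Rinv_le_contravar; auto. apply Rmin_r. }
  assert (Hlt : forall u, (u < 2 * Rmin (r / 2) (/ m))%R -> (u < r)%R).
  { intros u Hu. assert (K := Rmin_l (r / 2) (/ m)). lra. }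
  split; auto. split.
  - intros y Hy. apply Rle_trans with m; auto.
    assert (K := H y x (Hlt _ Hy)). rewrite mdist_refl in K.
    specialize (K Hr). assert (K' := Cmod_triangle_rev (f y) (f x)).
    rewrite mdist_sym in K. specialize (Hlt _ Hy).
    assert (L * mdist x y <= L * r)%R by (apply Rmult_le_compat_l; lra).
    unfold m. lra.
  - intros y z Hy Hz. eapply Rle_trans; [apply H; auto|].
    apply Rmult_le_compat_r; [apply mdist_pos|]. apply Rle_trans with m; auto.
    unfold m. nra. }
exists (2 * / d * / d + / d)%R.
assert (Hi : (0 < / d)%R) by (apply Rinv_0_lt_compat; auto).
split; [nra|].
intros y z Hy Hz.
assert (Hyz := mdist_pos y z).
destruct (HB y Hy) as (x & r & [Hg1 Hg2] & Hdr & Hxy).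
assert (Hir : (/ r <= / d)%R) by (apply Rinv_le_contravar; auto).
destruct (Rlt_dec (mdist y z) d) as [Hlt|Hge].
- apply Rle_trans with (/ r * mdist y z)%R.
  + apply Hg2; [lra|]. assert (K := mdist_tri x y z). lra.
  + apply Rmult_le_compat_r; nra.
- destruct (HB z Hz) as (x' & r' & [Hg1' _] & Hdr' & Hxz).
  assert (Hir' : (/ r' <= / d)%R) by (apply Rinv_le_contravar; auto).
  assert (K1 := Hg1 y ltac:(lra)). assert (K2 := Hg1' z ltac:(lra)).
  assert (K := Cmod_minus_le (f y) (f z)).
  apply Rle_trans with (2 * / d)%R; [lra|].
  assert (1 <= / d * mdist y z)%R.
  { apply Rmult_le_reg_l with d; auto. rewrite <- Rmult_assoc, Rinv_r by lra. lra. }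
  nra.
Qed.

(** * Compactly supported Lipschitz functions *)

(** Smoothness enters the trace formula only through this consequence, which
    survives averaging over [K]. *)
Definition lip_cs (L B : R) (f : SL2 -> C) : Prop :=
  (0 <= L)%R /\ (0 <= B)%R /\
  (forall x y, (Cmod (f x - f y) <= L * mdist x y)%R) /\
  (forall x, f x <> 0 -> (mnorm x <= B)%R).

Lemma Cc_infty_lip_cs (f : SL2 -> C) : Cc_infty f -> exists L B, lip_cs L B f.
Proof.
intros [Hs [B0 HB0]].
set (B := (4 * Rabs B0 + 1)%R).
assert (HB : forall x, f x <> 0 -> (mnorm x <= B - 1)%R).
{ intros x Hx. destruct (HB0 x Hx) as (H1 & H2 & H3 & H4).
  unfold mnorm, B. assert (K := Rle_abs B0). lra. }
destruct (smooth_lipschitz_bounded f B Hs) as (L & HL & HLip).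
assert (HBp : (0 <= B)%R) by (unfold B; generalize (Rabs_pos B0); lra).
(* A bound for [f] on the support, from the Lipschitz estimate against 1. *)
set (M := (Cmod (f SL2_one) + L * (B + 2))%R).
assert (HM : forall x, (Cmod (f x) <= M)%R).
{ intros x. destruct (classic (f x = 0)) as [->|Hx].
  - rewrite Cmod_0. unfold M. assert (K := Cmod_ge_0 (f SL2_one)). nra.
  - assert (Hn := HB x Hx).
    destruct (Rle_dec 2 B) as [H2|H2].
    + assert (N1 : (mnorm SL2_one <= B)%R).
      { unfold mnorm; simpl. rewrite Rabs_R1, Rabs_R0. lra. }
      assert (K := HLip x SL2_one ltac:(lra) N1).
      assert (K' := Cmod_triangle_rev (f x) (f SL2_one)).
      assert (Hd : (mdist x SL2_one <= B + 2)%R).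
      { assert (Q : forall a b, (Rabs (a - b) <= Rabs a + Rabs b)%R).
        { intros a b. unfold Rminus. eapply Rle_trans; [apply Rabs_triang|].
          rewrite Rabs_Ropp; lra. }
        unfold mdist. unfold mnorm in Hn.
        assert (Q1 := Q (m11 x) (m11 SL2_one)). assert (Q2 := Q (m12 x) (m12 SL2_one)).
        assert (Q3 := Q (m21 x) (m21 SL2_one)). assert (Q4 := Q (m22 x) (m22 SL2_one)).
        change (m11 SL2_one) with 1%R in *. change (m12 SL2_one) with 0%R in *.
        change (m21 SL2_one) with 0%R in *. change (m22 SL2_one) with 1%R in *.
        rewrite Rabs_R1 in *. rewrite Rabs_R0 in *. lra. }
      unfold M. assert (L * mdist x SL2_one <= L * (B + 2))%R
        by (apply Rmult_le_compat_l; lra). lra.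
    + exfalso. (* a matrix of determinant 1 has norm at least 1 *)
      unfold mnorm in Hn. assert (D := SL2_det x).
      assert (G : (1 <= Rabs (m11 x) * Rabs (m22 x) + Rabs (m12 x) * Rabs (m21 x))%R).
      { rewrite <- !Rabs_mult. assert (K1 := Rle_abs (m11 x * m22 x)).
        assert (K2 := Rabs_maj2 (m12 x * m21 x)). lra. }
      generalize (Rabs_pos (m11 x)) (Rabs_pos (m12 x)) (Rabs_pos (m21 x))
        (Rabs_pos (m22 x)). intros. nra. }
exists (L + M)%R, B.
assert (HM0 : (0 <= M)%R) by (eapply Rle_trans; [apply Cmod_ge_0|apply (HM SL2_one)]).
split; [lra|]. split; [exact HBp|]. split.
2: { intros x Hx. specialize (HB x Hx). lra. }
assert (G : forall x y, f x <> 0 -> (Cmod (f x - f y) <= (L + M) * mdist x y)%R).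
{ intros x y Hx. assert (Hn := HB x Hx). assert (Hp := mdist_pos x y).
  destruct (Rle_dec (mnorm y) B) as [Hy|Hy].
  - eapply Rle_trans; [apply HLip; lra|]. apply Rmult_le_compat_r; lra.
  - assert (Ey : f y = 0).
    { apply NNPP. intros Hf. specialize (HB y Hf). lra. }
    rewrite Ey. replace (f x - 0) with (f x) by ring.
    eapply Rle_trans; [apply HM|].
    assert (K := mnorm_mdist x y). apply Rabs_le_between in K.
    assert (1 <= mdist x y)%R by lra. nra. }
intros x y. destruct (classic (f x = 0)) as [Hx|Hx]; [|apply G, Hx].
destruct (classic (f y = 0)) as [Hy|Hy].
- rewrite Hx, Hy. replace (0 - 0) with (RtoC 0) by ring. rewrite Cmod_0.
  apply Rmult_le_pos; [lra|apply mdist_pos].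
- rewrite Cmod_minus_sym, mdist_sym. apply G, Hy.
Qed.

(** * Smooth functions on SL(2,R) *)

Lemma is_RCderive_mult (f g : R -> C) (x : R) (l m : C) :
  is_RCderive f x l -> is_RCderive g x m ->
  is_RCderive (fun t => f t * g t) x (l * g x + f x * m).
Proof.
rewrite !is_RCderive_pair. intros [H1 H2] [H3 H4].
assert (Hm : forall (u v : R -> R) (a b : R), is_derive u x a -> is_derive v x b ->
  is_derive (fun t => u t * v t)%R x (a * v x + u x * b)%R).
{ intros u v a b Hu Hv. apply (is_derive_mult (K := R_AbsRing) u v x a b); auto.
  intros; apply Rmult_comm. }
split.
- replace (Re (l * g x + f x * m)) with ((Re l * Re (g x) + Re (f x) * Re m) -
    (Im l * Im (g x) + Im (f x) * Im m))%R by (unfold Re, Im; simpl; ring).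
  apply (is_derive_minus (V := R_NormedModule) (fun t => Re (f t) * Re (g t))%R
    (fun t => Im (f t) * Im (g t))%R); apply Hm; auto.
- replace (Im (l * g x + f x * m)) with ((Re l * Im (g x) + Re (f x) * Im m) +
    (Im l * Re (g x) + Im (f x) * Re m))%R by (unfold Re, Im; simpl; ring).
  apply (is_derive_plus (V := R_NormedModule) (fun t => Re (f t) * Im (g t))%R
    (fun t => Im (f t) * Re (g t))%R); apply Hm; auto.
Qed.

Lemma is_RCderive_plus (f g : R -> C) (x : R) (l m : C) :
  is_RCderive f x l -> is_RCderive g x m ->
  is_RCderive (fun t => f t + g t) x (l + m).
Proof. apply (is_derive_plus (V := C_R_NormedModule)). Qed.

Lemma is_RCderive_minus (f g : R -> C) (x : R) (l m : C) :
  is_RCderive f x l -> is_RCderive g x m ->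
  is_RCderive (fun t => f t - g t) x (l - m).
Proof. apply (is_derive_minus (V := C_R_NormedModule)). Qed.

Lemma is_RCderive_const (c : C) (x : R) : is_RCderive (fun _ => c) x (RtoC 0).
Proof. apply (is_derive_const (V := C_R_NormedModule)). Qed.

Lemma is_RCderive_id (x : R) : is_RCderive (fun t => RtoC t) x (RtoC 1).
Proof. apply is_RCderive_pair; unfold Re, Im; simpl; split; auto_derive; auto. Qed.

Lemma is_RCderive_comp (f : R -> C) (g : R -> R) (x : R) (l : C) (m : R) :
  is_RCderive f (g x) l -> is_derive g x m ->
  is_RCderive (fun t => f (g t)) x (m * l).
Proof.
intros Hf Hg.
assert (E : (m * l : C) = scal (V := C_R_NormedModule) m l).
{ apply Ceq; unfold scal; simpl; unfold scal, mult; simpl; unfold mult; simpl; ring. }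
rewrite E. apply (is_derive_comp (V := C_R_NormedModule)); auto.
Qed.

(** [Ck_on] provides partial derivatives only; their continuity makes the
    function differentiable along lines. The increment is split into one in
    each variable, to which the mean value inequality applies. *)
Lemma is_RCderive_partials (H H1 H2 : R -> R -> C) (al be ga de s0 : R) :
  let x0 := (al * s0 + be)%R in let y0 := (ga * s0 + de)%R in
  (exists r, (0 < r)%R /\ forall x y, (Rabs (x - x0) < r)%R -> (Rabs (y - y0) < r)%R ->
    is_RCderive (fun t => H t y) x (H1 x y) /\ is_RCderive (fun t => H x t) y (H2 x y)) ->
  (forall e, (0 < e)%R -> exists r, (0 < r)%R /\ forall x y,
    (Rabs (x - x0) < r)%R -> (Rabs (y - y0) < r)%R ->
    (Cmod (H1 x y - H1 x0 y0) <= e)%R /\ (Cmod (H2 x y - H2 x0 y0) <= e)%R) ->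
  is_RCderive (fun s => H (al * s + be)%R (ga * s + de)%R) s0
    (al * H1 x0 y0 + ga * H2 x0 y0).
Proof.
intros x0 y0 (r0 & Hr0 & HD) HC. apply is_RCderive_iff. intros e He.
set (K := (2 * (Rabs al + Rabs ga) + 1)%R).
assert (Ha := Rabs_pos al). assert (Hg := Rabs_pos ga).
assert (HK : (0 < K)%R) by (unfold K; lra).
destruct (HC (e / K)%R ltac:(apply Rdiv_lt_0_compat; lra)) as (r1 & Hr1 & HC').
set (r := Rmin r0 r1).
assert (Hr : (0 < r)%R) by (apply Rmin_glb_lt; auto).
exists (r / K)%R. split; [apply Rdiv_lt_0_compat; lra|]. intros s Hs.
apply (Rmult_lt_compat_r K) in Hs; [|auto]. unfold Rdiv in Hs.
rewrite Rmult_assoc, Rinv_l, Rmult_1_r in Hs by lra.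
set (x := (al * s + be)%R). set (y := (ga * s + de)%R).
assert (Ex : (x - x0 = al * (s - s0))%R) by (unfold x, x0; ring).
assert (Ey : (y - y0 = ga * (s - s0))%R) by (unfold y, y0; ring).
assert (Ax : (Rabs (x - x0) = Rabs al * Rabs (s - s0))%R) by (rewrite Ex; apply Rabs_mult).
assert (Ay : (Rabs (y - y0) = Rabs ga * Rabs (s - s0))%R) by (rewrite Ey; apply Rabs_mult).
assert (Hp := Rabs_pos (s - s0)).
assert (Hx : (Rabs (x - x0) < r)%R) by (rewrite Ax; unfold K in Hs; nra).
assert (Hy : (Rabs (y - y0) < r)%R) by (rewrite Ay; unfold K in Hs; nra).
assert (L0 := Rmin_l r0 r1). assert (L1 := Rmin_r r0 r1). fold r in L0, L1.
assert (B1 : (Cmod ((H x y - x * H1 x0 y0) - (H x0 y - x0 * H1 x0 y0)) <=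
  2 * (e / K) * Rabs (x - x0))%R).
{ apply (RC_lip (fun t => H t y - t * H1 x0 y0) (fun t => H1 t y - H1 x0 y0)).
  intros t Ht. split; [|apply (HC' t y); lra].
  replace (H1 t y - H1 x0 y0) with (H1 t y - (1 * H1 x0 y0 + t * 0)) by ring.
  apply is_RCderive_minus; [apply (proj1 (HD t y ltac:(lra) ltac:(lra)))|].
  apply (is_RCderive_mult RtoC (fun _ => _)); [apply is_RCderive_id|apply is_RCderive_const]. }
assert (B2 : (Cmod ((H x0 y - y * H2 x0 y0) - (H x0 y0 - y0 * H2 x0 y0)) <=
  2 * (e / K) * Rabs (y - y0))%R).
{ assert (Z : (Rabs (x0 - x0) < r)%R) by (rewrite Rminus_diag, Rabs_R0; auto).
  apply (RC_lip (fun t => H x0 t - t * H2 x0 y0) (fun t => H2 x0 t - H2 x0 y0)).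
  intros t Ht. split; [|apply (HC' x0 t); lra].
  replace (H2 x0 t - H2 x0 y0) with (H2 x0 t - (1 * H2 x0 y0 + t * 0)) by ring.
  apply is_RCderive_minus; [apply (proj2 (HD x0 t ltac:(lra) ltac:(lra)))|].
  apply (is_RCderive_mult RtoC (fun _ => _)); [apply is_RCderive_id|apply is_RCderive_const]. }
change (Cmod (H x y - H x0 y0 - (s - s0)%R * (al * H1 x0 y0 + ga * H2 x0 y0))
  <= e * Rabs (s - s0))%R.
replace (H x y - H x0 y0 - (s - s0)%R * (al * H1 x0 y0 + ga * H2 x0 y0))
  with (((H x y - x * H1 x0 y0) - (H x0 y - x0 * H1 x0 y0)) +
        ((H x0 y - y * H2 x0 y0) - (H x0 y0 - y0 * H2 x0 y0))).
2: { assert (Ex' : RtoC x - RtoC x0 = al * (s - s0)%R)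
       by (rewrite <- RtoC_minus, Ex, RtoC_mult; reflexivity).
     assert (Ey' : RtoC y - RtoC y0 = ga * (s - s0)%R)
       by (rewrite <- RtoC_minus, Ey, RtoC_mult; reflexivity).
     transitivity (H x y - H x0 y0 - (RtoC x - RtoC x0) * H1 x0 y0
       - (RtoC y - RtoC y0) * H2 x0 y0); [ring|].
     rewrite Ex', Ey'. ring. }
eapply Rle_trans; [apply Cmod_triangle|].
rewrite Ax in B1. rewrite Ay in B2.
apply Rle_trans with (e / K * (2 * (Rabs al + Rabs ga)) * Rabs (s - s0))%R; [lra|].
apply Rmult_le_compat_r; auto.
apply Rle_trans with (e / K * K)%R; [|right; field; lra].
apply Rmult_le_compat_l; [left; apply Rdiv_lt_0_compat; lra|unfold K; lra].
Qed.

Lemma Ck_on_cont k U F p : Ck_on k U F -> U p -> Ccts F p.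
Proof. destruct k; intros [H _]; apply H. Qed.

Lemma Ck_on_pred k U F : Ck_on (S k) U F -> Ck_on k U F.
Proof.
revert F. induction k as [|k IH]; intros F [Hc H]; split; auto.
destruct H as (F1 & F2 & F3 & F4 & Hd & H1 & H2 & H3 & H4).
exists F1, F2, F3, F4. auto 10.
Qed.

Ltac split4 := refine (conj _ (conj _ (conj _ _))).

Lemma Ck_on_const k U c : Ck_on k U (fun _ => c).
Proof.
revert c. induction k as [|k IH]; intros c; split; auto;
  try (intros; apply Ccont_const).
exists (fun _ => 0), (fun _ => 0), (fun _ => 0), (fun _ => 0).
split; [intros; split4; apply is_RCderive_const|split4; apply IH].
Qed.

Lemma Ck_on_plus k U F G : Ck_on k U F -> Ck_on k U G -> Ck_on k U (fun p => F p + G p).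
Proof.
revert F G. induction k as [|k IH]; intros F G HF HG; split;
  try (intros; apply Ccont_plus; [apply HF|apply HG]; auto); auto.
destruct HF as (_ & F1 & F2 & F3 & F4 & Hd & H1 & H2 & H3 & H4).
destruct HG as (_ & G1 & G2 & G3 & G4 & Gd & K1 & K2 & K3 & K4).
exists (fun p => F1 p + G1 p), (fun p => F2 p + G2 p), (fun p => F3 p + G3 p),
  (fun p => F4 p + G4 p).
split; [|split4; apply IH; auto]. intros a b c d Hp.
destruct (Hd a b c d Hp) as (D1 & D2 & D3 & D4).
destruct (Gd a b c d Hp) as (E1 & E2 & E3 & E4).
split4; apply is_RCderive_plus; auto.
Qed.

Lemma Ck_on_mult k U F G : Ck_on k U F -> Ck_on k U G -> Ck_on k U (fun p => F p * G p).
Proof.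
revert F G. induction k as [|k IH]; intros F G HF HG; split;
  try (intros; apply Ccont_mult; [apply HF|apply HG]; auto); auto.
assert (PF := Ck_on_pred _ _ _ HF). assert (PG := Ck_on_pred _ _ _ HG).
destruct HF as (_ & F1 & F2 & F3 & F4 & Hd & H1 & H2 & H3 & H4).
destruct HG as (_ & G1 & G2 & G3 & G4 & Gd & K1 & K2 & K3 & K4).
exists (fun p => F1 p * G p + F p * G1 p), (fun p => F2 p * G p + F p * G2 p),
  (fun p => F3 p * G p + F p * G3 p), (fun p => F4 p * G p + F p * G4 p).
split; [|split4; apply Ck_on_plus; apply IH; auto].
intros a b c d Hp.
destruct (Hd a b c d Hp) as (D1 & D2 & D3 & D4).
destruct (Gd a b c d Hp) as (E1 & E2 & E3 & E4).
split4.
- apply (is_RCderive_mult (fun s => F (s, b, c, d)) (fun s => G (s, b, c, d))); auto.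
- apply (is_RCderive_mult (fun s => F (a, s, c, d)) (fun s => G (a, s, c, d))); auto.
- apply (is_RCderive_mult (fun s => F (a, b, s, d)) (fun s => G (a, b, s, d))); auto.
- apply (is_RCderive_mult (fun s => F (a, b, c, s)) (fun s => G (a, b, c, s))); auto.
Qed.

Lemma Ck_on_pow k U F n : Ck_on k U F -> Ck_on k U (fun p => F p ^ n).
Proof.
intros H. induction n as [|n IH]; simpl; [apply Ck_on_const|].
apply Ck_on_mult; auto.
Qed.

Definition c11 (p : R4) : R := fst (fst (fst p)).
Definition c12 (p : R4) : R := snd (fst (fst p)).
Definition c21 (p : R4) : R := snd (fst p).
Definition c22 (p : R4) : R := snd p.

Lemma c11_cont (p : R4) : Rcts c11 p.
Proof.
apply (continuous_comp (fun p : R4 => fst (fst p)) fst);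
[apply (continuous_comp (fun p : R4 => fst p) fst)|]; apply continuous_fst.
Qed.
Lemma c12_cont (p : R4) : Rcts c12 p.
Proof.
apply (continuous_comp (fun p : R4 => fst (fst p)) snd);
[apply (continuous_comp (fun p : R4 => fst p) fst); apply continuous_fst
|apply continuous_snd].
Qed.
Lemma c21_cont (p : R4) : Rcts c21 p.
Proof.
apply (continuous_comp (fun p : R4 => fst p) snd);
[apply continuous_fst|apply continuous_snd].
Qed.
Lemma c22_cont (p : R4) : Rcts c22 p.
Proof. apply continuous_snd. Qed.

Ltac coord_Ck c_cont := intros k; induction k as [|k IH]; split; auto;
  try (intros; apply Ccont_RtoC, c_cont).

Lemma Ck_on_c11 U : forall k, Ck_on k U (fun p => RtoC (c11 p)).
Proof.
coord_Ck c11_cont. exists (fun _ => 1), (fun _ => 0), (fun _ => 0), (fun _ => 0).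
split; [|split4; apply Ck_on_const].
intros; unfold c11, c12, c21, c22; cbn [fst snd]; split4; [apply is_RCderive_id|apply is_RCderive_const|apply is_RCderive_const|apply is_RCderive_const].
Qed.
Lemma Ck_on_c12 U : forall k, Ck_on k U (fun p => RtoC (c12 p)).
Proof.
coord_Ck c12_cont. exists (fun _ => 0), (fun _ => 1), (fun _ => 0), (fun _ => 0).
split; [|split4; apply Ck_on_const].
intros; unfold c11, c12, c21, c22; cbn [fst snd]; split4; [apply is_RCderive_const|apply is_RCderive_id|apply is_RCderive_const|apply is_RCderive_const].
Qed.
Lemma Ck_on_c21 U : forall k, Ck_on k U (fun p => RtoC (c21 p)).
Proof.
coord_Ck c21_cont. exists (fun _ => 0), (fun _ => 0), (fun _ => 1), (fun _ => 0).
split; [|split4; apply Ck_on_const].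
intros; unfold c11, c12, c21, c22; cbn [fst snd]; split4; [apply is_RCderive_const|apply is_RCderive_const|apply is_RCderive_id|apply is_RCderive_const].
Qed.
Lemma Ck_on_c22 U : forall k, Ck_on k U (fun p => RtoC (c22 p)).
Proof.
coord_Ck c22_cont. exists (fun _ => 0), (fun _ => 0), (fun _ => 0), (fun _ => 1).
split; [|split4; apply Ck_on_const].
intros; unfold c11, c12, c21, c22; cbn [fst snd]; split4; [apply is_RCderive_const|apply is_RCderive_const|apply is_RCderive_const|apply is_RCderive_id].
Qed.

(** Composition with a family of functions of one variable that is closed under
    differentiation: it applies to powers with a complex exponent and to the
    derivatives of [exp (- 1 / x)]. *)
Lemma Ck_on_family (I : Type) (phi : I -> R -> C) (k1 k2 : I -> C) (s1 s2 : I -> I)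
  (V : R -> Prop) (U : R4 -> Prop) (G G1 G2 G3 G4 : R4 -> R) :
  (forall i r, V r -> is_RCderive (phi i) r (k1 i * phi (s1 i) r + k2 i * phi (s2 i) r)) ->
  (forall p, U p -> V (G p)) ->
  (forall p, U p -> Rcts G p) ->
  (forall a b c d, U (a, b, c, d) ->
    is_derive (fun s => G (s, b, c, d)) a (G1 (a, b, c, d)) /\
    is_derive (fun s => G (a, s, c, d)) b (G2 (a, b, c, d)) /\
    is_derive (fun s => G (a, b, s, d)) c (G3 (a, b, c, d)) /\
    is_derive (fun s => G (a, b, c, s)) d (G4 (a, b, c, d))) ->
  (forall k, Ck_on k U (fun p => RtoC (G1 p))) ->
  (forall k, Ck_on k U (fun p => RtoC (G2 p))) ->
  (forall k, Ck_on k U (fun p => RtoC (G3 p))) ->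
  (forall k, Ck_on k U (fun p => RtoC (G4 p))) ->
  forall k i, Ck_on k U (fun p => phi i (G p)).
Proof.
intros Hphi HV HG HGd C1 C2 C3 C4 k.
assert (Hc : forall i p, U p -> Ccts (fun p => phi i (G p)) p).
{ intros i p Hp. apply (continuous_comp G (phi i)); auto.
  eapply is_RCderive_continuous, Hphi, HV, Hp. }
induction k as [|k IH]; intros i; split; auto.
exists (fun p => RtoC (G1 p) * (k1 i * phi (s1 i) (G p) + k2 i * phi (s2 i) (G p))),
 (fun p => RtoC (G2 p) * (k1 i * phi (s1 i) (G p) + k2 i * phi (s2 i) (G p))),
 (fun p => RtoC (G3 p) * (k1 i * phi (s1 i) (G p) + k2 i * phi (s2 i) (G p))),
 (fun p => RtoC (G4 p) * (k1 i * phi (s1 i) (G p) + k2 i * phi (s2 i) (G p))).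
split.
- intros a b c d Hp. destruct (HGd a b c d Hp) as (D1 & D2 & D3 & D4).
  assert (Hv := Hphi i _ (HV _ Hp)).
  split4.
  + apply (is_RCderive_comp (phi i) (fun s => G (s, b, c, d))); auto.
  + apply (is_RCderive_comp (phi i) (fun s => G (a, s, c, d))); auto.
  + apply (is_RCderive_comp (phi i) (fun s => G (a, b, s, d))); auto.
  + apply (is_RCderive_comp (phi i) (fun s => G (a, b, c, s))); auto.
- assert (HK : Ck_on k U (fun p => k1 i * phi (s1 i) (G p) + k2 i * phi (s2 i) (G p))).
  { apply Ck_on_plus; apply Ck_on_mult; auto; apply Ck_on_const. }
  split4; apply Ck_on_mult; auto.
Qed.

(** ** Left translations *)

Definition lmul (g : SL2) (p : R4) : R4 :=
  ((m11 g * c11 p + m12 g * c21 p)%R, (m11 g * c12 p + m12 g * c22 p)%R,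
   (m21 g * c11 p + m22 g * c21 p)%R, (m21 g * c12 p + m22 g * c22 p)%R).

Lemma R4_pair_cont (T : UniformSpace) (f1 f2 f3 f4 : T -> R) (x : T) :
  Rcts f1 x -> Rcts f2 x ->
  Rcts f3 x -> Rcts f4 x ->
  forall P : R4 -> Prop, locally (f1 x, f2 x, f3 x, f4 x) P ->
  locally x (fun y => P (f1 y, f2 y, f3 y, f4 y)).
Proof.
intros H1 H2 H3 H4 P [r Hr].
rewrite continuous_Rle_abs in H1, H2, H3, H4.
specialize (H1 r (cond_pos r)). specialize (H2 r (cond_pos r)).
specialize (H3 r (cond_pos r)). specialize (H4 r (cond_pos r)).
assert (H := filter_and _ _ (filter_and _ _ H1 H2) (filter_and _ _ H3 H4)).
eapply filter_imp; [|exact H]. intros y [[K1 K2] [K3 K4]].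
apply Hr. repeat split; assumption.
Qed.

Lemma lmul_locally g p (P : R4 -> Prop) :
  locally (lmul g p) P -> locally p (fun q => P (lmul g q)).
Proof.
intros H. apply (R4_pair_cont _ (fun p => m11 g * c11 p + m12 g * c21 p)%R
  (fun p => m11 g * c12 p + m12 g * c22 p)%R
  (fun p => m21 g * c11 p + m22 g * c21 p)%R
  (fun p => m21 g * c12 p + m22 g * c22 p)%R); auto;
apply Rcont_plus; apply Rcont_mult; try apply Rcont_const;
  auto using c11_cont, c12_cont, c21_cont, c22_cont.
Qed.

Lemma locally_R4_box (a b c d : R) (P : R4 -> Prop) :
  locally (a, b, c, d) P -> exists r, (0 < r)%R /\ forall a' b' c' d',
    (Rabs (a' - a) < r)%R -> (Rabs (b' - b) < r)%R -> (Rabs (c' - c) < r)%R ->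
    (Rabs (d' - d) < r)%R -> P (a', b', c', d').
Proof.
intros [r Hr]. exists r. split; [apply cond_pos|]. intros. apply Hr.
repeat split; assumption.
Qed.

(** Left multiplication acts on the two columns separately: each coordinate
    enters two entries of the product, and each partial derivative of the
    composite is a combination of two partial derivatives of the function. *)
Lemma Ck_on_lmul k U F g : open U -> Ck_on k U F ->
  Ck_on k (fun p => U (lmul g p)) (fun p => F (lmul g p)).
Proof.
intros HU. revert F.
assert (HC : forall F, (forall p, U p -> Ccts F p) ->
  forall p, U (lmul g p) -> Ccts (fun p => F (lmul g p)) p).
{ intros F HF p Hp P HP. apply (lmul_locally g p (fun q => P (F q))).
  apply (HF _ Hp P HP). }
induction k as [|k IH]; intros F HF; split; try (apply HC, HF); auto.
destruct HF as (_ & F1 & F2 & F3 & F4 & Hd & H1 & H2 & H3 & H4).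
exists (fun p => m11 g * F1 (lmul g p) + m21 g * F3 (lmul g p)),
 (fun p => m11 g * F2 (lmul g p) + m21 g * F4 (lmul g p)),
 (fun p => m12 g * F1 (lmul g p) + m22 g * F3 (lmul g p)),
 (fun p => m12 g * F2 (lmul g p) + m22 g * F4 (lmul g p)).
split; [|split4; apply Ck_on_plus; apply Ck_on_mult; try apply Ck_on_const; auto].
intros a b c d Hp.
set (q := lmul g (a, b, c, d)) in *.
assert (Lk : forall (A B : R4 -> C), Ck_on k U A -> Ck_on k U B ->
  forall e, (0 < e)%R -> locally q (fun w : R4 =>
    (Cmod (A w - A q) <= e)%R /\ (Cmod (B w - B q) <= e)%R)).
{ intros A B HA HB e He.
  assert (KA := Ck_on_cont _ _ _ q HA Hp). assert (KB := Ck_on_cont _ _ _ q HB Hp).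
  rewrite Ccontinuous_iff in KA, KB.
  apply filter_and; [eapply filter_imp; [|apply (KA e He)]
    |eapply filter_imp; [|apply (KB e He)]]; intros w Hw; left; exact Hw. }
assert (Z : forall (x r : R), (0 < r)%R -> (Rabs (x - x) < r)%R)
  by (intros; rewrite Rminus_diag, Rabs_R0; auto).
assert (D1 : forall al ga s0 be de, (al * s0 + be = fst (fst (fst q)))%R ->
   (ga * s0 + de = snd (fst q))%R ->
   is_RCderive (fun s => F ((al * s + be)%R, snd (fst (fst q)), (ga * s + de)%R, snd q)) s0
    (al * F1 q + ga * F3 q)).
{ intros al ga s0 be de E1 E2.
  assert (Eq : q = ((al * s0 + be)%R, snd (fst (fst q)), (ga * s0 + de)%R, snd q))
    by (rewrite E1, E2; destruct q as [[[? ?] ?] ?]; reflexivity).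
  rewrite (f_equal F1 Eq), (f_equal F3 Eq).
  apply (is_RCderive_partials (fun x z => F (x, snd (fst (fst q)), z, snd q))
    (fun x z => F1 (x, snd (fst (fst q)), z, snd q))
    (fun x z => F3 (x, snd (fst (fst q)), z, snd q)) al be ga de s0).
  - assert (HL : locally q U) by (apply HU, Hp). rewrite Eq in HL.
    apply locally_R4_box in HL. destruct HL as (r & Hr & HL).
    exists r. split; [exact Hr|]. intros x z Hx Hz.
    assert (Uxz : U (x, snd (fst (fst q)), z, snd q)) by (apply HL; auto).
    split; apply (Hd _ _ _ _ Uxz).
  - intros e He. assert (HL := Lk F1 F3 H1 H3 e He). rewrite Eq in HL.
    apply locally_R4_box in HL. destruct HL as (r & Hr & HL).
    exists r. split; [exact Hr|]. intros x z Hx Hz. apply HL; auto. }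
assert (D2 : forall al ga s0 be de, (al * s0 + be = snd (fst (fst q)))%R ->
   (ga * s0 + de = snd q)%R ->
   is_RCderive (fun s => F (fst (fst (fst q)), (al * s + be)%R, snd (fst q), (ga * s + de)%R)) s0
    (al * F2 q + ga * F4 q)).
{ intros al ga s0 be de E1 E2.
  assert (Eq : q = (fst (fst (fst q)), (al * s0 + be)%R, snd (fst q), (ga * s0 + de)%R))
    by (rewrite E1, E2; destruct q as [[[? ?] ?] ?]; reflexivity).
  rewrite (f_equal F2 Eq), (f_equal F4 Eq).
  apply (is_RCderive_partials (fun x z => F (fst (fst (fst q)), x, snd (fst q), z))
    (fun x z => F2 (fst (fst (fst q)), x, snd (fst q), z))
    (fun x z => F4 (fst (fst (fst q)), x, snd (fst q), z)) al be ga de s0).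
  - assert (HL : locally q U) by (apply HU, Hp). rewrite Eq in HL.
    apply locally_R4_box in HL. destruct HL as (r & Hr & HL).
    exists r. split; [exact Hr|]. intros x z Hx Hz.
    assert (Uxz : U (fst (fst (fst q)), x, snd (fst q), z)) by (apply HL; auto).
    split; apply (Hd _ _ _ _ Uxz).
  - intros e He. assert (HL := Lk F2 F4 H2 H4 e He). rewrite Eq in HL.
    apply locally_R4_box in HL. destruct HL as (r & Hr & HL).
    exists r. split; [exact Hr|]. intros x z Hx Hz. apply HL; auto. }
split4.
- apply (D1 (m11 g) (m21 g) a (m12 g * c)%R (m22 g * c)%R); reflexivity.
- apply (D2 (m11 g) (m21 g) b (m12 g * d)%R (m22 g * d)%R); reflexivity.
- apply (is_derive_ext (V := C_R_NormedModule) (fun s => F ((m12 g * s + m11 g * a)%R,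
    snd (fst (fst q)), (m22 g * s + m21 g * a)%R, snd q))).
  + intros t. unfold q, lmul, c11, c12, c21, c22; simpl. apply (f_equal F).
    apply (f_equal2 pair); [apply (f_equal2 pair); [apply (f_equal2 pair)|]|]; ring.
  + apply D1; unfold q, lmul, c11, c12, c21, c22; simpl; ring.
- apply (is_derive_ext (V := C_R_NormedModule) (fun s => F (fst (fst (fst q)),
    (m12 g * s + m11 g * b)%R, snd (fst q), (m22 g * s + m21 g * b)%R))).
  + intros t. unfold q, lmul, c11, c12, c21, c22; simpl. apply (f_equal F).
    apply (f_equal2 pair); [apply (f_equal2 pair); [apply (f_equal2 pair)|]|]; ring.
  + apply D2; unfold q, lmul, c11, c12, c21, c22; simpl; ring.
Qed.

Lemma smooth_translate (f : SL2 -> C) (g : SL2) :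
  smooth f -> smooth (fun x => f (SL2_mul g x)).
Proof.
intros Hf x. destruct (Hf (SL2_mul g x)) as (U & F & HU & Hx & HCk & Heq).
exists (fun p => U (lmul g p)), (fun p => F (lmul g p)).
split; [intros p Hp; apply (lmul_locally g p U), HU, Hp|].
split; [exact Hx|]. split; [intros k; apply Ck_on_lmul; auto|].
intros y Hy. apply Heq, Hy.
Qed.

Lemma Cc_infty_translate (f : SL2 -> C) (g : SL2) :
  Cc_infty f -> Cc_infty (fun x => f (SL2_mul g x)).
Proof.
intros [Hs [B HB]]. split; [apply smooth_translate, Hs|].
exists (mnorm (SL2_inv g) * (4 * B))%R. intros x Hx.
destruct (HB _ Hx) as (H1 & H2 & H3 & H4).
assert (Hn : (mnorm (SL2_mul g x) <= 4 * B)%R) by (unfold mnorm; lra).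
assert (E : SL2_mul (SL2_inv g) (SL2_mul g x) = x)
  by (rewrite <- SL2_mul_assoc, SL2_mul_inv_l; apply SL2_mul_1_l).
assert (K : (mnorm x <= mnorm (SL2_inv g) * (4 * B))%R).
{ rewrite <- E. eapply Rle_trans; [apply mnorm_mul|].
  apply Rmult_le_compat_l; [apply mnorm_pos|exact Hn]. }
unfold mnorm in K at 1.
generalize (Rabs_pos (m11 x)) (Rabs_pos (m12 x)) (Rabs_pos (m21 x)) (Rabs_pos (m22 x)).
intros. repeat split; lra.
Qed.

(** * A smooth bump at the identity *)

(** The functions [x ^ (- n) * exp (- 1 / x)], extended by [0], span a space
    that is closed under differentiation. *)
Definition flat (n : nat) (x : R) : R :=
  if Rlt_dec 0 x then ((/ x) ^ n * exp (- / x))%R else 0%R.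

Lemma exp_nat_mul n u : exp (INR n * u) = (exp u ^ n)%R.
Proof.
induction n as [|n IH].
- simpl. rewrite Rmult_0_l. apply exp_0.
- rewrite S_INR, Rmult_plus_distr_r, exp_plus, IH, Rmult_1_l. simpl. ring.
Qed.

Lemma pow_le_exp (n : nat) (y : R) : (0 < n)%nat -> (0 <= y)%R ->
  (y ^ n <= INR n ^ n * exp y)%R.
Proof.
intros Hn Hy. assert (Hn' : (0 < INR n)%R) by (apply lt_0_INR; auto).
replace y with (INR n * (y / INR n))%R at 1 2 by (field; lra).
rewrite exp_nat_mul, Rpow_mult_distr.
apply Rmult_le_compat_l; [apply pow_le; lra|].
apply pow_incr. split; [apply Rmult_le_pos; [lra|left; apply Rinv_0_lt_compat; lra]|].
generalize (exp_ineq1_le (y / INR n)). lra.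
Qed.

(** The exponential beats all powers: this bound makes the derivative at the
    origin vanish. *)
Lemma flat_quadratic n : exists M, forall x, (Rabs (flat n x) <= M * x ^ 2)%R.
Proof.
exists (INR (n + 2) ^ (n + 2))%R. intros x. unfold flat.
assert (HM : (0 <= INR (n + 2) ^ (n + 2))%R) by (apply pow_le, pos_INR).
destruct (Rlt_dec 0 x) as [Hx|Hx].
- assert (Hi : (0 < / x)%R) by (apply Rinv_0_lt_compat; auto).
  rewrite Rabs_pos_eq.
  2: { apply Rmult_le_pos; [apply pow_le; lra|left; apply exp_pos]. }
  assert (H := pow_le_exp (n + 2) (/ x) ltac:(lia) ltac:(lra)).
  rewrite exp_Ropp.
  apply Rmult_le_reg_r with (exp (/ x) * (/ x) ^ 2)%R.
  { apply Rmult_lt_0_compat; [apply exp_pos|apply pow_lt; auto]. }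
  replace ((/ x) ^ n * / exp (/ x) * (exp (/ x) * (/ x) ^ 2))%R
    with ((/ x) ^ (n + 2))%R.
  2: { rewrite pow_add. field. split; [lra|apply Rgt_not_eq, exp_pos]. }
  eapply Rle_trans; [exact H|]. right. field. lra.
- rewrite Rabs_R0. apply Rmult_le_pos; [auto|apply pow2_ge_0].
Qed.

Lemma flat_derive (n : nat) (x : R) :
  is_derive (flat n) x (- INR n * flat (S n) x + flat (S (S n)) x)%R.
Proof.
destruct (Rtotal_order x 0) as [Hx|[->|Hx]].
- apply (is_derive_ext_loc (fun _ => 0%R)).
  + exists (mkposreal (- x) ltac:(lra)). intros y Hy.
    change (Rabs (y - x) < - x)%R in Hy. apply Rabs_def2 in Hy.
    unfold flat. destruct (Rlt_dec 0 y); [lra|reflexivity].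
  + unfold flat. destruct (Rlt_dec 0 x); [lra|].
    replace (- INR n * 0 + 0)%R with 0%R by ring. apply (is_derive_const (V := R_NormedModule)).
- destruct (flat_quadratic n) as [M HM].
  assert (Z : forall k, flat k 0 = 0%R)
    by (intros k; unfold flat; destruct (Rlt_dec 0 0); [lra|reflexivity]).
  rewrite !Z. replace (- INR n * 0 + 0)%R with 0%R by ring.
  split; [apply is_linear_scal_l|]. intros y Hy.
  apply (is_filter_lim_locally_unique (V := AbsRing_NormedModule R_AbsRing)) in Hy.
  subst y. intros e.
  assert (He := cond_pos e). assert (HMp := Rabs_pos M).
  assert (Hd : (0 < e / (Rabs M + 1))%R) by (apply Rdiv_lt_0_compat; lra).
  exists (mkposreal _ Hd). intros y Hy.
  change (Rabs (y - 0) < e / (Rabs M + 1))%R in Hy.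
  change (Rabs (flat n y - flat n 0 - (y - 0) * 0) <= e * Rabs (y - 0))%R.
  rewrite Z. replace (flat n y - 0 - (y - 0) * 0)%R with (flat n y) by ring.
  rewrite Rminus_0_r in *. eapply Rle_trans; [apply HM|].
  apply (Rmult_lt_compat_r (Rabs M + 1)) in Hy; [|lra].
  unfold Rdiv in Hy. rewrite Rmult_assoc, Rinv_l, Rmult_1_r in Hy by lra.
  rewrite <- (pow2_abs y). assert (K := Rle_abs M). assert (Hp := Rabs_pos y). nra.
- apply (is_derive_ext_loc (fun y => ((/ y) ^ n * exp (- / y))%R)).
  + exists (mkposreal x Hx). intros y Hy.
    change (Rabs (y - x) < x)%R in Hy. apply Rabs_def2 in Hy.
    unfold flat. destruct (Rlt_dec 0 y); [reflexivity|lra].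
  + unfold flat. destruct (Rlt_dec 0 x); [|lra].
    auto_derive; [repeat split; auto; lra|].
    destruct n as [|n]; [simpl; field; lra|].
    simpl pred. rewrite !S_INR. simpl pow. field. lra.
Qed.

Lemma Rcont_sq (T : UniformSpace) (f : T -> R) (x : T) :
  Rcts f x ->
  Rcts (fun t => f t ^ 2)%R x.
Proof.
intros H. apply (continuous_ext (fun t => f t * f t)%R); [intros; simpl; ring|].
apply Rcont_mult; exact H.
Qed.

(** The squared Euclidean distance to the identity is invariant under
    conjugation by rotations, so that [bump] is its own average over [K]. *)
Definition sqdist1 (p : R4) : R :=
  ((c11 p - 1) ^ 2 + c12 p ^ 2 + c21 p ^ 2 + (c22 p - 1) ^ 2)%R.

Definition bump (x : SL2) : C := RtoC (flat 0 (1 - sqdist1 (coords x))).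

Lemma bump_smooth : smooth bump.
Proof.
intros x. exists (fun _ => True), (fun p => RtoC (flat 0 (1 - sqdist1 p))).
split; [apply open_true|]. split; [exact I|]. split; [|reflexivity].
intros k.
apply (Ck_on_family nat (fun n r => RtoC (flat n r)) (fun n => RtoC (- INR n))
  (fun _ => 1) S (fun n => S (S n)) (fun _ => True) (fun _ => True)
  (fun p => 1 - sqdist1 p)%R (fun p => - 2 * (c11 p - 1))%R (fun p => - 2 * c12 p)%R
  (fun p => - 2 * c21 p)%R (fun p => - 2 * (c22 p - 1))%R); auto.
- intros n r _. rewrite Cmult_1_l, <- RtoC_mult, <- RtoC_plus.
  apply is_RCderive_pair; simpl. split; [apply flat_derive|].
  apply (is_derive_const (V := R_NormedModule)).
- intros p _. unfold sqdist1. apply Rcont_minus; [apply Rcont_const|].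
  apply Rcont_plus; [apply Rcont_plus; [apply Rcont_plus|]|]; apply Rcont_sq;
    [apply Rcont_minus; [apply c11_cont|apply Rcont_const]
    |apply c12_cont|apply c21_cont|apply Rcont_minus; [apply c22_cont|apply Rcont_const]].
- intros a b c d _. unfold sqdist1, c11, c12, c21, c22; simpl.
  split4; auto_derive; auto; ring.
- intros k'. replace (fun p => RtoC (- 2 * (c11 p - 1))) with (fun p => RtoC (-2) * RtoC (c11 p) + RtoC 2).
  + apply Ck_on_plus; [apply Ck_on_mult; [apply Ck_on_const|apply Ck_on_c11]|apply Ck_on_const].
  + apply functional_extensionality; intros p. rewrite <- RtoC_mult, <- RtoC_plus. f_equal; ring.
- intros k'. replace (fun p => RtoC (- 2 * c12 p)) with (fun p => RtoC (-2) * RtoC (c12 p)).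
  + apply Ck_on_mult; [apply Ck_on_const|apply Ck_on_c12].
  + apply functional_extensionality; intros p. rewrite <- RtoC_mult. f_equal; ring.
- intros k'. replace (fun p => RtoC (- 2 * c21 p)) with (fun p => RtoC (-2) * RtoC (c21 p)).
  + apply Ck_on_mult; [apply Ck_on_const|apply Ck_on_c21].
  + apply functional_extensionality; intros p. rewrite <- RtoC_mult. f_equal; ring.
- intros k'. replace (fun p => RtoC (- 2 * (c22 p - 1))) with (fun p => RtoC (-2) * RtoC (c22 p) + RtoC 2).
  + apply Ck_on_plus; [apply Ck_on_mult; [apply Ck_on_const|apply Ck_on_c22]|apply Ck_on_const].
  + apply functional_extensionality; intros p. rewrite <- RtoC_mult, <- RtoC_plus. f_equal; ring.
Qed.

Lemma flat_nonneg n x : (0 <= flat n x)%R.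
Proof.
unfold flat. destruct (Rlt_dec 0 x) as [Hx|]; [|lra].
apply Rmult_le_pos; [apply pow_le; left; apply Rinv_0_lt_compat; auto|left; apply exp_pos].
Qed.

Lemma flat_pos x : (0 < x)%R -> (0 < flat 0 x)%R.
Proof.
intros Hx. unfold flat. destruct (Rlt_dec 0 x); [|lra]. simpl.
rewrite Rmult_1_l. apply exp_pos.
Qed.

Lemma bump_support x : bump x <> 0 -> (sqdist1 (coords x) < 1)%R.
Proof.
intros H. apply Rnot_le_lt. intros Hle. apply H. unfold bump, flat.
destruct (Rlt_dec 0 (1 - sqdist1 (coords x))); [lra|reflexivity].
Qed.

Lemma bump_Cc : Cc_infty bump.
Proof.
split; [apply bump_smooth|]. exists 2%R. intros x Hx. apply bump_support in Hx.
unfold sqdist1, coords, c11, c12, c21, c22 in Hx; simpl in Hx.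
assert (K : forall u, (u * u < 1)%R -> (Rabs u <= 1)%R).
{ intros u Hu. apply Rabs_le. split; nra. }
assert (A := Rle_0_sqr (m11 x - 1)). assert (B := Rle_0_sqr (m12 x)).
assert (C' := Rle_0_sqr (m21 x)). assert (D := Rle_0_sqr (m22 x - 1)).
unfold Rsqr in *.
assert (K1 := K (m11 x - 1)%R ltac:(lra)). assert (K2 := K (m12 x) ltac:(lra)).
assert (K3 := K (m21 x) ltac:(lra)). assert (K4 := K (m22 x - 1)%R ltac:(lra)).
apply Rabs_le_between in K1. apply Rabs_le_between in K4.
repeat split; try lra; apply Rabs_le; lra.
Qed.

(** * The standard basis of the principal series *)

Definition row_sq (x : SL2) : R := (m21 x ^ 2 + m22 x ^ 2)%R.

Lemma row_sq_pos x : (0 < row_sq x)%R.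
Proof.
unfold row_sq. assert (D := SL2_det x).
destruct (Req_dec (m21 x) 0) as [H1|H1]; [destruct (Req_dec (m22 x) 0) as [H2|H2]|].
- rewrite H1, H2 in D. lra.
- assert (0 < m22 x ^ 2)%R by (apply pow2_gt_0; auto). nra.
- assert (0 < m21 x ^ 2)%R by (apply pow2_gt_0; auto). nra.
Qed.

(** On the circle [elt_k th] this is [exp (i (p - q) th)]; the exponents [p] and
    [q] are natural numbers, so that the function is a polynomial in the bottom
    row of the matrix times a power of its length. *)
Definition psvec (s : C) (p q : nat) (x : SL2) : C :=
  (RtoC (m22 x) - Ci * RtoC (m21 x)) ^ p * (RtoC (m22 x) + Ci * RtoC (m21 x)) ^ q
  * Cexp (- ((1 + s + INR p + INR q) / 2) * RtoC (ln (row_sq x))).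

Lemma psvec_smooth s p q : smooth (psvec s p q).
Proof.
intros x.
exists (fun w => 0 < c21 w ^ 2 + c22 w ^ 2)%R,
  (fun w => (RtoC (c22 w) - Ci * RtoC (c21 w)) ^ p *
    (RtoC (c22 w) + Ci * RtoC (c21 w)) ^ q *
    Cexp (- ((1 + s + INR p + INR q) / 2) * RtoC (ln (c21 w ^ 2 + c22 w ^ 2)))).
assert (HC : forall w : R4, Rcts
  (fun w => c21 w ^ 2 + c22 w ^ 2)%R w).
{ intros w. apply Rcont_plus; apply Rcont_sq; [apply c21_cont|apply c22_cont]. }
split.
{ intros w Hw. specialize (HC w). rewrite continuous_Rle_abs in HC.
  eapply filter_imp; [|apply (HC _ Hw)]. intros y Hy. apply Rabs_def2 in Hy. simpl in *. lra. }
split; [apply (row_sq_pos x)|]. split; [|reflexivity].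
intros k. apply Ck_on_mult; [apply Ck_on_mult; apply Ck_on_pow|].
- replace (fun w => RtoC (c22 w) - Ci * RtoC (c21 w))
    with (fun w => RtoC (c22 w) + - Ci * RtoC (c21 w)).
  + apply Ck_on_plus; [apply Ck_on_c22|].
    apply Ck_on_mult; [apply Ck_on_const|apply Ck_on_c21].
  + apply functional_extensionality; intros w; ring.
- apply Ck_on_plus; [apply Ck_on_c22|].
  apply Ck_on_mult; [apply Ck_on_const|apply Ck_on_c21].
- apply (Ck_on_family C (fun al r => Cexp (al * RtoC (ln r))) (fun al => al)
  (fun _ => 0) (fun al => al - 1) (fun al => al) (fun r => 0 < r)%R
  (fun w => 0 < c21 w ^ 2 + c22 w ^ 2)%R
  (fun w => c21 w ^ 2 + c22 w ^ 2)%R (fun _ => 0)%R (fun _ => 0)%R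
  (fun w => 2 * c21 w)%R (fun w => 2 * c22 w)%R); auto.
  + intros al r Hr. rewrite Cmult_0_l, Cplus_0_r.
    replace ((al - 1) * RtoC (ln r)) with (al * RtoC (ln r) + RtoC (- ln r))
      by (rewrite RtoC_opp; ring).
    rewrite Cexp_plus, Cexp_RtoC, exp_Ropp, exp_ln by auto.
    apply is_RCderive_pair. destruct al as [a1 a2].
    unfold Cexp, Re, Im; simpl. split; auto_derive; auto; unfold Rminus; field; lra.
  + intros a b c d _. unfold c21, c22; simpl. split4; auto_derive; auto; ring.
  + intros k'. apply Ck_on_const.
  + intros k'. apply Ck_on_const.
  + intros k'. replace (fun w => RtoC (2 * c21 w)) with (fun w => 2 * RtoC (c21 w)).
    * apply Ck_on_mult; [apply Ck_on_const|apply Ck_on_c21].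
    * apply functional_extensionality; intros w. rewrite <- RtoC_mult; reflexivity.
  + intros k'. replace (fun w => RtoC (2 * c22 w)) with (fun w => 2 * RtoC (c22 w)).
    * apply Ck_on_mult; [apply Ck_on_const|apply Ck_on_c22].
    * apply functional_extensionality; intros w. rewrite <- RtoC_mult; reflexivity.
Qed.

Lemma psvec_right_k s p q x th :
  psvec s p q (SL2_mul x (elt_k th)) = cis ((INR p - INR q) * th) * psvec s p q x.
Proof.
unfold psvec.
assert (E : row_sq (SL2_mul x (elt_k th)) = row_sq x).
{ unfold row_sq; simpl.
  transitivity ((m21 x ^ 2 + m22 x ^ 2) * (Rsqr (sin th) + Rsqr (cos th)))%R.
  - unfold Rsqr; ring.
  - rewrite sin2_cos2. ring. }
rewrite E. simpl m22. simpl m21.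
replace (RtoC (m21 x * sin th + m22 x * cos th) - Ci * RtoC (m21 x * cos th + m22 x * - sin th))
  with (cis th * (RtoC (m22 x) - Ci * RtoC (m21 x)))
  by (unfold cis; apply Ceq; unfold Re, Im; simpl; ring).
replace (RtoC (m21 x * sin th + m22 x * cos th) + Ci * RtoC (m21 x * cos th + m22 x * - sin th))
  with (cis (- th) * (RtoC (m22 x) + Ci * RtoC (m21 x)))
  by (rewrite cis_opp; unfold cis, Cconj; apply Ceq; unfold Re, Im; simpl; ring).
rewrite !Cpow_mult_l, !cis_pow.
replace ((INR p - INR q) * th)%R with (INR p * th + INR q * - th)%R by ring.
rewrite cis_plus. ring.
Qed.

Lemma psvec_one s p q : psvec s p q SL2_one = 1.
Proof.
unfold psvec.
assert (E : row_sq SL2_one = 1%R) by (unfold row_sq; simpl; ring).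
rewrite E, ln_1. simpl m22. simpl m21.
replace (RtoC 1 - Ci * RtoC 0) with (cis 0) by (rewrite cis_0; ring).
replace (RtoC 1 + Ci * RtoC 0) with (cis 0) by (rewrite cis_0; ring).
rewrite !cis_pow, !Rmult_0_r, cis_0, Cmult_0_r, Cexp_0. ring.
Qed.

Definition parity (delta : Mhat) : nat := match delta with M0 => 0 | M1 => 1 end.

(** A triangular matrix multiplies the bottom row by the scalar [e / t]: the
    polynomial factor of degree [p + q] and the power of the length of the row
    combine to [t ^ (1 + s)] and the sign [e ^ (p + q)]. *)
Lemma psvec_equivariant (delta : Mhat) s p q e t u x :
  Nat.even (p + q) = Nat.even (parity delta) ->
  psvec s p q (SL2_mul (SL2_mul (SL2_mul (elt_m e) (elt_a t)) (elt_n u)) x)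
  = Rpow_C t (1 + s) * M_char delta e * psvec s p q x.
Proof.
intros Hpar. set (y := SL2_mul _ x).
assert (Ht := cond_pos t).
set (ep := (if e then -1 else 1)%R).
assert (E1 : m21 y = (ep * / t * m21 x)%R) by (unfold y, ep; simpl; ring).
assert (E2 : m22 y = (ep * / t * m22 x)%R) by (unfold y, ep; simpl; ring).
assert (Eep : (ep * ep = 1)%R) by (unfold ep; destruct e; ring).
assert (Er : row_sq y = (/ t * / t * row_sq x)%R).
{ unfold row_sq. rewrite E1, E2.
  transitivity (ep * ep * (/ t * / t * (m21 x ^ 2 + m22 x ^ 2)))%R; [ring|].
  rewrite Eep; ring. }
assert (Hi : (0 < / t)%R) by (apply Rinv_0_lt_compat; auto).
unfold psvec. rewrite Er, E1, E2.
rewrite !ln_mult, !ln_Rinv by (auto; try apply Rmult_lt_0_compat; auto using row_sq_pos).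
replace (RtoC (ep * / t * m22 x) - Ci * RtoC (ep * / t * m21 x))
  with (RtoC (ep * / t) * (RtoC (m22 x) - Ci * RtoC (m21 x)))
  by (rewrite (RtoC_mult (ep * / t) (m22 x)), (RtoC_mult (ep * / t) (m21 x)); ring).
replace (RtoC (ep * / t * m22 x) + Ci * RtoC (ep * / t * m21 x))
  with (RtoC (ep * / t) * (RtoC (m22 x) + Ci * RtoC (m21 x)))
  by (rewrite (RtoC_mult (ep * / t) (m22 x)), (RtoC_mult (ep * / t) (m21 x)); ring).
rewrite !Cpow_mult_l.
assert (Epow : forall n : nat, RtoC (ep * / t) ^ n = RtoC (ep ^ n) * Cexp (- (INR n * ln t))).
{ intros n. rewrite <- RtoC_pow, Rpow_mult_distr, RtoC_mult. f_equal.
  rewrite <- RtoC_mult, <- RtoC_opp, Cexp_RtoC. f_equal.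
  replace (- (INR n * ln t))%R with (INR n * (- ln t))%R by ring.
  rewrite exp_nat_mul, exp_Ropp, exp_ln by auto. reflexivity. }
rewrite !Epow.
assert (Esgn : RtoC (ep ^ p) * RtoC (ep ^ q) = M_char delta e).
{ rewrite <- RtoC_mult, <- pow_add. unfold ep, M_char.
  destruct e; [|destruct delta; rewrite pow1; reflexivity].
  destruct delta; simpl in Hpar.
  - apply Nat.even_spec in Hpar. destruct Hpar as [m ->]. rewrite pow_1_even. reflexivity.
  - assert (Ho : Nat.odd (p + q) = true) by (rewrite <- Nat.negb_even, Hpar; reflexivity).
    apply Nat.odd_spec in Ho. destruct Ho as [m ->].
    replace (2 * m + 1)%nat with (S (2 * m)) by lia. rewrite pow_1_odd.
    apply Ceq; unfold Re, Im; simpl; ring. }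
rewrite <- Esgn. unfold Rpow_C.
transitivity (RtoC (ep ^ p) * RtoC (ep ^ q) *
  ((RtoC (m22 x) - Ci * RtoC (m21 x)) ^ p * (RtoC (m22 x) + Ci * RtoC (m21 x)) ^ q) *
  (Cexp (- (INR p * ln t)) * Cexp (- (INR q * ln t)) *
   Cexp (- ((1 + s + INR p + INR q) / 2) * RtoC (- ln t + - ln t + ln (row_sq x))))).
{ ring. }
rewrite <- !Cexp_plus.
replace (- (INR p * ln t) + - (INR q * ln t) +
    - ((1 + s + INR p + INR q) / 2) * RtoC (- ln t + - ln t + ln (row_sq x)))
  with ((1 + s) * ln t + - ((1 + s + INR p + INR q) / 2) * RtoC (ln (row_sq x))).
- rewrite Cexp_plus. ring.
- rewrite !RtoC_plus, !RtoC_opp. field.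
Qed.

(** The weights [p - q] run through the integers of the parity of [delta]. *)
Definition basis (delta : Mhat) (s : C) (j : nat) : SL2 -> C :=
  psvec s (parity delta + 2 * fst (enum_pair j)) (2 * snd (enum_pair j)).

Definition weight (delta : Mhat) (j : nat) : R :=
  (INR (parity delta) + 2 * (INR (fst (enum_pair j)) - INR (snd (enum_pair j))))%R.

Lemma basis_principal delta s j : principal_series delta s (basis delta s j).
Proof.
split; [apply psvec_smooth|]. intros e t u x. apply psvec_equivariant.
replace (parity delta + 2 * fst (enum_pair j) + 2 * snd (enum_pair j))%nat
  with (parity delta + 2 * (fst (enum_pair j) + snd (enum_pair j)))%nat by lia.
rewrite Nat.even_add, Nat.even_mul. simpl. apply eqb_true_r || (destruct (Nat.even _); reflexivity).
Qed.

Lemma basis_right_k delta s j x th :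
  basis delta s j (SL2_mul x (elt_k th)) = cis (weight delta j * th) * basis delta s j x.
Proof.
unfold basis. rewrite psvec_right_k. do 3 f_equal. unfold weight.
rewrite plus_INR, !mult_INR. simpl (INR 2). ring.
Qed.

Lemma basis_k delta s j th : basis delta s j (elt_k th) = cis (weight delta j * th).
Proof.
rewrite <- (SL2_mul_1_l (elt_k th)), basis_right_k. unfold basis.
rewrite psvec_one. ring.
Qed.

Lemma enum_pair_inj i j : enum_pair i = enum_pair j -> i = j.
Proof.
assert (E : forall n, Nat.even n = true -> n = (2 * Nat.div2 n)%nat).
{ intros n Hn. rewrite (Nat.div2_odd n) at 1.
  rewrite <- Nat.negb_even, Hn. simpl. lia. }
assert (O' : forall n, Nat.even n = false -> S n = (2 * Nat.div2 (S n))%nat).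
{ intros n Hn. apply E. rewrite Nat.even_succ, <- Nat.negb_even, Hn. reflexivity. }
unfold enum_pair. intros H.
destruct (Nat.even i) eqn:Ei, (Nat.even j) eqn:Ej;
  [apply E in Ei; apply E in Ej|apply E in Ei; apply O' in Ej
  |apply O' in Ei; apply E in Ej|apply O' in Ei; apply O' in Ej];
  assert (H1 := f_equal fst H); assert (H2 := f_equal snd H);
  cbn [fst snd] in H1, H2; lia.
Qed.

Lemma enum_pair_zero j : fst (enum_pair j) = O \/ snd (enum_pair j) = O.
Proof. unfold enum_pair. destruct (Nat.even j); auto. Qed.

(** ** The standard basis is an orthonormal basis *)

Lemma inner_CInt (phi psi : SL2 -> C) : inner phi psi =
  / (2 * PI) * CInt (fun th => phi (elt_k th) * Cconj (psi (elt_k th))) 0 (2 * PI).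
Proof. reflexivity. Qed.

Lemma Cmod_mult_diff (a b a' b' : C) :
  (Cmod (a * b - a' * b') <= Cmod a * Cmod (b - b') + Cmod b' * Cmod (a - a'))%R.
Proof.
replace (a * b - a' * b') with (a * (b - b') + b' * (a - a')) by ring.
eapply Rle_trans; [apply Cmod_triangle|]. rewrite !Cmod_mult. lra.
Qed.

Lemma CInt_conj (f : R -> C) a b : (forall x, RCcontinuous f x) ->
  CInt (fun t => Cconj (f t)) a b = Cconj (CInt f a b).
Proof.
intros H. rewrite !CInt_pair; auto.
2: intros x; apply Ccont_conj, H.
unfold Cconj; simpl. f_equal.
apply (RInt_opp (V := R_CompleteNormedModule) (fun t => Im (f t))).
apply (ex_RInt_continuous (V := R_CompleteNormedModule)); intros z _.
apply (proj1 (Ccont_pair _ _ _) (H z)).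
Qed.

(** On a function of period [PI] that is Lipschitz on the circle, a translation by
    [x] acts as a translation by [x + PI]: whichever is the smaller is controlled
    by [|sin x|]. *)
Lemma pi_periodic_lip (u : R -> C) (L : R) : (0 <= L)%R ->
  (forall a b, (Cmod (u a - u b) <= L * Cmod (cis a - cis b))%R) ->
  (forall a, u (a + PI)%R = u a) ->
  forall a x, (Cmod (u (a + x)%R - u a) <= 2 * L * Rabs (sin x))%R.
Proof.
intros HL Hlip Hper a x.
assert (H1 := Hlip (a + x)%R a). assert (H2 := Hlip (a + x + PI)%R a).
rewrite Hper in H2.
assert (E1 : Cmod (cis (a + x) - cis a) = Cmod (cis x - 1)).
{ rewrite cis_plus. replace (cis a * cis x - cis a) with (cis a * (cis x - 1)) by ring.
  rewrite Cmod_mult, Cmod_cis. ring. }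
assert (EP : cis PI = - (1)).
{ unfold cis. rewrite cos_PI, sin_PI. apply Ceq; unfold Re, Im; simpl; ring. }
assert (E2 : Cmod (cis (a + x + PI) - cis a) = Cmod (cis x + 1)).
{ rewrite !cis_plus, EP.
  replace (cis a * cis x * - (1) - cis a) with (- cis a * (cis x + 1)) by ring.
  rewrite Cmod_mult, Cmod_opp, Cmod_cis. ring. }
rewrite E1 in H1. rewrite E2 in H2.
assert (E : (Cmod (cis x - 1) * Cmod (cis x + 1) = 2 * Rabs (sin x))%R).
{ rewrite <- Cmod_mult, <- Cmod_cis_double. f_equal.
  replace (2 * x)%R with (x + x)%R by ring. rewrite cis_plus. ring. }
assert (S : (2 <= Cmod (cis x - 1) + Cmod (cis x + 1))%R).
{ assert (T := Cmod_minus_le (cis x + 1) (cis x - 1)).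
  replace (cis x + 1 - (cis x - 1)) with (RtoC 2) in T by ring.
  rewrite Cmod_R, Rabs_pos_eq in T by lra. lra. }
assert (A1 := Cmod_ge_0 (cis x - 1)). assert (A2 := Cmod_ge_0 (cis x + 1)).
destruct (Rle_dec 1 (Cmod (cis x + 1))) as [H|H].
- assert (Cmod (cis x - 1) <= 2 * Rabs (sin x))%R by nra. nra.
- assert (Cmod (cis x + 1) <= 2 * Rabs (sin x))%R by nra. nra.
Qed.

Section Autocorrelation.

Variable u : R -> C.
Variable L : R.
Hypothesis HL : (0 <= L)%R.
Hypothesis Hlip : forall a b, (Cmod (u a - u b) <= L * Cmod (cis a - cis b))%R.
Hypothesis Hper : forall a, u (a + PI)%R = u a.

(** The Fourier coefficients of the autocorrelation are the squared moduli of
    those of [u], and its value at [0] is the mean of [|u|^2]: Fourier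
    inversion at [0] is Parseval's identity for [u]. *)
Definition autocorr (x : R) : C :=
  / (2 * PI) * CInt (fun th => u th * Cconj (u (th + x)%R)) 0 (2 * PI).

Lemma u_lip a b : (Cmod (u a - u b) <= 2 * L * Rabs (a - b))%R.
Proof.
eapply Rle_trans; [apply Hlip|]. assert (H := cis_lip a b).
apply Rle_trans with (L * (2 * Rabs (a - b)))%R; [|right; ring].
apply Rmult_le_compat_l; auto.
Qed.

Lemma u_cont x : RCcontinuous u x.
Proof. apply (lip_RCcontinuous _ (2 * L)). apply u_lip. Qed.

Lemma u_bound a : (Cmod (u a) <= Cmod (u 0%R) + 2 * L)%R.
Proof.
assert (H := Hlip a 0). assert (H1 := Cmod_triangle_rev (u a) (u 0%R)).
assert (H2 := Cmod_minus_le (cis a) (cis 0)). rewrite !Cmod_cis in H2.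
assert (L * Cmod (cis a - cis 0) <= L * 2)%R by (apply Rmult_le_compat_l; lra).
lra.
Qed.

Lemma u_shift_cont v x : RCcontinuous (fun t => u (t + v)%R) x.
Proof.
apply (continuous_comp (fun t => (t + v)%R) u); [|apply u_cont].
apply Rcont_plus; [apply Rcont_id|apply Rcont_const].
Qed.

Lemma PI_pos_C : RtoC 2 * RtoC PI <> 0.
Proof. rewrite <- RtoC_mult. apply RtoC_neq. generalize PI_RGT_0; lra. Qed.

Lemma Cmod_2PI : Cmod (/ (2 * PI)) = (/ (2 * PI))%R.
Proof.
rewrite Cmod_inv by apply PI_pos_C. rewrite <- RtoC_mult, Cmod_R, Rabs_pos_eq; auto.
generalize PI_RGT_0; lra.
Qed.

Lemma autocorr_diff x y :
  (Cmod (autocorr x - autocorr y) <=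
    (Cmod (u 0%R) + 2 * L) * (2 * L * Rabs (sin (x - y))))%R.
Proof.
assert (HPI := PI_RGT_0).
set (M := (Cmod (u 0%R) + 2 * L)%R).
assert (Hc : forall v x, RCcontinuous (fun th => u th * Cconj (u (th + v)%R)) x).
{ intros v z. apply Ccont_mult; [apply u_cont|apply Ccont_conj, u_shift_cont]. }
unfold autocorr.
replace (/ (2 * PI) * CInt (fun th => u th * Cconj (u (th + x)%R)) 0 (2 * PI) -
  / (2 * PI) * CInt (fun th => u th * Cconj (u (th + y)%R)) 0 (2 * PI))
  with (/ (2 * PI) * CInt (fun th => u th * Cconj (u (th + x)%R) -
    u th * Cconj (u (th + y)%R)) 0 (2 * PI)) by (rewrite CInt_minus by auto; ring).
rewrite Cmod_mult, Cmod_2PI.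
apply Rmult_le_reg_l with (2 * PI)%R; [lra|].
rewrite <- Rmult_assoc, Rinv_r, Rmult_1_l by lra.
replace (2 * PI)%R with (2 * PI - 0)%R at 2 by ring.
apply CInt_bound_const; [lra| |].
- intros z. apply Ccont_minus; auto.
- intros th _.
  replace (u th * Cconj (u (th + x)%R) - u th * Cconj (u (th + y)%R))
    with (u th * Cconj (u (th + x)%R - u (th + y)%R))
    by (rewrite Cminus_conj; ring).
  rewrite Cmod_mult, Cmod_conj. apply Rmult_le_compat; try apply Cmod_ge_0.
  + apply u_bound.
  + replace (th + x)%R with ((th + y) + (x - y))%R by ring.
    apply pi_periodic_lip; auto.
Qed.

Lemma autocorr_cont x : RCcontinuous autocorr x.
Proof.
set (M := (Cmod (u 0%R) + 2 * L)%R).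
assert (HM : (0 <= M)%R).
{ eapply Rle_trans; [apply Cmod_ge_0|apply (u_bound 0)]. }
apply (lip_RCcontinuous _ (M * (2 * L))). intros a b.
eapply Rle_trans; [apply autocorr_diff|]. fold M.
rewrite !Rmult_assoc. apply Rmult_le_compat_l; auto.
do 2 (apply Rmult_le_compat_l; [lra|]).
assert (H := bounded_variation sin cos 1 0 (a - b)).
rewrite sin_0, !Rminus_0_r, Rmult_1_l in H. apply H.
intros t _. split; [auto_derive; auto; ring|apply Rabs_le, COS_bound].
Qed.

(** Fubini's theorem and a translation by [th] in the inner integral, over a
    period. *)
Lemma autocorr_coef p q : fcoef autocorr p q =
  RtoC (Cmod (/ (2 * PI) * CInt (fun th => u th * cis (- (2 * (INR p - INR q) * th))) 0
    (2 * PI)) ^ 2).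
Proof.
assert (HPI := PI_RGT_0).
set (z := (2 * (INR p - INR q))%R).
set (B := CInt (fun th => u th * cis (- (z * th))) 0 (2 * PI)).
set (M := (Cmod (u 0%R) + 2 * L)%R).
assert (HM : (0 <= M)%R).
{ eapply Rle_trans; [apply Cmod_ge_0|apply (u_bound 0)]. }
assert (Hub := u_bound). assert (Hul := u_lip). fold M in Hub.
assert (Hc : forall v x, RCcontinuous (fun th => u th * Cconj (u (th + v)%R)) x).
{ intros v x. apply Ccont_mult; [apply u_cont|apply Ccont_conj, u_shift_cont]. }
assert (Cz : forall x, RCcontinuous (fun t => cis (- (z * t))) x).
{ intros x. apply Ccont_cis.
  apply (continuous_opp (V := R_NormedModule) (fun t => z * t)%R).
  apply Rcont_mult; [apply Rcont_const|apply Rcont_id]. }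
assert (Cg : forall x, RCcontinuous (fun t => u t * cis (- (z * t))) x)
  by (intros x; apply Ccont_mult; [apply u_cont|apply Cz]).
unfold fcoef. fold z.
assert (E : CInt (fun x => autocorr x * cis (z * x)) 0 (2 * PI) =
  / (2 * PI) * (B * Cconj B)).
{ rewrite (CInt_ext _ (fun x => / (2 * PI) *
    CInt (fun th => u th * Cconj (u (th + x)%R) * cis (z * x)) 0 (2 * PI))).
  2: { intros x _. unfold autocorr. rewrite <- Cmult_assoc. f_equal.
       rewrite Cmult_comm, <- CInt_scal by auto. apply CInt_ext. intros; ring. }
  assert (BF : forall x th, (Cmod (u th * Cconj (u (th + x)%R)) <= M * M)%R).
  { intros. rewrite Cmod_mult, Cmod_conj.
    apply Rmult_le_compat; try apply Cmod_ge_0; apply Hub. }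
  set (K := (M * M * (2 * Rabs z) + 2 * (M * (2 * L)))%R).
  assert (Hz := Rabs_pos z).
  assert (LX : forall x x' th, (Cmod (u th * Cconj (u (th + x)%R) * cis (z * x) -
    u th * Cconj (u (th + x')%R) * cis (z * x')) <= K * Rabs (x - x'))%R).
  { intros x x' th. eapply Rle_trans; [apply Cmod_mult_diff|].
    rewrite Cmod_cis.
    assert (H1 := cis_lip (z * x) (z * x')).
    replace (z * x - z * x')%R with (z * (x - x'))%R in H1 by ring.
    rewrite Rabs_mult in H1.
    assert (H2 : (Cmod (u th * Cconj (u (th + x)%R) - u th * Cconj (u (th + x')%R)) <=
      M * (2 * L * Rabs (x - x')))%R).
    { replace (u th * Cconj (u (th + x)%R) - u th * Cconj (u (th + x')%R))
        with (u th * Cconj (u (th + x)%R - u (th + x')%R))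
        by (rewrite Cminus_conj; ring).
      rewrite Cmod_mult, Cmod_conj. apply Rmult_le_compat; try apply Cmod_ge_0; auto.
      replace (x - x')%R with ((th + x) - (th + x'))%R by ring. apply Hul. }
    assert (H3 := BF x th). assert (Hp := Rabs_pos (x - x')).
    apply Rle_trans with (M * M * (2 * (Rabs z * Rabs (x - x'))) +
      1 * (M * (2 * L * Rabs (x - x'))))%R.
    - apply Rplus_le_compat; [|lra].
      apply Rmult_le_compat; auto; apply Cmod_ge_0.
    - unfold K.
      assert (0 <= M * (2 * L) * Rabs (x - x'))%R
        by (repeat apply Rmult_le_pos; lra).
      lra. }
  assert (LT : forall x th th', (Cmod (u th * Cconj (u (th + x)%R) * cis (z * x) -
    u th' * Cconj (u (th' + x)%R) * cis (z * x)) <= K * Rabs (th - th'))%R).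
  { intros x th th'.
    replace (u th * Cconj (u (th + x)%R) * cis (z * x) -
      u th' * Cconj (u (th' + x)%R) * cis (z * x))
      with ((u th * Cconj (u (th + x)%R) - u th' * Cconj (u (th' + x)%R)) * cis (z * x))
      by ring.
    rewrite Cmod_mult, Cmod_cis, Rmult_1_r.
    eapply Rle_trans; [apply Cmod_mult_diff|].
    rewrite <- Cminus_conj, !Cmod_conj.
    assert (H1 := Hul (th + x)%R (th' + x)%R).
    replace (th + x - (th' + x))%R with (th - th')%R in H1 by ring.
    assert (H2 := Hul th th'). assert (Hp := Rabs_pos (th - th')).
    apply Rle_trans with (M * (2 * L * Rabs (th - th')) + M * (2 * L * Rabs (th - th')))%R.
    - apply Rplus_le_compat; apply Rmult_le_compat; try apply Cmod_ge_0; auto.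
    - unfold K.
      assert (0 <= M * M * (2 * Rabs z) * Rabs (th - th'))%R
        by (repeat apply Rmult_le_pos; lra).
      lra. }
  assert (CF : forall x t, RCcontinuous (fun th => u th * Cconj (u (th + x)%R) * cis (z * x)) t)
    by (intros; apply Ccont_mult; [apply Hc|apply Ccont_const]).
  assert (CFx : forall th t, RCcontinuous (fun x => u th * Cconj (u (th + x)%R) * cis (z * x)) t)
    by (intros th; apply (lip_RCcontinuous _ K); intros; apply LX).
  assert (CI : forall t, RCcontinuous (fun x => CInt (fun th => u th * Cconj (u (th + x)%R) * cis (z * x)) 0 (2 * PI)) t).
  { apply (lip_RCcontinuous _ ((2 * PI - 0) * K)). intros x x'.
    rewrite <- CInt_minus by auto. rewrite Rmult_assoc.
    apply CInt_bound_const; [lra| |].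
    - intros; apply Ccont_minus; auto.
    - intros; apply LX. }
  rewrite CInt_scal by auto. f_equal.
  rewrite (CInt_fubini (fun x th => u th * Cconj (u (th + x)%R) * cis (z * x)) K)
    by (auto; lra).
  rewrite (CInt_ext _ (fun th => Cconj B * (u th * cis (- (z * th))))).
  - rewrite CInt_scal by auto. fold B. ring.
  - intros th _.
    rewrite (CInt_ext _ (fun x => (u th * cis (- (z * th))) *
      Cconj ((fun t => u t * cis (- (z * t))) (x + th)%R))).
    + rewrite CInt_scal.
      2: { intros x. apply Ccont_conj.
           apply (continuous_comp (fun x => (x + th)%R) (fun t => u t * cis (- (z * t)))).
           - apply Rcont_plus; [apply Rcont_id|apply Rcont_const].
           - apply Cg. }
      rewrite (CInt_conj (fun x => (fun t => u t * cis (- (z * t))) (x + th)%R)).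
      2: { intros x.
           apply (continuous_comp (fun x => (x + th)%R) (fun t => u t * cis (- (z * t)))).
           - apply Rcont_plus; [apply Rcont_id|apply Rcont_const].
           - apply Cg. }
      assert (SH : CInt (fun x => u (x + th)%R * cis (- (z * (x + th)))) 0 (2 * PI) = B).
      { apply (CInt_period_shift (fun t => u t * cis (- (z * t)))); auto.
        intros x. replace (x + 2 * PI)%R with (x + PI + PI)%R by ring.
        rewrite !Hper. f_equal.
        assert (EE : cis (- (z * (x + PI + PI)) + 2 * INR (2 * p) * PI) =
          cis (- (z * x) + 2 * INR (2 * q) * PI)).
        { f_equal. unfold z. rewrite !mult_INR. simpl. ring. }
        rewrite !cis_period in EE. exact EE. }
      cbv beta. rewrite SH. ring.
    + intros x _. cbv beta. rewrite Cmult_conj, <- cis_opp.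
      replace (- - (z * (x + th)))%R with (z * x + z * th)%R by ring.
      rewrite cis_plus.
      replace (th + x)%R with (x + th)%R by ring.
      transitivity (u th * Cconj (u (x + th)%R) * cis (z * x) *
        (cis (- (z * th)) * cis (z * th))).
      * rewrite <- cis_plus, Rplus_opp_l, cis_0. ring.
      * ring. }
rewrite E.
rewrite Cmod2_conj, Cmult_conj.
assert (EC : Cconj (/ (2 * PI)) = / (2 * PI)).
{ rewrite <- RtoC_mult, <- RtoC_inv by lra. apply Ceq; unfold Re, Im; simpl; ring. }
rewrite EC. fold B. ring.
Qed.

End Autocorrelation.

Lemma elt_m_form e : SL2_mul (SL2_mul (elt_m e) (elt_a (mkposreal 1 Rlt_0_1))) (elt_n 0)
  = elt_m e.
Proof. apply SL2_eq; simpl; field. Qed.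

Lemma principal_series_m delta s phi e x : principal_series delta s phi ->
  phi (SL2_mul (elt_m e) x) = M_char delta e * phi x.
Proof.
intros [_ H]. specialize (H e (mkposreal 1 Rlt_0_1) 0 x).
rewrite elt_m_form in H. rewrite H. unfold Rpow_C. simpl pos.
rewrite ln_1, Cmult_0_r, Cexp_0. ring.
Qed.

Lemma cis_parity delta : cis (INR (parity delta) * PI) = M_char delta true.
Proof.
destruct delta; simpl.
- rewrite Rmult_0_l. apply cis_0.
- rewrite Rmult_1_l. unfold cis. rewrite cos_PI, sin_PI.
  apply Ceq; unfold Re, Im; simpl; ring.
Qed.

Lemma M_char_sq delta e : M_char delta e * M_char delta e = 1.
Proof. destruct delta, e; simpl; ring. Qed.

Lemma M_char_conj delta e : Cconj (M_char delta e) = M_char delta e.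
Proof. destruct delta, e; apply Ceq; unfold Re, Im; simpl; ring. Qed.

(** On [K] the basis consists of exponentials of the parity of [delta]. A
    smooth vector becomes a function of period [PI] when multiplied by the
    exponential of parameter [- parity delta]; Parseval's identity holds for
    it because its autocorrelation has positive Fourier coefficients. *)
Lemma basis_orthonormal (delta : Mhat) (s : C) :
  orthonormal_basis delta s (basis delta s).
Proof.
assert (HPI := PI_RGT_0).
split; [apply basis_principal|]. split.
- intros i j. rewrite inner_CInt.
  set (pi := fst (enum_pair i)). set (qi := snd (enum_pair i)).
  set (pj := fst (enum_pair j)). set (qj := snd (enum_pair j)).
  rewrite (CInt_ext _ (fun x => cis (2 * (INR (pi + qj) - INR (qi + pj)) * x))).
  2: { intros x _. rewrite !basis_k, <- cis_opp, <- cis_plus. f_equal.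
       unfold weight. fold pi qi pj qj. rewrite !plus_INR. ring. }
  rewrite CInt_cis_nat.
  destruct (Nat.eqb_spec i j) as [->|Hne].
  + replace (Nat.eqb (pi + qj) (qi + pj)) with true.
    * rewrite RtoC_mult. field. apply RtoC_neq; lra.
    * symmetry. apply Nat.eqb_eq. unfold pi, qi, pj, qj. lia.
  + replace (Nat.eqb (pi + qj) (qi + pj)) with false; [ring|].
    symmetry. apply Nat.eqb_neq. intros E. apply Hne, enum_pair_inj.
    assert (Zi := enum_pair_zero i). assert (Zj := enum_pair_zero j).
    fold pi qi in Zi. fold pj qj in Zj.
    rewrite (surjective_pairing (enum_pair i)), (surjective_pairing (enum_pair j)).
    fold pi qi pj qj. f_equal; lia.
- intros phi Hphi.
  set (d := INR (parity delta)).
  set (u := fun th => phi (elt_k th) * cis (- (d * th))).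
  destruct (smooth_lipschitz_bounded phi 4 (proj1 Hphi)) as (L0 & HL0 & Hlip0).
  assert (Hphil : forall a b, (Cmod (phi (elt_k a) - phi (elt_k b)) <=
    4 * L0 * Cmod (cis a - cis b))%R).
  { intros a b. eapply Rle_trans; [apply Hlip0; apply mnorm_k|].
    assert (H := mdist_k a b). nra. }
  assert (Hcisd : forall a b, (Cmod (cis (- (d * a)) - cis (- (d * b))) <=
    Cmod (cis a - cis b))%R).
  { intros a b. unfold d. destruct delta; simpl.
    - rewrite !Rmult_0_l. replace (cis (- 0) - cis (- 0)) with (RtoC 0) by ring.
      rewrite Cmod_0. apply Cmod_ge_0.
    - rewrite !Rmult_1_l, !cis_opp, <- Cminus_conj, Cmod_conj. lra. }
  set (M := (Cmod (phi (elt_k 0)) + 8 * L0)%R).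
  assert (HM : forall a, (Cmod (phi (elt_k a)) <= M)%R).
  { intros a. assert (H := Hphil a 0%R).
    assert (H1 := Cmod_triangle_rev (phi (elt_k a)) (phi (elt_k 0))).
    assert (H2 := Cmod_minus_le (cis a) (cis 0)). rewrite !Cmod_cis in H2.
    assert (4 * L0 * Cmod (cis a - cis 0) <= 4 * L0 * 2)%R
      by (apply Rmult_le_compat_l; lra). unfold M. lra. }
  assert (HM0 : (0 <= M)%R) by (eapply Rle_trans; [apply Cmod_ge_0|apply (HM 0%R)]).
  assert (Hul : forall a b, (Cmod (u a - u b) <= (M + 4 * L0) * Cmod (cis a - cis b))%R).
  { intros a b. unfold u. eapply Rle_trans; [apply Cmod_mult_diff|].
    rewrite Cmod_cis. assert (H1 := Hphil a b). assert (H2 := Hcisd a b).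
    assert (H3 := HM a). assert (H4 := Cmod_ge_0 (phi (elt_k a))).
    assert (H5 := Cmod_ge_0 (cis (- (d * a)) - cis (- (d * b)))).
    assert (Cmod (phi (elt_k a)) * Cmod (cis (- (d * a)) - cis (- (d * b))) <=
      M * Cmod (cis a - cis b))%R by (apply Rmult_le_compat; auto).
    lra. }
  assert (Hper : forall a, u (a + PI)%R = u a).
  { intros a. unfold u. rewrite Rplus_comm, <- elt_k_plus, elt_k_PI.
    rewrite (principal_series_m delta s) by auto.
    replace (- (d * (PI + a)))%R with (- (d * a) + - (d * PI))%R by ring.
    rewrite cis_plus, (cis_opp (d * PI)). unfold d.
    rewrite cis_parity, M_char_conj. fold d.
    transitivity (M_char delta true * M_char delta true * (phi (elt_k a) * cis (- (d * a))));
      [ring|]. rewrite M_char_sq. ring. }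
  assert (HLp : (0 <= M + 4 * L0)%R) by lra.
  assert (E0 : Re (autocorr u 0) = Re (inner phi phi)).
  { f_equal. unfold autocorr. rewrite inner_CInt. f_equal. apply CInt_ext.
    intros x _. unfold u. rewrite Rplus_0_r, Cmult_conj.
    transitivity (phi (elt_k x) * Cconj (phi (elt_k x)) *
      (cis (- (d * x)) * Cconj (cis (- (d * x))))); [ring|].
    rewrite cis_conj. ring. }
  rewrite <- E0.
  apply (fourier_sum_pos (autocorr u)
    ((Cmod (u 0%R) + 2 * (M + 4 * L0)) * (2 * (M + 4 * L0)))).
  + apply Rmult_le_pos; [|lra]. assert (H := Cmod_ge_0 (u 0%R)). lra.
  + intros x. apply (autocorr_cont u (M + 4 * L0)); auto.
  + intros x. assert (H := autocorr_diff u (M + 4 * L0) HLp Hul Hper x 0).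
    rewrite Rminus_0_r in H. rewrite Rmult_assoc. exact H.
  + intros j. apply pow2_ge_0.
  + intros j. rewrite (autocorr_coef u (M + 4 * L0) HLp Hul Hper).
    rewrite inner_CInt.
    apply (f_equal (fun z : C => RtoC (Cmod (/ (2 * PI) * z) ^ 2))). apply CInt_ext. intros x _.
    rewrite basis_k, <- cis_opp. unfold u. rewrite <- Cmult_assoc, <- cis_plus.
    do 2 f_equal. unfold weight. fold d. ring.
Qed.

(** * The trace formula for the principal series *)

Lemma Cc_intro (F : SL2 -> R) (B : R) :
  (forall x, Rcts F x) ->
  (forall x, F x <> 0%R -> (mnorm x <= B)%R) -> Cc F.
Proof.
intros Hc Hs. split; [exact Hc|]. exists B. intros x Hx.
specialize (Hs x Hx). unfold mnorm in Hs.
generalize (Rabs_pos (m11 x)) (Rabs_pos (m12 x)) (Rabs_pos (m21 x)) (Rabs_pos (m22 x)).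
intros. repeat split; lra.
Qed.

Lemma Cc_bounded (F : SL2 -> R) : Cc F -> exists B, forall x, F x <> 0%R -> (mnorm x <= B)%R.
Proof.
intros [_ [B HB]]. exists (4 * B)%R. intros x Hx.
destruct (HB x Hx) as (H1 & H2 & H3 & H4). unfold mnorm. lra.
Qed.

Lemma haar_positive (mu : (SL2 -> R) -> R) : is_haar mu -> positive_functional SL2 Cc mu.
Proof.
intros (H1 & H2 & H3 & _). split; auto.
- intros f g Hf Hg. destruct (Cc_bounded f Hf) as [B HB].
  destruct (Cc_bounded g Hg) as [B' HB'].
  apply (Cc_intro _ (Rmax B B')).
  + intros x. apply Rcont_plus; [apply Hf|apply Hg].
  + intros x Hx. destruct (Req_dec (f x) 0) as [E|E].
    * eapply Rle_trans; [apply HB'|apply Rmax_r]. intros E'. apply Hx. lra.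
    * eapply Rle_trans; [apply HB, E|apply Rmax_l].
- intros c f Hf. destruct (Cc_bounded f Hf) as [B HB]. apply (Cc_intro _ B).
  + intros x. apply Rcont_mult; [apply Rcont_const|apply Hf].
  + intros x Hx. apply HB. intros E. apply Hx. rewrite E; ring.
Qed.

(** A continuous majorant of the indicator function of a ball; it dominates
    the families of functions to which Fubini's theorem is applied. *)
Definition cutoff (B : R) (x : SL2) : R := Rmax 0 (B + 1 - mnorm x).

Lemma Rmax_cont (T : UniformSpace) (f : T -> R) x :
  Rcts f x ->
  Rcts (fun t => Rmax 0 (f t)) x.
Proof.
rewrite !continuous_Rle_abs. intros H e He.
eapply filter_imp; [|apply (H e He)]. intros y Hy.
eapply Rle_lt_trans; [|exact Hy].
unfold Rmax; destruct (Rle_dec 0 (f y)), (Rle_dec 0 (f x)); unfold Rabs;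
  repeat destruct Rcase_abs; lra.
Qed.

Lemma cutoff_cont B x : Rcts (cutoff B) x.
Proof. apply Rmax_cont, Rcont_minus; [apply Rcont_const|apply mnorm_cont]. Qed.

Lemma cutoff_pos B x : (0 <= cutoff B x)%R.
Proof. apply Rmax_l. Qed.

Lemma cutoff_ge_1 B x : (mnorm x <= B)%R -> (1 <= cutoff B x)%R.
Proof. intros H. eapply Rle_trans; [|apply Rmax_r]. lra. Qed.

Lemma cutoff_mult_Cc B (f : SL2 -> R) :
  (forall x, Rcts f x) -> Cc (fun x => cutoff B x * f x)%R.
Proof.
intros Hf. apply (Cc_intro _ (B + 1)).
- intros x. apply Rcont_mult; [apply cutoff_cont|apply Hf].
- intros x Hx. apply Rnot_lt_le. intros H. apply Hx.
  unfold cutoff. rewrite Rmax_left by lra. ring.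
Qed.

Lemma pfC_dom_intro (H : SL2 -> C) (B : R) :
  (forall x, Ccts H x) ->
  (forall x, H x <> 0 -> (mnorm x <= B)%R) -> pfC_dom SL2 Cc H.
Proof.
intros Hc Hs. split; apply (Cc_intro _ B).
- intros x. apply (proj1 (Ccont_pair _ _ _) (Hc x)).
- intros x Hx. apply Hs. intros E. apply Hx. rewrite E. reflexivity.
- intros x. apply (proj1 (Ccont_pair _ _ _) (Hc x)).
- intros x Hx. apply Hs. intros E. apply Hx. rewrite E. reflexivity.
Qed.

Lemma haar_int_left mu (Hmu : is_haar mu) g (H : SL2 -> C) : pfC_dom SL2 Cc H ->
  haar_int mu (fun y => H (SL2_mul g y)) = haar_int mu H.
Proof.
intros [H1 H2]. destruct Hmu as (_ & _ & _ & Hl & _).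
unfold haar_int. f_equal.
- apply (Hl g (fun y => Re (H y)) H1).
- apply (Hl g (fun y => Im (H y)) H2).
Qed.

Lemma haar_int_right mu (Hmu : is_haar mu) g (H : SL2 -> C) : pfC_dom SL2 Cc H ->
  haar_int mu (fun y => H (SL2_mul y g)) = haar_int mu H.
Proof.
intros [H1 H2]. destruct Hmu as (_ & _ & _ & _ & Hr & _).
unfold haar_int. f_equal.
- apply (Hr g (fun y => Re (H y)) H1).
- apply (Hr g (fun y => Im (H y)) H2).
Qed.

Lemma haar_int_ext mu (H H' : SL2 -> C) : (forall y, H y = H' y) ->
  haar_int mu H = haar_int mu H'.
Proof. intros E. rewrite (functional_extensionality _ _ E). reflexivity. Qed.

Lemma haar_int_scal mu (Hmu : is_haar mu) c (H : SL2 -> C) : pfC_dom SL2 Cc H ->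
  haar_int mu (fun y => c * H y) = c * haar_int mu H.
Proof. apply (pfC_scal SL2 Cc mu (haar_positive mu Hmu)). Qed.

(** A family of functions on the group to which Fubini's theorem applies: supports
    in a common compact set, equicontinuous in the group variable, Lipschitz in the
    real parameter. *)
Record good_family (B K : R) (V : SL2 -> R -> C) : Prop := {
  gf_supp : forall y t, V y t <> 0 -> (mnorm y <= B)%R;
  gf_lip : forall y t t', (Cmod (V y t - V y t') <= K * Rabs (t - t'))%R;
  gf_cont : forall y e, (0 < e)%R ->
    locally y (fun y' => forall t, (Cmod (V y' t - V y t) <= e)%R)
}.

Section GoodFamily.

Variable mu : (SL2 -> R) -> R.
Hypothesis Hmu : is_haar mu.
Variables (B K : R) (V : SL2 -> R -> C) (e : SL2 -> C).
Hypothesis HV : good_family B K V.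
Hypothesis He : forall y, Ccts e y.

Lemma gf_cont_y t y : Ccts (fun y => V y t) y.
Proof.
apply Ccontinuous_iff. intros eps Heps.
eapply filter_imp; [|apply (gf_cont _ _ _ HV y (eps / 2)%R); lra].
intros y' H. eapply Rle_lt_trans; [apply (H t)|lra].
Qed.

Lemma gf_cont_t y t : RCcontinuous (V y) t.
Proof. apply (lip_RCcontinuous _ K), (gf_lip _ _ _ HV). Qed.

Lemma gf_dom t : pfC_dom SL2 Cc (fun y => V y t * e y).
Proof.
apply (pfC_dom_intro _ B).
- intros y. apply Ccont_mult; [apply gf_cont_y|apply He].
- intros y Hy. apply (gf_supp _ _ _ HV y t). intros E. apply Hy. rewrite E; ring.
Qed.

Lemma gf_int_cont a b y : Ccts (fun y => CInt (V y) a b) y.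
Proof.
apply Ccontinuous_iff. intros eps Heps.
assert (Hab := Rabs_pos (b - a)).
set (eta := (eps / (2 * (Rabs (b - a) + 1)))%R).
assert (Heta : (0 < eta)%R) by (apply Rdiv_lt_0_compat; lra).
eapply filter_imp; [|apply (gf_cont _ _ _ HV y eta Heta)].
intros y' H. rewrite <- CInt_minus by apply gf_cont_t.
rewrite Cmod_norm. eapply Rle_lt_trans.
- eapply (norm_RInt_le_const_abs (V := C_R_NormedModule)).
  2: { apply CInt_correct. intros; apply Ccont_minus; apply gf_cont_t. }
  intros t _. rewrite <- Cmod_norm. apply H.
- replace eps with (eta * (2 * (Rabs (b - a) + 1)))%R by (unfold eta; field; lra).
  nra.
Qed.

Lemma gf_int_zero a b y : ~ (mnorm y <= B)%R -> CInt (V y) a b = 0.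
Proof.
intros Hy. rewrite (CInt_ext _ (fun _ => 0)).
- rewrite CInt_const. ring.
- intros t _. apply NNPP. intros H. apply Hy, (gf_supp _ _ _ HV y t), H.
Qed.

Lemma gf_int_dom a b : pfC_dom SL2 Cc (fun y => CInt (V y) a b * e y).
Proof.
apply (pfC_dom_intro _ B).
- intros y. apply Ccont_mult; [apply gf_int_cont|apply He].
- intros y Hy. apply NNPP. intros H. apply Hy. rewrite gf_int_zero by auto. ring.
Qed.

Lemma gf_lip_weighted y t t' :
  (Cmod (V y t * e y - V y t' * e y) <= cutoff B y * (Rabs K * Cmod (e y)) * Rabs (t - t'))%R.
Proof.
replace (V y t * e y - V y t' * e y) with ((V y t - V y t') * e y) by ring.
rewrite Cmod_mult.
assert (H := gf_lip _ _ _ HV y t t'). assert (Hc := cutoff_pos B y).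
assert (He0 := Cmod_ge_0 (e y)). assert (Ht := Rabs_pos (t - t')).
assert (HK := Rle_abs K). assert (HK' := Rabs_pos K).
assert (HKt : (K * Rabs (t - t') <= Rabs K * Rabs (t - t'))%R)
  by (apply Rmult_le_compat_r; auto).
destruct (Rle_dec (mnorm y) B) as [Hy|Hy].
- assert (H1 := cutoff_ge_1 B y Hy).
  apply Rle_trans with (1 * ((Rabs K * Rabs (t - t')) * Cmod (e y)))%R.
  + rewrite Rmult_1_l. apply Rmult_le_compat_r; lra.
  + replace (cutoff B y * (Rabs K * Cmod (e y)) * Rabs (t - t'))%R
      with (cutoff B y * ((Rabs K * Rabs (t - t')) * Cmod (e y)))%R by ring.
    apply Rmult_le_compat_r; [repeat apply Rmult_le_pos; auto|exact H1].
- assert (Z : forall t, V y t = 0).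
  { intros t0. apply NNPP. intros H0. apply Hy, (gf_supp _ _ _ HV y t0), H0. }
  rewrite !Z. replace (0 - 0) with (RtoC 0) by ring. rewrite Cmod_0, Rmult_0_l.
  repeat apply Rmult_le_pos; auto.
Qed.

Lemma gf_weight_Cc : Cc (fun y => cutoff B y * (Rabs K * Cmod (e y)))%R.
Proof.
apply cutoff_mult_Cc. intros y. apply Rcont_mult; [apply Rcont_const|apply Ccont_mod, He].
Qed.

Lemma gf_int_swap a w y : CInt (fun t => V y t * e y) a w = CInt (V y) a w * e y.
Proof.
rewrite Cmult_comm, <- CInt_scal by (intros; apply gf_cont_t).
apply CInt_ext. intros; ring.
Qed.

Lemma gf_fubini a b : haar_int mu (fun y => CInt (V y) a b * e y)
  = CInt (fun t => haar_int mu (fun y => V y t * e y)) a b.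
Proof.
rewrite (haar_int_ext mu _ (fun y => CInt (fun t => V y t * e y) a b))
  by (intros; symmetry; apply gf_int_swap).
apply (pfC_fubini SL2 Cc mu (haar_positive mu Hmu) (fun y t => V y t * e y)
  (fun y => cutoff B y * (Rabs K * Cmod (e y)))%R gf_weight_Cc gf_dom gf_lip_weighted).
intros w. rewrite (functional_extensionality _ (fun y => CInt (V y) a w * e y))
  by (intros; apply gf_int_swap).
apply gf_int_dom.
Qed.

Lemma gf_int_lip (t t' : R) :
  (Cmod (haar_int mu (fun y => (V y t * e y)%C) - haar_int mu (fun y => (V y t' * e y)%C))
    <= 2 * mu (fun y => cutoff B y * (Rabs K * Cmod (e y)))%R * Rabs (t - t'))%R.
Proof.
assert (HP := haar_positive mu Hmu).
change (Cmod (pfC SL2 mu (fun y => V y t * e y)%C - pfC SL2 mu (fun y => V y t' * e y)%C) <=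
    2 * mu (fun y => cutoff B y * (Rabs K * Cmod (e y)))%R * Rabs (t - t'))%R.
rewrite <- (pfC_minus SL2 Cc mu HP) by apply gf_dom.
rewrite Rmult_assoc, (Rmult_comm (mu _)), <- (pf_scal _ _ _ HP) by apply gf_weight_Cc.
apply (pfC_bound SL2 Cc mu HP).
- apply (pfC_minus_dom SL2 Cc mu HP); apply gf_dom.
- apply (pf_scal_dom _ _ _ HP), gf_weight_Cc.
- intros y. rewrite Rmult_comm. apply gf_lip_weighted.
Qed.

End GoodFamily.

(** ** Averages over [K] and over the centre *)

Definition SL2_opp (x : SL2) : SL2 := SL2_mul (elt_m true) x.

Lemma SL2_opp_entries x : m11 (SL2_opp x) = (- m11 x)%R /\ m12 (SL2_opp x) = (- m12 x)%R /\
  m21 (SL2_opp x) = (- m21 x)%R /\ m22 (SL2_opp x) = (- m22 x)%R.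
Proof. unfold SL2_opp; simpl. repeat split; ring. Qed.

Lemma mnorm_opp x : mnorm (SL2_opp x) = mnorm x.
Proof.
destruct (SL2_opp_entries x) as (H1 & H2 & H3 & H4).
unfold mnorm. rewrite H1, H2, H3, H4, !Rabs_Ropp. reflexivity.
Qed.

Lemma mdist_opp x y : mdist (SL2_opp x) (SL2_opp y) = mdist x y.
Proof.
destruct (SL2_opp_entries x) as (H1 & H2 & H3 & H4).
destruct (SL2_opp_entries y) as (G1 & G2 & G3 & G4).
unfold mdist. rewrite H1, H2, H3, H4, G1, G2, G3, G4.
assert (E : forall a b, Rabs (- a - - b) = Rabs (a - b)).
{ intros. replace (- a - - b)%R with (- (a - b))%R by ring. apply Rabs_Ropp. }
rewrite !E. reflexivity.
Qed.

Lemma SL2_opp_involutive x : SL2_opp (SL2_opp x) = x.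
Proof. unfold SL2_opp. apply SL2_eq; simpl; ring. Qed.

Lemma SL2_opp_mul_l x y : SL2_mul (SL2_opp x) y = SL2_opp (SL2_mul x y).
Proof. unfold SL2_opp. apply SL2_mul_assoc. Qed.

Lemma SL2_opp_mul_r x y : SL2_mul x (SL2_opp y) = SL2_opp (SL2_mul x y).
Proof. unfold SL2_opp. apply SL2_eq; simpl; ring. Qed.

(** The projection onto the functions on which the centre acts by [delta]. *)
Definition central_part (delta : Mhat) (F : SL2 -> C) (x : SL2) : C :=
  / 2 * (F x + M_char delta true * F (SL2_opp x)).

Lemma Cmod_M_char delta e : Cmod (M_char delta e) = 1%R.
Proof. destruct delta, e; simpl; rewrite ?Cmod_m1, ?Cmod_1; reflexivity. Qed.

Lemma Cmod_half (z : C) : Cmod (/ 2 * z) = (/ 2 * Cmod z)%R.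
Proof.
rewrite Cmod_mult, Cmod_inv, Cmod_R, Rabs_pos_eq by (try lra; apply RtoC_neq; lra).
reflexivity.
Qed.

Lemma central_part_lip_cs delta L B F : lip_cs L B F -> lip_cs L B (central_part delta F).
Proof.
intros (HL & HB & Hlip & Hs). split; [|split; [|split]]; auto.
- intros x y. unfold central_part.
  replace (/ 2 * (F x + M_char delta true * F (SL2_opp x)) -
    / 2 * (F y + M_char delta true * F (SL2_opp y)))
    with (/ 2 * ((F x - F y) + M_char delta true * (F (SL2_opp x) - F (SL2_opp y)))) by ring.
  rewrite Cmod_half.
  assert (H := Cmod_triangle (F x - F y) (M_char delta true * (F (SL2_opp x) - F (SL2_opp y)))).
  rewrite Cmod_mult, Cmod_M_char in H.
  assert (H1 := Hlip x y). assert (H2 := Hlip (SL2_opp x) (SL2_opp y)).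
  rewrite mdist_opp in H2. lra.
- intros x Hx. destruct (classic (F x = 0)) as [E|E]; [|auto].
  rewrite <- mnorm_opp. apply Hs. intros E'. apply Hx. unfold central_part.
  rewrite E, E'. ring.
Qed.

Lemma central_part_opp delta F x :
  central_part delta F (SL2_opp x) = M_char delta true * central_part delta F x.
Proof.
unfold central_part. rewrite SL2_opp_involutive.
destruct delta; simpl; ring.
Qed.

Definition conj_k (t : R) (x : SL2) : SL2 := SL2_mul (SL2_mul (elt_k (- t)) x) (elt_k t).

Definition k_average (G : SL2 -> C) (x : SL2) : C :=
  / (2 * PI) * CInt (fun t => G (conj_k t x)) 0 (2 * PI).

Lemma mdist_conj_k t x y : (mdist (conj_k t x) (conj_k t y) <= 16 * mdist x y)%R.
Proof.
unfold conj_k. eapply Rle_trans; [apply mdist_mul_r|].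
assert (H := mdist_mul_l (elt_k (- t)) x y).
assert (H1 := mnorm_k t). assert (H2 := mnorm_k (- t)).
assert (P1 := mnorm_pos (elt_k t)). assert (P3 := mdist_pos x y).
assert (P4 := mdist_pos (SL2_mul (elt_k (- t)) x) (SL2_mul (elt_k (- t)) y)).
assert (mdist (SL2_mul (elt_k (- t)) x) (SL2_mul (elt_k (- t)) y) <= 4 * mdist x y)%R by nra.
nra.
Qed.

Lemma mdist_k_lip a b : (mdist (elt_k a) (elt_k b) <= 8 * Rabs (a - b))%R.
Proof. assert (H := mdist_k a b). assert (H1 := cis_lip a b). lra. Qed.

Lemma mdist_conj_k_angle t t' x :
  (mdist (conj_k t x) (conj_k t' x) <= 64 * mnorm x * Rabs (t - t'))%R.
Proof.
unfold conj_k.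
eapply Rle_trans;
  [apply (mdist_tri _ (SL2_mul (SL2_mul (elt_k (- t')) x) (elt_k t)))|].
assert (H1 := mdist_mul_r (elt_k t) (SL2_mul (elt_k (- t)) x) (SL2_mul (elt_k (- t')) x)).
assert (H2 := mdist_mul_r x (elt_k (- t)) (elt_k (- t'))).
assert (H3 := mdist_mul_l (SL2_mul (elt_k (- t')) x) (elt_k t) (elt_k t')).
assert (H4 := mnorm_mul (elt_k (- t')) x).
assert (K1 := mnorm_k t). assert (K2 := mnorm_k (- t')).
assert (L1 := mdist_k_lip (- t) (- t')). assert (L2 := mdist_k_lip t t').
replace (- t - - t')%R with (- (t - t'))%R in L1 by ring. rewrite Rabs_Ropp in L1.
assert (P1 := mnorm_pos (elt_k t)). assert (P2 := mnorm_pos (elt_k (- t'))).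
assert (P3 := mnorm_pos x). assert (P4 := Rabs_pos (t - t')).
assert (P5 := mdist_pos (elt_k t) (elt_k t')).
assert (P6 := mdist_pos (elt_k (- t)) (elt_k (- t'))).
assert (P7 := mnorm_pos (SL2_mul (elt_k (- t')) x)).
assert (P8 := mdist_pos (SL2_mul (elt_k (- t)) x) (SL2_mul (elt_k (- t')) x)).
set (r := Rabs (t - t')) in *. set (n := mnorm x) in *.
assert (A1 : (mdist (SL2_mul (elt_k (- t)) x) (SL2_mul (elt_k (- t')) x) <= 8 * r * n)%R)
  by (eapply Rle_trans; [exact H2|apply Rmult_le_compat_r; auto]).
assert (A2 : (mnorm (SL2_mul (elt_k (- t')) x) <= 4 * n)%R)
  by (eapply Rle_trans; [exact H4|apply Rmult_le_compat_r; auto]).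
assert (A3 : (mdist (SL2_mul (SL2_mul (elt_k (- t)) x) (elt_k t))
  (SL2_mul (SL2_mul (elt_k (- t')) x) (elt_k t)) <= (8 * r * n) * 4)%R)
  by (eapply Rle_trans; [exact H1|apply Rmult_le_compat; auto]).
assert (A4 : (mdist (SL2_mul (SL2_mul (elt_k (- t')) x) (elt_k t))
  (SL2_mul (SL2_mul (elt_k (- t')) x) (elt_k t')) <= (4 * n) * (8 * r))%R)
  by (eapply Rle_trans; [exact H3|apply Rmult_le_compat; auto]).
lra.
Qed.

Lemma conj_family L B G : lip_cs L B G ->
  good_family (16 * B) (L * (64 * (16 * B))) (fun y t => G (conj_k t y)).
Proof.
intros (HL & HB & Hlip & Hs). split.
- intros y t Hy. apply Hs in Hy.
  assert (H := mnorm_conj_k_rev t y). unfold conj_k in Hy. lra.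
- intros y t t'.
  assert (Ht := Rabs_pos (t - t')).
  destruct (Rle_dec (mnorm y) (16 * B)) as [Hy|Hy].
  + eapply Rle_trans; [apply Hlip|]. rewrite Rmult_assoc.
    apply Rmult_le_compat_l; auto.
    eapply Rle_trans; [apply mdist_conj_k_angle|].
    apply Rmult_le_compat_r; lra.
  + assert (Z : forall t, G (conj_k t y) = 0).
    { intros t0. apply NNPP. intros H. apply Hs in H.
      assert (H' := mnorm_conj_k_rev t0 y). unfold conj_k in H. lra. }
    rewrite !Z. replace (0 - 0) with (RtoC 0) by ring. rewrite Cmod_0.
    repeat apply Rmult_le_pos; lra.
- intros y e He. apply locally_SL2.
  exists (e / (L * 16 + 1))%R. split; [apply Rdiv_lt_0_compat; lra|].
  intros y' Hy' t. eapply Rle_trans; [apply Hlip|].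
  assert (H := mdist_conj_k t y' y). rewrite mdist_sym in Hy'.
  assert (Hp := mdist_pos y' y).
  clear_denominator Hy' (L * 16 + 1)%R.
  assert (L * mdist (conj_k t y') (conj_k t y) <= L * (16 * mdist y' y))%R
    by (apply Rmult_le_compat_l; auto). lra.
Qed.

Lemma k_average_lip_cs L B G : lip_cs L B G -> lip_cs (16 * L) (16 * B) (k_average G).
Proof.
intros HG. assert (HF := conj_family L B G HG).
destruct HG as (HL & HB & Hlip & Hs).
assert (HPI := PI_RGT_0).
split; [lra|]. split; [lra|]. split.
- intros x y. unfold k_average.
  replace (/ (2 * PI) * CInt (fun t => G (conj_k t x)) 0 (2 * PI) -
    / (2 * PI) * CInt (fun t => G (conj_k t y)) 0 (2 * PI))
    with (/ (2 * PI) * CInt (fun t => G (conj_k t x) - G (conj_k t y)) 0 (2 * PI)).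
  2: { rewrite CInt_minus; [ring| |]; intros; apply (gf_cont_t _ _ _ HF). }
  rewrite Cmod_mult, Cmod_2PI.
  apply Rmult_le_reg_l with (2 * PI)%R; [lra|].
  rewrite <- Rmult_assoc, Rinv_r, Rmult_1_l by lra.
  replace (2 * PI)%R with (2 * PI - 0)%R at 2 by ring.
  apply CInt_bound_const; [lra| |].
  + intros z. apply Ccont_minus; apply (gf_cont_t _ _ _ HF).
  + intros t _. eapply Rle_trans; [apply Hlip|].
    assert (H := mdist_conj_k t x y). nra.
- intros x Hx. apply NNPP. intros H. apply Hx. unfold k_average.
  rewrite (gf_int_zero _ _ _ HF) by auto. ring.
Qed.

Lemma k_average_conj L B G t x : lip_cs L B G ->
  k_average G (conj_k t x) = k_average G x.
Proof.
intros HG. assert (HF := conj_family L B G HG). unfold k_average. f_equal.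
rewrite <- (CInt_period_shift (fun th => G (conj_k th x)) t (2 * PI)).
- apply CInt_ext. intros th _. f_equal. unfold conj_k.
  replace (- (th + t))%R with (- th + - t)%R by ring.
  rewrite (Rplus_comm th t), <- !elt_k_plus, !SL2_mul_assoc. reflexivity.
- intros z. apply (gf_cont_t _ _ _ HF).
- intros z. f_equal. unfold conj_k. rewrite elt_k_period.
  assert (E : elt_k (- (z + 2 * PI)) = elt_k (- z)).
  { rewrite <- (elt_k_period (- (z + 2 * PI))). f_equal. ring. }
  rewrite E. reflexivity.
Qed.

Lemma k_average_opp delta L B G x : lip_cs L B G ->
  (forall x, G (SL2_opp x) = M_char delta true * G x) ->
  k_average G (SL2_opp x) = M_char delta true * k_average G x.
Proof.
intros HG HM. assert (HF := conj_family L B G HG). unfold k_average.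
rewrite (CInt_ext _ (fun t => M_char delta true * G (conj_k t x))).
- rewrite CInt_scal by (intros; apply (gf_cont_t _ _ _ HF)). ring.
- intros t _. unfold conj_k. rewrite SL2_opp_mul_r, SL2_opp_mul_l. apply HM.
Qed.

(** ** Iwasawa coordinates *)

Lemma pm_det (u t : R) : (exp t * exp (- t) - u * exp (- t) * 0 = 1)%R.
Proof. rewrite <- exp_plus, Rplus_opp_r, exp_0. ring. Qed.

(** The product of a unipotent and a diagonal matrix, with entries [u] and
    [exp t]. *)
Definition pm (u t : R) : SL2 := mkSL2 _ _ _ _ (pm_det u t).

Definition tau_of (y : SL2) : R := (- ln (row_sq y) / 2)%R.
Definition u_of (y : SL2) : R := ((m11 y * m21 y + m12 y * m22 y) / row_sq y)%R.
Definition an_part (y : SL2) : SL2 := pm (u_of y) (tau_of y).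

Lemma exp_tau_sq y : (exp (tau_of y) * exp (tau_of y) = / row_sq y)%R.
Proof.
unfold tau_of. rewrite <- exp_plus.
replace (- ln (row_sq y) / 2 + - ln (row_sq y) / 2)%R with (- ln (row_sq y))%R by field.
rewrite exp_Ropp, exp_ln; [reflexivity|apply row_sq_pos].
Qed.

Lemma angle_exists (a b : R) : (a * a + b * b = 1)%R -> exists t, a = cos t /\ b = sin t.
Proof.
intros H.
assert (Ha : (-1 <= a <= 1)%R) by (split; nra).
assert (Hs : (sqrt (1 - a * a) * sqrt (1 - a * a) = b * b)%R)
  by (rewrite sqrt_sqrt; nra).
assert (Hp := sqrt_pos (1 - a * a)).
destruct (Rle_dec 0 b) as [Hb|Hb].
- exists (acos a). rewrite cos_acos by lra. split; [reflexivity|].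
  rewrite sin_acos by lra. unfold Rsqr. nra.
- exists (- acos a)%R. rewrite cos_neg, sin_neg, cos_acos by lra. split; [reflexivity|].
  rewrite sin_acos by lra. unfold Rsqr. nra.
Qed.

Lemma iwasawa (y : SL2) : exists ph, y = SL2_mul (an_part y) (elt_k ph).
Proof.
assert (Hr := row_sq_pos y). assert (Ee := exp_tau_sq y).
set (x := exp (tau_of y)) in *.
assert (Hx : (0 < x)%R) by apply exp_pos.
assert (Ei : exp (- tau_of y) = (/ x)%R) by apply exp_Ropp.
destruct (angle_exists (m22 y * x) (- m21 y * x)) as (ph & H1 & H2).
{ transitivity (row_sq y * (x * x))%R; [unfold row_sq; ring|].
  rewrite Ee. field. lra. }
exists ph. apply SL2_eq; simpl; rewrite <- H1, <- H2, ?Ei; fold x.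
- transitivity ((m11 y * m22 y - m12 y * m21 y) * m22 y * (x * x) +
    (m11 y * m21 y + m12 y * m22 y) * m21 y * / row_sq y)%R.
  + rewrite Ee. unfold row_sq. field. unfold row_sq in Hr. lra.
  + rewrite SL2_det. unfold u_of. field. lra.
- transitivity (- (m11 y * m22 y - m12 y * m21 y) * m21 y * (x * x) +
    (m11 y * m21 y + m12 y * m22 y) * m22 y * / row_sq y)%R.
  + rewrite Ee. unfold row_sq. field. unfold row_sq in Hr. lra.
  + rewrite SL2_det. unfold u_of. field. lra.
- field. lra.
- field. lra.
Qed.

Lemma row_sq_cont y : Rcts row_sq y.
Proof. apply Rcont_plus; apply Rcont_sq; [apply m21_cont|apply m22_cont]. Qed.

Lemma tau_of_cont y : Rcts tau_of y.
Proof.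
assert (E : tau_of = fun y => ((- / 2) * ln (row_sq y))%R)
  by (apply functional_extensionality; intros z; unfold tau_of; field).
rewrite E.
apply Rcont_mult; [apply Rcont_const|].
apply (Rcont_comp _ row_sq ln); [apply row_sq_cont|].
apply continuity_pt_filterlim.
apply (ex_derive_continuous (V := R_NormedModule)).
exists (/ row_sq y)%R. apply is_derive_Reals, derivable_pt_lim_ln, row_sq_pos.
Qed.

Lemma Rcont_inv (T : UniformSpace) (f : T -> R) x : f x <> 0%R ->
  Rcts f x -> Rcts (fun t => / f t)%R x.
Proof.
intros H0 H. apply (Rcont_comp _ f Rinv); auto.
apply continuity_pt_filterlim. apply continuous_Rinv; auto.
Qed.

Lemma u_of_cont y : Rcts u_of y.
Proof.
unfold u_of. apply Rcont_mult.
- apply Rcont_plus; apply Rcont_mult; auto using m11_cont, m12_cont, m21_cont, m22_cont.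
- apply Rcont_inv; [apply Rgt_not_eq, row_sq_pos|apply row_sq_cont].
Qed.

Lemma SL2_pair_cont (T : UniformSpace) (f : T -> SL2) (x : T) :
  Rcts (fun t => m11 (f t)) x ->
  Rcts (fun t => m12 (f t)) x ->
  Rcts (fun t => m21 (f t)) x ->
  Rcts (fun t => m22 (f t)) x -> continuous f x.
Proof.
rewrite !continuous_Rle_abs. intros H1 H2 H3 H4 P HP.
apply locally_SL2 in HP. destruct HP as (d & Hd & HP).
assert (Hd4 : (0 < d / 4)%R) by lra.
specialize (H1 _ Hd4). specialize (H2 _ Hd4). specialize (H3 _ Hd4). specialize (H4 _ Hd4).
assert (H := filter_and _ _ (filter_and _ _ H1 H2) (filter_and _ _ H3 H4)).
refine (filter_imp _ _ _ H). intros y [[K1 K2] [K3 K4]].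
apply HP. rewrite mdist_sym. unfold mdist. lra.
Qed.

Lemma exp_cont (T : UniformSpace) (f : T -> R) x :
  Rcts f x ->
  Rcts (fun t => exp (f t)) x.
Proof.
intros H. apply (Rcont_comp _ f exp); auto.
apply derivable_continuous_pt, derivable_pt_exp.
Qed.

Lemma Rcont_opp (T : UniformSpace) (f : T -> R) x :
  Rcts f x ->
  Rcts (fun t => - f t)%R x.
Proof. apply (continuous_opp (V := R_NormedModule) f). Qed.

Lemma pm_cont (T : UniformSpace) (f g : T -> R) x :
  Rcts f x -> Rcts g x ->
  continuous (fun t => pm (f t) (g t)) x.
Proof.
intros Hf Hg. apply SL2_pair_cont; simpl.
- apply exp_cont, Hg.
- apply Rcont_mult; [exact Hf|apply exp_cont, Rcont_opp, Hg].
- apply Rcont_const.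
- apply exp_cont, Rcont_opp, Hg.
Qed.

Lemma an_part_cont y : continuous an_part y.
Proof. apply pm_cont; [apply u_of_cont|apply tau_of_cont]. Qed.

Lemma psvec_pm s p q u t : psvec s p q (pm u t) = Cexp ((1 + s) * t).
Proof.
unfold psvec.
assert (E : row_sq (pm u t) = exp (- t + - t))
  by (unfold row_sq; simpl; rewrite exp_plus; ring).
rewrite E, ln_exp. simpl m22. simpl m21.
replace (RtoC (exp (- t)) - Ci * RtoC 0) with (RtoC (exp (- t))) by ring.
replace (RtoC (exp (- t)) + Ci * RtoC 0) with (RtoC (exp (- t))) by ring.
rewrite <- !RtoC_pow, <- !exp_nat_mul, <- !Cexp_RtoC, <- !Cexp_plus. f_equal.
rewrite RtoC_plus, !RtoC_mult, RtoC_opp. field.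
Qed.

(** The common restriction of the basis vectors to the group [A N]. *)
Definition an_power (s : C) (y : SL2) : C := Cexp ((1 + s) * tau_of y).

Lemma an_power_cont s y : Ccts (an_power s) y.
Proof.
apply Ccont_Cexp, Ccont_mult; [apply Ccont_const|apply Ccont_RtoC, tau_of_cont].
Qed.

Lemma smooth_cont f : smooth f -> forall x, Ccts f x.
Proof.
intros Hf x. apply Ccontinuous_iff. intros e He. apply locally_SL2.
destruct (smooth_locally_lipschitz f Hf x) as (r & L & Hr & HL & H).
exists (Rmin r (e / (L + 1))).
split; [apply Rmin_glb_lt; auto; apply Rdiv_lt_0_compat; lra|].
intros y Hy. assert (H1 := Rlt_le_trans _ _ _ Hy (Rmin_l _ _)).
assert (H2 := Rlt_le_trans _ _ _ Hy (Rmin_r _ _)).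
assert (K := H y x H1 ltac:(rewrite mdist_refl; auto)). rewrite mdist_sym in K.
eapply Rle_lt_trans; [exact K|].
clear_denominator H2 (L + 1)%R.
assert (Hp := mdist_pos x y). nra.
Qed.

Lemma mdist_norms x y : (mdist x y <= mnorm x + mnorm y)%R.
Proof.
assert (Q : forall a b, (Rabs (a - b) <= Rabs a + Rabs b)%R).
{ intros a b. unfold Rminus. eapply Rle_trans; [apply Rabs_triang|].
  rewrite Rabs_Ropp; lra. }
unfold mdist, mnorm.
generalize (Q (m11 x) (m11 y)) (Q (m12 x) (m12 y)) (Q (m21 x) (m21 y)) (Q (m22 x) (m22 y)).
lra.
Qed.

Lemma lip_cs_bound L B F : lip_cs L B F -> exists M, (0 <= M)%R /\ forall x, (Cmod (F x) <= M)%R.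
Proof.
intros (HL & HB & Hlip & Hs).
exists (Cmod (F SL2_one) + L * (B + mnorm SL2_one))%R.
assert (H0 := Cmod_ge_0 (F SL2_one)). assert (H1 := mnorm_pos SL2_one).
assert (HLB : (0 <= L * (B + mnorm SL2_one))%R) by (apply Rmult_le_pos; lra).
split; [lra|]. intros x. destruct (classic (F x = 0)) as [E|E].
- rewrite E, Cmod_0. lra.
- specialize (Hs x E). assert (K := Hlip x SL2_one).
  assert (K' := Cmod_triangle_rev (F x) (F SL2_one)).
  assert (K2 := mdist_norms x SL2_one).
  assert (L * mdist x SL2_one <= L * (B + mnorm SL2_one))%R
    by (apply Rmult_le_compat_l; lra). lra.
Qed.

Lemma gf_cis B K M z V : good_family B K V -> (forall y t, (Cmod (V y t) <= M)%R) ->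
  good_family B (M * (2 * Rabs z) + K) (fun y t => V y t * cis (z * t)).
Proof.
intros HV HM. split.
- intros y t H. apply (gf_supp _ _ _ HV y t). intros E. apply H. rewrite E; ring.
- intros y t t'. eapply Rle_trans; [apply Cmod_mult_diff|].
  rewrite Cmod_cis.
  assert (H1 := gf_lip _ _ _ HV y t t'). assert (H2 := cis_lip (z * t) (z * t')).
  replace (z * t - z * t')%R with (z * (t - t'))%R in H2 by ring.
  rewrite Rabs_mult in H2. assert (H3 := HM y t). assert (H4 := Cmod_ge_0 (V y t)).
  assert (Cmod (V y t) * Cmod (cis (z * t) - cis (z * t')) <=
    M * (2 * (Rabs z * Rabs (t - t'))))%R
    by (apply Rmult_le_compat; auto; apply Cmod_ge_0). lra.
- intros y e He. eapply filter_imp; [|apply (gf_cont _ _ _ HV y e He)].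
  intros y' H t.
  replace (V y' t * cis (z * t) - V y t * cis (z * t))
    with ((V y' t - V y t) * cis (z * t)) by ring.
  rewrite Cmod_mult, Cmod_cis, Rmult_1_r. apply H.
Qed.

(** ** From the sum over the basis to a value on [A N] *)

Section Trace.

Variable mu : (SL2 -> R) -> R.
Hypothesis Hmu : is_haar mu.
Variables (delta : Mhat) (s : C).
Variables (L B : R) (G : SL2 -> C).
Hypothesis HG : lip_cs L B G.
Hypothesis HGm : forall x, G (SL2_opp x) = M_char delta true * G x.

Lemma mnorm_an y ph : (mnorm y <= 4 * mnorm (SL2_mul (an_part y) (elt_k ph)))%R.
Proof.
destruct (iwasawa y) as [th Hth].
assert (E : y = SL2_mul (SL2_mul (an_part y) (elt_k ph)) (elt_k (th - ph))).
{ rewrite SL2_mul_assoc, elt_k_plus. replace (ph + (th - ph))%R with th by ring. exact Hth. }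
rewrite E at 1. eapply Rle_trans; [apply mnorm_mul|]. rewrite Rmult_comm.
apply Rmult_le_compat_r; [apply mnorm_pos|apply mnorm_k].
Qed.

Lemma mnorm_an_rev y : (mnorm (an_part y) <= 4 * mnorm y)%R.
Proof.
destruct (iwasawa y) as [th Hth].
assert (E : an_part y = SL2_mul y (elt_k (- th))).
{ rewrite Hth at 2. rewrite SL2_mul_assoc, elt_k_plus, Rplus_opp_r, elt_k_0, SL2_mul_1_r.
  reflexivity. }
rewrite E. eapply Rle_trans; [apply mnorm_mul|]. rewrite Rmult_comm.
apply Rmult_le_compat_r; [apply mnorm_pos|apply mnorm_k].
Qed.

(** The function [G] along the [K]-orbit of the [A N]-part of [y]; the
    exponential factor makes the period [PI] instead of [2 PI]. *)
Definition slice (y : SL2) (x : R) : C :=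
  cis (INR (parity delta) * x) * G (SL2_mul (an_part y) (elt_k x)).

Lemma slice_supp y x : slice y x <> 0 -> (mnorm y <= 4 * B)%R.
Proof.
intros H. destruct HG as (_ & _ & _ & Hs).
assert (H' : G (SL2_mul (an_part y) (elt_k x)) <> 0).
{ intros E. apply H. unfold slice. rewrite E; ring. }
apply Hs in H'. assert (K := mnorm_an y x). lra.
Qed.

Lemma slice_lip : exists K, (0 <= K)%R /\
  forall y a b, (Cmod (slice y a - slice y b) <= K * Cmod (cis a - cis b))%R.
Proof.
destruct (lip_cs_bound _ _ _ HG) as (M & HM0 & HM).
destruct HG as (HL & HB & Hlip & Hs).
exists (L * (16 * B * 4) + M)%R.
assert (H16 : (0 <= L * (16 * B * 4))%R) by (apply Rmult_le_pos; lra).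
split.
{ apply Rplus_le_le_0_compat; [|exact HM0]. repeat apply Rmult_le_pos; lra. }
intros y a b. assert (Hab := Cmod_ge_0 (cis a - cis b)).
destruct (Rle_dec (mnorm y) (4 * B)) as [Hy|Hy].
- unfold slice.
  rewrite (Cmult_comm (cis (INR (parity delta) * a))).
  rewrite (Cmult_comm (cis (INR (parity delta) * b))).
  eapply Rle_trans; [apply Cmod_mult_diff|]. rewrite Cmod_cis.
  assert (H1 : (Cmod (cis (INR (parity delta) * a) - cis (INR (parity delta) * b)) <=
    Cmod (cis a - cis b))%R).
  { destruct delta; simpl.
    - rewrite !Rmult_0_l. replace (cis 0 - cis 0) with (RtoC 0) by ring.
      rewrite Cmod_0. auto.
    - rewrite !Rmult_1_l. lra. }
  assert (H2 : (Cmod (G (SL2_mul (an_part y) (elt_k a)) - G (SL2_mul (an_part y) (elt_k b)))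
    <= L * (16 * B * 4) * Cmod (cis a - cis b))%R).
  { eapply Rle_trans; [apply Hlip|]. rewrite (Rmult_assoc L). apply Rmult_le_compat_l; auto.
    eapply Rle_trans; [apply mdist_mul_l|].
    assert (N := mnorm_an_rev y). assert (K := mdist_k a b).
    assert (P := mnorm_pos (an_part y)). assert (P' := mdist_pos (elt_k a) (elt_k b)).
    replace (16 * B * 4 * Cmod (cis a - cis b))%R
      with (16 * B * (4 * Cmod (cis a - cis b)))%R by ring.
    apply Rmult_le_compat; auto. lra. }
  assert (H3 := HM (SL2_mul (an_part y) (elt_k a))).
  assert (Cmod (G (SL2_mul (an_part y) (elt_k a))) *
    Cmod (cis (INR (parity delta) * a) - cis (INR (parity delta) * b)) <=
    M * Cmod (cis a - cis b))%R by (apply Rmult_le_compat; auto; apply Cmod_ge_0).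
  lra.
- assert (Z : forall x, slice y x = 0).
  { intros x. apply NNPP. intros H. apply Hy, (slice_supp y x), H. }
  rewrite !Z. replace (0 - 0) with (RtoC 0) by ring. rewrite Cmod_0.
  apply Rmult_le_pos; auto. lra.
Qed.

Lemma slice_per y x : slice y (x + PI) = slice y x.
Proof.
unfold slice. rewrite Rmult_plus_distr_l, cis_plus, cis_parity.
rewrite <- elt_k_plus, elt_k_PI.
assert (E : SL2_mul (an_part y) (SL2_mul (elt_k x) (elt_m true)) =
  SL2_opp (SL2_mul (an_part y) (elt_k x))) by (apply SL2_eq; simpl; ring).
rewrite E, HGm.
transitivity (M_char delta true * M_char delta true *
  (cis (INR (parity delta) * x) * G (SL2_mul (an_part y) (elt_k x)))); [ring|].
rewrite M_char_sq. ring.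
Qed.

Lemma slice_family : exists K, good_family (4 * B) K slice.
Proof.
destruct slice_lip as (K & HK & Hl). exists (K * 2)%R. split.
- apply slice_supp.
- intros y t t'. eapply Rle_trans; [apply Hl|].
  assert (H := cis_lip t t'). rewrite Rmult_assoc. apply Rmult_le_compat_l; auto.
- destruct HG as (HL & HB & Hlip & Hs). intros y e He.
  assert (Hd : (0 < e / (4 * L + 1))%R) by (apply Rdiv_lt_0_compat; lra).
  assert (HC := an_part_cont y).
  assert (HL' : locally y (fun y' => (mdist (an_part y) (an_part y') < e / (4 * L + 1))%R)).
  { apply (HC (fun z => (mdist (an_part y) z < e / (4 * L + 1))%R)).
    apply locally_SL2. exists (e / (4 * L + 1))%R. split; auto. }
  eapply filter_imp; [|exact HL']. intros y' Hy' t. cbv beta in Hy'.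
  unfold slice.
  replace (cis (INR (parity delta) * t) * G (SL2_mul (an_part y') (elt_k t)) -
    cis (INR (parity delta) * t) * G (SL2_mul (an_part y) (elt_k t)))
    with (cis (INR (parity delta) * t) * (G (SL2_mul (an_part y') (elt_k t)) -
     G (SL2_mul (an_part y) (elt_k t)))) by ring.
  rewrite Cmod_mult, Cmod_cis, Rmult_1_l.
  eapply Rle_trans; [apply Hlip|].
  assert (K1 := mdist_mul_r (elt_k t) (an_part y') (an_part y)).
  assert (K2 := mnorm_k t). rewrite mdist_sym in Hy'.
  assert (K3 := mdist_pos (an_part y') (an_part y)). assert (K4 := mnorm_pos (elt_k t)).
  clear_denominator Hy' (4 * L + 1)%R.
  apply Rle_trans with (L * (mdist (an_part y') (an_part y) * 4))%R; [|lra].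
  apply Rmult_le_compat_l; auto. eapply Rle_trans; [exact K1|].
  apply Rmult_le_compat_l; auto.
Qed.

Lemma slice_bound : exists M, forall y x, (Cmod (slice y x) <= M)%R.
Proof.
destruct (lip_cs_bound _ _ _ HG) as (M & HM0 & HM). exists M. intros y x.
unfold slice. rewrite Cmod_mult, Cmod_cis, Rmult_1_l. apply HM.
Qed.

Definition trace_density (x : R) : C := haar_int mu (fun y => slice y x * an_power s y).

Lemma trace_density_cont x : RCcontinuous trace_density x.
Proof.
destruct slice_family as [K HF].
apply (lip_RCcontinuous _ (2 * mu (fun y => cutoff (4 * B) y * (Rabs K * Cmod (an_power s y)))%R)).
intros t t'. apply (gf_int_lip mu Hmu (4 * B) K slice (an_power s) HF (an_power_cont s)).
Qed.

(** This modulus of continuity is what Fourier inversion at [0] asks for. *)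
Lemma trace_density_sin : exists K, (0 <= K)%R /\
  forall x, (Cmod (trace_density x - trace_density 0) <= K * Rabs (sin x))%R.
Proof.
destruct slice_family as [K0 HF]. destruct slice_lip as (K & HK & Hl).
assert (HP := haar_positive mu Hmu).
set (w := (fun y => cutoff (4 * B) y * (2 * K * Cmod (an_power s y)))%R).
assert (Hw : Cc w).
{ apply cutoff_mult_Cc. intros y. apply Rcont_mult; [apply Rcont_const|].
  apply Ccont_mod, an_power_cont. }
assert (Hw0 : (0 <= mu w)%R).
{ apply (pf_pos _ _ _ HP); auto. intros y. unfold w.
  apply Rmult_le_pos; [apply cutoff_pos|].
  apply Rmult_le_pos; [lra|apply Cmod_ge_0]. }
exists (2 * mu w)%R. split; [lra|]. intros x.
assert (D := gf_dom (4 * B) K0 slice (an_power s) HF (an_power_cont s)).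
change (Cmod (pfC SL2 mu (fun y => (slice y x * an_power s y)%C) -
  pfC SL2 mu (fun y => (slice y 0 * an_power s y)%C)) <= 2 * mu w * Rabs (sin x))%R.
rewrite <- (pfC_minus SL2 Cc mu HP) by apply D.
rewrite Rmult_assoc, (Rmult_comm (mu _)), <- (pf_scal _ _ _ HP) by apply Hw.
apply (pfC_bound SL2 Cc mu HP).
- apply (pfC_minus_dom SL2 Cc mu HP); apply D.
- apply (pf_scal_dom _ _ _ HP), Hw.
- intros y. unfold w.
  replace (slice y x * an_power s y - slice y 0 * an_power s y)
    with ((slice y x - slice y 0) * an_power s y) by ring.
  rewrite Cmod_mult.
  assert (Hh := Cmod_ge_0 (an_power s y)). assert (Hs0 := Rabs_pos (sin x)).
  assert (Hc := cutoff_pos (4 * B) y).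
  destruct (Rle_dec (mnorm y) (4 * B)) as [Hy|Hy].
  + assert (H1 := cutoff_ge_1 _ _ Hy).
    assert (H2 := pi_periodic_lip (slice y) K HK (Hl y) (slice_per y) 0 x).
    rewrite Rplus_0_l in H2.
    apply Rle_trans with (1 * (2 * K * Rabs (sin x) * Cmod (an_power s y)))%R.
    * rewrite Rmult_1_l. apply Rmult_le_compat_r; auto.
    * replace (Rabs (sin x) * (cutoff (4 * B) y * (2 * K * Cmod (an_power s y))))%R
        with (cutoff (4 * B) y * (2 * K * Rabs (sin x) * Cmod (an_power s y)))%R by ring.
      apply Rmult_le_compat_r; auto. repeat apply Rmult_le_pos; auto; lra.
  + assert (Z : forall x, slice y x = 0).
    { intros x0. apply NNPP. intros H. apply Hy, (slice_supp y x0), H. }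
    rewrite !Z. replace (0 - 0) with (RtoC 0) by ring. rewrite Cmod_0, Rmult_0_l.
    repeat apply Rmult_le_pos; auto; lra.
Qed.

Lemma trace_density_0 :
  trace_density 0 = haar_int mu (fun y => G (an_part y) * an_power s y).
Proof.
apply haar_int_ext. intros y. unfold slice.
rewrite Rmult_0_r, cis_0, elt_k_0, SL2_mul_1_r. ring.
Qed.

(** Diagonal matrix coefficients are Fourier coefficients of the density: the
    integral over the group is averaged over right translations by [K], which only
    leaves the [A N]-part of the variable. *)
Lemma diagonal_coefficient (j : nat) :
  haar_int mu (fun y => G y * basis delta s j y) =
  fcoef trace_density (fst (enum_pair j)) (snd (enum_pair j)).
Proof.
assert (HPI := PI_RGT_0).
assert (Ce : forall y, Ccts (basis delta s j) y)
  by (apply smooth_cont, (proj1 (basis_principal delta s j))).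
assert (HG' := HG). destruct HG' as (HL & HB & Hlip & Hs).
destruct slice_family as [K HF]. destruct slice_bound as [M HM].
set (p := fst (enum_pair j)). set (q := snd (enum_pair j)).
set (z := (2 * (INR p - INR q))%R).
assert (HFz := gf_cis (4 * B) K M z slice HF HM).
(* the family of right translates, with the character of [K] *)
set (W := fun y x => G (SL2_mul y (elt_k x)) * cis (weight delta j * x)).
assert (HW : exists K', good_family (4 * B) K' W).
{ destruct (lip_cs_bound _ _ _ HG) as (M' & HM0' & HM').
  eexists. apply gf_cis with (K := (L * (16 * B * 8))%R) (M := M'); [|intros; apply HM'].
  assert (Sup : forall y t, G (SL2_mul y (elt_k t)) <> 0 -> (mnorm y <= 4 * B)%R).
  { intros y t H. apply Hs in H.
    assert (E : y = SL2_mul (SL2_mul y (elt_k t)) (elt_k (- t))).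
    { rewrite SL2_mul_assoc, elt_k_plus, Rplus_opp_r, elt_k_0, SL2_mul_1_r. reflexivity. }
    rewrite E. eapply Rle_trans; [apply mnorm_mul|].
    assert (N := mnorm_k (- t)). assert (P := mnorm_pos (elt_k (- t))).
    assert (P' := mnorm_pos (SL2_mul y (elt_k t))). nra. }
  split; auto.
  - intros y t t'. destruct (Rle_dec (mnorm y) (4 * B)) as [Hy|Hy].
    + eapply Rle_trans; [apply Hlip|]. rewrite Rmult_assoc. apply Rmult_le_compat_l; auto.
      eapply Rle_trans; [apply mdist_mul_l|]. rewrite (Rmult_assoc (16 * B)).
      apply Rmult_le_compat; [apply mnorm_pos|apply mdist_pos|lra|apply mdist_k_lip].
    + assert (Z : forall x, G (SL2_mul y (elt_k x)) = 0).
      { intros x. apply NNPP. intros H. apply Hy, (Sup y x), H. }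
      rewrite !Z. replace (0 - 0) with (RtoC 0) by ring. rewrite Cmod_0.
      repeat apply Rmult_le_pos; try lra. apply Rabs_pos.
  - intros y e He. apply locally_SL2.
    exists (e / (4 * L + 1))%R. split; [apply Rdiv_lt_0_compat; lra|].
    intros y' Hy' t. eapply Rle_trans; [apply Hlip|].
    assert (K1 := mdist_mul_r (elt_k t) y' y).
    assert (K2 := mnorm_k t). rewrite mdist_sym in Hy'.
    assert (K3 := mdist_pos y' y).
    clear_denominator Hy' (4 * L + 1)%R.
    apply Rle_trans with (L * (mdist y' y * 4))%R; [|lra].
    apply Rmult_le_compat_l; auto. eapply Rle_trans; [exact K1|].
    apply Rmult_le_compat_l; auto. }
destruct HW as [K' HW].
assert (D : pfC_dom SL2 Cc (fun y => G y * basis delta s j y)).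
{ apply (pfC_dom_intro _ B).
  - intros y. apply Ccont_mult; [apply (SL2_lip_Ccont G L Hlip)|apply Ce].
  - intros y Hy. apply Hs. intros E. apply Hy. rewrite E; ring. }
unfold fcoef. fold p q.
assert (E1 : CInt (fun x => haar_int mu (fun y => W y x * basis delta s j y)) 0 (2 * PI)
  = (2 * PI)%R * haar_int mu (fun y => G y * basis delta s j y)).
{ rewrite (CInt_ext _ (fun _ => haar_int mu (fun y => G y * basis delta s j y))).
  - rewrite CInt_const, Rminus_0_r. reflexivity.
  - intros x _. rewrite <- (haar_int_right mu Hmu (elt_k x) _ D).
    apply haar_int_ext. intros y. rewrite basis_right_k. unfold W. ring. }
assert (E2 : CInt (fun x => haar_int mu (fun y => W y x * basis delta s j y)) 0 (2 * PI)
  = CInt (fun x => trace_density x * cis (z * x)) 0 (2 * PI)).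
{ rewrite <- (gf_fubini mu Hmu (4 * B) K' W (basis delta s j) HW Ce).
  rewrite (haar_int_ext mu _ (fun y =>
    CInt (fun x => slice y x * cis (z * x)) 0 (2 * PI) * an_power s y)).
  - rewrite (gf_fubini mu Hmu _ _ _ (an_power s) HFz (an_power_cont s)).
    apply CInt_ext. intros x _. unfold trace_density.
    rewrite Cmult_comm, <- haar_int_scal; auto.
    + apply haar_int_ext. intros y. ring.
    + apply (gf_dom (4 * B) K slice (an_power s) HF (an_power_cont s)).
  - intros y. destruct (iwasawa y) as [ph Hph].
    rewrite <- (CInt_period_shift (fun x => slice y x * cis (z * x)) ph (2 * PI)).
    + rewrite Cmult_comm, <- CInt_scal by (intros; apply (gf_cont_t _ _ _ HW)).
      rewrite (Cmult_comm _ (an_power s y)), <- CInt_scal.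
      2: { intros x. apply (continuous_comp (fun x => (x + ph)%R)
             (fun x => slice y x * cis (z * x))).
           - apply Rcont_plus; [apply Rcont_id|apply Rcont_const].
           - apply (gf_cont_t _ _ _ HFz). }
      apply CInt_ext. intros x _. unfold W, slice.
      assert (Eb : basis delta s j y = cis (weight delta j * ph) * an_power s y).
      { rewrite Hph at 1. rewrite basis_right_k. f_equal.
        unfold basis, an_part. apply psvec_pm. }
      rewrite Eb.
      assert (Ey : SL2_mul y (elt_k x) = SL2_mul (an_part y) (elt_k (x + ph))).
      { rewrite Hph at 1. rewrite SL2_mul_assoc, elt_k_plus. do 2 f_equal. ring. }
      rewrite Ey.
      transitivity (an_power s y * G (SL2_mul (an_part y) (elt_k (x + ph))) *
        (cis (weight delta j * x) * cis (weight delta j * ph))); [ring|].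
      transitivity (an_power s y * G (SL2_mul (an_part y) (elt_k (x + ph))) *
        (cis (INR (parity delta) * (x + ph)) * cis (z * (x + ph)))); [|ring].
      f_equal. rewrite <- !cis_plus. f_equal. unfold weight, z, p, q. ring.
    + intros x. apply (gf_cont_t _ _ _ HFz).
    + intros x. replace (x + 2 * PI)%R with (x + PI + PI)%R by ring.
      rewrite !slice_per. f_equal.
      assert (EE : cis (z * (x + PI + PI) + 2 * INR (2 * q) * PI) =
        cis (z * x + 2 * INR (2 * p) * PI)).
      { f_equal. unfold z. rewrite !mult_INR. simpl. ring. }
      rewrite !cis_period in EE. exact EE. }
change (fun x : R => trace_density x * cis (2 * (INR p - INR q) * x))
  with (fun x : R => trace_density x * cis (z * x)).
rewrite <- E2, E1, RtoC_mult. field. apply RtoC_neq; lra.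
Qed.

(** The trace is the sum of the Fourier coefficients of the density, which is
    its value at [0]: formally, the trace is the integral over [K] of the
    kernel on the diagonal. *)
Lemma trace_of_coefficients (tau : C) :
  is_series (V := C_R_NormedModule)
    (fun j => haar_int mu (fun y => G y * basis delta s j y)) tau ->
  tau = haar_int mu (fun y => G (an_part y) * an_power s y).
Proof.
intros H. rewrite <- trace_density_0.
destruct trace_density_sin as (K & HK & Hl).
apply (fourier_sum_value trace_density K); auto using trace_density_cont.
eapply is_series_ext; [|exact H]. apply diagonal_coefficient.
Qed.

End Trace.

Close Scope C_scope.

(** * Haar measure in Iwasawa coordinates *)

(** Integrals of real functions live in a type that [ring] does not recognize. *)
Ltac as_R := lazymatch goal with |- @eq _ ?a ?b => change (@eq R a b) end.

Definition cc2 (r : R) (w : R -> R -> R) : Prop :=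
  (forall u t, R2continuous
    (fun z : R * R => w (fst z) (snd z)) (u, t)) /\
  (forall u t, w u t <> 0 -> Rabs u <= r /\ Rabs t <= r).

Lemma cc2_zero r w u t : cc2 r w -> (r < Rabs u \/ r < Rabs t) -> w u t = 0.
Proof.
intros [_ Hs] H. apply NNPP. intros Hw. destruct (Hs u t Hw). lra.
Qed.

Lemma cc2_uniform r w : cc2 r w -> forall e, 0 < e -> exists d, 0 < d /\
  forall u t u' t', Rabs (u' - u) < d -> Rabs (t' - t) < d -> Rabs (w u' t' - w u t) <= e.
Proof.
intros Hw e He. assert (Hw' := Hw). destruct Hw' as [Hc Hs].
assert (HG : forall p : Compactness.Tn 2 R, exists d : posreal,
  forall u t, Rabs (u - fst p) < 2 * d -> Rabs (t - fst (snd p)) < 2 * d ->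
   Rabs (w u t - w (fst p) (fst (snd p))) < e / 2).
{ intros (a & b & []). specialize (Hc a b). rewrite continuous_Rle_abs in Hc.
  destruct (Hc (e / 2) ltac:(lra)) as [d Hd].
  assert (Hd2 : 0 < d / 2) by (generalize (cond_pos d); lra).
  exists (mkposreal _ Hd2). simpl. intros u t H1 H2.
  apply (Hd (u, t)). split.
  - change (Rabs (u - a) < d). lra.
  - change (Rabs (t - b) < d). lra. }
pose (gauge := fun p => proj1_sig (constructive_indefinite_description _ (HG p))).
assert (Hgauge : forall p u t, Rabs (u - fst p) < 2 * gauge p ->
   Rabs (t - fst (snd p)) < 2 * gauge p ->
   Rabs (w u t - w (fst p) (fst (snd p))) < e / 2).
{ intros p. exact (proj2_sig (constructive_indefinite_description _ (HG p))). }
clearbody gauge.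
destruct (compactness_value 2 (- (r + 1), (- (r + 1), tt)) (r + 1, (r + 1, tt)) gauge)
  as [d Hd].
assert (Hdp := cond_pos d).
exists (Rmin d 1). split; [apply Rmin_glb_lt; lra|].
intros u t u' t' Hu Ht.
assert (Hu1 := Rlt_le_trans _ _ _ Hu (Rmin_l _ _)).
assert (Hu2 := Rlt_le_trans _ _ _ Hu (Rmin_r _ _)).
assert (Ht1 := Rlt_le_trans _ _ _ Ht (Rmin_l _ _)).
assert (Ht2 := Rlt_le_trans _ _ _ Ht (Rmin_r _ _)).
destruct (classic (Rabs u <= r + 1 /\ Rabs t <= r + 1)) as [[H1 H2]|Hout].
- assert (Hb : bounded_n 2 (- (r + 1), (- (r + 1), tt)) (r + 1, (r + 1, tt)) (u, (t, tt))).
  { refine (conj (proj1 (Rabs_le_between _ _) H1) (conj (proj1 (Rabs_le_between _ _) H2) I)). }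
  apply Hd, NNPP in Hb. destruct Hb as (p & _ & Hcl & Hdt).
  assert (Hgp := cond_pos (gauge p)). assert (HK := Hgauge p).
  set (dp := pos (gauge p)) in *. clearbody dp.
  destruct p as (a & b & []). destruct Hcl as (C1 & C2 & _). cbn [fst snd] in HK.
  assert (Tri : forall x y z, Rabs (x - z) <= Rabs (x - y) + Rabs (y - z))
    by (intros; apply Rabs_minus_tri).
  assert (K1 := HK u t ltac:(lra) ltac:(lra)).
  assert (K2 : Rabs (w u' t' - w a b) < e / 2).
  { apply HK; [assert (T := Tri u' u a)|assert (T := Tri t' t b)]; lra. }
  assert (T := Tri (w u' t') (w a b) (w u t)).
  rewrite (Rabs_minus_sym (w a b)) in T. lra.
- assert (Z : w u t = 0 /\ w u' t' = 0).
  { assert (T1 := Rabs_triang_inv u u'). assert (T2 := Rabs_triang_inv t t').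
    rewrite Rabs_minus_sym in Hu2, Ht2.
    split; apply (cc2_zero r); auto;
    destruct (Rle_dec (Rabs u) (r + 1)); destruct (Rle_dec (Rabs t) (r + 1)); try tauto; lra. }
  destruct Z as [-> ->]. rewrite Rminus_diag, Rabs_R0. lra.
Qed.

Lemma cc2_cont_u r w t u : cc2 r w -> continuous (fun u => w u t) u.
Proof.
intros Hw. apply continuous_Rle_abs. intros e He.
destruct (cc2_uniform r w Hw (e / 2) ltac:(lra)) as (d & Hd & H).
exists (mkposreal d Hd). intros y Hy. change (Rabs (y - u) < d) in Hy.
eapply Rle_lt_trans; [apply (H u t y t Hy)|lra]. rewrite Rminus_diag, Rabs_R0; auto.
Qed.

Lemma cc2_bound r w : cc2 r w -> exists M, 0 <= M /\ forall u t, Rabs (w u t) <= M.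
Proof.
intros Hw. destruct (cc2_uniform r w Hw 1 Rlt_0_1) as (d & Hd & H).
assert (Hn : forall n u t, u <= - Rabs r - 1 + INR n * (d / 2) -> Rabs (w u t) <= INR n).
{ induction n as [|n IH]; intros u t Hu.
  - simpl in *. rewrite (cc2_zero r); auto; [rewrite Rabs_R0; lra|].
    left. assert (K := Rle_abs (- u)). rewrite Rabs_Ropp in K.
    assert (K' := Rle_abs r). assert (K2 := Rabs_pos r). lra.
  - rewrite S_INR in *. specialize (IH (u - d / 2) t ltac:(lra)).
    assert (K := H (u - d / 2) t u t).
    replace (u - (u - d / 2)) with (d / 2) in K by ring.
    rewrite Rminus_diag, Rabs_R0, Rabs_pos_eq in K by lra.
    specialize (K ltac:(lra) ltac:(lra)).
    assert (T := Rabs_triang_inv (w u t) (w (u - d / 2) t)). lra. }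
destruct (INR_unbounded ((2 * Rabs r + 2) / (d / 2))) as [N HN].
exists (INR N). split; [apply pos_INR|]. intros u t.
destruct (Rle_dec u (- Rabs r - 1 + INR N * (d / 2))) as [Hu|Hu]; [apply Hn, Hu|].
rewrite (cc2_zero r); auto; [rewrite Rabs_R0; apply pos_INR|].
left. assert (Hd2 : 0 < d / 2) by lra.
clear_denominator HN (d / 2)%R.
assert (K := Rle_abs u). assert (K2 := Rle_abs r). assert (K3 := Rabs_pos r). lra.
Qed.

Lemma RInt_zero (f : R -> R) a b : (forall x, Rmin a b < x < Rmax a b -> f x = 0) ->
  RInt f a b = 0.
Proof.
intros H. rewrite (RInt_ext f (fun _ => 0)) by auto.
rewrite RInt_const. unfold scal; simpl. unfold mult; simpl. ring.
Qed.

Lemma RInt_eq (f g : R -> R) a b : (forall x, f x = g x) -> RInt f a b = RInt g a b.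
Proof. intros H. apply RInt_ext. intros; apply H. Qed.

Lemma RInt_abs_bound (f : R -> R) a b M : (forall x, continuous f x) ->
  (forall x, Rmin a b <= x <= Rmax a b -> Rabs (f x) <= M) ->
  Rabs (RInt f a b) <= Rabs (b - a) * M.
Proof.
intros Hc H. apply (norm_RInt_le_const_abs (V := R_NormedModule) f a b); auto.
apply (RInt_correct (V := R_CompleteNormedModule)), ex_RInt_continuous. intros; apply Hc.
Qed.

Lemma RInt_cont_minus (f g : R -> R) a b : (forall x, continuous f x) ->
  (forall x, continuous g x) ->
  RInt (fun x => f x - g x) a b = RInt f a b - RInt g a b.
Proof.
intros. apply (RInt_minus (V := R_CompleteNormedModule));
  apply ex_RInt_continuous; auto.
Qed.

Lemma RInt_cont_scal (f : R -> R) k a b : (forall x, continuous f x) ->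
  RInt (fun x => k * f x) a b = k * RInt f a b.
Proof.
intros. apply (RInt_scal (V := R_CompleteNormedModule)); apply ex_RInt_continuous; auto.
Qed.

Lemma RInt_cont_Chasles (f : R -> R) a b c : (forall x, continuous f x) ->
  RInt f a b + RInt f b c = RInt f a c.
Proof.
intros. apply (RInt_Chasles (V := R_CompleteNormedModule)); apply ex_RInt_continuous; auto.
Qed.

Lemma cc2_int_cont r w a b t : cc2 r w -> continuous (fun t => RInt (fun u => w u t) a b) t.
Proof.
intros Hw. apply continuous_Rle_abs. intros e He.
assert (Hab := Rabs_pos (b - a)).
assert (He' : 0 < e / (2 * (Rabs (b - a) + 1))) by (apply Rdiv_lt_0_compat; lra).
destruct (cc2_uniform r w Hw _ He') as (d & Hd & H).
exists (mkposreal d Hd). intros y Hy. change (Rabs (y - t) < d) in Hy.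
assert (C : forall t x, continuous (fun u => w u t) x) by (intros; eapply cc2_cont_u; eauto).
rewrite <- RInt_cont_minus by auto.
eapply Rle_lt_trans; [apply RInt_abs_bound|].
- intros x. apply Rcont_minus; auto.
- intros x _. apply (H x t x y); [rewrite Rminus_diag, Rabs_R0; auto|exact Hy].
- set (q := e / (2 * (Rabs (b - a) + 1))) in *.
  replace e with (q * (2 * (Rabs (b - a) + 1))) by (unfold q; field; lra). nra.
Qed.

(** The vanishing of the integrals makes the primitive compactly supported. *)
Lemma cc2_primitive r w : 0 <= r -> cc2 r w -> (forall t, RInt (fun u => w u t) (- r) r = 0) ->
  cc2 r (fun u t => RInt (fun v => w v t) (- r) u).
Proof.
intros Hr Hw H0.
assert (C : forall t x, continuous (fun u => w u t) x) by (intros; eapply cc2_cont_u; eauto).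
split.
- intros u t. apply continuous_Rle_abs. intros e He. simpl.
  destruct (cc2_bound r w Hw) as (M & HM & HMb).
  assert (Hu := Rabs_pos (u - - r)).
  set (q := e / (2 * (Rabs (u - - r) + 1))).
  assert (Hq : 0 < q) by (apply Rdiv_lt_0_compat; lra).
  destruct (cc2_uniform r w Hw q Hq) as (d & Hd & H).
  set (d' := Rmin d (e / (2 * (M + 1)))).
  assert (Hd' : 0 < d') by (apply Rmin_glb_lt; auto; apply Rdiv_lt_0_compat; lra).
  exists (mkposreal d' Hd'). intros [u' t'] [H1 H2].
  change (Rabs (u' - u) < d') in H1. change (Rabs (t' - t) < d') in H2. simpl.
  rewrite <- (RInt_cont_Chasles (fun v => w v t') (- r) u u') by auto.
  replace (RInt (fun v => w v t') (- r) u + RInt (fun v => w v t') u u'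
    - RInt (fun v => w v t) (- r) u)
    with ((RInt (fun v => w v t') (- r) u - RInt (fun v => w v t) (- r) u)
      + RInt (fun v => w v t') u u') by ring.
  rewrite <- RInt_cont_minus by auto.
  eapply Rle_lt_trans; [apply Rabs_triang|].
  assert (B1 : Rabs (RInt (fun v => w v t' - w v t) (- r) u) <= Rabs (u - - r) * q).
  { apply RInt_abs_bound; [intros; apply Rcont_minus; auto|].
    intros x _. apply H; [rewrite Rminus_diag, Rabs_R0; auto|].
    eapply Rlt_le_trans; [exact H2|apply Rmin_l]. }
  assert (B2 : Rabs (RInt (fun v => w v t') u u') <= Rabs (u' - u) * M)
    by (apply RInt_abs_bound; auto).
  assert (B3 : Rabs (u - - r) * q <= e / 2).
  { replace (e / 2) with ((Rabs (u - - r) + 1) * q) by (unfold q; field; lra). nra. }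
  assert (B4 : Rabs (u' - u) * M < e / 2).
  { assert (H1' := Rlt_le_trans _ _ _ H1 (Rmin_r _ _)).
    assert (Hp := Rabs_pos (u' - u)).
    apply (Rmult_lt_compat_r (M + 1)) in H1'; [|lra].
    replace (e / (2 * (M + 1)) * (M + 1)) with (e / 2) in H1' by (field; lra). nra. }
  lra.
- intros u t H.
  assert (Zt : Rabs t <= r).
  { apply Rnot_lt_le. intros Ht. apply H, RInt_zero. intros x _.
    apply (cc2_zero r); auto. }
  split; auto. apply Rnot_lt_le. intros Hu. apply H.
  destruct (Rle_dec 0 u) as [Hu0|Hu0].
  + rewrite Rabs_pos_eq in Hu by auto.
    rewrite <- (RInt_cont_Chasles _ _ r u) by auto. rewrite H0, Rplus_0_l.
    apply RInt_zero. intros x Hx. rewrite Rmin_left, Rmax_right in Hx by lra.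
    apply (cc2_zero r); auto. left. rewrite Rabs_pos_eq; lra.
  + rewrite Rabs_left in Hu by lra. apply RInt_zero. intros x Hx.
    rewrite Rmin_right, Rmax_left in Hx by lra.
    apply (cc2_zero r); auto. left. rewrite Rabs_left; lra.
Qed.

(** The difference quotients of the primitive converge uniformly. *)
Lemma cc2_increment r w e d v u t : cc2 r w ->
  (forall u t u' t', Rabs (u' - u) < d -> Rabs (t' - t) < d -> Rabs (w u' t' - w u t) <= e) ->
  Rabs v < d ->
  Rabs (RInt (fun x => w x t) (- r) (u + v) - RInt (fun x => w x t) (- r) u - v * w u t)
    <= e * Rabs v.
Proof.
intros Hw H Hv.
assert (C : forall t x, continuous (fun u => w u t) x) by (intros; eapply cc2_cont_u; eauto).
rewrite <- (RInt_cont_Chasles _ (- r) u (u + v)) by auto.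
assert (E : RInt (fun x => w x t) (- r) u + RInt (fun x => w x t) u (u + v)
  - RInt (fun x => w x t) (- r) u - v * w u t =
  RInt (fun x => w x t - w u t) u (u + v)).
{ rewrite RInt_cont_minus, RInt_const; auto; [|intros; apply Rcont_const].
  unfold scal; simpl. unfold mult; simpl. ring. }
rewrite E. eapply Rle_trans; [apply (RInt_abs_bound _ _ _ e)|].
- intros x. apply Rcont_minus; [apply C|apply Rcont_const].
- intros x Hx. apply H.
  + revert Hx. unfold Rmin, Rmax. destruct (Rle_dec u (u + v)); intros Hx;
      revert Hv; unfold Rabs; repeat destruct Rcase_abs; lra.
  + rewrite Rminus_diag, Rabs_R0. eapply Rle_lt_trans; [apply Rabs_pos|exact Hv].
- replace (u + v - u) with v by ring. lra.
Qed.

(** ** The coordinates under left translation *)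

Lemma row_sq_n v y : row_sq (SL2_mul (elt_n v) y) = row_sq y.
Proof. unfold row_sq; simpl. ring. Qed.

Lemma tau_of_n v y : tau_of (SL2_mul (elt_n v) y) = tau_of y.
Proof. unfold tau_of. rewrite row_sq_n. reflexivity. Qed.

Lemma u_of_n v y : u_of (SL2_mul (elt_n v) y) = u_of y + v.
Proof.
assert (Hr := row_sq_pos y). unfold u_of. rewrite row_sq_n. simpl.
transitivity ((m11 y * m21 y + m12 y * m22 y + v * row_sq y) / row_sq y).
- f_equal. unfold row_sq. ring.
- field. lra.
Qed.

Definition expos (x : R) : posreal := mkposreal (exp x) (exp_pos x).

Lemma row_sq_a x y : row_sq (SL2_mul (elt_a (expos x)) y) = / exp x * / exp x * row_sq y.
Proof. unfold row_sq; simpl. ring. Qed.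

Lemma tau_of_a x y : tau_of (SL2_mul (elt_a (expos x)) y) = tau_of y + x.
Proof.
assert (Hr := row_sq_pos y). assert (He := exp_pos x).
assert (Hi := Rinv_0_lt_compat _ He).
unfold tau_of. rewrite row_sq_a, !ln_mult, !ln_Rinv, ln_exp by (try apply Rmult_lt_0_compat; auto).
field.
Qed.

Lemma u_of_a x y : u_of (SL2_mul (elt_a (expos x)) y) = exp (2 * x) * u_of y.
Proof.
assert (Hr := row_sq_pos y). assert (He := exp_pos x).
unfold u_of. rewrite row_sq_a. simpl.
replace (2 * x) with (x + x) by ring. rewrite exp_plus. field. lra.
Qed.

Lemma pm_norm_bound r u t : Rabs u <= r -> Rabs t <= r ->
  mnorm (pm u t) <= (2 + r) * exp r.
Proof.
intros Hu Ht. unfold mnorm; simpl.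
assert (T := proj1 (Rabs_le_between _ _) Ht).
assert (E1 : exp t <= exp r) by (apply exp_mono; lra).
assert (E2 : exp (- t) <= exp r) by (apply exp_mono; lra).
assert (P1 := exp_pos t). assert (P2 := exp_pos (- t)).
rewrite Rabs_mult, Rabs_R0, !(Rabs_pos_eq (exp _)) by lra.
assert (Rabs u * exp (- t) <= r * exp r)
  by (apply Rmult_le_compat; auto; [apply Rabs_pos|lra]).
lra.
Qed.

Lemma coords_norm_bound r y : Rabs (u_of y) <= r -> Rabs (tau_of y) <= r ->
  mnorm y <= 4 * ((2 + r) * exp r).
Proof.
intros Hu Ht. assert (H := mnorm_an y 0). rewrite elt_k_0, SL2_mul_1_r in H.
eapply Rle_trans; [exact H|]. apply Rmult_le_compat_l; [lra|]. apply pm_norm_bound; auto.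
Qed.

Lemma cc2_Cc r w : cc2 r w -> Cc (fun y => w (u_of y) (tau_of y)).
Proof.
intros [Hc Hs]. apply (Cc_intro _ (4 * ((2 + r) * exp r))).
- intros y. apply (continuous_comp_2 u_of tau_of w);
    [apply u_of_cont|apply tau_of_cont|apply Hc].
- intros y Hy. destruct (Hs _ _ Hy). apply coords_norm_bound; auto.
Qed.

Lemma cc2_minus r w w' : cc2 r w -> cc2 r w' -> cc2 r (fun u t => w u t - w' u t).
Proof.
intros [Hc Hs] [Hc' Hs']. split.
- intros u t. apply Rcont_minus; auto.
- intros u t H. destruct (Req_dec (w u t) 0); [apply Hs'; lra|auto].
Qed.

Lemma cc2_enlarge r r' w : r <= r' -> cc2 r w -> cc2 r' w.
Proof.
intros Hr [Hc Hs]. split; auto. intros u t H. destruct (Hs u t H). lra.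
Qed.

Lemma cc2_scal r k w : cc2 r w -> cc2 r (fun u t => k * w u t).
Proof.
intros [Hc Hs]. split.
- intros u t. apply Rcont_mult; [apply Rcont_const|apply Hc].
- intros u t H. apply Hs. intros E. apply H. rewrite E; as_R; ring.
Qed.

(** A function with vanishing integrals along the lines of translation is the
    derivative of its primitive, that is a limit of difference quotients; each of
    these is annihilated by an invariant functional. *)
Lemma invariant_zero_mean (J : (R -> R -> R) -> R) r w : 1 <= r ->
  (forall w w', cc2 (r + 1) w -> cc2 (r + 1) w' -> J (fun u t => w u t - w' u t) = J w - J w') ->
  (forall k w, cc2 (r + 1) w -> J (fun u t => k * w u t) = k * J w) ->
  (forall v w, cc2 (r + 1) w -> J (fun u t => w (u + v) t) = J w) ->
  (exists m, 0 <= m /\ forall e w, 0 <= e -> cc2 (r + 1) w ->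
    (forall u t, Rabs (w u t) <= e) -> Rabs (J w) <= e * m) ->
  cc2 r w -> (forall t, RInt (fun u => w u t) (- r) r = 0) -> J w = 0.
Proof.
intros Hr Jminus Jscal Jinv (m & Hm & Jb) Hw H0.
assert (HW := cc2_primitive r w ltac:(lra) Hw H0).
set (W := fun u t => RInt (fun v => w v t) (- r) u) in *.
assert (HW1 := cc2_enlarge r (r + 1) W ltac:(lra) HW).
assert (Hw1 := cc2_enlarge r (r + 1) w ltac:(lra) Hw).
assert (HE : forall e, 0 < e -> Rabs (J w) <= e * m).
{ intros e He. destruct (cc2_uniform r w Hw e He) as (d & Hd & Hu).
  set (v := Rmin (d / 2) (1 / 2)).
  assert (Hv : 0 < v) by (apply Rmin_glb_lt; lra).
  assert (Hvd : v <= d / 2) by apply Rmin_l.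
  assert (Hv1 : v <= 1 / 2) by apply Rmin_r.
  assert (HWv : cc2 (r + 1) (fun u t => W (u + v) t)).
  { destruct HW as [HWc HWs]. split.
    - intros u t. apply (continuous_comp_2 (fun z : R * R => fst z + v)
        (fun z : R * R => snd z) W); [|apply continuous_snd|apply HWc].
      apply Rcont_plus; [apply continuous_fst|apply Rcont_const].
    - intros u t HH. destruct (HWs _ _ HH) as [H1 H2]. split; [|lra].
      revert H1; unfold Rabs; repeat destruct Rcase_abs; lra. }
  assert (Dm := cc2_minus _ _ _ HWv HW1). assert (Ds := cc2_scal _ v _ Hw1).
  assert (E : J (fun u t => (W (u + v) t - W u t) - v * w u t) = - (v * J w)).
  { rewrite (Jminus _ _ Dm Ds), (Jminus _ _ HWv HW1), (Jscal v w Hw1), (Jinv v W HW1). ring. }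
  assert (Bd : Rabs (J (fun u t => (W (u + v) t - W u t) - v * w u t)) <= (e * v) * m).
  { apply Jb; [apply Rmult_le_pos; lra|apply cc2_minus; auto|]. intros u t.
    assert (K := cc2_increment r w e d v u t Hw Hu ltac:(rewrite Rabs_pos_eq; lra)).
    rewrite (Rabs_pos_eq v) in K by lra. exact K. }
  rewrite E, Rabs_Ropp, Rabs_mult, (Rabs_pos_eq v) in Bd by lra.
  apply Rmult_le_reg_l with v; auto. lra. }
apply Rabs_eq_0. apply Rle_antisym; [|apply Rabs_pos]. apply Rnot_lt_le. intros Hpos.
assert (K := HE (Rabs (J w) / (2 * (m + 1))) ltac:(apply Rdiv_lt_0_compat; lra)).
apply (Rmult_le_compat_r (2 * (m + 1))) in K; [|lra].
replace (Rabs (J w) / (2 * (m + 1)) * m * (2 * (m + 1))) with (Rabs (J w) * m) in K by (field; lra).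
nra.
Qed.

Section AN.

Variable mu : (SL2 -> R) -> R.
Hypothesis Hmu : is_haar mu.
Let HP := haar_positive mu Hmu.

Definition mu2 (w : R -> R -> R) : R := mu (fun y => w (u_of y) (tau_of y)).

Lemma mu2_ext w w' : (forall u t, w u t = w' u t) -> mu2 w = mu2 w'.
Proof. intros H. unfold mu2. f_equal. apply functional_extensionality; intros; apply H. Qed.

Lemma mu2_translate_n r w v : cc2 r w -> mu2 (fun u t => w (u + v) t) = mu2 w.
Proof.
intros Hw. assert (Hmu' := Hmu); destruct Hmu' as (_ & _ & _ & Hl & _).
unfold mu2. rewrite <- (Hl (elt_n v) _ (cc2_Cc _ _ Hw)). f_equal.
apply functional_extensionality; intros y. rewrite u_of_n, tau_of_n. reflexivity.
Qed.

Lemma mu2_translate_a r w x : cc2 r w ->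
  mu2 (fun u t => w (exp (2 * x) * u) (t + x)) = mu2 w.
Proof.
intros Hw. assert (Hmu' := Hmu); destruct Hmu' as (_ & _ & _ & Hl & _).
unfold mu2. rewrite <- (Hl (elt_a (expos x)) _ (cc2_Cc _ _ Hw)). f_equal.
apply functional_extensionality; intros y. rewrite u_of_a, tau_of_a. reflexivity.
Qed.

Lemma mu2_minus r w w' : cc2 r w -> cc2 r w' ->
  mu2 (fun u t => w u t - w' u t) = mu2 w - mu2 w'.
Proof.
intros Hw Hw'. apply (pf_minus SL2 Cc mu HP (fun y => w (u_of y) (tau_of y))
  (fun y => w' (u_of y) (tau_of y))); eapply cc2_Cc; eauto.
Qed.

Lemma mu2_scal r k w : cc2 r w -> mu2 (fun u t => k * w u t) = k * mu2 w.
Proof.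
intros Hw. apply (pf_scal _ _ _ HP k (fun y => w (u_of y) (tau_of y))).
eapply cc2_Cc; eauto.
Qed.

(** A multiple of a cutoff dominates all functions that are supported in the square
    and bounded by [e]. *)
Lemma mu2_bound r : 0 <= r -> exists m, 0 <= m /\ forall e w, 0 <= e -> cc2 r w ->
  (forall u t, Rabs (w u t) <= e) -> Rabs (mu2 w) <= e * m.
Proof.
intros Hr. set (B := 4 * ((2 + r) * exp r)).
assert (Hcut : Cc (fun y => cutoff B y * 1)) by (apply cutoff_mult_Cc; intros; apply Rcont_const).
exists (mu (fun y => cutoff B y * 1)). split.
- apply (pf_pos _ _ _ HP); auto. intros y. assert (K := cutoff_pos B y). lra.
- intros e w He Hw Hb. rewrite <- (pf_scal _ _ _ HP) by auto.
  apply (pf_abs SL2 Cc mu HP).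
  + apply (cc2_Cc r w Hw).
  + apply (pf_scal_dom _ _ _ HP), Hcut.
  + intros y. assert (Hc0 := cutoff_pos B y). specialize (Hb (u_of y) (tau_of y)).
    destruct (Req_dec (w (u_of y) (tau_of y)) 0) as [E|E]; [rewrite E, Rabs_R0; nra|].
    destruct (proj2 Hw _ _ E) as [H1 H2].
    assert (H3 := cutoff_ge_1 B y (coords_norm_bound _ _ H1 H2)). nra.
Qed.

(** Any continuous function of integral [1] with compact support would serve
    to split off the mean of a function. *)
Definition tent (x : R) : R := Rmax 0 (1 - Rabs x).

Lemma tent_cont (T : UniformSpace) (f : T -> R) x :
  Rcts f x ->
  Rcts (fun t => tent (f t)) x.
Proof.
intros H. apply Rmax_cont, Rcont_minus; [apply Rcont_const|].
apply (Rcont_comp _ f Rabs); auto. apply Rcontinuity_abs.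
Qed.

Lemma tent_continuous x : continuous tent x.
Proof. apply (tent_cont R_UniformSpace (fun x => x)), continuous_id. Qed.

Lemma tent_supp x : tent x <> 0 -> Rabs x <= 1.
Proof.
intros H. apply Rnot_lt_le. intros Hx. apply H. apply Rmax_left. lra.
Qed.

Lemma tent_pos x : 0 <= tent x.
Proof. apply Rmax_l. Qed.

Lemma tent_mass r : 1 <= r -> RInt tent (- r) r = 1.
Proof.
intros Hr. assert (C := tent_continuous).
rewrite <- (RInt_cont_Chasles tent (- r) (-1) r), <- (RInt_cont_Chasles tent (-1) 0 r),
  <- (RInt_cont_Chasles tent 0 1 r) by auto.
rewrite (RInt_zero tent (- r) (-1)), (RInt_zero tent 1 r).
- assert (E1 : RInt tent (-1) 0 = 1 / 2).
  { apply is_RInt_unique.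
    apply (is_RInt_ext (fun x => 1 + x)).
    - intros x. rewrite Rmin_left, Rmax_right by lra. intros Hx. unfold tent.
      rewrite Rabs_left by lra. rewrite Rmax_right; lra.
    - replace (1 / 2) with (minus (0 + 0 * 0 / 2) (-1 + -1 * -1 / 2))
        by (unfold minus, plus, opp; simpl; field).
      apply (is_RInt_derive (V := R_CompleteNormedModule) (fun x => x + x * x / 2)).
      + intros x _. auto_derive; auto. field.
      + intros x _. apply Rcont_plus; [apply Rcont_const|apply Rcont_id]. }
  assert (E2 : RInt tent 0 1 = 1 / 2).
  { apply is_RInt_unique.
    apply (is_RInt_ext (fun x => 1 - x)).
    - intros x. rewrite Rmin_left, Rmax_right by lra. intros Hx. unfold tent.
      rewrite Rabs_pos_eq by lra. rewrite Rmax_right; lra.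
    - replace (1 / 2) with (minus (1 - 1 * 1 / 2) (0 - 0 * 0 / 2))
        by (unfold minus, plus, opp; simpl; field).
      apply (is_RInt_derive (V := R_CompleteNormedModule) (fun x => x - x * x / 2)).
      + intros x _. auto_derive; auto. field.
      + intros x _. apply Rcont_minus; [apply Rcont_const|apply Rcont_id]. }
  rewrite E1, E2. as_R.
  field.
- intros x. rewrite Rmin_left, Rmax_right by lra. intros Hx.
  apply NNPP. intros H. apply tent_supp in H. rewrite Rabs_pos_eq in H; lra.
- intros x. rewrite Rmin_left, Rmax_right by lra. intros Hx.
  apply NNPP. intros H. apply tent_supp in H. rewrite Rabs_left in H; lra.
Qed.

Lemma tent_tensor r g : 1 <= r -> (forall t, continuous g t) ->
  (forall t, g t <> 0 -> Rabs t <= r) -> cc2 r (fun u t => tent u * g t).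
Proof.
intros Hr Hg Hs. split.
- intros u t. apply Rcont_mult.
  + apply (tent_cont _ (fun z : R * R => fst z)), continuous_fst.
  + apply (continuous_comp (fun z : R * R => snd z) g); [apply continuous_snd|apply Hg].
- intros u t H. split.
  + assert (tent u <> 0) as Hu by (intros E; apply H; rewrite E; as_R; ring).
    apply tent_supp in Hu. lra.
  + apply Hs. intros E. apply H. rewrite E; as_R; ring.
Qed.

(** The difference of the two functions has vanishing integrals in [u]. *)
Lemma mu2_integrate_u r w : 1 <= r -> cc2 r w ->
  mu2 w = mu2 (fun u t => tent u * RInt (fun v => w v t) (- r) r).
Proof.
intros Hr Hw.
assert (Ht : cc2 r (fun u t => tent u * RInt (fun v => w v t) (- r) r)).
{ apply tent_tensor; auto.
  - intros t. eapply cc2_int_cont; eauto.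
  - intros t H. apply Rnot_lt_le. intros Ht. apply H, RInt_zero. intros x _.
    apply (cc2_zero r); auto. }
assert (Z : mu2 (fun u t => w u t - tent u * RInt (fun v => w v t) (- r) r) = 0).
{ apply (invariant_zero_mean mu2 r); auto; [apply mu2_minus|intros k; apply mu2_scal|
    intros v w'; apply mu2_translate_n|apply mu2_bound; lra|apply cc2_minus; auto|]. intros t.
  assert (C := tent_continuous).
  rewrite RInt_cont_minus.
  - rewrite (RInt_eq (fun u => tent u * RInt (fun v => w v t) (- r) r)
      (fun u => RInt (fun v => w v t) (- r) r * tent u)) by (intros; ring).
    rewrite RInt_cont_scal, tent_mass by auto. as_R. ring.
  - intros; eapply cc2_cont_u; eauto.
  - intros x. apply Rcont_mult; [apply C|apply Rcont_const]. }
rewrite (mu2_minus r) in Z; auto. lra.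
Qed.

(** The functional on functions of [tau] that remains. Translating [tau] by
    [x] dilates [u] by [exp (2 x)]; the factor [exp (2 t)] compensates this
    and makes the functional invariant. *)
Definition rho (g : R -> R) : R := mu2 (fun u t => tent u * (exp (2 * t) * g t)).

Definition cc1 (r : R) (g : R -> R) : Prop :=
  (forall t, continuous g t) /\ (forall t, g t <> 0 -> Rabs t <= r).

Lemma rho_dom r g : 1 <= r -> cc1 r g -> cc2 r (fun u t => tent u * (exp (2 * t) * g t)).
Proof.
intros Hr [Hc Hs]. apply tent_tensor; auto.
- intros t. apply Rcont_mult; [|apply Hc].
  apply exp_cont, Rcont_mult; [apply Rcont_const|apply Rcont_id].
- intros t H. apply Hs. intros E. apply H. rewrite E; as_R; ring.
Qed.

Lemma tent_mass_scaled k r : 0 < k -> 1 <= r -> 1 <= k * r ->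
  RInt (fun u => tent (k * u)) (- r) r = / k.
Proof.
intros Hk Hr Hkr.
assert (C := tent_continuous).
assert (E := RInt_comp_lin (V := R_CompleteNormedModule) tent k 0 (- r) r).
rewrite !Rplus_0_r in E. replace (k * - r) with (- (k * r)) in E by ring.
rewrite (tent_mass (k * r)) in E by auto.
assert (E' := E (ex_RInt_continuous (V := R_CompleteNormedModule) _ _ _ (fun z _ => C z))).
clear E.
rewrite (RInt_ext _ (fun u => k * tent (k * u))) in E'.
2: { intros x _. unfold scal; simpl. unfold mult; simpl. rewrite Rplus_0_r. reflexivity. }
rewrite RInt_cont_scal in E'.
- apply Rmult_eq_reg_l with k; [|lra]. rewrite E'. field. lra.
- intros x. apply (tent_cont _ (fun u => k * u)).
  apply Rcont_mult; [apply Rcont_const|apply Rcont_id].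
Qed.

Lemma rho_translate r g x : 1 <= r -> cc1 r g -> rho (fun t => g (t + x)) = rho g.
Proof.
intros Hr Hg. assert (HD := rho_dom r g Hr Hg).
unfold rho at 2. rewrite <- (mu2_translate_a r _ x HD).
set (k := exp (2 * x)). assert (Hk : 0 < k) by apply exp_pos.
set (r' := r + Rabs x + / k).
assert (Hik : 0 < / k) by (apply Rinv_0_lt_compat; auto).
assert (Hx := Rabs_pos x).
assert (Hr' : 1 <= r') by (unfold r'; lra).
assert (HD' : cc2 r' (fun u t => tent (k * u) * (exp (2 * (t + x)) * g (t + x)))).
{ split.
  - intros u t. apply Rcont_mult.
    + apply (tent_cont _ (fun z : R * R => k * fst z)).
      apply Rcont_mult; [apply Rcont_const|apply continuous_fst].
    + apply (continuous_comp (fun z : R * R => snd z) (fun t => exp (2 * (t + x)) * g (t + x)));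
        [apply continuous_snd|].
      assert (Cx : continuous (fun t => t + x) t)
        by (apply Rcont_plus; [apply Rcont_id|apply Rcont_const]).
      apply Rcont_mult.
      * apply exp_cont, Rcont_mult; [apply Rcont_const|exact Cx].
      * apply (continuous_comp (fun t => t + x) g); [exact Cx|apply Hg].
  - intros u t H. split.
    + assert (Hu : tent (k * u) <> 0) by (intros E; apply H; rewrite E; as_R; ring).
      apply tent_supp in Hu. rewrite Rabs_mult, (Rabs_pos_eq k) in Hu by lra.
      assert (Rabs u <= / k).
      { apply Rmult_le_reg_l with k; auto. rewrite Rinv_r; lra. }
      unfold r'. lra.
    + assert (Ht : g (t + x) <> 0) by (intros E; apply H; rewrite E; as_R; ring).
      apply (proj2 Hg) in Ht. assert (T := Rabs_triang_inv t (- x)).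
      rewrite Rabs_Ropp in T. replace (t - - x) with (t + x) in T by ring.
      unfold r'. lra. }
rewrite (mu2_integrate_u r' _ Hr' HD'). unfold rho. apply mu2_ext. intros u t.
f_equal.
rewrite (RInt_eq _ (fun v => (exp (2 * (t + x)) * g (t + x)) * tent (k * v))) by (intros; ring).
rewrite RInt_cont_scal, tent_mass_scaled; auto.
- replace (2 * (t + x)) with (2 * t + 2 * x) by ring. rewrite exp_plus. fold k. field. lra.
- unfold r'. assert (k * / k = 1) by (field; lra). nra.
- intros v. apply (tent_cont _ (fun v => k * v)).
  apply Rcont_mult; [apply Rcont_const|apply Rcont_id].
Qed.

Lemma rho_minus r g g' : 1 <= r -> cc1 r g -> cc1 r g' ->
  rho (fun t => g t - g' t) = rho g - rho g'.
Proof.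
intros Hr Hg Hg'. unfold rho. rewrite <- (mu2_minus r) by (apply rho_dom; auto).
apply mu2_ext. intros; ring.
Qed.

Lemma rho_scal r k g : 1 <= r -> cc1 r g -> rho (fun t => k * g t) = k * rho g.
Proof.
intros Hr Hg. unfold rho. rewrite <- (mu2_scal r) by (apply rho_dom; auto).
apply mu2_ext. intros; ring.
Qed.

Lemma cc1_minus r g g' : cc1 r g -> cc1 r g' -> cc1 r (fun t => g t - g' t).
Proof.
intros [H1 H2] [H3 H4]. split.
- intros t; apply Rcont_minus; auto.
- intros t H. destruct (Req_dec (g t) 0); [apply H4; lra|auto].
Qed.

Lemma cc1_scal r k g : cc1 r g -> cc1 r (fun t => k * g t).
Proof.
intros [H1 H2]. split.
- intros t; apply Rcont_mult; [apply Rcont_const|auto].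
- intros t H. apply H2. intros E. apply H. rewrite E; as_R; ring.
Qed.

(** Functions of [tau] are the restrictions [w tau 0] of functions of two variables,
    the variable of translation coming first. *)
Lemma rho_zero_mean r g : 1 <= r -> cc1 r g -> RInt g (- r) r = 0 -> rho g = 0.
Proof.
intros Hr Hg H0. set (w := fun t u => tent u * g t).
assert (Hw : cc2 r w).
{ destruct (tent_tensor r g Hr (proj1 Hg) (proj2 Hg)) as [Hc Hs]. split.
  - intros t u. apply (continuous_comp_2 (fun z : R * R => snd z) (fun z : R * R => fst z)
      (fun u t => tent u * g t)); [apply continuous_snd|apply continuous_fst|apply Hc].
  - intros t u H. destruct (Hs u t H). auto. }
assert (T0 : tent 0 = 1) by (unfold tent; rewrite Rabs_R0, Rmax_right; lra).
assert (Sec : forall r w, cc2 r w -> cc1 r (fun t => w t 0)).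
{ intros r' w' Hw'. split; [intros t; apply (cc2_cont_u r' w' 0 t Hw')|].
  intros t H. apply (proj2 Hw' t 0 H). }
transitivity (rho (fun t => w t 0)).
{ apply (f_equal rho), functional_extensionality. intros t. unfold w. rewrite T0. as_R. ring. }
apply (invariant_zero_mean (fun w => rho (fun t => w t 0)) r); auto.
- intros w1 w2 H1 H2. apply (rho_minus (r + 1)); auto; lra.
- intros k w1 H1. apply (rho_scal (r + 1)); auto; lra.
- intros v w1 H1. apply (rho_translate (r + 1) (fun t => w1 t 0)); auto; lra.
- destruct (mu2_bound (r + 1) ltac:(lra)) as (m & Hm & Hb).
  exists (exp (2 * (r + 1)) * m). assert (P := exp_pos (2 * (r + 1))).
  split; [apply Rmult_le_pos; lra|]. intros e w1 He Hw1 Hb1.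
  rewrite <- Rmult_assoc. apply Hb; [apply Rmult_le_pos; lra|apply rho_dom; auto; lra|].
  intros u t. destruct (Req_dec (w1 t 0) 0) as [E|E].
  + rewrite E, !Rmult_0_r, Rabs_R0. apply Rmult_le_pos; lra.
  + destruct (proj2 Hw1 t 0 E) as [Ht _]. assert (Ht' := Rle_abs t).
    assert (P1 : exp (2 * t) <= exp (2 * (r + 1))) by (apply exp_mono; lra).
    assert (P2 := exp_pos (2 * t)). assert (P3 := tent_pos u). assert (P4 := Rabs_pos u).
    assert (P5 : tent u <= 1) by (apply Rmax_lub; lra).
    rewrite !Rabs_mult, (Rabs_pos_eq (tent u)), (Rabs_pos_eq (exp _)) by lra.
    specialize (Hb1 t 0). assert (P6 := Rabs_pos (w1 t 0)).
    rewrite <- (Rmult_1_l (e * _)). apply Rmult_le_compat; auto; [apply Rmult_le_pos; lra|].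
    rewrite (Rmult_comm e). apply Rmult_le_compat; lra.
- intros t. unfold w. rewrite RInt_cont_scal, H0 by apply Hg. as_R. ring.
Qed.

Lemma tent_cc1 r : 1 <= r -> cc1 r tent.
Proof.
intros Hr. split.
- exact tent_continuous.
- intros t H. apply tent_supp in H. lra.
Qed.

(** Uniqueness of the invariant functional on the line. *)
Lemma rho_lebesgue r g : 1 <= r -> cc1 r g -> rho g = rho tent * RInt g (- r) r.
Proof.
intros Hr Hg. assert (Ht := tent_cc1 r Hr).
assert (Z : rho (fun t => g t - RInt g (- r) r * tent t) = 0).
{ apply (rho_zero_mean r); auto; [apply cc1_minus; auto; apply cc1_scal; auto|].
  rewrite RInt_cont_minus, RInt_cont_scal, tent_mass; auto; [as_R; ring|apply Ht|apply Hg|].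
  intros x; apply Rcont_mult; [apply Rcont_const|apply Ht]. }
rewrite (rho_minus r), (rho_scal r) in Z; auto; [lra|apply cc1_scal; auto].
Qed.

(** Both variables are integrated out one after the other; the density [exp (-
    2 tau)] is the inverse of the factor in [rho]. *)
Lemma haar_iwasawa r w : 1 <= r -> cc2 r w ->
  mu2 w = rho tent * RInt (fun t => exp (- (2 * t)) * RInt (fun u => w u t) (- r) r) (- r) r.
Proof.
intros Hr Hw. rewrite (mu2_integrate_u r w Hr Hw).
rewrite <- (rho_lebesgue r); auto.
- unfold rho. apply mu2_ext. intros u t. f_equal.
  rewrite <- Rmult_assoc, <- exp_plus.
  replace (2 * t + - (2 * t)) with 0 by ring. rewrite exp_0, Rmult_1_l. reflexivity.
- split.
  + intros t. apply Rcont_mult; [|eapply cc2_int_cont; eauto].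
    apply exp_cont, Rcont_opp, Rcont_mult; [apply Rcont_const|apply Rcont_id].
  + intros t H. apply Rnot_lt_le. intros Ht. apply H. rewrite RInt_zero; [ring|].
    intros x _. apply (cc2_zero r); auto.
Qed.

Lemma Cc_real_bound (F : SL2 -> R) : Cc F -> exists M, 0 <= M /\ forall x, Rabs (F x) <= M.
Proof.
intros HF. destruct (Cc_bounded F HF) as [B HB]. destruct HF as [Hc _].
destruct (SL2_lebesgue_number (fun x d => forall y, mdist x y < d -> Rabs (F y) <= / d) B)
  as (d & Hd & H).
{ intros x. specialize (Hc x). rewrite continuous_Rle_abs in Hc.
  specialize (Hc 1 Rlt_0_1). apply locally_SL2 in Hc. destruct Hc as (r & Hr & Hc).
  set (m := Rabs (F x) + 1). assert (Hm : 0 < m) by (unfold m; generalize (Rabs_pos (F x)); lra).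
  exists (Rmin r (/ m)). assert (Hi : 0 < / m) by (apply Rinv_0_lt_compat; auto).
  assert (Hp : 0 < Rmin r (/ m)) by (apply Rmin_glb_lt; auto).
  split; auto. intros y Hy. apply Rle_trans with m.
  - assert (K := Hc y (Rlt_le_trans _ _ _ Hy (Rmin_l _ _))).
    assert (T := Rabs_triang_inv (F y) (F x)). unfold m. lra.
  - rewrite <- (Rinv_inv m) at 1. apply Rinv_le_contravar; auto. apply Rmin_r. }
assert (Hi : 0 < / d) by (apply Rinv_0_lt_compat; auto).
exists (/ d). split; [lra|]. intros y.
destruct (Rle_dec (mnorm y) B) as [Hy|Hy].
- destruct (H y Hy) as (x & r & Hg & Hr & Hxy).
  eapply Rle_trans; [apply (Hg y Hxy)|]. apply Rinv_le_contravar; auto.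
- assert (Z : F y = 0) by (apply NNPP; intros Hz; apply Hy, HB, Hz).
  rewrite Z, Rabs_R0. lra.
Qed.

Lemma an_coords_bound y B : mnorm (an_part y) <= B ->
  Rabs (tau_of y) <= B /\ Rabs (u_of y) <= B * B.
Proof.
intros H. unfold mnorm in H; simpl in H.
rewrite Rabs_mult, Rabs_R0, !(Rabs_pos_eq (exp _)) in H by (left; apply exp_pos).
assert (P1 := exp_pos (tau_of y)). assert (P2 := exp_pos (- tau_of y)).
assert (P3 := Rabs_pos (u_of y)).
assert (0 <= Rabs (u_of y) * exp (- tau_of y)) by (apply Rmult_le_pos; lra).
assert (E1 := exp_ineq1_le (tau_of y)). assert (E2 := exp_ineq1_le (- tau_of y)).
split; [apply Rabs_le; lra|].
replace (Rabs (u_of y)) with ((Rabs (u_of y) * exp (- tau_of y)) * exp (tau_of y)).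
- apply Rmult_le_compat; lra.
- rewrite Rmult_assoc, <- exp_plus, Rplus_opp_l, exp_0. ring.
Qed.

(** Were the constant [0], the Haar functional would vanish on a continuous
    function that dominates any given one with compact support, and so vanish
    identically. *)
Lemma haar_constant_pos : 0 < rho tent.
Proof.
assert (H0 : 0 <= rho tent).
{ apply (pf_pos _ _ _ HP); [apply (cc2_Cc 1 (fun u t => tent u * (exp (2 * t) * tent t))), rho_dom;
    [lra|apply tent_cc1; lra]|].
  intros y. apply Rmult_le_pos; [apply tent_pos|].
  apply Rmult_le_pos; [left; apply exp_pos|apply tent_pos]. }
destruct H0 as [H0|H0]; auto. exfalso.
assert (Hmu' := Hmu); destruct Hmu' as (_ & _ & _ & _ & _ & F & HF & Hne). apply Hne.
destruct (Cc_real_bound F HF) as (M & HM & HMb).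
destruct (Cc_bounded F HF) as [B HB].
set (B' := 4 * Rabs B + 1). set (r := B' * B' + B').
assert (HB' : 1 <= B') by (unfold B'; generalize (Rabs_pos B); lra).
assert (Hr : 1 <= r) by (unfold r; nra).
set (kf := fun t => Rmax 0 (r + 1 - Rabs t)).
assert (Hkc : forall (T : UniformSpace) (f : T -> R) x, Rcts f x ->
  Rcts (fun t => kf (f t)) x).
{ intros T f x Hf. apply Rmax_cont, Rcont_minus; [apply Rcont_const|].
  apply (Rcont_comp _ f Rabs); auto. apply Rcontinuity_abs. }
assert (Hks : forall t, kf t <> 0 -> Rabs t <= r + 1).
{ intros t H. apply Rnot_lt_le. intros Ht. apply H. apply Rmax_left. lra. }
assert (Hk2 : cc2 (r + 1) (fun u t => kf u * kf t)).
{ split.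
  - intros u t. apply Rcont_mult; [apply (Hkc _ (fun z : R * R => fst z)), continuous_fst
      |apply (Hkc _ (fun z : R * R => snd z)), continuous_snd].
  - intros u t H. split; apply Hks; intros E; apply H; rewrite E; as_R; ring. }
assert (Z : mu2 (fun u t => kf u * kf t) = 0).
{ rewrite (haar_iwasawa (r + 1)) by (auto; lra). rewrite <- H0. ring. }
apply Rabs_eq_0. apply Rle_antisym; [|apply Rabs_pos].
replace 0 with (M * mu2 (fun u t => kf u * kf t)) by (rewrite Z; ring).
unfold mu2. rewrite <- (pf_scal _ _ _ HP) by apply (cc2_Cc (r + 1) _ Hk2).
apply (pf_abs SL2 Cc mu HP); auto.
- apply (pf_scal_dom _ _ _ HP). apply (cc2_Cc (r + 1) _ Hk2).
- intros y. destruct (Req_dec (F y) 0) as [E|E].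
  + rewrite E, Rabs_R0. apply Rmult_le_pos; auto. apply Rmult_le_pos; apply Rmax_l.
  + assert (Hy := HB y E). assert (Hn := mnorm_an_rev y).
    destruct (an_coords_bound y B') as [Ht Hu].
    { unfold B'. assert (K := Rle_abs B). lra. }
    assert (K1 : 1 <= kf (u_of y)) by (eapply Rle_trans; [|apply Rmax_r]; unfold r; nra).
    assert (K2 : 1 <= kf (tau_of y)) by (eapply Rle_trans; [|apply Rmax_r]; unfold r; nra).
    eapply Rle_trans; [apply HMb|]. rewrite <- (Rmult_1_r M) at 1.
    apply Rmult_le_compat_l; auto. nra.
Qed.

End AN.

Open Scope C_scope.

(** * Characters as Laplace transforms *)

Lemma lip_cs_dom L B F (e : SL2 -> C) : lip_cs L B F ->
  (forall y, Ccts e y) ->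
  pfC_dom SL2 Cc (fun y => F y * e y).
Proof.
intros (HL & HB & Hlip & Hs) He. apply (pfC_dom_intro _ B).
- intros y. apply Ccont_mult; [apply (SL2_lip_Ccont F L Hlip)|apply He].
- intros y Hy. apply Hs. intros E. apply Hy. rewrite E; ring.
Qed.

Lemma basis_opp delta s j x :
  basis delta s j (SL2_opp x) = M_char delta true * basis delta s j x.
Proof. apply (principal_series_m delta s), basis_principal. Qed.

Lemma basis_cont delta s j y : Ccts (basis delta s j) y.
Proof. apply smooth_cont, (proj1 (basis_principal delta s j)). Qed.

(** The diagonal matrix coefficient of the operator of [F]: translating the
    variable by the central element and conjugating it by [K] replaces [F] by its
    averages. *)
Lemma operator_diagonal mu (Hmu : is_haar mu) delta s L B F j th : lip_cs L B F ->
  ps_op mu F (basis delta s j) (elt_k th) * Cconj (basis delta s j (elt_k th)) =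
  haar_int mu (fun y => central_part delta F (conj_k th y) * basis delta s j y).
Proof.
intros HF.
assert (HP := haar_positive mu Hmu).
set (e := basis delta s j).
assert (Ce : forall y, Ccts (fun y => e (SL2_mul (elt_k th) y)) y).
{ intros y. apply (continuous_comp (SL2_mul (elt_k th)) e);
    [apply SL2_mul_l_cont|apply basis_cont]. }
assert (HG := central_part_lip_cs delta L B F HF).
assert (D1 := lip_cs_dom _ _ _ _ HF Ce). assert (D2 := lip_cs_dom _ _ _ _ HG Ce).
assert (E1 : haar_int mu (fun y => F y * e (SL2_mul (elt_k th) y)) =
  haar_int mu (fun y => central_part delta F y * e (SL2_mul (elt_k th) y))).
{ set (F' := fun y => F (SL2_opp y)).
  assert (HF' : lip_cs L B F').
  { destruct HF as (HL & HB & Hlip & Hs). split; [|split; [|split]]; auto.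
    - intros x y. unfold F'. rewrite <- (mdist_opp x y). apply Hlip.
    - intros x Hx. rewrite <- mnorm_opp. apply Hs, Hx. }
  assert (D3 := lip_cs_dom _ _ _ _ HF' Ce).
  assert (E2 : haar_int mu (fun y => M_char delta true * (F' y * e (SL2_mul (elt_k th) y))) =
    haar_int mu (fun y => F y * e (SL2_mul (elt_k th) y))).
  { rewrite <- (haar_int_left mu Hmu (elt_m true) _ D1). apply haar_int_ext. intros y.
    change (SL2_mul (elt_m true) y) with (SL2_opp y).
    rewrite SL2_opp_mul_r. unfold e. rewrite basis_opp. unfold F'. ring. }
  rewrite (haar_int_ext mu (fun y => central_part delta F y * e (SL2_mul (elt_k th) y))
    (fun y => / 2 * (F y * e (SL2_mul (elt_k th) y) +
      M_char delta true * (F' y * e (SL2_mul (elt_k th) y)))))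
    by (intros; unfold central_part, F'; ring).
  assert (D4 := pfC_scal_dom SL2 Cc mu HP (M_char delta true) _ D3).
  rewrite haar_int_scal; auto; [|apply (pfC_plus_dom SL2 Cc mu HP); auto].
  assert (E3 := pfC_plus SL2 Cc mu HP _ _ D1 D4).
  change (pfC SL2 mu) with (haar_int mu) in E3. rewrite E3, E2.
  field. }
change (ps_op mu F e (elt_k th)) with (haar_int mu (fun y => F y * e (SL2_mul (elt_k th) y))).
rewrite E1.
set (G := central_part delta F) in *.
set (H := fun y => G y * e (SL2_mul (elt_k th) y)).
assert (D5 : pfC_dom SL2 Cc (fun y => H (SL2_mul (elt_k (- th)) y))).
{ destruct HG as (HL & HB & Hlip & Hs). apply (pfC_dom_intro _ (4 * B)).
  - intros y. apply (continuous_comp (SL2_mul (elt_k (- th))) H); [apply SL2_mul_l_cont|].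
    apply Ccont_mult; [apply (SL2_lip_Ccont G L Hlip)|apply Ce].
  - intros y Hy.
    assert (Hy' : G (SL2_mul (elt_k (- th)) y) <> 0).
    { intros E. apply Hy. unfold H. rewrite E; ring. }
    apply Hs in Hy'.
    assert (Ey : y = SL2_mul (elt_k th) (SL2_mul (elt_k (- th)) y)).
    { rewrite <- SL2_mul_assoc, elt_k_plus, Rplus_opp_r, elt_k_0, SL2_mul_1_l. reflexivity. }
    rewrite Ey. eapply Rle_trans; [apply mnorm_mul|].
    apply Rmult_le_compat; auto using mnorm_pos, mnorm_k. }
change (haar_int mu (fun y => G y * e (SL2_mul (elt_k th) y))) with (haar_int mu H).
rewrite <- (haar_int_left mu Hmu (elt_k (- th)) H D2).
rewrite <- (haar_int_right mu Hmu (elt_k th) _ D5).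
assert (D6 : pfC_dom SL2 Cc (fun y => G (conj_k th y) * e y)).
{ apply (gf_dom _ _ _ e (conj_family L B G HG) (basis_cont delta s j)). }
rewrite (haar_int_ext mu _ (fun y => cis (weight delta j * th) * (G (conj_k th y) * e y))).
- rewrite haar_int_scal by auto. unfold e at 2. rewrite basis_k.
  transitivity (cis (weight delta j * th) * Cconj (cis (weight delta j * th)) *
    haar_int mu (fun y => G (conj_k th y) * e y)); [ring|].
  rewrite cis_conj. ring.
- intros y. unfold H.
  assert (E4 : SL2_mul (elt_k th) (SL2_mul (elt_k (- th)) (SL2_mul y (elt_k th))) =
    SL2_mul y (elt_k th)).
  { rewrite <- SL2_mul_assoc, elt_k_plus, Rplus_opp_r, elt_k_0, SL2_mul_1_l. reflexivity. }
  rewrite E4. unfold e. rewrite basis_right_k. unfold conj_k.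
  rewrite SL2_mul_assoc. ring.
Qed.

Lemma operator_coefficient mu (Hmu : is_haar mu) delta s L B F j : lip_cs L B F ->
  inner (ps_op mu F (basis delta s j)) (basis delta s j) =
  haar_int mu (fun y => k_average (central_part delta F) y * basis delta s j y).
Proof.
intros HF. rewrite inner_CInt.
assert (HG := central_part_lip_cs delta L B F HF).
assert (HC := conj_family L B _ HG).
rewrite (CInt_ext _ (fun th => haar_int mu (fun y =>
  central_part delta F (conj_k th y) * basis delta s j y)))
  by (intros; apply (operator_diagonal mu Hmu delta s L B F); auto).
rewrite <- (gf_fubini mu Hmu _ _ _ (basis delta s j) HC (basis_cont delta s j)).
rewrite <- haar_int_scal; auto.
- apply haar_int_ext. intros y. unfold k_average. ring.
- apply (gf_int_dom _ _ _ (basis delta s j) HC (basis_cont delta s j)).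
Qed.

(** The trace formula: the averages of [F] are those under which the diagonal
    matrix coefficients are unchanged. *)
Lemma character_value mu (Hmu : is_haar mu) delta s Th F :
  is_character mu delta s Th -> Cc_infty F ->
  Th F = haar_int mu (fun y => k_average (central_part delta F) (an_part y) * an_power s y).
Proof.
intros HT HF. destruct (Cc_infty_lip_cs F HF) as (L & B & HLB).
assert (HG := central_part_lip_cs delta L B F HLB).
apply (trace_of_coefficients mu Hmu delta s _ _ _ (k_average_lip_cs L B _ HG)).
- intros x. apply (k_average_opp delta L B); auto. apply central_part_opp.
- assert (HS := HT F HF _ (basis_orthonormal delta s)).
  rewrite <- (functional_extensionality _ _
    (fun j => operator_coefficient mu Hmu delta s L B F j HLB)).
  exact HS.
Qed.

(** ** The Abel transform *)

Lemma ut_det (x t : R) : (exp t * exp (- t) - x * 0 = 1)%R.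
Proof. rewrite <- exp_plus, Rplus_opp_r, exp_0. ring. Qed.

Definition ut (x t : R) : SL2 := mkSL2 _ _ _ _ (ut_det x t).

Lemma pm_ut u t : pm u t = ut (u * exp (- t)) t.
Proof. apply SL2_eq; reflexivity. Qed.

(** The two triangular matrices have the same eigenvalues in the opposite order;
    a rotation that sends the first basis vector to the second eigenvector
    conjugates one to the other, and preserves the difference of the off-diagonal
    entries.  This is the action of the Weyl group. *)
Lemma ut_conj (x t : R) : exists th, conj_k th (ut x t) = ut x (- t).
Proof.
set (a := exp t). set (b := exp (- t)).
destruct (Req_dec (x * x + (a - b) * (a - b)) 0) as [Hz|Hnz].
- assert (Hab : a = b) by nra.
  exists 0%R. unfold conj_k. rewrite Ropp_0, elt_k_0, SL2_mul_1_l, SL2_mul_1_r.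
  unfold a, b in Hab. apply SL2_eq; simpl; rewrite ?Ropp_involutive, <- ?Hab; auto.
- set (n := sqrt (x * x + (a - b) * (a - b))).
  assert (Hp : (0 < x * x + (a - b) * (a - b))%R).
  { assert (Q1 := Rle_0_sqr x). assert (Q2 := Rle_0_sqr (a - b)). unfold Rsqr in *. lra. }
  assert (Hn : (0 < n)%R) by (apply sqrt_lt_R0; auto).
  assert (Hnn : (n * n = x * x + (a - b) * (a - b))%R) by (apply sqrt_sqrt; lra).
  destruct (angle_exists (x / n) ((a - b) / n)) as (th & Hc & Hs).
  { transitivity ((x * x + (a - b) * (a - b)) / (n * n))%R; [field; lra|].
    rewrite <- Hnn. field. lra. }
  exists th.
  assert (Hrel : (sin th * x = cos th * (a - b))%R) by (rewrite <- Hc, <- Hs; field; lra).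
  assert (H1 : (sin th * sin th + cos th * cos th = 1)%R)
    by (generalize (sin2_cos2 th); unfold Rsqr; lra).
  unfold conj_k. apply SL2_eq; simpl; rewrite ?cos_neg, ?sin_neg, ?Ropp_involutive;
    fold a b.
  + transitivity (a * (cos th * cos th) + b * (sin th * sin th) - cos th * (sin th * x))%R; [ring|].
    rewrite Hrel. transitivity (b * (sin th * sin th + cos th * cos th))%R; [ring|].
    rewrite H1; ring.
  + transitivity (sin th * (cos th * (a - b)) + x * (cos th * cos th))%R; [ring|].
    rewrite <- Hrel. transitivity (x * (sin th * sin th + cos th * cos th))%R; [ring|].
    rewrite H1; ring.
  + transitivity (sin th * (cos th * (a - b)) - sin th * (sin th * x))%R; [ring|].
    rewrite Hrel; ring.
  + transitivity (a * (sin th * sin th) + cos th * (sin th * x) + b * (cos th * cos th))%R; [ring|].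
    rewrite Hrel. transitivity (a * (sin th * sin th + cos th * cos th))%R; [ring|].
    rewrite H1; ring.
Qed.

Lemma CInt_support (f : R -> C) (a b : R) : (0 <= b <= a)%R -> (forall x, RCcontinuous f x) ->
  (forall x, f x <> 0 -> (Rabs x <= b)%R) -> CInt f (- a) a = CInt f (- b) b.
Proof.
intros Hab Hc Hs.
rewrite <- (CInt_Chasles f (- a) (- b) a), <- (CInt_Chasles f (- b) b a) by auto.
rewrite (CInt_ext f (fun _ => 0) (- a) (- b)), (CInt_ext f (fun _ => 0) b a), !CInt_const.
- ring.
- intros x. rewrite Rmin_left, Rmax_right by lra. intros Hx.
  apply NNPP. intros H. apply Hs in H. rewrite Rabs_pos_eq in H; lra.
- intros x. rewrite Rmin_left, Rmax_right by lra. intros Hx.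
  apply NNPP. intros H. apply Hs in H. rewrite Rabs_left in H; lra.
Qed.

Section Abel.

Variables (L B : R) (H : SL2 -> C).
Hypothesis HH : lip_cs L B H.

Lemma ut_support x t : H (ut x t) <> 0 -> (Rabs x <= B)%R /\ (Rabs t <= B)%R.
Proof.
intros Hx. destruct HH as (_ & _ & _ & Hs). apply Hs in Hx.
unfold mnorm in Hx; simpl in Hx.
rewrite Rabs_R0, !(Rabs_pos_eq (exp _)) in Hx by (left; apply exp_pos).
assert (P1 := exp_pos t). assert (P2 := exp_pos (- t)). assert (P3 := Rabs_pos x).
assert (E1 := exp_ineq1_le t). assert (E2 := exp_ineq1_le (- t)).
split; [lra|apply Rabs_le; lra].
Qed.

Lemma ut_cont (T : UniformSpace) (f g : T -> R) z :
  Rcts f z -> Rcts g z ->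
  Ccts (fun z => H (ut (f z) (g z))) z.
Proof.
intros Hf Hg. apply (continuous_comp (fun z => ut (f z) (g z)) H).
- apply SL2_pair_cont; simpl; [apply exp_cont, Hg|exact Hf|apply Rcont_const
    |apply exp_cont, Rcont_opp, Hg].
- destruct HH as (_ & _ & Hlip & _). apply (SL2_lip_Ccont H L Hlip).
Qed.

Lemma ut_cont_x t x : RCcontinuous (fun x => H (ut x t)) x.
Proof. apply (ut_cont _ (fun x => x) (fun _ => t)); [apply Rcont_id|apply Rcont_const]. Qed.

Definition abel (t : R) : C := CInt (fun x => H (ut x t)) (- B) B.

Lemma abel_support t : abel t <> 0 -> (Rabs t <= B)%R.
Proof.
intros Ht. apply Rnot_lt_le. intros Hlt. apply Ht. unfold abel.
rewrite (CInt_ext _ (fun _ => 0)), CInt_const; [ring|].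
intros x _. apply NNPP. intros Hx. apply ut_support in Hx. lra.
Qed.

Lemma exp_lip (m a b : R) : (a <= m)%R -> (b <= m)%R ->
  (Rabs (exp a - exp b) <= exp m * Rabs (a - b))%R.
Proof.
assert (G : forall a b, (b <= a)%R -> (a <= m)%R ->
  (Rabs (exp a - exp b) <= exp m * Rabs (a - b))%R).
{ intros x y Hyx Hx.
  destruct (MVT_gen exp y x exp) as (c & Hc & E).
  - intros z _. apply is_derive_exp.
  - intros z _. apply derivable_continuous_pt, derivable_pt_exp.
  - rewrite Rmin_left, Rmax_right in Hc by lra. rewrite E, Rabs_mult.
    apply Rmult_le_compat_r; [apply Rabs_pos|].
    rewrite Rabs_pos_eq by (left; apply exp_pos). apply exp_mono. lra. }
intros Ha Hb. destruct (Rle_dec b a) as [Hba|Hba]; [apply G; auto|].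
rewrite Rabs_minus_sym, (Rabs_minus_sym a). apply G; lra.
Qed.

Lemma abel_lip : exists K, (0 <= K)%R /\ forall t h, (Rabs h <= 1)%R ->
  (Cmod (abel (t + h) - abel t) <= K * Rabs h)%R.
Proof.
assert (HH' := HH). destruct HH' as (HL & HB & Hlip & Hs).
set (m := (B + 2)%R).
assert (Hm := exp_pos m).
exists ((B - - B) * (L * (2 * exp m)))%R.
split; [repeat apply Rmult_le_pos; lra|].
intros t h Hh. assert (Hhp := Rabs_pos h).
assert (HC := ut_cont_x).
unfold abel. rewrite <- CInt_minus by auto. rewrite Rmult_assoc.
apply CInt_bound_const; [lra| |].
- intros x. apply Ccont_minus; auto.
- intros x _. destruct (Rle_dec (Rabs t) (B + 1)) as [Ht|Ht].
  + eapply Rle_trans; [apply Hlip|]. rewrite Rmult_assoc.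
    apply Rmult_le_compat_l; auto. unfold mdist; simpl.
    rewrite !Rminus_diag, Rabs_R0.
    apply Rabs_le_between in Ht. apply Rabs_le_between in Hh.
    assert (E1 := exp_lip m (t + h) t ltac:(unfold m; lra) ltac:(unfold m; lra)).
    assert (E2 := exp_lip m (- (t + h)) (- t) ltac:(unfold m; lra) ltac:(unfold m; lra)).
    replace (t + h - t)%R with h in E1 by ring.
    replace (- (t + h) - - t)%R with (- h)%R in E2 by ring. rewrite Rabs_Ropp in E2.
    lra.
  + assert (T := Rabs_triang_inv t (- h)). rewrite Rabs_Ropp in T.
    replace (t - - h)%R with (t + h)%R in T by ring.
    assert (Z : forall u, (B < Rabs u)%R -> H (ut x u) = 0).
    { intros u Hu. apply NNPP. intros Hx. apply ut_support in Hx. lra. }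
    rewrite !Z by lra. replace (0 - 0) with (RtoC 0) by ring. rewrite Cmod_0.
    repeat apply Rmult_le_pos; lra.
Qed.

Hypothesis Hconj : forall th x, H (conj_k th x) = H x.

(** Invariance under [K] lets [ut x t] be replaced by [ut x (- t)]. *)
Lemma abel_even t : abel (- t) = abel t.
Proof.
unfold abel. apply CInt_ext. intros x _.
destruct (ut_conj x t) as [th Hth]. rewrite <- Hth. apply Hconj.
Qed.

End Abel.

Lemma lip1_RCcontinuous (A : R -> C) (K : R) : (0 <= K)%R ->
  (forall t h, (Rabs h <= 1)%R -> (Cmod (A (t + h)%R - A t) <= K * Rabs h)%R) ->
  forall t, RCcontinuous A t.
Proof.
intros HK H t. apply Ccontinuous_iff. intros e He.
assert (Hd : (0 < Rmin 1 (e / (K + 1)))%R)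
  by (apply Rmin_glb_lt; [lra|apply Rdiv_lt_0_compat; lra]).
exists (mkposreal _ Hd). intros y Hy. change (Rabs (y - t) < Rmin 1 (e / (K + 1)))%R in Hy.
assert (H1 := Rlt_le_trans _ _ _ Hy (Rmin_l _ _)).
assert (H2 := Rlt_le_trans _ _ _ Hy (Rmin_r _ _)).
assert (H3 := H t (y - t)%R ltac:(lra)).
rewrite (Rplus_minus t y) in H3.
clear_denominator H2 (K + 1)%R.
assert (Hp := Rabs_pos (y - t)). nra.
Qed.

(** Iwasawa coordinates and the substitution [x = u exp (- tau)]. *)
Lemma haar_abel mu (Hmu : is_haar mu) s L B H : (1 <= B)%R -> lip_cs L B H ->
  haar_int mu (fun y => H (an_part y) * an_power s y) =
  rho mu tent * CInt (fun t => Cexp (s * t) * abel B H t) (- B) B.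
Proof.
intros HB1 HH.
set (r := (B * exp B)%R).
assert (HeB := exp_ineq1_le B).
assert (HBr : (B <= r)%R) by (unfold r; nra).
set (w := fun u t : R => H (pm u t) * Cexp ((1 + s) * t)).
assert (Cw : forall (f g : R * R -> R) z, Rcts f z ->
  Rcts g z ->
  Ccts (fun z => w (f z) (g z)) z).
{ intros f g z Hf Hg. unfold w. apply Ccont_mult.
  - apply (continuous_ext (fun z => H (ut (f z * exp (- g z)) (g z)))).
    { intros x. rewrite <- pm_ut. reflexivity. }
    apply (ut_cont L B H HH); [|exact Hg].
    apply Rcont_mult; [exact Hf|apply exp_cont, Rcont_opp, Hg].
  - apply Ccont_Cexp, Ccont_mult; [apply Ccont_const|apply Ccont_RtoC, Hg]. }
assert (Sw : forall u t, w u t <> 0 -> (Rabs u <= r)%R /\ (Rabs t <= B)%R).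
{ intros u t Hw. assert (Hh : H (ut (u * exp (- t)) t) <> 0).
  { rewrite <- pm_ut. intros E. apply Hw. unfold w. rewrite E; ring. }
  apply (ut_support L B H HH) in Hh. destruct Hh as [H1 H2]. split; auto.
  rewrite Rabs_mult, (Rabs_pos_eq (exp _)) in H1 by (left; apply exp_pos).
  unfold r. replace (Rabs u) with ((Rabs u * exp (- t)) * exp t)%R.
  - apply Rmult_le_compat; auto.
    + apply Rmult_le_pos; [apply Rabs_pos|left; apply exp_pos].
    + left; apply exp_pos.
    + apply exp_mono. assert (K := Rle_abs t). lra.
  - rewrite Rmult_assoc, <- exp_plus, Rplus_opp_l, exp_0. ring. }
assert (WR : cc2 r (fun u t => Re (w u t))).
{ split.
  - intros u t. apply (proj1 (Ccont_pair _ _ _) (Cw fst snd (u, t)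
      (continuous_fst _ _) (continuous_snd _ _))).
  - intros u t Hz. destruct (Sw u t); [intros E; apply Hz; rewrite E; reflexivity|split; lra]. }
assert (WI : cc2 r (fun u t => Im (w u t))).
{ split.
  - intros u t. apply (proj1 (Ccont_pair _ _ _) (Cw fst snd (u, t)
      (continuous_fst _ _) (continuous_snd _ _))).
  - intros u t Hz. destruct (Sw u t); [intros E; apply Hz; rewrite E; reflexivity|split; lra]. }
assert (Cu : forall t u, RCcontinuous (fun u => w u t) u).
{ intros t u. apply Ccont_pair. split; [apply (cc2_cont_u r _ t u WR)|apply (cc2_cont_u r _ t u WI)]. }
assert (CI : forall t, RCcontinuous (fun t => Cexp (- (2 * t)) * CInt (fun u => w u t) (- r) r) t).
{ intros t. apply Ccont_mult.
  - apply (continuous_ext (fun t : R => Cexp (RtoC (- (2 * t))))).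
    { intros x. rewrite RtoC_opp, RtoC_mult. reflexivity. }
    apply Ccont_Cexp, Ccont_RtoC, Rcont_opp, Rcont_mult; [apply Rcont_const|apply Rcont_id].
  - apply (continuous_ext (fun t => (RInt (fun u => Re (w u t)) (- r) r,
      RInt (fun u => Im (w u t)) (- r) r))).
    { intros x. symmetry. apply CInt_pair, Cu. }
    apply Ccont_pair. split; simpl; [apply (cc2_int_cont r _ _ _ t WR)|apply (cc2_int_cont r _ _ _ t WI)]. }
assert (E1 : haar_int mu (fun y => H (an_part y) * an_power s y) =
  rho mu tent * CInt (fun t => Cexp (- (2 * t)) * CInt (fun u => w u t) (- r) r) (- r) r).
{ assert (ER := haar_iwasawa mu Hmu r _ ltac:(lra) WR).
  assert (EI := haar_iwasawa mu Hmu r _ ltac:(lra) WI).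
  rewrite CInt_pair by auto. unfold haar_int.
  change (mu (fun y => Re (H (an_part y) * an_power s y))) with (mu2 mu (fun u t => Re (w u t))).
  change (mu (fun y => Im (H (an_part y) * an_power s y))) with (mu2 mu (fun u t => Im (w u t))).
  rewrite ER, EI.
  assert (Ex : forall t : R, Cexp (- (2 * t)) * CInt (fun u => w u t) (- r) r =
    (exp (- (2 * t)) * RInt (fun u => Re (w u t)) (- r) r,
     exp (- (2 * t)) * RInt (fun u => Im (w u t)) (- r) r)%R).
  { intros t. rewrite CInt_pair by apply Cu.
    rewrite <- RtoC_mult, <- RtoC_opp, Cexp_RtoC.
    apply Ceq; unfold Re, Im; simpl; ring. }
  apply Ceq.
  - transitivity (rho mu tent * RInt (fun t => Re (Cexp (- (2 * t)) * CInt (fun u => w u t) (- r) r)) (- r) r)%R.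
    + apply (f_equal (Rmult (rho mu tent))), RInt_eq. intros t.
      exact (eq_sym (f_equal Re (Ex t))).
    + unfold Re, Im; simpl. ring.
  - transitivity (rho mu tent * RInt (fun t => Im (Cexp (- (2 * t)) * CInt (fun u => w u t) (- r) r)) (- r) r)%R.
    + apply (f_equal (Rmult (rho mu tent))), RInt_eq. intros t.
      exact (eq_sym (f_equal Im (Ex t))).
    + unfold Re, Im; simpl. ring. }
rewrite E1. f_equal.
assert (HL := HH). destruct HL as (HL & HB0 & _ & _).
assert (Ein : forall t : R, Cexp (- (2 * t)) * CInt (fun u => w u t) (- r) r =
  Cexp (s * t) * abel B H t).
{ intros t. destruct (Rle_dec (Rabs t) B) as [Ht|Ht].
  - assert (Et := exp_pos (- t)).
    unfold w. rewrite (CInt_ext _ (fun u => Cexp ((1 + s) * t) *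
      (fun x => H (ut x t)) (exp (- t) * u + 0)%R)).
    2: { intros u _. rewrite pm_ut, Rplus_0_r, (Rmult_comm u). ring. }
    rewrite CInt_scal.
    2: { intros u. apply (continuous_comp (fun u => exp (- t) * u + 0)%R (fun x => H (ut x t))).
         - apply Rcont_lin.
         - apply (ut_cont_x L B H HH). }
    assert (EL := CInt_comp_lin (fun x => H (ut x t)) (exp (- t)) 0 (- r) r
      (ut_cont_x L B H HH t)).
    rewrite !Rplus_0_r in EL.
    replace (exp (- t) * - r)%R with (- (exp (- t) * r))%R in EL by ring.
    rewrite (CInt_support (fun x => H (ut x t)) (exp (- t) * r) B) in EL.
    + fold (abel B H t) in EL. rewrite <- EL, <- Cexp_RtoC.
      transitivity (Cexp (- (2 * t)) * Cexp ((1 + s) * t) *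
        CInt (fun u => (fun x => H (ut x t)) (exp (- t) * u + 0)%R) (- r) r); [ring|].
      transitivity (Cexp (s * t) * Cexp (- t)%R *
        CInt (fun u => (fun x => H (ut x t)) (exp (- t) * u + 0)%R) (- r) r); [|ring].
      rewrite <- !Cexp_plus. do 2 f_equal. rewrite RtoC_opp. ring.
    + split; auto. unfold r.
      assert (exp (- B) <= exp (- t))%R.
      { apply exp_mono. assert (K := Rle_abs t). lra. }
      assert (E0 : (exp (- B) * exp B = 1)%R) by (rewrite <- exp_plus, Rplus_opp_l; apply exp_0).
      assert (P := exp_pos B).
      replace (exp (- t) * (B * exp B))%R with (B * (exp (- t) * exp B))%R by ring.
      rewrite <- (Rmult_1_r B) at 1. apply Rmult_le_compat_l; auto.
      rewrite <- E0. apply Rmult_le_compat_r; lra.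
    + apply (ut_cont_x L B H HH).
    + intros x Hx. apply (ut_support L B H HH) in Hx. apply Hx.
  - assert (Za : abel B H t = 0).
    { apply NNPP. intros Hz. apply (abel_support L B H HH) in Hz. lra. }
    rewrite Za, (CInt_ext _ (fun _ => 0)), CInt_const; [ring|].
    intros u _. apply NNPP. intros Hz. apply Sw in Hz. lra. }
rewrite (CInt_ext _ (fun t => Cexp (s * t) * abel B H t)) by (intros; apply Ein).
apply CInt_support; [lra| |].
- intros t. destruct (abel_lip L B H HH) as (K & HK & Hl).
  apply Ccont_mult; [|apply (lip1_RCcontinuous _ K); auto].
  apply Ccont_Cexp, Ccont_mult; [apply Ccont_const|apply Ccont_RtoC, Rcont_id].
- intros t Ht. apply (abel_support L B H HH). intros E. apply Ht. rewrite E; ring.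
Qed.

Lemma lip_cs_enlarge L B B' F : (B <= B')%R -> lip_cs L B F -> lip_cs L B' F.
Proof.
intros Hle (HL & HB & Hlip & Hs). split; [|split; [|split]]; auto; [lra|].
intros x Hx. specialize (Hs x Hx). lra.
Qed.

(** The characters of the principal series with a given [delta] are the values
    at [s] of one Laplace transform, whose density is even, Lipschitz and of
    compact support: this makes them entire and even in [s], and decaying on
    vertical strips. *)
Definition laplace_density (r K : R) (A : R -> C) : Prop :=
  (0 < r)%R /\ (0 <= K)%R /\ (forall t, A (- t)%R = A t) /\
  (forall t h, (Rabs h <= 1)%R -> (Cmod (A (t + h)%R - A t) <= K * Rabs h)%R) /\
  (forall t, A t <> 0 -> (Rabs t <= r)%R).

Definition laplace (r : R) (A : R -> C) (s : C) : C :=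
  CInt (fun t => Cexp (s * t) * A t) (- r) r.

Lemma character_laplace mu (Hmu : is_haar mu) delta (Th : C -> (SL2 -> C) -> C) F :
  (forall s, is_character mu delta s (Th s)) -> Cc_infty F ->
  exists r K A, laplace_density r K A /\ forall s, Th s F = laplace r A s.
Proof.
intros HT HF. destruct (Cc_infty_lip_cs F HF) as (L0 & B0 & HLB).
assert (HG := central_part_lip_cs delta L0 B0 F HLB).
assert (HA := k_average_lip_cs L0 B0 _ HG).
set (H := k_average (central_part delta F)) in *.
set (B := (16 * B0 + 1)%R).
assert (HB0 : (0 <= B0)%R) by apply HLB.
assert (HH := lip_cs_enlarge (16 * L0) (16 * B0) B H ltac:(unfold B; lra) HA).
destruct (abel_lip _ _ _ HH) as (K & HK & Hl).
set (c := rho mu tent).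
assert (Hc := haar_constant_pos mu Hmu). fold c in Hc.
exists B, (c * K)%R, (fun t => c * abel B H t). split.
- split; [unfold B; lra|]. split; [nra|]. split; [|split].
  + intros t. apply (f_equal (Cmult c)). apply (abel_even B H). intros th x. apply (k_average_conj L0 B0); auto.
  + intros t h Hh.
    replace (c * abel B H (t + h)%R - c * abel B H t)
      with (c * (abel B H (t + h)%R - abel B H t)) by ring.
    rewrite Cmod_mult, Cmod_R, Rabs_pos_eq, Rmult_assoc by lra.
    apply Rmult_le_compat_l; [lra|apply Hl, Hh].
  + intros t Ht. apply (abel_support _ _ _ HH). intros E. apply Ht. rewrite E; ring.
- intros s. rewrite (character_value mu Hmu delta s (Th s) F (HT s) HF). fold H.
  rewrite (haar_abel mu Hmu s _ B H ltac:(unfold B; lra) HH). fold c. unfold laplace.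
  rewrite <- CInt_scal.
  + apply CInt_ext. intros; ring.
  + intros t. apply Ccont_mult; [|apply (lip1_RCcontinuous _ K); auto].
    apply Ccont_Cexp, Ccont_mult; [apply Ccont_const|apply Ccont_RtoC, Rcont_id].
Qed.

(** ** A test function with non-zero characters *)

Lemma bump_conj th x : bump (conj_k th x) = bump x.
Proof.
unfold bump. do 3 f_equal. unfold sqdist1, coords, c11, c12, c21, c22; simpl.
rewrite cos_neg, sin_neg.
assert (H1 : (sin th * sin th + cos th * cos th = 1)%R)
  by (generalize (sin2_cos2 th); unfold Rsqr; lra).
set (c := cos th) in *. set (s := sin th) in *.
set (a := m11 x). set (b := m12 x). set (d := m21 x). set (e := m22 x).
transitivity ((s * s + c * c) * (s * s + c * c) * (a * a + b * b + d * d + e * e)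
  - 2 * ((s * s + c * c) * (a + e)) + 2)%R; [ring|].
rewrite H1. ring.
Qed.

Lemma bump_average delta x t :
  k_average (central_part delta bump) (ut x t) = RtoC (/ 2 * flat 0 (1 - sqdist1 (coords (ut x t)))).
Proof.
assert (HPI := PI_RGT_0).
unfold k_average. rewrite (CInt_ext _ (fun _ => RtoC (/ 2 * flat 0 (1 - sqdist1 (coords (ut x t)))))).
- rewrite CInt_const, Rminus_0_r, RtoC_mult. field. apply RtoC_neq; lra.
- intros th _. unfold central_part.
  assert (E : SL2_opp (conj_k th (ut x t)) = conj_k th (SL2_opp (ut x t))).
  { unfold conj_k. rewrite SL2_opp_mul_r, SL2_opp_mul_l. reflexivity. }
  rewrite E, !bump_conj.
  assert (Z : bump (SL2_opp (ut x t)) = 0).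
  { apply NNPP. intros H. apply bump_support in H.
    unfold sqdist1, coords, c11, c12, c21, c22 in H.
    destruct (SL2_opp_entries (ut x t)) as (H1 & H2 & H3 & H4).
    cbn [fst snd] in H. rewrite H1, H2, H3, H4 in H. simpl in H.
    assert (P1 := exp_pos t). assert (P2 := exp_pos (- t)).
    assert (Q := Rle_0_sqr x). unfold Rsqr in Q. nra. }
  rewrite Z. unfold bump. rewrite RtoC_mult, RtoC_inv by lra. ring.
Qed.

Lemma RInt_pos_center (f : R -> R) r : (0 < r)%R -> (forall x, continuous f x) ->
  (forall x, (0 <= f x)%R) -> (0 < f 0)%R -> (0 < RInt f (- r) r)%R.
Proof.
intros Hr Hc Hp H0. assert (H := Hc 0%R). rewrite continuous_Rle_abs in H.
destruct (H (f 0 / 2)%R ltac:(lra)) as [d Hd].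
set (q := Rmin (d / 2) r). assert (Hdp := cond_pos d).
assert (Hq : (0 < q)%R) by (apply Rmin_glb_lt; lra).
assert (Hq1 : (q <= d / 2)%R) by apply Rmin_l. assert (Hq2 : (q <= r)%R) by apply Rmin_r.
rewrite <- (RInt_cont_Chasles f (- r) (- q) r), <- (RInt_cont_Chasles f (- q) q r) by auto.
assert (Ex : forall a b, ex_RInt f a b)
  by (intros; apply (ex_RInt_continuous (V := R_CompleteNormedModule)); auto).
assert (P1 : (0 <= RInt f (- r) (- q))%R) by (apply RInt_ge_0; auto; lra).
assert (P2 : (0 <= RInt f q r)%R) by (apply RInt_ge_0; auto; lra).
assert (P3 : (0 < RInt f (- q) q)%R).
{ apply RInt_gt_0; auto; [lra|]. intros x Hx.
  assert (K := Hd x). cbv beta in K.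
  assert (Hb : ball (M := R_UniformSpace) 0%R d x).
  { change (Rabs (x - 0) < d)%R. rewrite Rminus_0_r. apply Rabs_def1; lra. }
  specialize (K Hb). apply Rabs_def2 in K. lra. }
lra.
Qed.

(** The density of the character is non-negative, and positive at the origin,
    because [bump] is a non-negative function that is invariant under
    conjugation by [K] and lives far from minus the identity. *)
Lemma bump_character mu (Hmu : is_haar mu) delta (l : R) Th :
  is_character mu delta l Th -> Th bump <> 0.
Proof.
intros HT. destruct (Cc_infty_lip_cs bump bump_Cc) as (L0 & B0 & HLB).
assert (HG := central_part_lip_cs delta L0 B0 bump HLB).
assert (HA := k_average_lip_cs L0 B0 _ HG).
set (H := k_average (central_part delta bump)) in *.
set (B := (16 * B0 + 1)%R).
assert (HB0 : (0 <= B0)%R) by apply HLB.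
assert (HB : (1 <= B)%R) by (unfold B; lra).
assert (HH := lip_cs_enlarge (16 * L0) (16 * B0) B H ltac:(unfold B; lra) HA).
rewrite (character_value mu Hmu delta l Th bump HT bump_Cc). fold H.
rewrite (haar_abel mu Hmu l _ B H HB HH).
assert (Hc := haar_constant_pos mu Hmu).
apply Cmult_integral_contr; [apply RtoC_neq; lra|].
assert (EH : forall x t, H (ut x t) = RtoC (/ 2 * flat 0 (1 - sqdist1 (coords (ut x t)))))
  by (intros; apply bump_average).
set (f := fun t => RInt (fun x => / 2 * flat 0 (1 - sqdist1 (coords (ut x t))))%R (- B) B).
assert (Hab : forall t, abel B H t = RtoC (f t)).
{ intros t. unfold abel. rewrite CInt_pair by apply (ut_cont_x _ _ _ HH).
  unfold f. apply Ceq; simpl.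
  - apply RInt_eq. intros x. exact (f_equal Re (EH x t)).
  - rewrite (RInt_eq _ (fun _ => 0%R)) by (intros x; exact (f_equal Im (EH x t))).
    apply RInt_zero. auto. }
destruct (abel_lip _ _ _ HH) as (K & HK & Hl).
assert (Cab : forall t, RCcontinuous (abel B H) t) by (apply (lip1_RCcontinuous _ K); auto).
assert (Cf : forall t, continuous f t).
{ intros t. apply (continuous_ext (fun t => Re (abel B H t))).
  - intros x. rewrite Hab. reflexivity.
  - apply (proj1 (Ccont_pair _ _ _) (Cab t)). }
assert (Cx : forall t x, continuous (fun x => / 2 * flat 0 (1 - sqdist1 (coords (ut x t))))%R x).
{ intros t x. apply (continuous_ext (fun x => Re (H (ut x t)))).
  - intros z. rewrite EH. reflexivity.
  - apply (proj1 (Ccont_pair _ _ _) (ut_cont_x _ _ _ HH t x)). }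
assert (Pf : forall t, (0 <= f t)%R).
{ intros t. apply RInt_ge_0; [lra| |].
  - apply (ex_RInt_continuous (V := R_CompleteNormedModule)); intros; apply Cx.
  - intros x _. assert (P := flat_nonneg 0 (1 - sqdist1 (coords (ut x t)))). lra. }
assert (Pf0 : (0 < f 0)%R).
{ apply RInt_pos_center; [lra|apply Cx| |].
  - intros x. assert (P := flat_nonneg 0 (1 - sqdist1 (coords (ut x 0)))). lra.
  - assert (E : sqdist1 (coords (ut 0 0)) = 0%R).
    { unfold sqdist1, coords, c11, c12, c21, c22; simpl. rewrite Ropp_0, exp_0. ring. }
    rewrite E. assert (P := flat_pos (1 - 0) ltac:(lra)). lra. }
assert (E : CInt (fun t => Cexp (l * t) * abel B H t) (- B) B =
  RtoC (RInt (fun t => exp (l * t) * f t)%R (- B) B)).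
{ assert (Ep : forall t : R, Cexp (l * t) * abel B H t = RtoC (exp (l * t) * f t)%R)
    by (intros t; rewrite Hab, <- RtoC_mult, Cexp_RtoC, <- RtoC_mult; reflexivity).
  rewrite CInt_pair.
  - apply Ceq; simpl.
    + apply RInt_eq. intros t. exact (f_equal Re (Ep t)).
    + rewrite (RInt_eq _ (fun _ => 0%R)) by (intros t; exact (f_equal Im (Ep t))).
      apply RInt_zero. auto.
  - intros t. apply Ccont_mult; [|apply Cab].
    apply Ccont_Cexp, Ccont_mult; [apply Ccont_const|apply Ccont_RtoC, Rcont_id]. }
rewrite E. apply RtoC_neq, Rgt_not_eq.
apply RInt_pos_center; [lra| | |].
- intros t. apply Rcont_mult; [|apply Cf].
  apply exp_cont, Rcont_mult; [apply Rcont_const|apply Rcont_id].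
- intros t. apply Rmult_le_pos; [left; apply exp_pos|apply Pf].
- apply Rmult_lt_0_compat; [apply exp_pos|exact Pf0].
Qed.

(** * Continuously differentiable functions of a complex variable *)

(** Continuity of the derivative is included because moving the line of
    integration differentiates under the integral sign. *)
Definition C1_on (D : C -> Prop) (f : C -> C) : Prop :=
  exists df : C -> C, forall z, D z -> is_Cderive f z (df z) /\ Ccontinuous df z.

Lemma C1_const D c : C1_on D (fun _ => c).
Proof.
exists (fun _ => RtoC 0). intros z _. split; [apply is_Cderive_const|apply Ccont_const].
Qed.

Lemma C1_id D : C1_on D (fun z => z).
Proof.
exists (fun _ => RtoC 1). intros z _. split; [apply is_Cderive_id|apply Ccont_const].
Qed.

Lemma C1_plus D f g : C1_on D f -> C1_on D g -> C1_on D (fun z => f z + g z).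
Proof.
intros (df & Hf) (dg & Hg). exists (fun z => df z + dg z). intros z Hz.
destruct (Hf z Hz), (Hg z Hz).
split; [apply is_Cderive_plus|apply Ccont_plus]; auto.
Qed.

Lemma C1_minus D f g : C1_on D f -> C1_on D g -> C1_on D (fun z => f z - g z).
Proof.
intros (df & Hf) (dg & Hg). exists (fun z => df z - dg z). intros z Hz.
destruct (Hf z Hz), (Hg z Hz).
split; [apply is_Cderive_minus|apply Ccont_minus]; auto.
Qed.

Lemma C1_mult D f g : C1_on D f -> C1_on D g -> C1_on D (fun z => f z * g z).
Proof.
intros (df & Hf) (dg & Hg). exists (fun z => df z * g z + f z * dg z). intros z Hz.
destruct (Hf z Hz) as [H1 H2], (Hg z Hz) as [H3 H4].
split; [apply (is_Cderive_mult f g z); auto|].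
apply Ccont_plus; apply Ccont_mult; auto;
  [apply (is_Cderive_continuous _ _ _ H3)|apply (is_Cderive_continuous _ _ _ H1)].
Qed.

Lemma C1_inv D f : C1_on D f -> (forall z, D z -> f z <> 0) -> C1_on D (fun z => / f z).
Proof.
intros (df & Hf) H0. exists (fun z => - df z * (/ f z * / f z)). intros z Hz.
destruct (Hf z Hz) as [H1 H2]. assert (H3 := is_Cderive_continuous _ _ _ H1).
split; [apply is_Cderive_Cinv; auto|].
apply (continuous_ext (fun z => (- (1) * df z) * (/ f z * / f z))).
{ intros x. change (@eq C (- (1) * df x * (/ f x * / f x)) (- df x * (/ f x * / f x))). ring. }
assert (H4 : Ccontinuous (fun z => / f z) z) by (apply Ccont_inv; auto).
apply Ccont_mult; apply Ccont_mult; [apply Ccont_const|exact H2|exact H4|exact H4].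
Qed.

Lemma C1_comp_aff D f (c d : C) : C1_on (fun _ => True) f -> C1_on D (fun z => f (c * z + d)).
Proof.
intros (df & Hf). exists (fun z => c * df (c * z + d)). intros z Hz.
destruct (Hf (c * z + d) I) as [H1 H2]. split.
- apply (is_Cderive_comp f (fun z => c * z + d) z); auto.
  apply (is_Cderive_eq _ _ (c * RtoC 1 + RtoC 0)); [ring|].
  apply is_Cderive_plus; [apply is_Cderive_scal, is_Cderive_id|apply is_Cderive_const].
- apply Ccont_mult; [apply Ccont_const|].
  apply (continuous_comp (fun z => c * z + d) df); auto.
  apply Ccont_plus; [|apply Ccont_const].
  apply Ccont_mult; [apply Ccont_const|apply continuous_id].
Qed.

Lemma C1_sub (D D' : C -> Prop) f : (forall z, D' z -> D z) -> C1_on D f -> C1_on D' f.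
Proof. intros H (df & Hf). exists df. auto. Qed.

Lemma C1_continuous D f z : C1_on D f -> D z -> Ccontinuous f z.
Proof. intros (df & Hf) Hz. apply (is_Cderive_continuous _ _ _ (proj1 (Hf z Hz))). Qed.

Lemma C1_Cexp D : C1_on D Cexp.
Proof.
exists Cexp. intros z _. split; [apply is_Cderive_Cexp|].
apply Ccont_Cexp, continuous_id.
Qed.

(** * Laplace transforms of compactly supported densities *)

Definition expint (a b : R) (A : R -> C) (s : C) : C := CInt (fun t => Cexp (s * t) * A t) a b.

Lemma cont_bounded (f : R -> C) (a b : R) : (a <= b)%R -> (forall x, RCcontinuous f x) ->
  exists M, (0 <= M)%R /\ forall x, (a <= x <= b)%R -> (Cmod (f x) <= M)%R.
Proof.
intros Hab Hc. destruct (continuity_ab_maj (fun x => Cmod (f x)) a b Hab) as (m & Hm & _).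
- intros x _. apply continuity_pt_filterlim. apply (Ccont_mod _ f x), Hc.
- exists (Cmod (f m)). split; [apply Cmod_ge_0|exact Hm].
Qed.

Lemma Ccont_explin (s : C) (A : R -> C) x : RCcontinuous A x ->
  RCcontinuous (fun t => Cexp (s * t) * A t) x.
Proof.
intros H. apply Ccont_mult; [|exact H].
apply Ccont_Cexp, Ccont_mult; [apply Ccont_const|apply Ccont_RtoC, Rcont_id].
Qed.

(** The second order remainder of the exponential is bounded uniformly on the
    interval of integration. *)
Lemma expint_derive (a b : R) (A : R -> C) (s : C) : (a <= b)%R -> (forall x, RCcontinuous A x) ->
  is_Cderive (expint a b A) s (expint a b (fun t => t * A t) s).
Proof.
intros Hab Hc.
set (m := Rmax (Rabs a) (Rabs b)).
assert (Hm : forall t, (a <= t <= b)%R -> (Rabs t <= m)%R).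
{ intros t Ht. unfold m. apply Rabs_le. split.
  - assert (H := Rmax_l (Rabs a) (Rabs b)). assert (H2 := Rle_abs (- a)). rewrite Rabs_Ropp in H2. lra.
  - assert (H := Rmax_r (Rabs a) (Rabs b)). assert (H2 := Rle_abs b). lra. }
assert (Hm0 : (0 <= m)%R) by (eapply Rle_trans; [apply Rabs_pos|apply Rmax_l]).
destruct (cont_bounded (fun t => Cexp (s * t) * A t) a b Hab) as (M & HM & HB).
{ intros; apply Ccont_explin, Hc. }
set (Q := ((b - a) * (4 * (m * m) * exp m * M))%R).
assert (HQ : (0 <= Q)%R).
{ unfold Q. repeat apply Rmult_le_pos; try lra. left; apply exp_pos. }
apply is_Cderive_iff. intros e He.
assert (Hd : (0 < Rmin 1 (e / (Q + 1)))%R)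
  by (apply Rmin_glb_lt; [lra|apply Rdiv_lt_0_compat; lra]).
exists (Rmin 1 (e / (Q + 1))). split; [exact Hd|]. intros w Hw.
assert (H1 := Rlt_le_trans _ _ _ Hw (Rmin_l _ _)).
assert (H2 := Rlt_le_trans _ _ _ Hw (Rmin_r _ _)).
assert (Hct : forall x, RCcontinuous (fun t : R => t * A t) x)
  by (intros; apply Ccont_mult; [apply Ccont_RtoC, Rcont_id|apply Hc]).
unfold expint.
rewrite <- CInt_scal by (intros; apply Ccont_explin, Hct).
rewrite <- CInt_minus by (intros; apply Ccont_explin, Hc).
rewrite <- CInt_minus.
2:{ intros; apply Ccont_minus; apply Ccont_explin, Hc. }
2:{ intros; apply Ccont_mult; [apply Ccont_const|apply Ccont_explin, Hct]. }
eapply Rle_trans.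
- apply (CInt_bound_const _ (4 * (m * m) * exp m * M * Cmod (w - s) ^ 2)%R a b Hab).
  + intros x. apply Ccont_minus; [apply Ccont_minus; apply Ccont_explin, Hc|].
    apply Ccont_mult; [apply Ccont_const|apply Ccont_explin, Hct].
  + intros t Ht.
    replace (Cexp (w * t)) with (Cexp (s * t) * Cexp ((w - s) * t))
      by (rewrite <- Cexp_plus; f_equal; ring).
    replace (Cexp (s * t) * Cexp ((w - s) * t) * A t - Cexp (s * t) * A t -
      (w - s) * (Cexp (s * t) * (t * A t)))
      with (Cexp (s * t) * A t * (Cexp ((w - s) * t) - 1 - (w - s) * t)) by ring.
    rewrite Cmod_mult. specialize (HB t Ht). specialize (Hm t Ht).
    assert (HE := Cexp_minus_1_minus ((w - s) * t)).
    rewrite Cmod_mult, Cmod_R in HE.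
    set (q := Cmod (w - s)) in *. assert (Hq : (0 <= q)%R) by apply Cmod_ge_0.
    assert (Hat := Rabs_pos t).
    assert (HX : (exp (q * Rabs t) <= exp m)%R) by (apply exp_mono; nra).
    assert (HX0 := exp_pos (q * Rabs t)).
    assert (HY : ((q * Rabs t) ^ 2 <= q ^ 2 * (m * m))%R).
    { rewrite Rpow_mult_distr. apply Rmult_le_compat_l; [apply pow2_ge_0|]. simpl. nra. }
    assert (HY0 := pow2_ge_0 (q * Rabs t)).
    assert (HZ : (4 * (q * Rabs t) ^ 2 * exp (q * Rabs t) <= 4 * (q ^ 2 * (m * m)) * exp m)%R).
    { apply Rmult_le_compat; lra. }
    eapply Rle_trans; [apply Rmult_le_compat; [apply Cmod_ge_0|apply Cmod_ge_0|exact HB|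
      eapply Rle_trans; [exact HE|exact HZ]]|].
    apply Req_le. ring.
- replace ((b - a) * (4 * (m * m) * exp m * M * Cmod (w - s) ^ 2))%R
    with (Q * Cmod (w - s) * Cmod (w - s))%R by (unfold Q; ring).
  apply Rmult_le_compat_r; [apply Cmod_ge_0|].
  clear_denominator H2 (Q + 1)%R.
  assert (H3 := Cmod_ge_0 (w - s)). nra.
Qed.

Lemma expint_C1 (a b : R) (A : R -> C) D : (a <= b)%R -> (forall x, RCcontinuous A x) ->
  C1_on D (expint a b A).
Proof.
intros Hab Hc. exists (expint a b (fun t => t * A t)). intros z _.
split; [apply expint_derive; auto|].
eapply is_Cderive_continuous. apply expint_derive; auto.
intros x; apply Ccont_mult; [apply Ccont_RtoC, Rcont_id|apply Hc].
Qed.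

Section Density.

Variables (r K : R) (A : R -> C).
Hypothesis HA : laplace_density r K A.

Let Hr : (0 < r)%R := proj1 HA.
Let HK : (0 <= K)%R := proj1 (proj2 HA).
Let Aeven : forall t, A (- t)%R = A t := proj1 (proj2 (proj2 HA)).
Let Alip : forall t h, (Rabs h <= 1)%R -> (Cmod (A (t + h)%R - A t) <= K * Rabs h)%R :=
  proj1 (proj2 (proj2 (proj2 HA))).
Let Asupp : forall t, A t <> 0 -> (Rabs t <= r)%R := proj2 (proj2 (proj2 (proj2 HA))).
Let Acont : forall x, RCcontinuous A x := lip1_RCcontinuous A K HK Alip.

Lemma laplace_even s : laplace r A (- s) = laplace r A s.
Proof.
unfold laplace.
assert (E := CInt_comp_lin (fun t => Cexp (s * t) * A t) (-1) 0 (- r) r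
  (fun x => Ccont_explin s A x (Acont x))).
cbv beta in E.
replace (-1 * - r + 0)%R with r in E by ring.
replace (-1 * r + 0)%R with (- r)%R in E by ring.
rewrite (CInt_swap _ r (- r)) in E by (intros; apply Ccont_explin, Acont).
rewrite (CInt_ext _ (fun t : R => Cexp (- s * t) * A t)) in E.
- assert (E2 : RtoC (-1) = - (1)) by (apply Ceq; unfold Re, Im; simpl; ring).
  rewrite E2 in E. set (u := CInt _ _ _) in *. set (v := CInt _ _ _) in *.
  replace u with (- (- (1) * u)) by ring. rewrite E. ring.
- intros t _. replace (-1 * t + 0)%R with (- t)%R by ring.
  rewrite Aeven, RtoC_opp. do 2 f_equal. ring.
Qed.

Lemma laplace_wide R s : (r <= R)%R ->
  laplace r A s = CInt (fun t => Cexp (s * t) * A t) (- R) R.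
Proof.
intros HR. symmetry. apply CInt_support; [lra| |].
- intros; apply Ccont_explin, Acont.
- intros x H. apply Asupp. intros E. apply H. rewrite E. ring.
Qed.

(** A translation by [PI / Im s] changes the sign of the oscillating factor, so
    the transform is controlled by the variation of [A] over that distance. *)
Lemma laplace_oscillation Y s : (Rabs (Re s) <= Y)%R -> (4 <= Rabs (Im s))%R ->
  (Cmod (laplace r A s) * Rabs (Im s) <= 2 * (r + 2) * (exp (Y * (r + 2)) * K * 4))%R.
Proof.
intros HY HI. set (R := (r + 2)%R). assert (HPI := PI_RGT_0). assert (HP4 := PI_4).
assert (Hs : Im s <> 0%R) by (intros E; rewrite E, Rabs_R0 in HI; lra).
set (h := (PI / Im s)%R).
assert (Hh : (Rabs h * Rabs (Im s) = PI)%R).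
{ rewrite <- Rabs_mult. unfold h. replace (PI / Im s * Im s)%R with PI by (field; auto).
  apply Rabs_pos_eq; lra. }
assert (Hh0 := Rabs_pos h).
assert (Hh1 : (Rabs h <= 1)%R) by nra.
set (J := laplace r A s).
assert (EJ : J = CInt (fun t => Cexp (s * t) * A t) (- R) R) by (apply laplace_wide; unfold R; lra).
set (E := exp (Re s * h)).
assert (HE : (0 < E)%R) by apply exp_pos.
assert (EE : Cexp (s * h) = - RtoC E).
{ rewrite Cexp_polar.
  assert (E1 : Re (s * h) = (Re s * h)%R) by (unfold Re, Im; simpl; ring).
  assert (E2 : Im (s * h) = PI).
  { transitivity (Im s * h)%R; [unfold Re, Im; simpl; ring|]. unfold h; field; auto. }
  rewrite E1, E2. fold E. apply Ceq; unfold cis, Re, Im; simpl; rewrite cos_PI, sin_PI; ring. }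
assert (CA : forall x, RCcontinuous (fun t => A (t + h)%R) x).
{ intros x. apply (continuous_comp (fun t => (t + h)%R) A); [|apply Acont].
  apply Rcont_plus; [apply Rcont_id|apply Rcont_const]. }
assert (CE : forall x, RCcontinuous (fun t => Cexp (s * t) * A t) x)
  by (intros; apply Ccont_explin, Acont).
assert (EJ2 : J = - E * CInt (fun t => Cexp (s * t) * A (t + h)%R) (- R) R).
{ transitivity (CInt (fun t => Cexp (s * (t + h)%R) * A (t + h)%R) (- R) R).
  - assert (L := CInt_comp_lin (fun t => Cexp (s * t) * A t) 1 h (- (r + 1) - h) (r + 1 - h) CE).
    cbv beta in L.
    replace (1 * (- (r + 1) - h) + h)%R with (- (r + 1))%R in L by ring.
    replace (1 * (r + 1 - h) + h)%R with (r + 1)%R in L by ring.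
    rewrite <- (laplace_wide (r + 1)) in L by lra. fold J in L. rewrite <- L.
    rewrite Cmult_1_l.
    set (g := fun t : Rdefinitions.R => Cexp (s * (t + h)%R) * A (t + h)%R).
    assert (Cg : forall x, RCcontinuous g x).
    { intros x. apply (continuous_comp (fun t => (t + h)%R) (fun t => Cexp (s * t) * A t)); [|apply CE].
      apply Rcont_plus; [apply Rcont_id|apply Rcont_const]. }
    assert (Z : forall t, (r < Rabs (t + h))%R -> g t = 0).
    { intros t Ht. unfold g.
      assert (EA : A (t + h)%R = 0) by (apply NNPP; intros Q; apply Asupp in Q; lra).
      rewrite EA. ring. }
    apply Rabs_le_between in Hh1.
    rewrite (CInt_ext _ g (- (r + 1) - h)).
    2:{ intros t _. unfold g. rewrite Rmult_1_l. reflexivity. }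
    rewrite <- (CInt_Chasles g (- R) (- (r + 1) - h) R), <- (CInt_Chasles g _ (r + 1 - h) R) by auto.
    rewrite (CInt_ext g (fun _ => 0) (- R)), (CInt_ext g (fun _ => 0) (r + 1 - h)), !CInt_const.
    + ring.
    + unfold R. rewrite Rmin_left, Rmax_right by lra. intros t Ht. apply Z.
      rewrite Rabs_pos_eq; lra.
    + unfold R. rewrite Rmin_left, Rmax_right by lra. intros t Ht. apply Z.
      rewrite Rabs_left; lra.
  - rewrite <- CInt_scal by (intros; apply Ccont_explin, CA).
    apply CInt_ext. intros t _. rewrite <- EE, RtoC_plus, Cmult_plus_distr_l, Cexp_plus. ring. }
assert (Key : (1 + E) * J = E * CInt (fun t => Cexp (s * t) * (A t - A (t + h)%R)) (- R) R).
{ rewrite (CInt_ext _ (fun t => Cexp (s * t) * A t - Cexp (s * t) * A (t + h)%R))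
    by (intros; ring).
  rewrite CInt_minus by (auto; intros; apply Ccont_explin, CA).
  rewrite <- EJ. replace ((1 + E) * J) with (J + E * J) by ring.
  rewrite EJ2 at 1. ring. }
assert (Hb : (Cmod (CInt (fun t => Cexp (s * t) * (A t - A (t + h)%R))%C (- R) R)
  <= (R - - R) * (exp (Y * R) * (K * Rabs h)))%R).
{ apply CInt_bound_const; [unfold R; lra| |].
  - intros x. apply Ccont_explin, Ccont_minus; [apply Acont|apply CA].
  - intros t Ht. rewrite Cmod_mult, Cmod_Cexp.
    apply Rmult_le_compat; [left; apply exp_pos|apply Cmod_ge_0| |].
    + apply exp_mono. replace (Re (s * t)) with (Re s * t)%R by (unfold Re; simpl; ring).
      apply Rabs_le_between in HY. unfold R in *.
      apply Rle_trans with (Rabs (Re s * t)); [apply Rle_abs|]. rewrite Rabs_mult.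
      apply Rmult_le_compat; try apply Rabs_pos; apply Rabs_le; lra.
    + rewrite Cmod_minus_sym. apply Alip, Hh1. }
assert (Key2 := f_equal Cmod Key). rewrite !Cmod_mult in Key2.
replace (1 + E) with (RtoC (1 + E)%R) in Key2 by (rewrite RtoC_plus; reflexivity).
rewrite !Cmod_R, !Rabs_pos_eq in Key2 by lra.
set (I0 := Cmod (CInt _ _ _)) in *.
assert (HI0 : (0 <= I0)%R) by apply Cmod_ge_0.
assert (HJ : (Cmod J <= I0)%R).
{ apply Rmult_le_reg_l with (1 + E)%R; [lra|]. rewrite Key2. nra. }
assert (HX : (0 <= 2 * R * (exp (Y * R) * K))%R).
{ assert (0 < exp (Y * R))%R by apply exp_pos. unfold R in *.
  repeat apply Rmult_le_pos; lra. }
apply Rle_trans with (2 * R * (exp (Y * R) * K) * (Rabs h * Rabs (Im s)))%R.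
- apply Rle_trans with (I0 * Rabs (Im s))%R; [apply Rmult_le_compat_r; [apply Rabs_pos|exact HJ]|].
  rewrite <- Rmult_assoc. apply Rmult_le_compat_r; [apply Rabs_pos|].
  eapply Rle_trans; [exact Hb|]. apply Req_le; ring.
- rewrite Hh. replace (2 * R * (exp (Y * R) * K * 4))%R with (2 * R * (exp (Y * R) * K) * 4)%R by ring.
  apply Rmult_le_compat_l; auto.
Qed.

Lemma laplace_decay Y : exists M, (0 <= M)%R /\ forall s, (Rabs (Re s) <= Y)%R ->
  (Cmod (laplace r A s) * (1 + Rabs (Im s)) <= M)%R.
Proof.
destruct (cont_bounded A (- r) r ltac:(lra) Acont) as (a & Ha & HB).
set (M1 := (2 * (r + 2) * (exp (Y * (r + 2)) * K * 4))%R).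
set (M2 := ((r - - r) * (exp (Y * r) * a))%R).
assert (HM1 : (0 <= M1)%R).
{ unfold M1. assert (0 < exp (Y * (r + 2)))%R by apply exp_pos. repeat apply Rmult_le_pos; lra. }
assert (HM2 : (0 <= M2)%R).
{ unfold M2. assert (0 < exp (Y * r))%R by apply exp_pos. repeat apply Rmult_le_pos; lra. }
exists (2 * M1 + 5 * M2)%R. split; [lra|]. intros s Hs.
assert (H0 := Cmod_ge_0 (laplace r A s)).
destruct (Rle_dec 4 (Rabs (Im s))) as [H4|H4].
- assert (H := laplace_oscillation Y s Hs H4). fold M1 in H. nra.
- assert (H : (Cmod (laplace r A s) <= M2)%R).
  { apply CInt_bound_const; [lra|intros; apply Ccont_explin, Acont|].
    intros t Ht. rewrite Cmod_mult, Cmod_Cexp.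
    apply Rmult_le_compat; [left; apply exp_pos|apply Cmod_ge_0| |apply HB, Ht].
    apply exp_mono. replace (Re (s * t)) with (Re s * t)%R by (unfold Re; simpl; ring).
    apply Rle_trans with (Rabs (Re s * t)); [apply Rle_abs|]. rewrite Rabs_mult.
    apply Rmult_le_compat; try apply Rabs_pos; auto; apply Rabs_le; lra. }
  assert (H1 := Rabs_pos (Im s)). nra.
Qed.

End Density.

(** * Amplitudes *)

(** The properties of [lam |-> Theta delta (i lam) f] that the contour argument
    uses. *)
Definition amplitude (T : C -> C) : Prop :=
  C1_on (fun _ => True) T /\ (forall z, T (- z) = T z) /\
  forall Y, exists M, (0 <= M)%R /\
    forall z, (Rabs (Im z) <= Y)%R -> (Cmod (T z) * (1 + Rabs (Re z)) <= M)%R.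

Lemma laplace_amplitude r K A : laplace_density r K A ->
  amplitude (fun lam => laplace r A (Ci * lam)).
Proof.
intros HA. split; [|split].
- assert (Hc : forall x, RCcontinuous A x).
  { apply (lip1_RCcontinuous A K); apply HA. }
  assert (H := C1_comp_aff (fun _ => True) (expint (- r) r A) Ci 0
    (expint_C1 (- r) r A _ ltac:(destruct HA; lra) Hc)).
  destruct H as (df & H). exists df. intros z Hz. destruct (H z Hz) as [H1 H2]. split; auto.
  apply (is_Cderive_ext_loc (fun z => expint (- r) r A (Ci * z + 0))); [|exact H1].
  apply filter_forall. intros w. unfold expint, laplace. rewrite Cplus_0_r. reflexivity.
- intros z. cbv beta. replace (Ci * - z) with (- (Ci * z)) by ring.
  apply (laplace_even r K A HA).
- intros Y. destruct (laplace_decay r K A HA Y) as (M & HM & H). exists M. split; auto.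
  intros z Hz. specialize (H (Ci * z)).
  replace (Re (Ci * z)) with (- Im z)%R in H by (unfold Re, Im; simpl; ring).
  replace (Im (Ci * z)) with (Re z) in H by (unfold Re, Im; simpl; ring).
  rewrite Rabs_Ropp in H. auto.
Qed.

(** * The Plancherel densities near their poles *)

(** [expm1_quot w] is [(exp w - 1) / w], extended over [w = 0]. *)
Definition expm1_quot (w : C) : C := expint 0 1 (fun _ => 1) w.

Lemma expm1_quot_mult w : w * expm1_quot w = Cexp w - 1.
Proof.
unfold expm1_quot, expint.
rewrite <- CInt_scal by (intros; apply Ccont_explin, Ccont_const).
rewrite (CInt_ext _ (fun t : R => w * Cexp (t * w))).
- rewrite (CInt_FTC (fun t : R => Cexp (t * w))).
  + rewrite Cmult_1_l, Cmult_0_l, Cexp_0. reflexivity.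
  + intros x. apply is_RCderive_Cexp_line.
  + intros x. apply Ccont_mult; [apply Ccont_const|].
    apply Ccont_Cexp, Ccont_mult; [apply Ccont_RtoC, Rcont_id|apply Ccont_const].
- intros t _. rewrite Cmult_1_r, (Cmult_comm w t). reflexivity.
Qed.

Lemma expm1_quot_0 : expm1_quot 0 = 1.
Proof.
unfold expm1_quot, expint. rewrite (CInt_ext _ (fun _ => RtoC 1)).
- rewrite CInt_const, Rminus_0_r. ring.
- intros t _. rewrite Cmult_0_l, Cexp_0. ring.
Qed.

Lemma Cexp_real (w : C) (c : R) : (Rabs (Im w) < PI)%R -> Cexp w = c ->
  Im w = 0%R /\ c = exp (Re w).
Proof.
intros Hw E. assert (E1 := f_equal Re E). assert (E2 := f_equal Im E).
unfold Cexp, Re, Im in E1, E2; simpl in E1, E2. fold (Re w) in *. fold (Im w) in *.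
assert (He := exp_pos (Re w)).
assert (Hs : sin (Im w) = 0%R) by nra.
assert (Hi : Im w = 0%R).
{ apply Rabs_def2 in Hw. destruct (Rtotal_order (Im w) 0) as [H|[H|H]]; auto.
  - assert (P := sin_gt_0 (- Im w) ltac:(lra) ltac:(lra)). rewrite sin_neg in P. lra.
  - assert (P := sin_gt_0 (Im w) H ltac:(lra)). lra. }
split; [exact Hi|]. rewrite Hi, cos_0 in E1. lra.
Qed.

Lemma Cexp_eq_1 (w : C) : (Rabs (Im w) < PI)%R -> Cexp w = 1 -> w = 0.
Proof.
intros Hw E. destruct (Cexp_real w 1 Hw E) as [H1 H2].
apply Ceq; [|exact H1]. apply (f_equal ln) in H2. rewrite ln_exp, ln_1 in H2. symmetry; exact H2.
Qed.

(** [kern (-1) z] is [tanh (PI z / 2)] and [kern 1 z] is [coth (PI z / 2)];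
    written in this way the two have their poles where [exp (PI z) = sg]. *)
Definition kern (sg : R) (z : C) : C := 1 + 2 / (sg * Cexp (PI * z) - 1).

Definition pole (l : nat) : C := - (Ci * INR l).

(** In this strip there is no pole but [pole l]. *)
Definition strip (l : nat) (z : C) : Prop := (Rabs (Im z + INR l) < 1)%R.

(** The residue of [kern sg] at [pole l], which is a regular point for the
    wrong parity of [l]. *)
Definition kern_residue (sg : R) (l : nat) : R :=
  if Req_EM_T sg ((-1) ^ l) then (2 / PI)%R else 0%R.

Lemma Im_pole l : Im (pole l) = (- INR l)%R.
Proof. unfold pole, Im; simpl. ring. Qed.

Lemma Cexp_pole l : Cexp (PI * pole l) = RtoC ((-1) ^ l).
Proof.
induction l as [|l IH].
- simpl. replace (PI * pole 0) with (RtoC 0); [apply Cexp_0|]. unfold pole. simpl. ring.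
- replace (PI * pole (S l)) with (PI * pole l + RtoC (-1) * (Ci * PI)).
  + rewrite Cexp_plus, IH.
    replace (Cexp (RtoC (-1) * (Ci * PI))) with (RtoC (-1)).
    * rewrite <- RtoC_mult. apply f_equal. simpl. ring.
    * rewrite Cexp_polar. replace (Re (RtoC (-1) * (Ci * PI))) with 0%R by (unfold Re, Im; simpl; ring).
      replace (Im (RtoC (-1) * (Ci * PI))) with (- PI)%R by (unfold Re, Im; simpl; ring).
      rewrite exp_0, cis_opp. apply Ceq; unfold cis, Cconj, Re, Im; simpl; rewrite cos_PI, sin_PI; ring.
  + unfold pole. rewrite S_INR, RtoC_plus. replace (RtoC (-1)) with (- (1)); [ring|].
    apply Ceq; unfold Re, Im; simpl; ring.
Qed.

Lemma Cexp_near_pole l z : Cexp (PI * z) = (-1) ^ l * Cexp (PI * (z - pole l)).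
Proof.
replace (PI * z) with (PI * pole l + PI * (z - pole l)) by ring.
rewrite Cexp_plus, Cexp_pole. rewrite RtoC_pow.
reflexivity.
Qed.

Lemma strip_Im l z : strip l z -> (Rabs (Im (PI * (z - pole l))) < PI)%R.
Proof.
intros H. assert (HPI := PI_RGT_0).
replace (Im (PI * (z - pole l))) with (PI * (Im z + INR l))%R
  by (unfold pole, Re, Im; simpl; ring).
rewrite Rabs_mult, Rabs_pos_eq by lra. unfold strip in H. nra.
Qed.

Lemma pow_m1_sq l : ((-1) ^ l * (-1) ^ l = 1)%R.
Proof. rewrite <- Rpow_mult_distr. replace (-1 * -1)%R with 1%R by ring. apply pow1. Qed.

Lemma kern_den sg l z : (sg * sg = 1)%R -> strip l z ->
  (z <> pole l \/ sg <> (-1) ^ l)%R -> sg * Cexp (PI * z) - 1 <> 0.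
Proof.
intros Hs Hz Hor E.
assert (HPI := PI_RGT_0). assert (P := pow_m1_sq l).
rewrite (Cexp_near_pole l), <- RtoC_pow in E.
set (w := PI * (z - pole l)) in *.
assert (E1 : Cexp w = RtoC (sg * (-1) ^ l)%R).
{ rewrite RtoC_mult.
  transitivity (RtoC (sg * sg * ((-1) ^ l * (-1) ^ l))%R * Cexp w).
  - rewrite Hs, P. rewrite Rmult_1_l. ring.
  - rewrite !RtoC_mult.
    transitivity (sg * (-1) ^ l * (sg * (RtoC ((-1) ^ l) * Cexp w) - 1) + sg * (-1) ^ l).
    + rewrite RtoC_pow. ring.
    + rewrite E. rewrite RtoC_pow. ring. }
assert (E2 := Cexp_real w _ (strip_Im l z Hz) E1).
destruct E2 as [E2 E3]. assert (E4 := exp_pos (Re w)).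
assert (E5 : (sg * (-1) ^ l = 1)%R) by nra.
rewrite E5 in E1. apply Cexp_eq_1 in E1; [|apply strip_Im, Hz].
destruct Hor as [Hn|Hn].
- apply Hn. replace z with (pole l + w / PI).
  + rewrite E1. field. apply RtoC_neq; lra.
  + unfold w. field. apply RtoC_neq; lra.
- apply Hn. nra.
Qed.

Lemma C1_ext D f g : (forall z, f z = g z) -> C1_on D f -> C1_on D g.
Proof.
intros E (df & H). exists df. intros z Hz. destruct (H z Hz) as [H1 H2]. split; auto.
apply (is_Cderive_ext_loc f); auto. apply filter_forall, E.
Qed.

(** In the strip, [sg * exp (PI z) - 1] is [exp w - 1] with [w = PI (z - pole
    l)], or [- exp w - 1] for the wrong parity. The former vanishes for [w =
    0] only, and there to the first order; the latter does not vanish. *)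
Lemma kern_factor sg l : (sg * sg = 1)%R -> exists M : C -> C,
  C1_on (strip l) M /\ M (pole l) = kern_residue sg l /\
  forall z, strip l z -> z <> pole l -> M z = (z - pole l) * kern sg z.
Proof.
intros Hs. assert (HPI := PI_RGT_0). assert (P := pow_m1_sq l).
assert (HPC : RtoC PI <> 0) by (apply RtoC_neq; lra).
unfold kern_residue. destruct (Req_EM_T sg ((-1) ^ l)) as [E|E].
- exists (fun z => (z - pole l) + 2 / PI * / expm1_quot (PI * (z - pole l))).
  assert (H0 : forall z, strip l z -> expm1_quot (PI * (z - pole l)) <> 0).
  { intros z Hz Q. assert (Q2 := expm1_quot_mult (PI * (z - pole l))).
    rewrite Q, Cmult_0_r in Q2.
    assert (Q3 : PI * (z - pole l) = 0).
    { apply Cexp_eq_1; [apply strip_Im, Hz|].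
      replace (Cexp (PI * (z - pole l))) with (Cexp (PI * (z - pole l)) - 1 + 1) by ring.
      rewrite <- Q2. ring. }
    rewrite Q3, expm1_quot_0 in Q. revert Q; apply RtoC_neq; lra. }
  split; [|split].
  + apply C1_plus; [apply C1_minus; [apply C1_id|apply C1_const]|].
    apply C1_mult; [apply C1_const|]. apply C1_inv; [|exact H0].
    apply (C1_ext _ (fun z => expm1_quot (PI * z + - (PI * pole l)))).
    { intros z. apply f_equal. ring. }
    apply (C1_comp_aff _ expm1_quot). apply expint_C1; [lra|]. intros; apply Ccont_const.
  + replace (pole l - pole l) with (RtoC 0) by ring.
    rewrite Cmult_0_r, expm1_quot_0. rewrite RtoC_div by lra. field; auto.
  + intros z Hz Hn. unfold kern.
    assert (Ed : sg * Cexp (PI * z) - 1 = PI * (z - pole l) * expm1_quot (PI * (z - pole l))).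
    { rewrite expm1_quot_mult, (Cexp_near_pole l), <- RtoC_pow, E.
      transitivity (RtoC ((-1) ^ l * (-1) ^ l)%R * Cexp (PI * (z - pole l)) - 1).
      - rewrite RtoC_mult. ring.
      - rewrite P. ring. }
    rewrite Ed. field. split; [apply H0, Hz|]. split; auto.
    intros Q. apply Hn. replace z with (z - pole l + pole l) by ring. rewrite Q. ring.
- exists (fun z => (z - pole l) * kern sg z). split; [|split].
  + apply C1_mult; [apply C1_minus; [apply C1_id|apply C1_const]|].
    unfold kern. apply C1_plus; [apply C1_const|]. apply C1_mult; [apply C1_const|].
    apply C1_inv; [|intros z Hz; apply (kern_den sg l); auto].
    apply C1_minus; [|apply C1_const]. apply C1_mult; [apply C1_const|].
    apply (C1_ext _ (fun z => Cexp (PI * z + 0))); [intros; apply f_equal; ring|].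
    apply C1_comp_aff, C1_Cexp.
  + ring.
  + auto.
Qed.

Lemma Ctanh_kern l z : strip l z -> z <> pole l -> Ctanh (PI * z / 2) = kern (-1) z.
Proof.
intros Hz Hn.
assert (H := kern_den (-1) l z ltac:(ring) Hz (or_introl Hn)).
unfold Ctanh, Csinh, Ccosh, kern.
set (e := Cexp (PI * z / 2)). assert (He : e <> 0) by apply Cexp_neq_0.
assert (E : Cexp (PI * z) = e * e).
{ unfold e. rewrite <- Cexp_plus. apply f_equal. field; apply RtoC_neq; lra. }
rewrite Cexp_opp. fold e. rewrite E in *.
replace (RtoC (-1)) with (- (1)) in * by (apply Ceq; unfold Re, Im; simpl; ring).
assert (H' : e * e + 1 <> 0).
{ intros Q. apply H. replace (- (1) * (e * e) - 1) with (- (e * e + 1)) by ring. rewrite Q. ring. }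
field. repeat split; auto; try (apply RtoC_neq; lra).
intros Q. apply H. rewrite <- Q. apply Ceq; unfold Re, Im; simpl; ring.
Qed.

Lemma Ccoth_kern l z : strip l z -> z <> pole l -> Ccoth (PI * z / 2) = kern 1 z.
Proof.
intros Hz Hn.
assert (H := kern_den 1 l z ltac:(ring) Hz (or_introl Hn)).
unfold Ccoth, Csinh, Ccosh, kern.
set (e := Cexp (PI * z / 2)). assert (He : e <> 0) by apply Cexp_neq_0.
assert (E : Cexp (PI * z) = e * e).
{ unfold e. rewrite <- Cexp_plus. apply f_equal. field; apply RtoC_neq; lra. }
rewrite Cexp_opp. fold e. rewrite E in *. rewrite Cmult_1_l in *.
field. repeat split; auto; try (apply RtoC_neq; lra).
Qed.

Lemma kern_bound sg z : (sg * sg = 1)%R -> (1 <= Rabs (Re z))%R -> (Cmod (kern sg z) <= 4)%R.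
Proof.
intros Hs Hz. assert (HPI := PI2_3_2).
assert (Hsa : Rabs sg = 1%R).
{ assert (H := Rabs_pos sg). assert (H2 : (Rabs sg * Rabs sg = 1)%R)
    by (rewrite <- Rabs_mult, Hs; apply Rabs_R1). nra. }
set (q := sg * Cexp (PI * z)).
assert (Eq : Cmod q = exp (PI * Re z)).
{ unfold q. rewrite Cmod_mult, Cmod_R, Hsa, Cmod_Cexp, Rmult_1_l. apply f_equal.
  unfold Re, Im; simpl; ring. }
assert (Hd : (2 / 3 <= Cmod (q - 1))%R).
{ unfold Rabs in Hz. destruct (Rcase_abs (Re z)).
  - assert (H := Cmod_triangle_rev 1 q). rewrite Cmod_1, Eq, Cmod_minus_sym in H.
    assert (H2 : (exp (PI * Re z) * exp (- (PI * Re z)) = 1)%R)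
      by (rewrite <- exp_plus, Rplus_opp_r; apply exp_0).
    assert (H3 := exp_ineq1_le (- (PI * Re z))).
    assert (H4 := exp_pos (PI * Re z)). assert (3 <= exp (- (PI * Re z)))%R by nra. nra.
  - assert (H := Cmod_triangle_rev q 1). rewrite Cmod_1, Eq in H.
    assert (H3 := exp_ineq1_le (PI * Re z)). nra. }
assert (Hq0 : q - 1 <> 0) by (apply Cmod_pos_neq; lra).
unfold kern. fold q.
eapply Rle_trans; [apply Cmod_triangle|]. rewrite Cmod_1, Cmod_div by auto.
rewrite Cmod_R, (Rabs_pos_eq 2) by lra.
assert (H5 : (2 / Cmod (q - 1) <= 3)%R).
{ apply Rmult_le_reg_r with (Cmod (q - 1)); [lra|]. unfold Rdiv.
  rewrite Rmult_assoc, Rinv_l by lra. lra. }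
lra.
Qed.

Lemma kern_odd sg z : (sg * sg = 1)%R -> sg * Cexp (PI * z) - 1 <> 0 -> kern sg (- z) = - kern sg z.
Proof.
intros Hs H. unfold kern.
replace (PI * - z) with (- (PI * z)) by ring. rewrite Cexp_opp.
set (e := Cexp (PI * z)) in *. assert (He : e <> 0) by apply Cexp_neq_0.
assert (Es : RtoC sg * RtoC sg = 1) by (rewrite <- RtoC_mult, Hs; reflexivity).
assert (H2 : RtoC sg - e <> 0).
{ intros Q. apply H. assert (Q2 : e = sg) by (replace e with (sg - (sg - e)) by ring; rewrite Q; ring).
  rewrite Q2, Es. ring. }
assert (Ee : sg * / e - 1 = (sg - e) / e) by (field; auto).
assert (Ef : sg - e = - (RtoC sg) * (sg * e - 1)).
{ replace (- RtoC sg * (sg * e - 1)) with (RtoC sg - RtoC sg * RtoC sg * e) by ring.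
  rewrite Es. ring. }
assert (Hs0 : RtoC sg <> 0) by (apply RtoC_neq; nra).
rewrite Ee, Ef.
replace (2 / (- RtoC sg * (sg * e - 1) / e)) with (- (2 * e * sg / (sg * e - 1)) / (RtoC sg * RtoC sg))
  by (field; auto).
rewrite Es. field. auto.
Qed.

(** * Moving a segment across a strip *)

Section DependingOnParameter.

Variables (F dF : R -> R -> C) (a b t e : R).
Hypothesis He : (0 < e)%R.
Hypothesis Hab : (a <= b)%R.
Hypothesis Hcont : forall s, (Rabs (s - t) < e)%R -> forall x, RCcontinuous (F s) x.

Lemma near_t (P : R -> Prop) : (forall s, (Rabs (s - t) < e)%R -> P s) -> locally t P.
Proof. intros H. exists (mkposreal e He). intros s Hs. apply H. exact Hs. Qed.

Lemma continuity_2d_of_prod (G : R -> R -> R) x :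
  R2continuous
    (fun p : R * R => G (fst p) (snd p)) (t, x) -> continuity_2d_pt G t x.
Proof. intros H. apply continuity_2d_pt_filterlim. exact H. Qed.

Lemma CInt_param_derive :
  (forall s, (Rabs (s - t) < e)%R -> forall x, is_RCderive (fun s => F s x) s (dF s x)) ->
  (forall x, R2Ccontinuous (fun p : R * R => dF (fst p) (snd p)) (t, x)) ->
  is_RCderive (fun s => CInt (F s) a b) t (CInt (dF t) a b).
Proof.
intros Hd Hdc.
assert (Hx : forall x, RCcontinuous (dF t) x).
{ intros x. apply (continuous_comp (U := R_UniformSpace) (V := prod_UniformSpace R_UniformSpace R_UniformSpace) (W := C_UniformSpace)
    (fun x => (t, x)) (fun p : R * R => dF (fst p) (snd p))); [|apply Hdc].
  apply (continuous_comp_2 (fun _ : R => t) (fun x : R => x) (fun a b : R => (a, b)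
    : prod_UniformSpace R_UniformSpace R_UniformSpace)).
  - apply continuous_const.
  - apply continuous_id.
  - apply continuous_ext with (fun z : R * R => z);
    [intros []; reflexivity|apply continuous_id]. }
assert (Hgen : forall p : C -> R,
  (forall f x l, is_RCderive f x l -> is_derive (fun s => p (f s)) x (p l)) ->
  (forall (T : UniformSpace) (f : T -> C) x, Ccts f x ->
    Rcts (fun y => p (f y)) x) ->
  is_derive (fun s => RInt (fun x => p (F s x)) a b) t (RInt (fun x => p (dF t x)) a b)).
{ intros p Hpd Hpc.
  assert (HD : forall s x, (Rabs (s - t) < e)%R -> Derive (fun s => p (F s x)) s = p (dF s x)).
  { intros s x Hs. apply is_derive_unique, (Hpd (fun s => F s x)), Hd, Hs. }
  assert (Ht : (Rabs (t - t) < e)%R) by (rewrite Rminus_diag, Rabs_R0; exact He).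
  assert (H := is_derive_RInt_param (fun s x => p (F s x)) a b t).
  rewrite (RInt_ext _ (fun x => p (dF t x))) in H by (intros; apply HD, Ht).
  apply H.
  - apply near_t. intros s Hs x _. exists (p (dF s x)). apply (Hpd (fun s => F s x)), Hd, Hs.
  - intros x _. apply (continuity_2d_pt_ext_loc (fun s x => p (dF s x))).
    + exists (mkposreal e He). intros s v Hs _. symmetry. apply HD. exact Hs.
    + apply continuity_2d_of_prod. apply (Hpc _ (fun q : R * R => dF (fst q) (snd q))), Hdc.
  - apply near_t. intros s Hs. apply (ex_RInt_continuous (V := R_CompleteNormedModule)).
    intros z _. apply (Hpc _ (F s)), Hcont, Hs. }
assert (HRe := Hgen Re). assert (HIm := Hgen Im). clear Hgen.
assert (Ht : (Rabs (t - t) < e)%R) by (rewrite Rminus_diag, Rabs_R0; exact He).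
apply is_RCderive_pair. rewrite (CInt_pair (dF t)) by exact Hx. split.
- apply (is_derive_ext_loc (fun s => RInt (fun x => Re (F s x)) a b)).
  + apply near_t. intros s Hs. rewrite CInt_pair by auto. reflexivity.
  + apply HRe; [intros f x l H; apply (proj1 (is_RCderive_pair f x l) H)|
      intros T f x H; apply (proj1 (Ccont_pair T f x) H)].
- apply (is_derive_ext_loc (fun s => RInt (fun x => Im (F s x)) a b)).
  + apply near_t. intros s Hs. rewrite CInt_pair by auto. reflexivity.
  + apply HIm; [intros f x l H; apply (proj1 (is_RCderive_pair f x l) H)|
      intros T f x H; apply (proj1 (Ccont_pair T f x) H)].
Qed.

Lemma CInt_param_continuous :
  (forall x, R2Ccontinuous (fun p : R * R => F (snd p) (fst p)) (x, t)) ->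
  RCcontinuous (fun s => CInt (F s) a b) t.
Proof.
intros Hc. apply Ccontinuous_iff. intros q Hq.
assert (Ht : (Rabs (t - t) < e)%R) by (rewrite Rminus_diag, Rabs_R0; exact He).
set (q' := (q / (2 * (b - a) + 1) / 2)%R).
assert (Hq' : (0 < q')%R) by (unfold q'; repeat apply Rdiv_lt_0_compat; lra).
assert (Hu : forall p : C -> R, (forall (T : UniformSpace) (f : T -> C) x,
    Ccts f x -> Rcts (fun y => p (f y)) x) ->
  exists d, (0 < d)%R /\ forall s x, (Rabs (s - t) < d)%R -> (a <= x <= b)%R ->
    (Rabs (p (F s x) - p (F t x)) < q')%R).
{ intros p Hp. destruct (uniform_continuity_2d_1d (fun x s => p (F s x)) a b t) with
    (eps := mkposreal q' Hq') as [d Hd].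
  - intros x _. apply continuity_2d_pt_filterlim.
    exact (Hp _ (fun q : R * R => F (snd q) (fst q)) (x, t) (Hc x)).
  - exists d. split; [apply cond_pos|]. intros s x Hs Hx.
    apply Rabs_def2 in Hs. assert (Hdp := cond_pos d).
    apply (Hd x t x s); auto; try lra. rewrite Rminus_diag, Rabs_R0. lra. }
destruct (Hu Re) as (d1 & Hd1 & H1); [intros T f x H; apply (proj1 (Ccont_pair T f x) H)|].
destruct (Hu Im) as (d2 & Hd2 & H2); [intros T f x H; apply (proj1 (Ccont_pair T f x) H)|].
assert (Hd : (0 < Rmin e (Rmin d1 d2))%R) by (repeat apply Rmin_glb_lt; auto).
exists (mkposreal _ Hd). intros s Hs. change (Rabs (s - t) < Rmin e (Rmin d1 d2))%R in Hs.
assert (B1 := Rmin_l e (Rmin d1 d2)). assert (B2 := Rmin_r e (Rmin d1 d2)).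
assert (B3 := Rmin_l d1 d2). assert (B4 := Rmin_r d1 d2).
rewrite <- CInt_minus; [|apply Hcont; lra|apply Hcont; lra].
eapply Rle_lt_trans.
- apply (CInt_bound_const _ (q' + q') a b Hab).
  + intros x. apply Ccont_minus; apply Hcont; lra.
  + intros x Hx. eapply Rle_trans; [apply Cmod_le_abs|].
    apply Rplus_le_compat; left; [apply H1|apply H2]; lra || exact Hx.
- unfold q'. apply Rmult_lt_reg_r with (2 * (b - a) + 1)%R; [lra|].
  replace ((b - a) * (q / (2 * (b - a) + 1) / 2 + q / (2 * (b - a) + 1) / 2) * (2 * (b - a) + 1))%R
    with ((b - a) * q)%R by (field; lra). nra.
Qed.

End DependingOnParameter.

Lemma cont_point (u : C -> C) (s x : R) : Ccontinuous u (x - Ci * s) ->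
  R2Ccontinuous (fun p : R * R => u (fst p - Ci * snd p)) (x, s).
Proof.
intros H. apply (continuous_comp (U := prod_UniformSpace R_UniformSpace R_UniformSpace) (V := C_UniformSpace) (W := C_UniformSpace) (fun p : R * R => RtoC (fst p) - Ci * snd p) u); [|exact H].
apply Ccont_minus; [apply Ccont_RtoC, continuous_fst|].
apply Ccont_mult; [apply Ccont_const|apply Ccont_RtoC, continuous_snd].
Qed.

Lemma cont_point_swap (u : C -> C) (s x : R) : Ccontinuous u (x - Ci * s) ->
  R2Ccontinuous (fun p : R * R => u (snd p - Ci * fst p)) (s, x).
Proof.
intros H. apply (continuous_comp (U := prod_UniformSpace R_UniformSpace R_UniformSpace) (V := C_UniformSpace) (W := C_UniformSpace) (fun p : R * R => RtoC (snd p) - Ci * fst p) u); [|exact H].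
apply Ccont_minus; [apply Ccont_RtoC, continuous_snd|].
apply Ccont_mult; [apply Ccont_const|apply Ccont_RtoC, continuous_fst].
Qed.

Lemma cont_horizontal (u : C -> C) (s x : R) : Ccontinuous u (x - Ci * s) ->
  RCcontinuous (fun x : R => u (x - Ci * s)) x.
Proof.
intros H. apply (continuous_comp (U := R_UniformSpace) (V := C_UniformSpace) (W := C_UniformSpace) (fun x : R => RtoC x - Ci * s) u); [|exact H].
apply Ccont_minus; [apply Ccont_RtoC, Rcont_id|apply Ccont_const].
Qed.

(** The integral of [u] over a horizontal segment changes, as the segment moves,
    by the integrals of [u] over its ends (Cauchy's theorem for rectangles).  On
    the height [l] only continuity is known: this is where a removable
    singularity is allowed. *)
Lemma segment_shift (u : C -> C) (l a b t1 t2 R C0 : R) :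
  (a < t1)%R -> (t1 <= t2)%R -> (t2 < b)%R -> (0 <= R)%R ->
  (forall z, (a < - Im z < b)%R -> Ccontinuous u z) ->
  C1_on (fun z => (a < - Im z < b)%R /\ (- Im z <> l)%R) u ->
  (forall t, (t1 <= t <= t2)%R -> (Cmod (u (R - Ci * t)%C) <= C0)%R /\
    (Cmod (u ((- R)%R - Ci * t)%C) <= C0)%R) ->
  (Cmod (CInt (fun x : Rdefinitions.R => u (x - Ci * t2))%C (- R) R
    - CInt (fun x : Rdefinitions.R => u (x - Ci * t1))%C (- R) R)
   <= 4 * C0 * (t2 - t1))%R.
Proof.
intros Ha H12 Hb HR Hc (du & Hdu) Hside.
set (J := fun t : Rdefinitions.R => CInt (fun x : Rdefinitions.R => u (x - Ci * t)) (- R) R).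
assert (Him : forall x t : Rdefinitions.R, (- Im (x - Ci * t))%R = t)
  by (intros; unfold Im; simpl; ring).
assert (HJc : forall t, (a < t < b)%R -> RCcontinuous J t).
{ intros t Ht. apply (CInt_param_continuous (fun t x => u (x - Ci * t)) (- R) R t (Rmin (t - a) (b - t))).
  - apply Rmin_glb_lt; lra.
  - lra.
  - intros s Hs x. assert (B1 := Rmin_l (t - a) (b - t)). assert (B2 := Rmin_r (t - a) (b - t)).
    apply Rabs_def2 in Hs. apply cont_horizontal, Hc. rewrite Him. lra.
  - intros x. apply cont_point, Hc. rewrite Him. lra. }
assert (HJd : forall t, (a < t < b)%R -> t <> l ->
  is_RCderive J t (- Ci * (u (R - Ci * t) - u ((- R)%R - Ci * t)))).
{ intros t Ht Hl.
  set (e := Rmin (Rabs (t - l)) (Rmin (t - a) (b - t))).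
  assert (B1 := Rmin_l (t - a) (b - t)). assert (B2 := Rmin_r (t - a) (b - t)).
  assert (B3 := Rmin_l (Rabs (t - l)) (Rmin (t - a) (b - t))).
  assert (B4 := Rmin_r (Rabs (t - l)) (Rmin (t - a) (b - t))). fold e in B3, B4.
  assert (He : (0 < e)%R).
  { unfold e. repeat apply Rmin_glb_lt; try lra. apply Rabs_pos_lt. lra. }
  assert (Hne : forall s, (Rabs (s - t) < e)%R -> (a < s < b)%R /\ s <> l).
  { intros s Hs. split; [apply Rabs_def2 in Hs; lra|]. intros ->.
    rewrite Rabs_minus_sym in Hs. lra. }
  assert (Ht0 : (Rabs (t - t) < e)%R) by (rewrite Rminus_diag, Rabs_R0; exact He).
  assert (H := CInt_param_derive (fun t x => u (x - Ci * t))
    (fun t x => - Ci * du (x - Ci * t)) (- R) R t e He).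
  assert (E : CInt (fun x : Rdefinitions.R => - Ci * du (x - Ci * t)) (- R) R =
    - Ci * (u (R - Ci * t) - u ((- R)%R - Ci * t))).
  { assert (Hcd : forall x, RCcontinuous (fun x : Rdefinitions.R => du (x - Ci * t)) x).
    { intros x. apply cont_horizontal, Hdu. rewrite Him. auto. }
    rewrite CInt_scal by exact Hcd. apply (f_equal (Cmult (- Ci))).
    apply (CInt_FTC (fun x : Rdefinitions.R => u (x - Ci * t))); [|exact Hcd].
    intros x. assert (L := is_RCderive_line u (- (Ci * t)) 1 x (du (x - Ci * t))).
    rewrite Cmult_1_l in L.
    apply (is_derive_ext (fun s : Rdefinitions.R => u (- (Ci * t) + s * 1))).
    - intros s. apply (f_equal u). rewrite Cmult_1_r. unfold Cminus. apply Cplus_comm.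
    - apply L. replace (- (Ci * t) + x * 1) with (x - Ci * t) by ring.
      apply Hdu. rewrite Him. auto. }
  rewrite <- E. apply H.
  - intros s Hs x. apply cont_horizontal, Hc. rewrite Him. apply Hne, Hs.
  - intros s Hs x. assert (L := is_RCderive_line u x (- Ci) s (du (x - Ci * s))).
    apply (is_derive_ext (fun s : Rdefinitions.R => u (x + s * - Ci))).
    + intros s'. apply (f_equal u). change (@eq C (x + s' * - Ci) (x - Ci * s')). ring.
    + apply L. replace (x + s * - Ci) with (x - Ci * s) by ring.
      apply Hdu. rewrite Him. apply Hne, Hs.
  - intros x. apply Ccont_mult; [apply Ccont_const|].
    apply cont_point_swap, Hdu. rewrite Him. apply Hne, Ht0. }
assert (Hmv : forall s1 s2, (t1 <= s1)%R -> (s1 <= s2)%R -> (s2 <= t2)%R ->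
  (forall t, (s1 < t < s2)%R -> t <> l) ->
  (Cmod (J s2 - J s1) <= 2 * (2 * C0) * (s2 - s1))%R).
{ intros s1 s2 H1 H2 H3 Hl. apply (RC_mean_value J
    (fun t => - Ci * (u (R - Ci * t) - u ((- R)%R - Ci * t)))); auto.
  - intros x Hx. apply HJc. lra.
  - intros x Hx. split; [apply HJd; [lra|apply Hl, Hx]|].
    destruct (Hside x ltac:(lra)) as [Q1 Q2].
    rewrite Cmod_mult, Cmod_opp, Cmod_Ci, Rmult_1_l.
    eapply Rle_trans; [apply Cmod_minus_le|]. lra. }
fold (J t1) (J t2).
destruct (Rlt_dec t1 l) as [Q1|Q1]; [destruct (Rlt_dec l t2) as [Q2|Q2]|].
- assert (M1 := Hmv t1 l ltac:(lra) ltac:(lra) ltac:(lra) ltac:(intros; lra)).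
  assert (M2 := Hmv l t2 ltac:(lra) ltac:(lra) ltac:(lra) ltac:(intros; lra)).
  replace (J t2 - J t1) with ((J t2 - J l) + (J l - J t1)) by ring.
  eapply Rle_trans; [apply Cmod_triangle|]. lra.
- assert (M1 := Hmv t1 t2 ltac:(lra) ltac:(lra) ltac:(lra) ltac:(intros; lra)). lra.
- assert (M1 := Hmv t1 t2 ltac:(lra) ltac:(lra) ltac:(lra) ltac:(intros; lra)). lra.
Qed.

(** The difference quotient of a holomorphic function at [a], made continuous
    by its value at [a]. *)
Definition diff_quot (p : C -> C) (a p' z : C) : C :=
  if excluded_middle_informative (z = a) then p' else (p z - p a) / (z - a).

Lemma diff_quot_continuous (p : C -> C) (a p' : C) : is_Cderive p a p' -> Ccontinuous (diff_quot p a p') a.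
Proof.
intros H. apply Ccontinuous_iff. intros e He. rewrite is_Cderive_iff in H.
destruct (H (e / 2)%R ltac:(lra)) as (d & Hd & H'). apply locally_Cmod. exists d. split; auto.
intros w Hw. unfold diff_quot at 2. destruct (excluded_middle_informative (a = a)); [|tauto].
unfold diff_quot. destruct (excluded_middle_informative (w = a)) as [E|E].
- replace (p' - p') with (RtoC 0) by ring. rewrite Cmod_0. exact He.
- assert (Hwa : w - a <> 0).
  { intros Q. apply E. replace w with (w - a + a) by ring. rewrite Q. ring. }
  assert (Hpos := proj1 (Cmod_gt_0 _) Hwa). specialize (H' w Hw).
  replace ((p w - p a) / (w - a) - p') with ((p w - p a - (w - a) * p') / (w - a)) by (field; auto).
  rewrite Cmod_div by auto. apply Rmult_lt_reg_r with (Cmod (w - a)); auto.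
  unfold Rdiv. rewrite Rmult_assoc, Rinv_l by lra. nra.
Qed.

Lemma diff_quot_C1 (D : C -> Prop) (p : C -> C) (a p' : C) : C1_on D p ->
  C1_on (fun z => D z /\ z <> a) (diff_quot p a p').
Proof.
intros Hp.
assert (H : C1_on (fun z => D z /\ z <> a) (fun z => (p z - p a) * / (z - a))).
{ apply C1_mult.
  - apply C1_minus; [|apply C1_const]. apply (C1_sub D); [tauto|exact Hp].
  - apply C1_inv; [apply C1_minus; [apply C1_id|apply C1_const]|].
    intros z [_ Hz] Q. apply Hz. replace z with (z - a + a) by ring. rewrite Q. ring. }
destruct H as (df & H). exists df. intros z Hz. destruct (H z Hz) as [H1 H2]. split; auto.
refine (is_Cderive_ext_loc _ _ _ _ _ H1). apply locally_Cmod.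
assert (Hza : z - a <> 0).
{ intros Q. apply Hz. replace z with (z - a + a) by ring. rewrite Q. ring. }
exists (Cmod (z - a)). split; [apply Cmod_gt_0, Hza|]. intros w Hw.
unfold diff_quot. destruct (excluded_middle_informative (w = a)) as [->|E]; [|reflexivity].
rewrite Cmod_minus_sym in Hw. lra.
Qed.

(** * Improper integrals *)

Definition tends (S : R -> C) (l : C) : Prop :=
  forall e, (0 < e)%R -> exists N, (0 < N)%R /\ forall x, (N <= x)%R -> (Cmod (S x - l) <= e)%R.

Lemma tends_unique S l m : tends S l -> tends S m -> l = m.
Proof.
intros H1 H2. apply NNPP. intros H.
assert (Hlm : l - m <> 0).
{ intros Q. apply H. replace l with (l - m + m) by ring. rewrite Q. ring. }
assert (Hp := proj1 (Cmod_gt_0 _) Hlm).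
destruct (H1 (Cmod (l - m) / 4)%R ltac:(lra)) as (N1 & P1 & H1').
destruct (H2 (Cmod (l - m) / 4)%R ltac:(lra)) as (N2 & P2 & H2').
specialize (H1' (Rmax N1 N2) (Rmax_l _ _)). specialize (H2' (Rmax N1 N2) (Rmax_r _ _)).
set (s := S (Rmax N1 N2)) in *.
assert (E : Cmod (l - m) = Cmod ((s - m) - (s - l))) by (f_equal; ring).
assert (Hb := Cmod_minus_le (s - m) (s - l)). lra.
Qed.

Lemma tends_ext S S' l : (forall x, (0 < x)%R -> S x = S' x) -> tends S l -> tends S' l.
Proof.
intros E H e He. destruct (H e He) as (N & HN & H'). exists N. split; auto.
intros x Hx. rewrite <- E by lra. auto.
Qed.

Lemma tends_plus S S' l m : tends S l -> tends S' m -> tends (fun x => S x + S' x) (l + m).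
Proof.
intros H1 H2 e He.
destruct (H1 (e / 2)%R ltac:(lra)) as (N1 & P1 & H1').
destruct (H2 (e / 2)%R ltac:(lra)) as (N2 & P2 & H2').
exists (Rmax N1 N2). split; [eapply Rlt_le_trans; [exact P1|apply Rmax_l]|].
intros x Hx. specialize (H1' x (Rle_trans _ _ _ (Rmax_l _ _) Hx)).
specialize (H2' x (Rle_trans _ _ _ (Rmax_r _ _) Hx)).
replace (S x + S' x - (l + m)) with ((S x - l) + (S' x - m)) by ring.
eapply Rle_trans; [apply Cmod_triangle|]. lra.
Qed.

Lemma tends_scal c S l : tends S l -> tends (fun x => c * S x) (c * l).
Proof.
intros H e He. assert (Hc := Cmod_ge_0 c).
destruct (H (e / (Cmod c + 1))%R ltac:(apply Rdiv_lt_0_compat; lra)) as (N & P & H').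
exists N. split; auto. intros x Hx. specialize (H' x Hx).
replace (c * S x - c * l) with (c * (S x - l)) by ring. rewrite Cmod_mult.
clear_denominator H' (Cmod c + 1)%R.
assert (Hs := Cmod_ge_0 (S x - l)). nra.
Qed.

Lemma tends_minus S S' l m : tends S l -> tends S' m -> tends (fun x => S x - S' x) (l - m).
Proof.
intros H1 H2. replace (l - m) with (l + - (1) * m) by ring.
apply (tends_ext (fun x => S x + - (1) * S' x)); [intros; ring|].
apply tends_plus; [exact H1|apply tends_scal, H2].
Qed.

Lemma tends_rate S l N : (forall x, (1 <= x)%R -> (Cmod (S x - l) * x <= N)%R) -> tends S l.
Proof.
intros H e He. exists (Rmax 1 (N / e)). split; [eapply Rlt_le_trans; [|apply Rmax_l]; lra|].
intros x Hx. assert (H1 := Rle_trans _ _ _ (Rmax_l _ _) Hx).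
assert (H2 := Rle_trans _ _ _ (Rmax_r _ _) Hx). specialize (H x H1).
clear_denominator H2 e.
apply Rmult_le_reg_r with x; lra || nra.
Qed.

Lemma atan_le x : (0 <= x)%R -> (atan x <= x)%R.
Proof.
intros [Hx|<-]; [|rewrite atan_0; lra].
destruct (MVT_gen (fun t => t - atan t)%R 0 x (fun t => 1 - / (1 + t²))%R) as (c & Hc & E).
- intros t _. apply (is_derive_minus (V := R_NormedModule) (fun t => t) atan);
    [apply (is_derive_id (K := R_AbsRing))|apply is_derive_atan].
- intros t _. apply continuity_pt_filterlim.
  apply (Rcont_minus _ (fun t => t) atan); [apply Rcont_id|apply continuous_atan].
- cbv beta in E. rewrite atan_0 in E.
  assert (H : (0 <= 1 - / (1 + c²))%R).
  { assert (Hc2 := Rle_0_sqr c). assert (/ (1 + c²) <= / 1)%R by (apply Rinv_le_contravar; lra).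
    rewrite Rinv_1 in *. lra. }
  nra.
Qed.

Lemma atan_near x : (0 < x)%R -> (0 <= PI / 2 - atan x <= / x)%R.
Proof.
intros Hx. assert (H := Rinv_0_lt_compat x Hx). rewrite <- atan_inv by auto. split.
- rewrite <- atan_0. left. apply atan_increasing, H.
- apply atan_le. lra.
Qed.

Lemma CInt_atan_bound (phi : R -> C) M a b : (forall x, RCcontinuous phi x) ->
  (forall x, (Cmod (phi x) * (1 + x²) <= M)%R) -> (a <= b)%R ->
  (Cmod (CInt phi a b) <= M * (atan b - atan a))%R.
Proof.
intros Hc HM Hab.
assert (Hcg : forall x, continuous (fun x => M * / (1 + x²))%R x).
{ intros x. apply Rcont_mult; [apply Rcont_const|]. assert (H := Rle_0_sqr x).
  apply (Rcont_inv _ (fun x => 1 + x²)%R); [lra|].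
  apply Rcont_plus; [apply Rcont_const|]. apply Rcont_mult; apply Rcont_id. }
eapply Rle_trans.
- apply (CInt_bound phi (fun x => M * / (1 + x²))%R a b); auto.
  intros x _. assert (H := Rle_0_sqr x). apply Rmult_le_reg_r with (1 + x²)%R; [lra|].
  rewrite Rmult_assoc, Rinv_l by lra. rewrite Rmult_1_r. apply HM.
- apply Req_le. apply is_RInt_unique.
  replace (M * (atan b - atan a))%R with (minus (M * atan b)%R (M * atan a)%R)
    by (unfold minus, plus, opp; simpl; ring).
  apply (is_RInt_derive (V := R_CompleteNormedModule) (fun x => M * atan x)%R); auto.
  intros x _. apply (is_derive_scal (fun x => atan x)). apply is_derive_atan.
Qed.

Lemma tail_limit (phi : R -> C) M : (forall x, RCcontinuous phi x) ->
  (forall x, (Cmod (phi x) * (1 + x²) <= M)%R) ->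
  exists l, forall b, (0 < b)%R -> (Cmod (CInt phi 0 b - l) <= M / b)%R.
Proof.
intros Hc HM.
assert (HM0 : (0 <= M)%R).
{ specialize (HM 0%R). eapply Rle_trans; [|exact HM].
  apply Rmult_le_pos; [apply Cmod_ge_0|]. assert (H := Rle_0_sqr 0). lra. }
assert (Hd : forall a b, (0 < a)%R -> (a <= b)%R ->
  (Cmod (CInt phi 0 b - CInt phi 0 a) <= M / a)%R).
{ intros a b Ha Hab. rewrite <- (CInt_Chasles phi 0 a b) by auto.
  replace (CInt phi 0 a + CInt phi a b - CInt phi 0 a) with (CInt phi a b) by ring.
  eapply Rle_trans; [apply (CInt_atan_bound phi M); auto|].
  assert (H1 := atan_near a Ha). assert (H2 := atan_near b ltac:(lra)).
  unfold Rdiv. nra. }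
assert (HP : ProperFilter (Rbar_locally p_infty)) by apply Rbar_locally_filter.
destruct (proj1 (filterlim_locally_cauchy (U := C_R_CompleteNormedModule) (FF := HP)
  (fun b => CInt phi 0 b))) as [l Hl].
- intros eps. assert (He := cond_pos eps).
  set (N := ((M + 1) / eps)%R). assert (HN : (0 < N)%R) by (apply Rdiv_lt_0_compat; lra).
  assert (HNe : (M / N < eps)%R).
  { unfold N. apply Rmult_lt_reg_r with ((M + 1) / eps)%R; [exact HN|].
    unfold Rdiv at 1. rewrite Rmult_assoc, Rinv_l by (fold N; lra).
    replace (eps * ((M + 1) / eps))%R with (M + 1)%R by (field; lra). lra. }
  assert (Hmono : forall u, (N < u)%R -> (M / u <= M / N)%R).
  { intros u Hu. apply Rmult_le_compat_l; auto. apply Rinv_le_contravar; lra. }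
  exists (fun u => (N < u)%R). split; [exists N; auto|]. intros u v Hu Hv.
  apply ball_C_of_lt. destruct (Rle_dec u v) as [Huv|Huv].
  + eapply Rle_lt_trans; [apply Hd; lra|]. specialize (Hmono u Hu). lra.
  + rewrite Cmod_minus_sym. eapply Rle_lt_trans; [apply Hd; lra|]. specialize (Hmono v Hv). lra.
- exists l. intros b Hb. apply Rnot_lt_le. intros Hlt.
  set (e := (Cmod (CInt phi 0 b - l) - M / b)%R) in *.
  assert (He : (0 < e / 2)%R) by (unfold e; lra).
  destruct (Hl (fun z => ball (M := C_UniformSpace) l (e / 2) z)) as [N HN].
  { exists (mkposreal _ He). intros y Hy. exact Hy. }
  specialize (HN (Rmax b (N + 1)) ltac:(eapply Rlt_le_trans; [|apply Rmax_r]; lra)).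
  apply ball_C_lt in HN. specialize (Hd b (Rmax b (N + 1)) Hb (Rmax_l _ _)).
  set (c := CInt phi 0 (Rmax b (N + 1))) in *.
  assert (E : Cmod (CInt phi 0 b - l) = Cmod ((c - l) - (c - CInt phi 0 b))) by (f_equal; ring).
  assert (Hb2 := Cmod_minus_le (c - l) (c - CInt phi 0 b)). unfold e in *. lra.
Qed.

(** Functions that are integrable over the real line by comparison with
    [1 / (1 + x^2)]. *)
Definition decaying (phi : R -> C) (M : R) : Prop :=
  (forall x, RCcontinuous phi x) /\ (forall x, (Cmod (phi x) * (1 + x²) <= M)%R).

Lemma decaying_pos phi M : decaying phi M -> (0 <= M)%R.
Proof.
intros [_ HM]. specialize (HM 0%R). eapply Rle_trans; [|exact HM].
apply Rmult_le_pos; [apply Cmod_ge_0|]. assert (H := Rle_0_sqr 0). lra.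
Qed.

Definition int_R (phi : R -> C) : C :=
  RInt_gen (V := C_R_CompleteNormedModule) phi (Rbar_locally m_infty) (Rbar_locally p_infty).

Lemma line_integral (phi : R -> C) M : decaying phi M ->
  ex_RInt_gen (V := C_R_NormedModule) phi (Rbar_locally m_infty) (Rbar_locally p_infty) /\
  tends (fun x => CInt phi (- x) x) (int_R phi).
Proof.
intros HD. assert (HM0 := decaying_pos _ _ HD). destruct HD as [Hc HM].
destruct (tail_limit phi M Hc HM) as [l1 H1].
assert (Hc' : forall x, RCcontinuous (fun t => phi (-1 * t + 0)%R) x).
{ intros x. apply (continuous_comp (fun t : R => (-1 * t + 0)%R) phi); [|apply Hc].
  apply Rcont_plus; [|apply Rcont_const]. apply Rcont_mult; [apply Rcont_const|apply Rcont_id]. }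
destruct (tail_limit (fun t => phi (-1 * t + 0)%R) M Hc') as [l2 H2].
{ intros x. specialize (HM (-1 * x + 0)%R). replace ((-1 * x + 0)²) with (x²) in HM; auto.
  unfold Rsqr; ring. }
assert (Em : RtoC (-1) = - (1)) by (apply Ceq; unfold Re, Im; simpl; ring).
assert (E2 : forall b, CInt (fun t => phi (-1 * t + 0)%R) 0 b = CInt phi (- b) 0).
{ intros b. assert (L := CInt_comp_lin phi (-1) 0 0 b Hc).
  replace (-1 * 0 + 0)%R with 0%R in L by ring.
  replace (-1 * b + 0)%R with (- b)%R in L by ring.
  rewrite (CInt_swap phi 0), Em in L by auto.
  set (u := CInt _ _ _) in *. replace u with (- (- (1) * u)) by ring. rewrite L. ring. }
assert (Hab : forall a b, (0 < a)%R -> (0 < b)%R ->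
  (Cmod (CInt phi (- a) b - (l2 + l1)) <= M / a + M / b)%R).
{ intros a b Ha Hb. rewrite <- (CInt_Chasles phi (- a) 0 b) by auto.
  specialize (H1 b Hb). specialize (H2 a Ha). rewrite E2 in H2.
  replace (CInt phi (- a) 0 + CInt phi 0 b - (l2 + l1))
    with ((CInt phi (- a) 0 - l2) + (CInt phi 0 b - l1)) by ring.
  eapply Rle_trans; [apply Cmod_triangle|]. lra. }
assert (HI : is_RInt_gen (V := C_R_NormedModule) phi (Rbar_locally m_infty)
  (Rbar_locally p_infty) (l2 + l1)).
{ apply (filterlimi_locally (U := C_R_NormedModule)). intros eps. assert (He := cond_pos eps).
  set (N := ((M + 1) * 2 / eps)%R).
  assert (HN : (0 < N)%R) by (apply Rdiv_lt_0_compat; lra).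
  assert (Hsm : forall u, (N < u)%R -> (M / u < eps / 2)%R).
  { intros u Hu. apply Rmult_lt_reg_r with u; [lra|]. unfold Rdiv at 1.
    rewrite Rmult_assoc, Rinv_l by lra.
    apply (Rmult_lt_compat_r (eps / 2)) in Hu; [|lra]. unfold N in Hu.
    replace ((M + 1) * 2 / eps * (eps / 2))%R with (M + 1)%R in Hu by (field; lra). lra. }
  apply (Filter_prod _ _ _ (fun x => x < - N)%R (fun x => N < x)%R).
  - exists (- N)%R. auto.
  - exists N. auto.
  - intros x y Hx Hy. exists (CInt phi x y). split; [apply CInt_correct, Hc|].
    apply ball_C_of_lt. specialize (Hab (- x)%R y ltac:(lra) ltac:(lra)).
    rewrite Ropp_involutive in Hab. eapply Rle_lt_trans; [exact Hab|].
    assert (A1 := Hsm (- x)%R ltac:(lra)). assert (A2 := Hsm y Hy). lra. }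
split; [exists (l2 + l1); exact HI|].
assert (EI : int_R phi = l2 + l1).
{ apply (is_RInt_gen_unique (V := C_R_CompleteNormedModule) phi). exact HI. }
rewrite EI. apply (tends_rate _ _ (2 * M)). intros x Hx.
specialize (Hab x x ltac:(lra) ltac:(lra)).
apply (Rmult_le_compat_r x) in Hab; [|lra].
replace ((M / x + M / x) * x)%R with (2 * M)%R in Hab by (field; lra). exact Hab.
Qed.

Lemma int_R_of_tends phi M l : decaying phi M -> tends (fun x => CInt phi (- x) x) l -> int_R phi = l.
Proof.
intros HD H. eapply tends_unique; [|exact H]. apply (line_integral phi M HD).
Qed.

Lemma decaying_plus phi psi M N : decaying phi M -> decaying psi N ->
  decaying (fun x => phi x + psi x) (M + N).
Proof.
intros [C1 B1] [C2 B2]. split; [intros; apply Ccont_plus; auto|].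
intros x. specialize (B1 x). specialize (B2 x). assert (Hx := Rle_0_sqr x).
assert (Ht := Cmod_triangle (phi x) (psi x)).
eapply Rle_trans; [apply Rmult_le_compat_r; [lra|exact Ht]|]. lra.
Qed.

Lemma int_R_plus phi psi M N : decaying phi M -> decaying psi N ->
  int_R (fun x => phi x + psi x) = int_R phi + int_R psi.
Proof.
intros H1 H2. apply (int_R_of_tends _ (M + N)); [apply decaying_plus; auto|].
apply (tends_ext (fun x => CInt phi (- x) x + CInt psi (- x) x)).
- intros x _. rewrite CInt_plus; auto; [apply H1|apply H2].
- apply tends_plus; [apply (line_integral phi M H1)|apply (line_integral psi N H2)].
Qed.

Lemma decaying_scal c phi M : decaying phi M -> decaying (fun x => c * phi x) (Cmod c * M).
Proof.
intros [C1 B1]. split; [intros; apply Ccont_mult; [apply Ccont_const|auto]|].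
intros x. rewrite Cmod_mult, Rmult_assoc. apply Rmult_le_compat_l; [apply Cmod_ge_0|auto].
Qed.

Lemma int_R_scal c phi M : decaying phi M -> int_R (fun x => c * phi x) = c * int_R phi.
Proof.
intros H1. apply (int_R_of_tends _ (Cmod c * M)); [apply decaying_scal, H1|].
apply (tends_ext (fun x => c * CInt phi (- x) x)).
- intros x _. rewrite CInt_scal; auto. apply H1.
- apply tends_scal, (line_integral phi M H1).
Qed.

Lemma tends_bound S l B : (forall x, (0 < x)%R -> (Cmod (S x) <= B)%R) -> tends S l -> (Cmod l <= B)%R.
Proof.
intros HB H. apply Rnot_lt_le. intros Hlt.
destruct (H ((Cmod l - B) / 2)%R ltac:(lra)) as (N & HN & H').
specialize (H' N (Rle_refl _)). specialize (HB N HN).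
assert (Ht := Cmod_triangle_rev l (S N)). rewrite Cmod_minus_sym in Ht. lra.
Qed.

Lemma int_R_bound phi M : decaying phi M -> (Cmod (int_R phi) <= PI * M)%R.
Proof.
intros H. apply (tends_bound (fun x => CInt phi (- x) x)); [|apply (line_integral phi M H)].
intros x Hx. eapply Rle_trans; [apply (CInt_atan_bound phi M); [apply H|apply H|lra]|].
assert (H1 := atan_bound x). assert (H2 := atan_bound (- x)). assert (HM := decaying_pos _ _ H).
nra.
Qed.

(** Over a half-line, the integrand is only required to agree with a decaying
    function for positive arguments. *)
Lemma half_line_integral (v k : R -> C) M l : decaying v M -> (forall x, (0 < x)%R -> k x = v x) ->
  tends (fun x => CInt v 0 x) l ->
  ex_RInt_half_line k /\ RInt_half_line k = l.
Proof.
intros HD Hk Hl. assert (HM0 := decaying_pos _ _ HD). destruct HD as [Hc HM].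
destruct (tail_limit v M Hc HM) as [l1 H1].
assert (El : l1 = l).
{ apply (tends_unique (fun x => CInt v 0 x)); auto. apply (tends_rate _ _ M).
  intros x Hx. specialize (H1 x ltac:(lra)).
  apply (Rmult_le_compat_r x) in H1; [|lra].
  replace (M / x * x)%R with M in H1 by (field; lra). exact H1. }
subst l1.
assert (HI : is_RInt_gen (V := C_R_NormedModule) k (at_right 0) (Rbar_locally p_infty) l).
{ apply (filterlimi_locally (U := C_R_NormedModule)). intros eps. assert (He := cond_pos eps).
  set (N := ((M + 1) * 2 / eps)%R).
  assert (HN : (0 < N)%R) by (apply Rdiv_lt_0_compat; lra).
  set (d := (eps / (2 * (M + 1)))%R).
  assert (Hd : (0 < d)%R) by (apply Rdiv_lt_0_compat; lra).
  apply (Filter_prod _ _ _ (fun x => 0 < x < d)%R (fun x => N < x)%R).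
  - exists (mkposreal d Hd). intros y Hy Hy0. split; [exact Hy0|].
    change (Rabs (y - 0) < d)%R in Hy. rewrite Rminus_0_r in Hy. apply Rabs_def2 in Hy. lra.
  - exists N. auto.
  - intros x y Hx Hy. exists (CInt v x y). split.
    + apply (is_RInt_ext (V := C_R_NormedModule) v); [|apply CInt_correct, Hc].
      cbn [fst snd]. intros t Ht. symmetry. apply Hk.
      assert (Q : (0 < Rmin x y)%R) by (apply Rmin_glb_lt; lra). lra.
    + apply ball_C_of_lt. specialize (H1 y ltac:(lra)).
      rewrite <- (CInt_Chasles v 0 x y) in H1 by auto.
      assert (Hs : (Cmod (CInt v 0 x) <= (x - 0) * M)%R).
      { apply CInt_bound_const; [lra|auto|]. intros t _. specialize (HM t).
        assert (Ht := Rle_0_sqr t). assert (Hv := Cmod_ge_0 (v t)). nra. }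
      replace (CInt v x y - l) with ((CInt v 0 x + CInt v x y - l) - CInt v 0 x) by ring.
      eapply Rle_lt_trans; [apply Cmod_minus_le|].
      assert (A1 : (M / y < eps / 2)%R).
      { apply Rmult_lt_reg_r with y; [lra|]. unfold Rdiv at 1.
        rewrite Rmult_assoc, Rinv_l by lra.
        apply (Rmult_lt_compat_r (eps / 2)) in Hy; [|lra]. unfold N in Hy.
        replace ((M + 1) * 2 / eps * (eps / 2))%R with (M + 1)%R in Hy by (field; lra). lra. }
      assert (A2 : (x * M <= eps / 2)%R).
      { apply Rle_trans with (d * (M + 1))%R; [apply Rmult_le_compat; lra|].
        apply Req_le. unfold d. field. lra. }
      lra. }
split; [exists l; exact HI|].
apply (is_RInt_gen_unique (V := C_R_CompleteNormedModule) k). exact HI.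
Qed.

Lemma CInt_cauchy_kernel (be : R) x : be <> 0%R ->
  CInt (fun t => / (t + Ci * be)) (- x) x = - (2 * Ci * atan (x / be)).
Proof.
intros Hbe.
assert (Hq : forall t : R, (0 < t * t + be * be)%R).
{ intros t. assert (H := Rle_0_sqr t). assert (H2 := Rsqr_pos_lt be Hbe). unfold Rsqr in *. lra. }
assert (E : forall t : R, / (t + Ci * be) = ((t / (t * t + be * be))%R, (- be / (t * t + be * be))%R)).
{ intros t. assert (Q := Hq t). apply Ceq; unfold Cinv, Re, Im; simpl; field; nra. }
assert (Hc : forall t, RCcontinuous (fun t : R => / (t + Ci * be)) t).
{ intros t. apply Ccont_inv.
  - intros Q. apply (f_equal Im) in Q. unfold Im in Q; simpl in Q. apply Hbe. lra.
  - apply Ccont_plus; [apply Ccont_RtoC, Rcont_id|apply Ccont_const]. }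
rewrite (CInt_FTC (fun t : R => ((ln (t * t + be * be) / 2)%R, (- atan (t / be))%R) : C)).
- apply Ceq; unfold Re, Im; simpl.
  + replace (- x * - x)%R with (x * x)%R by ring. ring.
  + replace (- x / be)%R with (- (x / be))%R by (field; auto). rewrite atan_opp. ring.
- intros t. rewrite E. assert (Q := Hq t). apply is_RCderive_pair. unfold Re, Im; simpl. split.
  + auto_derive; [auto|]. field; lra.
  + apply (is_derive_ext (fun t => - atan (/ be * t))%R).
    { intros s. apply (f_equal (fun u => - atan u)%R). unfold Rdiv. apply Rmult_comm. }
    assert (D : is_derive (fun s => atan (/ be * s)) t (/ be * / (1 + (/ be * t)²))%R).
    { apply (is_derive_comp atan (fun s => / be * s)%R t); [apply is_derive_atan|].
      auto_derive; [auto|ring]. }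
    replace (- be / (t * t + be * be))%R with (- (/ be * / (1 + (/ be * t)²)))%R.
    * apply (is_derive_opp (V := R_NormedModule) (fun s => atan (/ be * s))). exact D.
    * unfold Rsqr. field. repeat split; try lra; nra.
- exact Hc.
Qed.

(** The symmetric integral of [1 / (x + i beta)] jumps by [2 PI i] as [beta]
    changes its sign: this is what a residue contributes. *)
Lemma tends_cauchy_kernel (be : R) : be <> 0%R ->
  tends (fun x => CInt (fun t => / (t + Ci * be)) (- x) x) (if Rlt_dec 0 be then - (Ci * PI) else Ci * PI).
Proof.
intros Hbe. apply (tends_rate _ _ (2 * Rabs be)). intros x Hx.
rewrite CInt_cauchy_kernel by auto. destruct (Rlt_dec 0 be) as [H|H].
- replace (- (2 * Ci * atan (x / be)) - - (Ci * PI)) with (2 * Ci * (PI / 2 - atan (x / be))%R).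
  + rewrite !Cmod_mult, Cmod_Ci, !Cmod_R, (Rabs_pos_eq 2) by lra.
    destruct (atan_near (x / be)) as [H1 H2]; [apply Rdiv_lt_0_compat; lra|].
    rewrite Rabs_pos_eq, (Rabs_pos_eq be) by lra.
    replace (/ (x / be))%R with (be / x)%R in H2 by (field; lra).
    apply (Rmult_le_compat_r x) in H2; [|lra].
    replace (be / x * x)%R with be in H2 by (field; lra). lra.
  + rewrite RtoC_minus, RtoC_div by lra. field.
- assert (Ea : (atan (x / be) = - atan (x / - be))%R).
  { rewrite <- atan_opp. f_equal. field. lra. }
  rewrite Ea.
  replace (- (2 * Ci * RtoC (- atan (x / - be))) - Ci * PI) with (- (2 * Ci * (PI / 2 - atan (x / - be))%R)).
  + rewrite Cmod_opp, !Cmod_mult, Cmod_Ci, !Cmod_R, (Rabs_pos_eq 2) by lra.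
    destruct (atan_near (x / - be)) as [H1 H2]; [apply Rdiv_lt_0_compat; lra|].
    rewrite Rabs_pos_eq, (Rabs_left be) by lra.
    replace (/ (x / - be))%R with (- be / x)%R in H2 by (field; lra).
    apply (Rmult_le_compat_r x) in H2; [|lra].
    replace (- be / x * x)%R with (- be)%R in H2 by (field; lra). lra.
  + rewrite RtoC_minus, RtoC_div, RtoC_opp by lra. field.
Qed.

(** * Contour integrals below the real axis *)

(** Uniform in [ze'] near [ze] and in the height of the line, as needed for
    derivatives in [ze] and for vertical sides. *)
Lemma cauchy_lower y ze : (- y < Im ze)%R -> exists c, (0 < c)%R /\
  forall (x t : R) (ze' : C), (y <= t)%R -> (Cmod (ze' - ze) <= (Im ze + y) / 2)%R ->
  (c * (1 + Rabs x) <= Cmod (x - Ci * t - ze'))%R.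
Proof.
intros Hy. set (d := (Im ze + y)%R). assert (Hd : (0 < d)%R) by (unfold d; lra).
set (k := (1 + (1 + Cmod ze + d / 2) * (2 / d))%R).
assert (H2d : (0 < 2 / d)%R) by (apply Rdiv_lt_0_compat; lra).
assert (Hz := Cmod_ge_0 ze).
assert (Hk : (0 < k)%R) by (unfold k; nra).
exists (/ k)%R. split; [apply Rinv_0_lt_compat, Hk|]. intros x t ze' Ht Hz'.
set (m := Cmod (x - Ci * t - ze')).
assert (Him : (d / 2 <= m)%R).
{ assert (H1 := im_le_Cmod (ze' - ze)). assert (H2 := im_le_Cmod (x - Ci * t - ze')).
  fold m in H2. replace (Im (x - Ci * t - ze')) with (- (t + Im ze + Im (ze' - ze)))%R in H2
    by (unfold Im; simpl; ring).
  rewrite Rabs_Ropp in H2. assert (H3 := Rle_abs (t + Im ze + Im (ze' - ze))).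
  assert (H4 := Rle_abs (- Im (ze' - ze))). rewrite Rabs_Ropp in H4.
  fold d in Hz'. unfold d in *. lra. }
assert (Hre : (Rabs x <= m + (Cmod ze + d / 2))%R).
{ rewrite <- Cmod_R.
  assert (H1 : (Rabs (Re (x - Ci * t - ze')) <= m)%R) by apply re_le_Cmod.
  replace (Re (x - Ci * t - ze')) with (x - Re ze')%R in H1 by (unfold Re; simpl; ring).
  assert (H2 := re_le_Cmod ze'). assert (H3 := Cmod_triangle (ze' - ze) ze).
  replace (ze' - ze + ze) with ze' in H3 by ring. rewrite Cmod_R.
  assert (H4 := Rabs_triang (x - Re ze') (Re ze')).
  replace (x - Re ze' + Re ze')%R with x in H4 by ring. fold d in Hz'. lra. }
assert (H1m : (1 <= m * (2 / d))%R).
{ apply (Rmult_le_compat_r (2 / d)) in Him; [|lra].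
  replace (d / 2 * (2 / d))%R with 1%R in Him by (field; lra). exact Him. }
apply Rmult_le_reg_l with k; [exact Hk|]. rewrite <- Rmult_assoc, Rinv_r, Rmult_1_l by lra.
unfold k. nra.
Qed.

Lemma strip_line l (y x : R) : (INR l - 1 < y < INR l + 1)%R -> strip l (x - Ci * y).
Proof.
intros H. unfold strip. replace (Im (x - Ci * y)) with (- y)%R by (unfold Im; simpl; ring).
apply Rabs_def1; lra.
Qed.

Lemma line_off_pole l (y x : R) : y <> INR l -> x - Ci * y <> pole l.
Proof.
intros H E. apply H. apply (f_equal Im) in E. rewrite Im_pole in E.
unfold Im in E; simpl in E. lra.
Qed.

Lemma kern_C1 sg l : (sg * sg = 1)%R -> C1_on (fun z => strip l z /\ z <> pole l) (kern sg).
Proof.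
intros Hs. unfold kern. apply C1_plus; [apply C1_const|]. apply C1_mult; [apply C1_const|].
apply C1_inv; [|intros z [Hz Hn]; apply (kern_den sg l); auto].
apply C1_minus; [|apply C1_const]. apply C1_mult; [apply C1_const|].
apply (C1_ext _ (fun z => Cexp (PI * z + 0))); [intros; apply f_equal; ring|].
apply C1_comp_aff, C1_Cexp.
Qed.

Lemma decaying_mult (w q : R -> C) W Q : (0 <= W)%R ->
  (forall x, RCcontinuous w x) -> (forall x, RCcontinuous q x) ->
  (forall x, (Cmod (w x) * (1 + Rabs x) <= W)%R) ->
  (forall x, (Cmod (q x) * (1 + Rabs x) <= Q)%R) -> decaying (fun x => q x * w x) (Q * W).
Proof.
intros HW Cw Cq Bw Bq. split; [intros; apply Ccont_mult; auto|].
intros x. specialize (Bw x). specialize (Bq x). rewrite Cmod_mult.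
assert (H := Rabs_pos x). assert (H1 := Cmod_ge_0 (w x)). assert (H2 := Cmod_ge_0 (q x)).
assert (H3 : (1 + x² <= (1 + Rabs x) * (1 + Rabs x))%R).
{ rewrite (Rsqr_abs x). unfold Rsqr. nra. }
apply Rle_trans with ((Cmod (q x) * (1 + Rabs x)) * (Cmod (w x) * (1 + Rabs x)))%R.
- replace ((Cmod (q x) * (1 + Rabs x)) * (Cmod (w x) * (1 + Rabs x)))%R
    with (Cmod (q x) * Cmod (w x) * ((1 + Rabs x) * (1 + Rabs x)))%R by ring.
  apply Rmult_le_compat_l; auto. apply Rmult_le_pos; auto.
- apply Rmult_le_compat; auto; apply Rmult_le_pos; lra.
Qed.

Section Contour.

Variables (T : C -> C) (sg : R).
Hypothesis HT : amplitude T.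
Hypothesis Hsg : (sg * sg = 1)%R.

Let TC1 : C1_on (fun _ => True) T := proj1 HT.
Let Tdecay : forall Y, exists M, (0 <= M)%R /\
  forall z, (Rabs (Im z) <= Y)%R -> (Cmod (T z) * (1 + Rabs (Re z)) <= M)%R := proj2 (proj2 HT).

Definition plancherel_weight (z : C) : C := T z * kern sg z.
Definition contour (ze z : C) : C := / (z - ze) * T z * kern sg z.

Lemma plancherel_weight_line l y : (INR l - 1 < y < INR l + 1)%R -> y <> INR l ->
  (forall x, RCcontinuous (fun x : R => plancherel_weight (x - Ci * y)) x) /\
  exists W, (0 <= W)%R /\ forall x : R, (Cmod (plancherel_weight (x - Ci * y)) * (1 + Rabs x) <= W)%R.
Proof.
intros Hy Hl.
assert (Ck : forall x, RCcontinuous (fun x : R => kern sg (x - Ci * y)) x).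
{ intros x. apply (cont_horizontal (kern sg)).
  apply (C1_continuous _ _ _ (kern_C1 sg l Hsg)).
  split; [apply strip_line, Hy|apply line_off_pole, Hl]. }
split.
- intros x. apply Ccont_mult; [|apply Ck].
  apply (cont_horizontal T), (C1_continuous _ _ _ TC1 I).
- destruct (cont_bounded _ (-1) 1 ltac:(lra) Ck) as (B & HB0 & HB).
  destruct (Tdecay (Rabs y)) as (M & HM0 & HM).
  exists (M * (B + 4))%R. split; [apply Rmult_le_pos; lra|]. intros x.
  unfold plancherel_weight. rewrite Cmod_mult.
  assert (Hk : (Cmod (kern sg (x - Ci * y)%C) <= B + 4)%R).
  { destruct (Rle_dec 1 (Rabs x)) as [H|H].
    - assert (K := kern_bound sg (x - Ci * y) Hsg).
      replace (Re (x - Ci * y)) with x in K by (unfold Re; simpl; ring).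
      specialize (K H). lra.
    - assert (K := HB x). cbv beta in K. assert (Hx : (-1 <= x <= 1)%R) by (apply Rabs_le_between; lra).
      specialize (K Hx). lra. }
  specialize (HM (x - Ci * y)).
  replace (Im (x - Ci * y)) with (- y)%R in HM by (unfold Im; simpl; ring).
  replace (Re (x - Ci * y)) with x in HM by (unfold Re; simpl; ring).
  rewrite Rabs_Ropp in HM. specialize (HM (Rle_refl _)).
  assert (H0 := Cmod_ge_0 (T (x - Ci * y))). assert (H1 := Cmod_ge_0 (kern sg (x - Ci * y))).
  assert (H2 := Rabs_pos x).
  replace (Cmod (T (x - Ci * y)%C) * Cmod (kern sg (x - Ci * y)%C) * (1 + Rabs x))%R
    with ((Cmod (T (x - Ci * y)%C) * (1 + Rabs x)) * Cmod (kern sg (x - Ci * y)%C))%R by ring.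
  apply Rmult_le_compat; auto. apply Rmult_le_pos; lra.
Qed.

Lemma resolvent_cont y ze (x : R) : (- y < Im ze)%R ->
  RCcontinuous (fun x : R => / (x - Ci * y - ze)) x.
Proof.
intros H. apply Ccont_inv.
- intros Q. apply (f_equal Im) in Q. unfold Im in *; simpl in Q. lra.
- apply Ccont_minus; [|apply Ccont_const].
  apply Ccont_minus; [apply Ccont_RtoC, Rcont_id|apply Ccont_const].
Qed.

Lemma inv_bound c (v : C) x : (0 < c)%R -> (c * (1 + Rabs x) <= Cmod v)%R ->
  (Cmod (/ v) * (1 + Rabs x) <= / c)%R /\ (Cmod (/ v) <= / c)%R.
Proof.
intros Hc H. assert (H1 := Rabs_pos x).
assert (Hv : (0 < Cmod v)%R) by nra.
rewrite Cmod_inv by (apply Cmod_pos_neq; auto).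
assert (A : (/ Cmod v * (1 + Rabs x) <= / c)%R).
{ apply Rmult_le_reg_l with (Cmod v); auto. rewrite <- Rmult_assoc, Rinv_r, Rmult_1_l by lra.
  apply Rmult_le_reg_l with c; auto. rewrite (Rmult_comm c (_ * / c)), Rmult_assoc, Rinv_l by lra. lra. }
split; auto. assert (H2 := Rinv_0_lt_compat _ Hv). nra.
Qed.

Definition line_int (y : R) (ze : C) : C := int_R (fun x => contour ze (x - Ci * y)).

Lemma contour_decaying l y ze : (INR l - 1 < y < INR l + 1)%R -> y <> INR l -> (- y < Im ze)%R ->
  exists M, decaying (fun x => contour ze (x - Ci * y)) M.
Proof.
intros Hy Hl Hz. destruct (plancherel_weight_line l y Hy Hl) as (Cw & W & HW & Bw).
destruct (cauchy_lower y ze Hz) as (c & Hc & Bc).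
exists (/ c * W)%R.
assert (D := decaying_mult (fun x : R => plancherel_weight (x - Ci * y)) (fun x : R => / (x - Ci * y - ze)) W (/ c)
  HW Cw (fun x => resolvent_cont y ze x Hz) Bw).
destruct D as [D1 D2].
- intros x. apply inv_bound; auto. apply Bc; [lra|].
  replace (ze - ze) with (RtoC 0) by ring. rewrite Cmod_0. lra.
- assert (E : forall x : R, / (x - Ci * y - ze) * plancherel_weight (x - Ci * y) = contour ze (x - Ci * y))
    by (intros; unfold contour, plancherel_weight; ring).
  split.
  + intros x. apply (continuous_ext _ _ _ E), D1.
  + intros x. rewrite <- E. apply D2.
Qed.

(** With [q = / (z - ze)], the remainder of the difference quotient of [q] is
    a product of three such factors, and its integral is bounded uniformly
    near [ze]. *)
Lemma line_int_derive l y ze : (INR l - 1 < y < INR l + 1)%R -> y <> INR l -> (- y < Im ze)%R ->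
  exists d, is_Cderive (line_int y) ze d.
Proof.
intros Hy Hl Hz. destruct (plancherel_weight_line l y Hy Hl) as (Cw & W & HW & Bw).
destruct (cauchy_lower y ze Hz) as (c & Hc & Bc).
set (q := fun (ze : C) (x : R) => / (x - Ci * y - ze)).
set (w := fun x : R => plancherel_weight (x - Ci * y)) in *.
set (r := ((Im ze + y) / 2)%R) in *. assert (Hr : (0 < r)%R) by (unfold r; lra).
assert (Hq : forall ze', (Cmod (ze' - ze) <= r)%R -> (- y < Im ze')%R).
{ intros ze' H. assert (H1 := im_le_Cmod (ze' - ze)). assert (H2 := Rle_abs (- Im (ze' - ze))).
  rewrite Rabs_Ropp in H2. replace (Im (ze' - ze)) with (Im ze' - Im ze)%R in * by (unfold Im; simpl; ring).
  unfold r in H. lra. }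
assert (Bq : forall ze' x, (Cmod (ze' - ze) <= r)%R ->
  (Cmod (q ze' x) * (1 + Rabs x) <= / c)%R /\ (Cmod (q ze' x) <= / c)%R).
{ intros ze' x H. apply inv_bound; auto. apply Bc; [lra|exact H]. }
assert (Hself : (Cmod (ze - ze) <= r)%R).
{ replace (ze - ze) with (RtoC 0) by ring. rewrite Cmod_0. lra. }
assert (Hci : (0 < / c)%R) by (apply Rinv_0_lt_compat, Hc).
assert (Cq : forall ze', (Cmod (ze' - ze) <= r)%R -> forall x, RCcontinuous (q ze') x)
  by (intros; apply resolvent_cont, Hq; auto).
assert (D1 : forall ze', (Cmod (ze' - ze) <= r)%R -> decaying (fun x => q ze' x * w x) (/ c * W)).
{ intros ze' H. apply decaying_mult; auto. intros x. apply Bq, H. }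
assert (D2 : decaying (fun x => (q ze x * q ze x) * w x) (/ c * / c * W)).
{ apply (decaying_mult w (fun x => q ze x * q ze x)); [exact HW|exact Cw| |exact Bw|].
  { intros x. apply Ccont_mult; apply Cq; auto. }
  intros x. rewrite Cmod_mult, Rmult_assoc. destruct (Bq ze x Hself) as [B1 B2].
  assert (H0 := Cmod_ge_0 (q ze x)). assert (H1 := Rabs_pos x).
  apply Rmult_le_compat; auto. apply Rmult_le_pos; lra. }
assert (D3 : forall ze', (Cmod (ze' - ze) <= r)%R ->
  decaying (fun x => (q ze x * q ze x * q ze' x) * w x) (/ c * / c * / c * W)).
{ intros ze' H. apply (decaying_mult w (fun x => q ze x * q ze x * q ze' x)); [exact HW|exact Cw| |exact Bw|].
  { intros x. apply Ccont_mult; [apply Ccont_mult|]; apply Cq; auto. }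
  intros x. rewrite !Cmod_mult, !Rmult_assoc. destruct (Bq ze x Hself) as [B1 B2].
  destruct (Bq ze' x H) as [B3 B4].
  assert (H0 := Cmod_ge_0 (q ze x)). assert (H1 := Rabs_pos x). assert (H2 := Cmod_ge_0 (q ze' x)).
  assert (H3 : (0 <= Cmod (q ze' x) * (1 + Rabs x))%R) by (apply Rmult_le_pos; lra).
  apply Rmult_le_compat; auto; [apply Rmult_le_pos; auto|].
  apply Rmult_le_compat; auto. }
exists (int_R (fun x => (q ze x * q ze x) * w x)).
set (N := (PI * (/ c * / c * / c * W))%R).
assert (HN : (0 <= N)%R).
{ unfold N. assert (H := PI_RGT_0).
  apply Rmult_le_pos; [lra|]. repeat apply Rmult_le_pos; lra. }
apply is_Cderive_iff. intros e He.
exists (Rmin r (e / (N + 1))). split; [apply Rmin_glb_lt; [lra|apply Rdiv_lt_0_compat; lra]|].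
intros ze' Hze'.
assert (H1 : (Cmod (ze' - ze) <= r)%R) by (left; eapply Rlt_le_trans; [exact Hze'|apply Rmin_l]).
assert (H2 := Rlt_le_trans _ _ _ Hze' (Rmin_r _ _)).
assert (EL : forall ze', line_int y ze' = int_R (fun x => q ze' x * w x)).
{ intros z. unfold line_int. apply f_equal. apply functional_extensionality. intros x.
  unfold contour, q, w, plancherel_weight. ring. }
assert (E : line_int y ze' = line_int y ze + ((ze' - ze) * int_R (fun x => (q ze x * q ze x) * w x)
  + (ze' - ze) * (ze' - ze) * int_R (fun x => (q ze x * q ze x * q ze' x) * w x))).
{ rewrite !EL. rewrite <- (int_R_scal _ _ _ D2), <- (int_R_scal _ _ _ (D3 ze' H1)).
  rewrite <- (int_R_plus _ _ _ _ (decaying_scal _ _ _ D2) (decaying_scal _ _ _ (D3 ze' H1))).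
  assert (D4 : decaying (fun x => (ze' - ze) * (q ze x * q ze x * w x)
    + (ze' - ze) * (ze' - ze) * (q ze x * q ze x * q ze' x * w x))
    (Cmod (ze' - ze) * (/ c * / c * W) + Cmod ((ze' - ze) * (ze' - ze)) * (/ c * / c * / c * W))).
  { apply decaying_plus; apply decaying_scal; auto. }
  rewrite <- (int_R_plus _ _ _ _ (D1 ze Hself) D4).
  apply f_equal. apply functional_extensionality. intros x. unfold q.
  assert (N1 : x - Ci * y - ze <> 0).
  { intros Q. apply (f_equal Im) in Q. unfold Im in *; simpl in Q. lra. }
  assert (N2 : x - Ci * y - ze' <> 0).
  { specialize (Hq ze' H1). intros Q. apply (f_equal Im) in Q. unfold Im in *; simpl in Q. lra. }
  field. auto. }
rewrite E.
set (X := int_R (fun x => (q ze x * q ze x) * w x)) in *.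
set (Y := int_R (fun x => (q ze x * q ze x * q ze' x) * w x)) in *.
replace (line_int y ze + ((ze' - ze) * X + (ze' - ze) * (ze' - ze) * Y) - line_int y ze - (ze' - ze) * X)
  with ((ze' - ze) * Y * (ze' - ze)) by ring.
rewrite !Cmod_mult. apply Rmult_le_compat_r; [apply Cmod_ge_0|].
assert (HY : (Cmod Y <= N)%R) by (apply (int_R_bound _ _ (D3 ze' H1))).
clear_denominator H2 (N + 1)%R.
assert (H3 := Cmod_ge_0 (ze' - ze)). assert (H4 := Cmod_ge_0 Y). nra.
Qed.

(** ** Crossing one pole *)

(** The residue at [pole l] of the product of [T] and the Plancherel density. *)
Definition kappa (l : nat) : C := T (pole l) * kern_residue sg l.

(** The contour integrand is [p z / (z - a)] with [p] holomorphic in the strip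
    around the pole [a]. Subtracting [p a / (z - a)] leaves the difference
    quotient of [p], to which the theorem on moving segments applies; its
    decay makes the sides negligible. *)
Lemma one_pole l ze t1 t2 : (INR l - 1 < t1 <= INR l)%R -> (t1 <= t2 < INR l + 1)%R ->
  (- t1 < Im ze)%R -> exists u : C -> C,
  (forall z, (t1 <= - Im z <= t2)%R -> Ccontinuous u z) /\
  (forall z, (t1 <= - Im z <= t2)%R -> z <> pole l ->
     u z = contour ze z - kappa l * / (pole l - ze) * / (z - pole l)) /\
  tends (fun x => CInt (fun s : R => u (s - Ci * t2)) (- x) x
    - CInt (fun s : R => u (s - Ci * t1)) (- x) x) 0.
Proof.
intros H1 H2 Hz. destruct (kern_factor sg l Hsg) as (M & MC1 & Ma & Mk).
set (a := pole l) in *.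
set (D := fun z => strip l z /\ (Im z < Im ze)%R).
set (p := fun z => T z * M z * / (z - ze)).
assert (HD : forall z, D z -> z - ze <> 0).
{ intros z [_ H] Q. apply (f_equal Im) in Q. unfold Im in *; simpl in Q. lra. }
assert (pC1 : C1_on D p).
{ apply C1_mult; [apply C1_mult|].
  - apply (C1_sub (fun _ => True)); auto.
  - apply (C1_sub (strip l)); [intros z [H _]; exact H|exact MC1].
  - apply C1_inv; [apply C1_minus; [apply C1_id|apply C1_const]|exact HD]. }
assert (Da : D a).
{ unfold D, strip, a. rewrite Im_pole. split; [rewrite Rplus_opp_l, Rabs_R0; lra|lra]. }
assert (Hpa : exists p', is_Cderive p a p').
{ destruct pC1 as (dp & Hp). exists (dp a). apply Hp, Da. }
destruct Hpa as (p' & Hp').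
set (u := diff_quot p a p').
set (lo := Rmax (INR l - 1) (- Im ze)).
assert (Hlo1 : (INR l - 1 <= lo)%R) by apply Rmax_l.
assert (Hlo2 : (- Im ze <= lo)%R) by apply Rmax_r.
assert (Hlo3 : (lo < t1)%R) by (apply Rmax_lub_lt; lra).
assert (DD : forall z, (lo < - Im z < INR l + 1)%R -> D z).
{ intros z H. split; [unfold strip; apply Rabs_def1; lra|lra]. }
assert (uC1 := diff_quot_C1 D p a p' pC1). fold u in uC1.
assert (uc : forall z, (lo < - Im z < INR l + 1)%R -> Ccontinuous u z).
{ intros z H. destruct (excluded_middle_informative (z = a)) as [->|E].
  - apply diff_quot_continuous, Hp'.
  - apply (C1_continuous _ _ _ uC1). auto. }
assert (ue : forall z, D z -> z <> a ->
  u z = contour ze z - kappa l * / (a - ze) * / (z - a)).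
{ intros z Hz0 Hza. unfold u, diff_quot. destruct (excluded_middle_informative (z = a)) as [E|_]; [tauto|].
  unfold p, contour, kappa. fold a. rewrite Ma, Mk by (auto; apply Hz0).
  assert (N1 := HD z Hz0). assert (N2 := HD a Da).
  assert (N3 : z - a <> 0).
  { intros Q. apply Hza. replace z with (z - a + a) by ring. rewrite Q. ring. }
  field. auto. }
exists u. split; [intros z H; apply uc; lra|]. split; [intros z H Hn; apply ue; auto; apply DD; lra|].
destruct (Tdecay (Rabs t1 + Rabs t2)) as (B & HB0 & HB).
destruct (cauchy_lower t1 ze Hz) as (c & Hc & Bc).
set (kk := Cmod (kappa l * / (a - ze))). assert (Hkk : (0 <= kk)%R) by apply Cmod_ge_0.
set (C0 := (/ c * B * 4 + kk)%R).
assert (Hci : (0 < / c)%R) by (apply Rinv_0_lt_compat, Hc).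
assert (Hside : forall x t : R, (t1 <= t <= t2)%R -> (1 <= Rabs x)%R ->
  (Cmod (u (x - Ci * t)%C) * Rabs x <= C0)%R).
{ intros x t Ht Hx.
  assert (Him : Im (x - Ci * t) = (- t)%R) by (unfold Im; simpl; ring).
  assert (Hre : Re (x - Ci * t) = x) by (unfold Re; simpl; ring).
  assert (Hza : x - Ci * t - a <> 0).
  { intros Q. apply (f_equal Re) in Q. unfold Re, a, pole in Q; simpl in Q.
    assert (x = 0%R) by lra. subst x. rewrite Rabs_R0 in Hx. lra. }
  rewrite ue.
  2:{ apply DD. rewrite Him. lra. }
  2:{ intros Q. apply Hza. rewrite Q. ring. }
  assert (A1 : (Cmod (contour ze (x - Ci * t)%C) * Rabs x <= / c * B * 4)%R).
  { unfold contour. rewrite !Cmod_mult.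
    destruct (inv_bound c (x - Ci * t - ze) x Hc) as [B1 B2].
    { apply Bc; [lra|]. replace (ze - ze) with (RtoC 0) by ring. rewrite Cmod_0. lra. }
    assert (B3 := HB (x - Ci * t)). rewrite Him, Hre, Rabs_Ropp in B3.
    assert (Hta : (Rabs t <= Rabs t1 + Rabs t2)%R).
    { assert (Q1 := Rle_abs t2). assert (Q2 := Rle_abs (- t1)). rewrite Rabs_Ropp in Q2.
      assert (Q3 := Rabs_pos t1). assert (Q4 := Rabs_pos t2). apply Rabs_le. lra. }
    specialize (B3 Hta).
    assert (B4 := kern_bound sg (x - Ci * t) Hsg). rewrite Hre in B4. specialize (B4 Hx).
    set (i1 := Cmod (/ _)) in *. set (i2 := Cmod (T _)) in *. set (i3 := Cmod (kern _ _)) in *.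
    assert (P1 : (0 <= i1)%R) by apply Cmod_ge_0. assert (P2 : (0 <= i2)%R) by apply Cmod_ge_0.
    assert (P3 : (0 <= i3)%R) by apply Cmod_ge_0.
    assert (B5 : (i2 <= B)%R) by nra.
    assert (B6 : (i1 * Rabs x <= / c)%R) by nra.
    replace (i1 * i2 * i3 * Rabs x)%R with ((i1 * Rabs x) * i2 * i3)%R by ring.
    assert (P4 : (0 <= i1 * Rabs x)%R) by (apply Rmult_le_pos; lra).
    repeat apply Rmult_le_compat; auto. apply Rmult_le_pos; auto. }
  assert (A2 : (Cmod (kappa l * / (a - ze) * / (x - Ci * t - a))%C * Rabs x <= kk)%R).
  { rewrite Cmod_mult. fold kk. rewrite Rmult_assoc.
    rewrite <- (Rmult_1_r kk) at 2. apply Rmult_le_compat_l; auto.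
    assert (Hp := proj1 (Cmod_gt_0 _) Hza). rewrite Cmod_inv by auto.
    apply Rmult_le_reg_l with (Cmod (x - Ci * t - a)); auto.
    rewrite <- Rmult_assoc, Rinv_r, Rmult_1_l, Rmult_1_r by lra.
    assert (Q := re_le_Cmod (x - Ci * t - a)).
    replace (Re (x - Ci * t - a)) with x in Q by (unfold Re, a, pole; simpl; ring). exact Q. }
  assert (A3 := Cmod_minus_le (contour ze (x - Ci * t)) (kappa l * / (a - ze) * / (x - Ci * t - a))).
  assert (Hx0 := Rabs_pos x). unfold C0.
  apply Rle_trans with ((Cmod (contour ze (x - Ci * t)%C) +
    Cmod (kappa l * / (a - ze) * / (x - Ci * t - a))%C) * Rabs x)%R.
  - apply Rmult_le_compat_r; auto.
  - lra. }
apply (tends_rate _ _ (4 * C0 * (t2 - t1))). intros x Hx.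
assert (S := segment_shift u (INR l) lo (INR l + 1) t1 t2 x (C0 / x) Hlo3 ltac:(lra) ltac:(lra) ltac:(lra) uc).
assert (HS : (Cmod (CInt (fun s : R => u (s - Ci * t2))%C (- x) x
  - CInt (fun s : R => u (s - Ci * t1))%C (- x) x) <= 4 * (C0 / x) * (t2 - t1))%R).
{ apply S.
  - apply (C1_sub (fun z => D z /\ z <> a)); [|exact uC1].
    intros z [Hz1 Hz2]. split; [apply DD, Hz1|]. intros Q. apply Hz2. rewrite Q.
    unfold a. rewrite Im_pole. ring.
  - intros t Ht. split; apply Rmult_le_reg_r with x; try lra;
      unfold Rdiv; rewrite (Rmult_assoc C0), Rinv_l, Rmult_1_r by lra.
    + assert (Q := Hside x t Ht). rewrite (Rabs_pos_eq x) in Q by lra. apply Q, Hx.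
    + assert (Q := Hside (- x)%R t Ht). rewrite Rabs_Ropp, (Rabs_pos_eq x) in Q by lra. apply Q, Hx. }
set (I2 := CInt _ (- x) x) in *. set (I1 := CInt (fun s : R => u (s - Ci * t1)) (- x) x) in *.
replace (I2 - I1 - 0) with (I2 - I1) by ring.
apply (Rmult_le_compat_r x) in HS; [|lra].
replace (4 * (C0 / x) * (t2 - t1) * x)%R with (4 * C0 * (t2 - t1))%R in HS by (field; lra). exact HS.
Qed.

(** The polar part that was subtracted contributes a half residue, with a sign that
    depends on the side of the line on which the pole lies. *)
Lemma line_regular l ze y (u : C -> C) : (INR l - 1 < y < INR l + 1)%R -> y <> INR l -> (- y < Im ze)%R ->
  (forall x : R, u (x - Ci * y) = contour ze (x - Ci * y)
     - kappa l * / (pole l - ze) * / (x - Ci * y - pole l)) ->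
  tends (fun x => CInt (fun s : R => u (s - Ci * y)) (- x) x)
    (line_int y ze - kappa l * / (pole l - ze) * (if Rlt_dec 0 (INR l - y) then - (Ci * PI) else Ci * PI)).
Proof.
intros Hy Hl Hz Hu. destruct (contour_decaying l y ze Hy Hl Hz) as (M & HM).
assert (Hbe : (INR l - y)%R <> 0%R) by lra.
assert (Ek : forall x : R, / (x - Ci * y - pole l) = / (x + Ci * (INR l - y)%R)).
{ intros x. apply f_equal. unfold pole. rewrite RtoC_minus. ring. }
assert (Cke : forall x, RCcontinuous (fun x : R => / (x + Ci * (INR l - y)%R)) x).
{ intros t. apply Ccont_inv.
  - intros Q. apply (f_equal Im) in Q. unfold Im in Q; simpl in Q. lra.
  - apply Ccont_plus; [apply Ccont_RtoC, Rcont_id|apply Ccont_const]. }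
apply (tends_ext (fun x => CInt (fun s : R => contour ze (s - Ci * y)) (- x) x
  - kappa l * / (pole l - ze) * CInt (fun s : R => / (s + Ci * (INR l - y)%R)) (- x) x)).
- intros x _. rewrite <- CInt_scal, <- CInt_minus; auto.
  + apply CInt_ext. intros s _. rewrite Hu, Ek. reflexivity.
  + apply HM.
  + intros s. apply Ccont_mult; [apply Ccont_const|apply Cke].
- apply tends_minus; [apply (line_integral _ M HM)|].
  apply tends_scal, tends_cauchy_kernel, Hbe.
Qed.

End Contour.

Lemma Cinv_neg (x : C) : x <> 0 -> / - x = - / x.
Proof. intros H. field. exact H. Qed.

(** ** The shifted formula for one of the two densities *)

Section Shift.

Variables (T : C -> C) (sg : R).
Hypothesis HT : amplitude T.
Hypothesis Hsg : (sg * sg = 1)%R.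

Lemma tends_same S1 S2 l1 l2 : tends (fun x => S2 x - S1 x) 0 -> tends S1 l1 -> tends S2 l2 -> l1 = l2.
Proof.
intros H H1 H2. assert (E := tends_unique _ _ _ (tends_minus _ _ _ _ H2 H1) H).
replace l1 with (l2 - (l2 - l1)) by ring. rewrite E. ring.
Qed.

Lemma Im_line (x y : R) : (- Im (x - Ci * y))%R = y.
Proof. unfold Im; simpl; ring. Qed.

Lemma shift_through l ze y1 y2 : (INR l - 1 < y1 < INR l)%R -> (y1 <= y2 < INR l + 1)%R -> y2 <> INR l ->
  (- y1 < Im ze)%R ->
  line_int T sg y1 ze + kappa T sg l * / (pole l - ze) * (Ci * PI) =
  line_int T sg y2 ze - kappa T sg l * / (pole l - ze) * (if Rlt_dec 0 (INR l - y2) then - (Ci * PI) else Ci * PI).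
Proof.
intros H1 H2 Hn Hz.
destruct (one_pole T sg HT Hsg l ze y1 y2 ltac:(lra) H2 Hz) as (u & Hc & Hu & Ht).
assert (R1 := line_regular T sg HT Hsg l ze y1 u ltac:(lra) ltac:(lra) Hz).
assert (R2 := line_regular T sg HT Hsg l ze y2 u ltac:(lra) Hn ltac:(lra)).
rewrite <- (tends_same _ _ _ _ Ht
  (R1 ltac:(intros; apply Hu; [rewrite Im_line; lra|apply line_off_pole; lra]))
  (R2 ltac:(intros; apply Hu; [rewrite Im_line; lra|apply line_off_pole; auto]))).
destruct (Rlt_dec 0 (INR l - y1)); [ring|lra].
Qed.

Lemma shift_same n ze y1 y2 : (INR n < y1)%R -> (y1 <= y2 < INR n + 1)%R -> (- y1 < Im ze)%R ->
  line_int T sg y1 ze = line_int T sg y2 ze.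
Proof.
intros H1 H2 Hz. assert (HS := S_INR n).
assert (E := shift_through (S n) ze y1 y2 ltac:(lra) ltac:(lra) ltac:(lra) Hz).
destruct (Rlt_dec 0 (INR (S n) - y2)); [|lra].
set (k := kappa T sg (S n) * / (pole (S n) - ze) * (Ci * PI)) in *.
replace (line_int T sg y1 ze) with (line_int T sg y1 ze + k - k) by ring.
rewrite E. unfold k. ring.
Qed.

(** The pole at the origin lies on the line where the integration starts, and
    contributes half of its residue. *)
Definition end_factor (l : nat) : R := if l then / 2 else 1.

Definition half_formula (n : nat) (y : R) (ze : C) : C :=
  / 2 * line_int T sg y ze
  + csum (fun l => end_factor l * (Ci * PI * kappa T sg l) * / (Ci * INR l + ze)) (S n).

Lemma shift_cross n ze y1 y2 : (INR n < y1 < INR n + 1)%R -> (INR n + 1 < y2 < INR n + 2)%R ->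
  (- y1 < Im ze)%R -> half_formula n y1 ze = half_formula (S n) y2 ze.
Proof.
intros H1 H2 Hz. assert (HS := S_INR n).
assert (E := shift_through (S n) ze y1 y2 ltac:(lra) ltac:(lra) ltac:(lra) Hz).
destruct (Rlt_dec 0 (INR (S n) - y2)) as [Q|_]; [lra|].
unfold half_formula. change (csum ?f (S (S n))) with (csum f (S n) + f (S n)).
set (s := csum _ (S n)).
assert (Hp : Ci * INR (S n) + ze <> 0).
{ intros Q. apply (f_equal Im) in Q. unfold Im in *; cbn -[INR] in Q. lra. }
assert (Ei : / (pole (S n) - ze) = - / (Ci * INR (S n) + ze)).
{ unfold pole. replace (- (Ci * INR (S n)) - ze) with (- (Ci * INR (S n) + ze)) by ring.
  apply Cinv_neg, Hp. }
rewrite Ei in E. set (q := / (Ci * INR (S n) + ze)) in *. set (k := kappa T sg (S n)) in *.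
replace (line_int T sg y1 ze) with (line_int T sg y1 ze + k * - q * (Ci * PI) + k * q * (Ci * PI)) by ring.
rewrite E. cbv beta. change (end_factor (S n)) with 1%R. fold k. fold q. field; apply RtoC_neq; lra.
Qed.

(** The poles are crossed one at a time, by way of heights between consecutive
    integers. *)
Lemma half_formula_indep n1 n2 ze y1 y2 : (INR n1 < y1 < INR n1 + 1)%R -> (INR n2 < y2 < INR n2 + 1)%R ->
  (y1 <= y2)%R -> (- y1 < Im ze)%R -> half_formula n1 y1 ze = half_formula n2 y2 ze.
Proof.
intros H1. revert y2. induction n2 as [|m IH]; intros y2 H2 H12 Hz.
- assert (Hn : n1 = O).
  { destruct n1 as [|k]; auto. rewrite S_INR in H1. assert (P := pos_INR k). simpl in H2. lra. }
  subst n1. unfold half_formula. rewrite (shift_same 0 ze y1 y2); auto; lra.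
- destruct (Nat.eq_dec n1 (S m)) as [->|Hn].
  + unfold half_formula. rewrite (shift_same (S m) ze y1 y2); auto; lra.
  + assert (Hle : (n1 <= m)%nat).
    { apply Nat.nlt_ge. intros Hlt. assert (HL : (S (S m) <= n1)%nat) by lia.
      apply le_INR in HL. rewrite (S_INR (S m)) in HL. lra. }
    assert (HmI := le_INR _ _ Hle). rewrite S_INR in H2.
    set (y' := Rmax y1 (INR m + / 2)).
    assert (Hy1 : (y1 <= y')%R) by apply Rmax_l.
    assert (Hy2 : (INR m + / 2 <= y')%R) by apply Rmax_r.
    assert (Hy3 : (y' < INR m + 1)%R).
    { apply Rmax_lub_lt; [|lra]. destruct (Nat.eq_dec n1 m) as [->|Hne]; [lra|].
      assert (HL : (S n1 <= m)%nat) by lia. apply le_INR in HL. rewrite S_INR in HL. lra. }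
    rewrite (IH y') by lra. apply shift_cross; lra.
Qed.

Lemma kern_axis_odd (x : R) : x <> 0%R -> kern sg (- x) = - kern sg x.
Proof.
intros Hx. apply kern_odd; auto. apply (kern_den sg 0); auto.
- unfold strip. simpl. rewrite Rplus_0_r, Rabs_R0. lra.
- left. intros E. apply Hx. apply (f_equal Re) in E. unfold pole, Re in E; simpl in E. lra.
Qed.

(** The integrand over the half-line is the even part of the contour integrand;
    the odd polar part at the origin disappears from it. *)
Lemma half_line_formula ze y (k : R -> C) : (0 < y < 1)%R -> (0 < Im ze)%R ->
  (forall x : R, (0 < x)%R -> k x = / (x ^ 2 - ze ^ 2) * T x * (x * kern sg x)) ->
  ex_RInt_half_line k /\ RInt_half_line k = half_formula 0 y ze.
Proof.
intros Hy Hz Hk.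
destruct (one_pole T sg HT Hsg 0 ze 0 y ltac:(simpl; lra) ltac:(simpl; lra) ltac:(lra))
  as (u & Hc & Hu & Ht).
set (U := fun x : R => u (x - Ci * 0%R)) in *.
assert (CU : forall x, RCcontinuous U x).
{ intros x. apply cont_horizontal, Hc. rewrite Im_line. lra. }
assert (CU2 : forall x, RCcontinuous (fun x => U (-1 * x + 0)%R) x).
{ intros x. apply (continuous_comp (fun t : R => (-1 * t + 0)%R) U); [|apply CU].
  apply Rcont_plus; [|apply Rcont_const]. apply Rcont_mult; [apply Rcont_const|apply Rcont_id]. }
assert (EU : forall x : R, x <> 0%R -> U x = contour T sg ze x - kappa T sg 0 * / (pole 0 - ze) * / x).
{ intros x Hx. unfold U. assert (E0 : x - Ci * 0%R = x) by ring.
  rewrite Hu.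
  - rewrite E0. replace (x - pole 0) with (RtoC x); [reflexivity|]. unfold pole; simpl; ring.
  - rewrite Im_line. lra.
  - rewrite E0. intros Q. apply Hx. apply (f_equal Re) in Q. unfold pole, Re in Q; simpl in Q. lra. }
set (v := fun x : R => / 2 * (U x + U (-1 * x + 0)%R)).
assert (Ev : forall x : R, x <> 0%R -> v x = / 2 * (contour T sg ze x + contour T sg ze (- x)%R)).
{ intros x Hx. unfold v. replace (-1 * x + 0)%R with (- x)%R by ring.
  rewrite !EU by lra. rewrite RtoC_opp.
  assert (HxC : RtoC x <> 0) by (apply RtoC_neq, Hx).
  rewrite Cinv_neg by auto. ring. }
assert (Cv : forall x, RCcontinuous v x).
{ intros x. apply Ccont_mult; [apply Ccont_const|]. apply Ccont_plus; auto. }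
assert (Hkv : forall x, (0 < x)%R -> k x = v x).
{ intros x Hx. rewrite Hk, Ev by lra. unfold contour. rewrite RtoC_opp, kern_axis_odd by lra.
  rewrite (proj1 (proj2 HT)).
  assert (N1 : RtoC x - ze <> 0).
  { intros Q. apply (f_equal Im) in Q. unfold Im in *; simpl in Q. lra. }
  assert (N2 : - RtoC x - ze <> 0).
  { intros Q. apply (f_equal Im) in Q. unfold Im in *; simpl in Q. lra. }
  assert (E2 : RtoC x ^ 2 - ze ^ 2 = - ((RtoC x - ze) * (- RtoC x - ze))) by ring.
  rewrite E2.
  assert (N3 : (RtoC x - ze) * (- RtoC x - ze) <> 0) by (apply Cmult_integral_contr; auto).
  assert (N4 : - ((RtoC x - ze) * (- RtoC x - ze)) <> 0).
  { intros Q. apply N3. replace ((RtoC x - ze) * (- RtoC x - ze))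
      with (- - ((RtoC x - ze) * (- RtoC x - ze))) by ring. rewrite Q. ring. }
  field; auto. }
destruct (proj2 (proj2 HT) 0%R) as (M & HM0 & HM).
destruct (cauchy_lower 0 ze ltac:(lra)) as (c & Hcp & Bc).
destruct (cont_bounded v (-1) 1 ltac:(lra) Cv) as (B & HB0 & HB).
assert (Hci : (0 < / c)%R) by (apply Rinv_0_lt_compat, Hcp).
assert (Hcont : forall x : R, (1 <= Rabs x)%R -> (Cmod (contour T sg ze x) * (1 + x²) <= / c * M * 4)%R).
{ intros x Hx. unfold contour. rewrite !Cmod_mult.
  destruct (inv_bound c (x - ze) x Hcp) as [B1 B2].
  { replace (RtoC x - ze) with (x - Ci * 0%R - ze) by ring. apply Bc; [lra|].
    replace (ze - ze) with (RtoC 0) by ring. rewrite Cmod_0. lra. }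
  assert (B3 := HM x). unfold Re, Im in B3; simpl in B3. rewrite Rabs_R0 in B3. specialize (B3 (Rle_refl _)).
  assert (B4 := kern_bound sg x Hsg). unfold Re in B4; simpl in B4. specialize (B4 Hx).
  set (i1 := Cmod (/ _)) in *. set (i2 := Cmod (T _)) in *. set (i3 := Cmod (kern _ _)) in *.
  assert (P1 : (0 <= i1)%R) by apply Cmod_ge_0. assert (P2 : (0 <= i2)%R) by apply Cmod_ge_0.
  assert (P3 : (0 <= i3)%R) by apply Cmod_ge_0.
  assert (P4 : (0 <= i1 * (1 + Rabs x))%R) by (apply Rmult_le_pos; lra).
  assert (P5 : (0 <= i2 * (1 + Rabs x))%R) by (apply Rmult_le_pos; lra).
  apply Rle_trans with ((i1 * (1 + Rabs x)) * (i2 * (1 + Rabs x)) * i3)%R.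
  - replace ((i1 * (1 + Rabs x)) * (i2 * (1 + Rabs x)) * i3)%R
      with (i1 * i2 * i3 * ((1 + Rabs x) * (1 + Rabs x)))%R by ring.
    apply Rmult_le_compat_l; [repeat apply Rmult_le_pos; auto|].
    rewrite (Rsqr_abs x). unfold Rsqr. nra.
  - repeat apply Rmult_le_compat; auto. apply Rmult_le_pos; auto. }
assert (Dv : decaying v (/ c * M * 4 + 2 * B)).
{ assert (HcM : (0 <= / c * M * 4)%R) by (repeat apply Rmult_le_pos; lra).
  split; [exact Cv|]. intros x. destruct (Rle_dec 1 (Rabs x)) as [H|H].
  - rewrite Ev by (intros ->; rewrite Rabs_R0 in H; lra).
    assert (A1 := Hcont x H). assert (A2 := Hcont (- x)%R ltac:(rewrite Rabs_Ropp; exact H)).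
    replace ((- x)²) with (x²) in A2 by (unfold Rsqr; ring).
    rewrite Cmod_mult, <- RtoC_inv, Cmod_R, Rabs_pos_eq by lra.
    assert (A3 := Cmod_triangle (contour T sg ze x) (contour T sg ze (- x)%R)).
    assert (Q := Rle_0_sqr x).
    apply (Rmult_le_compat_r (1 + x²)) in A3; [|lra]. lra.
  - assert (Hx : (-1 <= x <= 1)%R) by (apply Rabs_le_between; lra).
    specialize (HB x Hx). assert (Q := Cmod_ge_0 (v x)).
    assert (Q2 : (1 + x² <= 2)%R) by (unfold Rsqr; nra). assert (Q3 := Rle_0_sqr x). nra. }
assert (Hy0 : y <> INR 0) by (simpl; lra).
assert (R2 := line_regular T sg HT Hsg 0 ze y u ltac:(simpl; lra) Hy0 ltac:(lra)
  ltac:(intros; apply Hu; [rewrite Im_line; lra|apply line_off_pole; auto])).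
destruct (Rlt_dec 0 (INR 0 - y)) as [Q|_]; [simpl in Q; lra|].
set (lim := line_int T sg y ze - kappa T sg 0 * / (pole 0 - ze) * (Ci * PI)) in *.
assert (R1 : tends (fun x => CInt U (- x) x) lim).
{ assert (R := tends_minus _ _ _ _ R2 Ht). replace (lim - 0) with lim in R by ring.
  refine (tends_ext _ _ _ _ R). intros x _. cbv beta. unfold U. ring. }
assert (R3 : tends (fun x => CInt v 0 x) (/ 2 * lim)).
{ apply (tends_ext (fun x => / 2 * CInt U (- x) x)); [|apply tends_scal, R1].
  intros x _. unfold v. rewrite CInt_scal by (intros; apply Ccont_plus; auto).
  rewrite CInt_plus by auto. apply (f_equal (Cmult (/ 2))).
  rewrite <- (CInt_Chasles U (- x) 0 x) by auto.
  assert (L := CInt_comp_lin U (-1) 0 0 x CU).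
  replace (-1 * 0 + 0)%R with 0%R in L by ring.
  replace (-1 * x + 0)%R with (- x)%R in L by ring.
  assert (Em : RtoC (-1) = - (1)) by (apply Ceq; unfold Re, Im; simpl; ring).
  rewrite (CInt_swap U 0), Em in L by auto.
  set (a := CInt U (- x) 0) in *. set (b := CInt (fun t => U (-1 * t + 0)%R) 0 x) in *.
  replace a with (- - a) by ring. rewrite <- L. ring. }
destruct (half_line_integral v k _ _ Dv Hkv R3) as [X1 X2]. split; [exact X1|]. rewrite X2.
unfold half_formula, lim, csum, end_factor. simpl INR.
assert (Hze : ze <> 0) by (intros Q; rewrite Q in Hz; unfold Im in Hz; simpl in Hz; lra).
unfold pole. simpl INR. rewrite RtoC_inv by lra.
replace (- (Ci * 0) - ze) with (- ze) by ring. replace (Ci * 0 + ze) with ze by ring.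
rewrite Cinv_neg by auto. field; auto.
Qed.

End Shift.

(** * Poles of sums of simple fractions *)

Lemma near_imp (p : C) (P Q : C -> Prop) : (forall w, P w -> Q w) ->
  Cnear p P -> Cnear p Q.
Proof. intros H HP. apply (filter_imp P Q H HP). Qed.

Lemma near_and (p : C) (P Q : C -> Prop) : Cnear p P ->
  Cnear p Q -> Cnear p (fun w => P w /\ Q w).
Proof. apply filter_and. Qed.

Lemma locally_neq (p q : C) : p <> q -> Cnear p (fun w => w <> q).
Proof.
intros H.
assert (Hpq : p - q <> 0).
{ intros Q. apply H. replace p with (p - q + q) by ring. rewrite Q. ring. }
apply (proj2 (locally_Cmod _ _)). exists (Cmod (p - q)). split; [apply Cmod_gt_0, Hpq|].
intros w Hw ->. rewrite Cmod_minus_sym in Hw. lra.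
Qed.

Lemma locally_neq_family (p : C) (q : nat -> C) (D : nat -> Prop) n :
  (forall k, (k < n)%nat -> D k -> p <> q k) ->
  Cnear p (fun w => forall k, (k < n)%nat -> D k -> w <> q k).
Proof.
induction n as [|n IH]; intros H.
- apply filter_forall. intros w k Hk. lia.
- assert (H1 : Cnear p (fun w => D n -> w <> q n)).
  { destruct (classic (D n)) as [Hd|Hd].
    - refine (near_imp _ _ _ _ (locally_neq p (q n) (H n ltac:(lia) Hd))). auto.
    - apply filter_forall. tauto. }
  refine (near_imp _ _ _ _ (near_and _ _ _ H1 (IH _))).
  + intros w [Q1 Q2] k Hk Hd. destruct (Nat.eq_dec k n) as [->|Hn]; [auto|].
    apply Q2; auto; lia.
  + intros k Hk. apply H. lia.
Qed.

Lemma locally_half_plane (p : C) (y : R) : (- y < Im p)%R ->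
  Cnear p (fun w => (- y < Im w)%R).
Proof.
intros H. apply (proj2 (locally_Cmod _ _)). exists (Im p + y)%R. split; [lra|]. intros w Hw.
assert (H1 := im_le_Cmod (w - p)). replace (Im (w - p)) with (Im w - Im p)%R in H1 by (unfold Im; simpl; ring).
assert (H2 := Rle_abs (- (Im w - Im p))). rewrite Rabs_Ropp in H2. lra.
Qed.

Definition Cdiff (f : C -> C) (z : C) : Prop := exists d, is_Cderive f z d.

Lemma Cdiff_plus f g z : Cdiff f z -> Cdiff g z -> Cdiff (fun w => f w + g w) z.
Proof. intros [a Ha] [b Hb]. exists (a + b). apply is_Cderive_plus; auto. Qed.

Lemma Cdiff_mult f g z : Cdiff f z -> Cdiff g z -> Cdiff (fun w => f w * g w) z.
Proof. intros [a Ha] [b Hb]. eexists. apply is_Cderive_mult; eauto. Qed.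

Lemma Cdiff_const c z : Cdiff (fun _ => c) z.
Proof. exists (RtoC 0). apply is_Cderive_const. Qed.

Lemma Cdiff_translate c z : Cdiff (fun w => w - c) z.
Proof. eexists. apply is_Cderive_minus; [apply is_Cderive_id|apply is_Cderive_const]. Qed.

Lemma Cdiff_pole c k z : z <> pole k -> Cdiff (fun w => c * / (Ci * INR k + w)) z.
Proof.
intros H. apply Cdiff_mult; [apply Cdiff_const|]. eexists.
apply (is_Cderive_Cinv (fun w => Ci * INR k + w)).
- intros Q. apply H. unfold pole. replace z with (Ci * INR k + z - Ci * INR k) by ring. rewrite Q. ring.
- apply is_Cderive_plus; [apply is_Cderive_const|apply is_Cderive_id].
Qed.

Lemma Cdiff_csum (F : nat -> C -> C) n z : (forall k, (k < n)%nat -> Cdiff (F k) z) ->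
  Cdiff (fun w => csum (fun k => F k w) n) z.
Proof.
induction n as [|n IH]; intros H; simpl; [apply Cdiff_const|].
apply Cdiff_plus; [apply IH; auto|apply H; lia].
Qed.

Lemma pole_inj k l : pole k = pole l -> k = l.
Proof.
intros H. apply (f_equal Im) in H. rewrite !Im_pole in H. apply INR_eq. lra.
Qed.

Section PolarSum.

Variables (y : R) (n : nat) (Phi A : C -> C) (c : nat -> C).
Hypothesis HPhi : forall z, (- y < Im z)%R ->
  Phi z = A z + csum (fun k => c k * / (Ci * INR k + z)) n.
Hypothesis HA : forall z, (- y < Im z)%R -> Cdiff A z.

Lemma polar_sum_holomorphic p : (- y < Im p)%R -> (forall k, (k < n)%nat -> p <> pole k) ->
  holomorphic_at Phi p.
Proof.
intros Hp Hn. unfold holomorphic_at.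
assert (L1 := locally_half_plane p y Hp).
assert (L2 := locally_neq_family p pole (fun _ => True) n (fun k Hk _ => Hn k Hk)).
refine (near_imp _ _ _ _ (near_and _ _ _ (locally_locally _ _ L1) L2)).
intros w [W1 W2].
assert (D : Cdiff (fun z => A z + csum (fun k => c k * / (Ci * INR k + z)) n) w).
{ apply Cdiff_plus; [apply HA, (locally_singleton _ _ W1)|].
  apply (Cdiff_csum (fun k z => c k * / (Ci * INR k + z))). intros k Hk. apply Cdiff_pole; auto. }
destruct D as [d D]. exists d. refine (is_Cderive_ext_loc _ _ _ _ _ D).
refine (near_imp _ _ _ _ W1). intros z Hz. symmetry. apply HPhi, Hz.
Qed.

Lemma csum_split (f : nat -> C) m l : (l < m)%nat ->
  csum f m = f l + csum (fun k => if Nat.eq_dec k l then RtoC 0 else f k) m.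
Proof.
induction m as [|m IH]; intros H; [lia|]. simpl.
destruct (Nat.eq_dec m l) as [E|E].
- subst m. rewrite (csum_ext (fun k => if Nat.eq_dec k l then RtoC 0 else f k) f l).
  + ring.
  + intros k Hk. destruct (Nat.eq_dec k l); [lia|reflexivity].
- rewrite IH by lia. ring.
Qed.

Lemma polar_sum_pole l : (- y < - INR l)%R -> (l < n)%nat ->
  exists H : C -> C, holomorphic_at H (pole l) /\ H (pole l) = c l /\
    locally (pole l) (fun w : C => w <> pole l -> Phi w = H w / (w - pole l) ^ 1).
Proof.
intros Hy Hl. set (p := pole l).
set (rest := fun w => csum (fun k => if Nat.eq_dec k l then RtoC 0 else c k * / (Ci * INR k + w)) n).
exists (fun w => c l + (w - p) * (A w + rest w)).
assert (Hp : (- y < Im p)%R) by (unfold p; rewrite Im_pole; exact Hy).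
assert (L1 := locally_half_plane p y Hp).
assert (L2 := locally_neq_family p pole (fun k => k <> l) n
  (fun k Hk Hkl => fun E => Hkl (eq_sym (pole_inj l k E)))).
split; [|split].
- refine (near_imp _ _ _ _ (near_and _ _ _ L1 L2)). intros w [W1 W2].
  assert (D : Cdiff (fun w => c l + (w - p) * (A w + rest w)) w).
  { apply Cdiff_plus; [apply Cdiff_const|]. apply Cdiff_mult; [apply Cdiff_translate|].
    apply Cdiff_plus; [apply HA, W1|].
    apply (Cdiff_csum (fun k w => if Nat.eq_dec k l then RtoC 0 else c k * / (Ci * INR k + w))).
    intros k Hk. destruct (Nat.eq_dec k l); [apply Cdiff_const|]. apply Cdiff_pole; auto. }
  exact D.
- replace (p - p) with (RtoC 0) by ring. ring.
- refine (near_imp _ _ _ _ L1). intros w W1 Hw.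
  assert (Hwp : w - p <> 0).
  { intros Q. apply Hw. replace w with (w - p + p) by ring. rewrite Q. ring. }
  rewrite HPhi by exact W1. rewrite (csum_split _ n l Hl). fold (rest w).
  replace (Ci * INR l + w) with (w - p) by (unfold p, pole; ring).
  simpl. field. exact Hwp.
Qed.

End PolarSum.

(** Otherwise the numerator [H] would be the product of a continuous function
    and a positive power of [w - p], and vanish at [p]. *)
Lemma pole_not_holomorphic (F : C -> C) p n : (1 <= n)%nat -> pole_of_order n F p -> ~ holomorphic_at F p.
Proof.
intros Hn (H & HH & H0 & HL) HF.
assert (CF : Ccontinuous F p).
{ destruct (locally_singleton _ _ HF) as [d Hd]. apply (is_Cderive_continuous _ _ _ Hd). }
assert (CH : Ccontinuous H p).
{ destruct (locally_singleton _ _ HH) as [d Hd]. apply (is_Cderive_continuous _ _ _ Hd). }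
assert (CG : Ccontinuous (fun w => F w * (w - p) ^ n) p).
{ apply Ccont_mult; [exact CF|]. apply (Ccont_pow _ (fun w => w - p)).
  apply Ccont_minus; [apply continuous_id|apply Ccont_const]. }
assert (HM := proj1 (Cmod_gt_0 _) H0). set (m := Cmod (H p)) in *.
assert (L1 := proj1 (Ccontinuous_iff _ _ _) CH (m / 2)%R ltac:(lra)).
assert (L2 := proj1 (Ccontinuous_iff _ _ _) CG (m / 2)%R ltac:(lra)).
assert (L := near_and _ _ _ HL (near_and _ _ _ L1 L2)).
apply locally_Cmod in L. destruct L as (d & Hd & L).
set (w := p + (d / 2)%R).
assert (Ew : w - p = (d / 2)%R) by (unfold w; ring).
destruct (L w) as [Q1 [Q2 Q3]].
{ rewrite Ew, Cmod_R, Rabs_pos_eq by lra. lra. }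
assert (Hne : w - p <> 0) by (rewrite Ew; apply RtoC_neq; lra).
assert (Hw : w <> p) by (intros Q; apply Hne; rewrite Q; ring).
specialize (Q1 Hw). cbv beta in Q3.
assert (E1 : F w * (w - p) ^ n = H w).
{ rewrite Q1. field. apply Cpow_nz, Hne. }
assert (E2 : F p * (p - p) ^ n = 0).
{ replace (p - p) with (RtoC 0) by ring. destruct n as [|k]; [lia|]. simpl. ring. }
rewrite E1, E2 in Q3. replace (H w - 0) with (H w) in Q3 by ring.
assert (T := Cmod_triangle_rev (H p) (H w)). rewrite Cmod_minus_sym in T. fold m in T. lra.
Qed.

(** * The resolvent *)

Section Resolvent.

Variables (mu : (SL2 -> R) -> R) (Hmu : is_haar mu) (Theta : char_family).
Hypothesis HTheta : forall delta s, is_character mu delta s (Theta delta s).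

Definition amp (delta : Mhat) (f : SL2 -> C) (g : SL2) (lam : C) : C :=
  char_conv (Theta delta (Ci * lam)) f g.

Lemma char_amplitude delta f g : Cc_infty f -> amplitude (amp delta f g).
Proof.
intros Hf. assert (HF := Cc_infty_translate f g Hf).
destruct (character_laplace mu Hmu delta (Theta delta) _ (HTheta delta) HF) as (r & K & A & HA & E).
assert (Ef : amp delta f g = (fun lam => laplace r A (Ci * lam))).
{ apply functional_extensionality. intros lam. apply E. }
rewrite Ef. apply (laplace_amplitude r K A HA).
Qed.

(** The residue at [pole l] of the continuation. *)
Definition residue (f : SL2 -> C) (g : SL2) (l : nat) : C :=
  2 * Ci * end_factor l * char_conv (Theta (delta_of (Z.of_nat l)) (INR l)) f g.

Lemma Zodd_pow l : ((-1) ^ l = if Z.odd (Z.of_nat l) then -1 else 1)%R.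
Proof.
induction l as [|l IH]; [reflexivity|].
rewrite Nat2Z.inj_succ, Z.odd_succ, <- Z.negb_odd.
change ((-1) ^ S l)%R with (-1 * (-1) ^ l)%R. rewrite IH.
destruct (Z.odd (Z.of_nat l)); simpl; ring.
Qed.

Lemma residue_kappa f g l : end_factor l * (Ci * PI * kappa (amp M0 f g) (-1) l)
  + end_factor l * (Ci * PI * kappa (amp M1 f g) 1 l) = residue f g l.
Proof.
assert (HPI := PI_RGT_0). unfold residue, kappa, amp, kern_residue, delta_of.
assert (E : Ci * pole l = INR l).
{ unfold pole. apply Ceq; unfold Re, Im; simpl; ring. }
rewrite E, Zodd_pow.
assert (HPC : RtoC PI <> 0) by (apply RtoC_neq; lra).
assert (E2 : RtoC (2 / PI) = 2 / PI) by (apply RtoC_div; lra).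
destruct (Z.odd (Z.of_nat l)).
- destruct (Req_EM_T (-1) (-1)); [|lra]. destruct (Req_EM_T 1 (-1)); [lra|].
  rewrite E2. field. auto.
- destruct (Req_EM_T (-1) 1); [lra|]. destruct (Req_EM_T 1 1); [|lra].
  rewrite E2. field. auto.
Qed.

Definition line_part (f : SL2 -> C) (g : SL2) (y : R) (ze : C) : C :=
  / 2 * line_int (amp M0 f g) (-1) y ze + / 2 * line_int (amp M1 f g) 1 y ze.

Lemma half_formulas n y f g ze :
  half_formula (amp M0 f g) (-1) n y ze + half_formula (amp M1 f g) 1 n y ze =
  line_part f g y ze + csum (fun l => residue f g l * / (Ci * INR l + ze)) (S n).
Proof.
unfold half_formula, line_part.
rewrite (csum_ext (fun l => residue f g l * / (Ci * INR l + ze))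
  (fun l => end_factor l * (Ci * PI * kappa (amp M0 f g) (-1) l) * / (Ci * INR l + ze)
    + end_factor l * (Ci * PI * kappa (amp M1 f g) 1 l) * / (Ci * INR l + ze))).
- rewrite csum_plus. ring.
- intros k _. rewrite <- residue_kappa. ring.
Qed.

Lemma contour0 n y f g ze (x : R) : (INR n < y < INR n + 1)%R ->
  contour_integrand0 Theta f g ze (x - Ci * y) = contour (amp M0 f g) (-1) ze (x - Ci * y).
Proof.
intros Hy. unfold contour_integrand0, contour. rewrite (Ctanh_kern n); [reflexivity| |].
- apply strip_line. lra.
- apply line_off_pole. lra.
Qed.

Lemma contour1 n y f g ze (x : R) : (INR n < y < INR n + 1)%R ->
  contour_integrand1 Theta f g ze (x - Ci * y) = contour (amp M1 f g) 1 ze (x - Ci * y).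
Proof.
intros Hy. unfold contour_integrand1, contour. rewrite (Ccoth_kern n); [reflexivity| |].
- apply strip_line. lra.
- apply line_off_pole. lra.
Qed.

Lemma sum_n_m_csum (f : nat -> C) n :
  sum_n_m (G := C_AbelianGroup) f 1 n = csum (fun k => f (S k)) n.
Proof.
induction n as [|n IH].
- apply (sum_n_m_zero (G := C_AbelianGroup)). lia.
- rewrite (sum_n_Sm (G := C_AbelianGroup)) by lia. rewrite IH. reflexivity.
Qed.

Lemma up_nat n y : (INR n < y < INR n + 1)%R -> Z.to_nat (up y) = S n.
Proof.
intros H. rewrite <- (tech_up y (Z.of_nat (S n))).
- apply Nat2Z.id.
- rewrite <- INR_IZR_INZ, S_INR. lra.
- rewrite <- INR_IZR_INZ, S_INR. lra.
Qed.

Lemma shifted_formula_split n y f g ze : (INR n < y < INR n + 1)%R ->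
  shifted_formula Theta y f g ze =
  line_part f g y ze + csum (fun l => residue f g l * / (Ci * INR l + ze)) (S n).
Proof.
intros Hy. unfold shifted_formula, line_part.
assert (E0 : int_line y (contour_integrand0 Theta f g ze) = line_int (amp M0 f g) (-1) y ze).
{ unfold int_line, line_int, int_R. apply f_equal3; try reflexivity.
  apply functional_extensionality. intros x. apply (contour0 n); auto. }
assert (E1 : int_line y (contour_integrand1 Theta f g ze) = line_int (amp M1 f g) 1 y ze).
{ unfold int_line, line_int, int_R. apply f_equal3; try reflexivity.
  apply functional_extensionality. intros x. apply (contour1 n); auto. }
rewrite E0, E1. unfold residue_sum. rewrite (up_nat n y Hy), sum_n_m_csum.
rewrite (csum_S_l (fun l => residue f g l * / (Ci * INR l + ze))).
set (t := fun l : nat => / (Ci * INR l + ze) * char_conv (Theta (delta_of (Z.of_nat l)) (INR l)) f g).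
change (csum ?f (S n)) with (csum f n + f n). cbv beta.
(* the range of summation ends with [S n], which is above [y] *)
destruct (Rlt_dec (INR (S n)) y) as [Q|_]; [rewrite S_INR in Q; lra|].
rewrite (csum_ext _ (fun k => t (S k))).
2:{ intros k Hk. destruct (Rlt_dec (INR (S k)) y) as [Q|Q]; [reflexivity|].
    exfalso. apply Q. apply lt_INR in Hk. assert (HL : (S k <= n)%nat) by (apply INR_lt in Hk; lia).
    apply le_INR in HL. lra. }
rewrite (csum_ext (fun k => residue f g (S k) * / (Ci * INR (S k) + ze)) (fun k => 2 * Ci * t (S k))).
2:{ intros k _. unfold residue, t. change (end_factor (S k)) with 1%R. ring. }
rewrite csum_scal.
assert (Er : residue f g 0 * / (Ci * INR 0 + ze) = Ci / ze * char_conv (Theta M1 0) f g).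
{ unfold residue. change (end_factor 0) with (/ 2)%R. change (delta_of (Z.of_nat 0)) with M1.
  change (INR 0) with 0%R. rewrite RtoC_inv by lra.
  replace (Ci * 0 + ze) with ze by ring. unfold Cdiv.
  replace (2 * Ci * / 2) with Ci by (field; apply RtoC_neq; lra). ring. }
rewrite Er. ring.
Qed.

Lemma nonint_floor y : (0 < y)%R -> (forall k : Z, y <> IZR k) -> exists n, (INR n < y < INR n + 1)%R.
Proof.
intros Hy Hk. destruct (archimed y) as [H1 H2].
assert (H3 : (0 < up y)%Z) by (apply lt_IZR; lra).
exists (Z.to_nat (up y - 1)). rewrite INR_IZR_INZ, Z2Nat.id by lia. rewrite minus_IZR.
assert (H4 := Hk (up y - 1)%Z). rewrite minus_IZR in H4. lra.
Qed.

Lemma sq_m1 : (-1 * -1 = 1)%R. Proof. ring. Qed.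
Lemma sq_1 : (1 * 1 = 1)%R. Proof. ring. Qed.

Lemma shifted_formula_le n1 n2 y1 y2 f g ze : Cc_infty f ->
  (INR n1 < y1 < INR n1 + 1)%R -> (INR n2 < y2 < INR n2 + 1)%R -> (y1 <= y2)%R -> (- y1 < Im ze)%R ->
  shifted_formula Theta y1 f g ze = shifted_formula Theta y2 f g ze.
Proof.
intros Hf H1 H2 H12 Hz.
rewrite (shifted_formula_split n1), (shifted_formula_split n2) by auto. rewrite <- !half_formulas.
rewrite (half_formula_indep _ _ (char_amplitude M0 f g Hf) sq_m1 n1 n2 ze y1 y2),
  (half_formula_indep _ _ (char_amplitude M1 f g Hf) sq_1 n1 n2 ze y1 y2) by auto. reflexivity.
Qed.

Lemma shifted_formula_indep n1 n2 y1 y2 f g ze : Cc_infty f ->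
  (INR n1 < y1 < INR n1 + 1)%R -> (INR n2 < y2 < INR n2 + 1)%R ->
  (- y1 < Im ze)%R -> (- y2 < Im ze)%R ->
  shifted_formula Theta y1 f g ze = shifted_formula Theta y2 f g ze.
Proof.
intros Hf H1 H2 Hz1 Hz2. destruct (Rle_dec y1 y2).
- apply (shifted_formula_le n1 n2); auto.
- symmetry. apply (shifted_formula_le n2 n1); auto. lra.
Qed.

Lemma resolvent_shifted n y f g ze : Cc_infty f -> (INR n < y < INR n + 1)%R -> (0 < Im ze)%R ->
  ex_RInt_half_line (resolvent_integrand0 Theta f g ze) /\
  ex_RInt_half_line (resolvent_integrand1 Theta f g ze) /\
  resolvent Theta f g ze = shifted_formula Theta y f g ze.
Proof.
intros Hf Hy Hz.
assert (Hax : forall x : R, (0 < x)%R -> strip 0 x /\ RtoC x <> pole 0).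
{ intros x Hx. split.
  - unfold strip. simpl. rewrite Rplus_0_r, Rabs_R0. lra.
  - intros E. apply (f_equal Re) in E. unfold pole, Re in E; simpl in E. lra. }
assert (Hh : (0 < / 2 < 1)%R) by lra.
destruct (half_line_formula _ _ (char_amplitude M0 f g Hf) sq_m1 ze (/ 2)
  (resolvent_integrand0 Theta f g ze) Hh Hz) as [X0 E0].
{ intros x Hx. unfold resolvent_integrand0. rewrite (Ctanh_kern 0) by (apply Hax, Hx). reflexivity. }
destruct (half_line_formula _ _ (char_amplitude M1 f g Hf) sq_1 ze (/ 2)
  (resolvent_integrand1 Theta f g ze) Hh Hz) as [X1 E1].
{ intros x Hx. unfold resolvent_integrand1. rewrite (Ccoth_kern 0) by (apply Hax, Hx). reflexivity. }
split; [exact X0|]. split; [exact X1|].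
assert (Hn : (0 <= INR n)%R) by apply pos_INR.
rewrite (shifted_formula_indep n 0 y (/ 2)) by (auto; simpl; lra).
rewrite (shifted_formula_split 0) by (simpl; lra). rewrite <- half_formulas.
unfold resolvent. rewrite E0, E1. reflexivity.
Qed.

Lemma line_part_diff n y f g ze : Cc_infty f -> (INR n < y < INR n + 1)%R -> (- y < Im ze)%R ->
  Cdiff (line_part f g y) ze.
Proof.
intros Hf Hy Hz. unfold line_part.
apply (Cdiff_plus (fun z => / 2 * line_int (amp M0 f g) (-1) y z)
  (fun z => / 2 * line_int (amp M1 f g) 1 y z));
  apply (Cdiff_mult (fun _ => / 2)); [apply Cdiff_const| |apply Cdiff_const|].
- apply (line_int_derive _ _ (char_amplitude M0 f g Hf) sq_m1 n); auto; lra.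
- apply (line_int_derive _ _ (char_amplitude M1 f g Hf) sq_1 n); auto; lra.
Qed.

Lemma contour_integrable n y f g ze : Cc_infty f -> (INR n < y < INR n + 1)%R -> (- y < Im ze)%R ->
  ex_int_line y (contour_integrand0 Theta f g ze) /\ ex_int_line y (contour_integrand1 Theta f g ze).
Proof.
intros Hf Hy Hz. assert (Hs : (INR n - 1 < y < INR n + 1)%R) by lra. assert (Hn : y <> INR n) by lra.
unfold ex_int_line. split.
- rewrite (functional_extensionality _ _ (fun x => contour0 n y f g ze x Hy)).
  destruct (contour_decaying _ _ (char_amplitude M0 f g Hf) sq_m1 n y ze Hs Hn Hz) as [M HM].
  apply (line_integral _ M HM).
- rewrite (functional_extensionality _ _ (fun x => contour1 n y f g ze x Hy)).
  destruct (contour_decaying _ _ (char_amplitude M1 f g Hf) sq_1 n y ze Hs Hn Hz) as [M HM].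
  apply (line_integral _ M HM).
Qed.

(** After a translation by [g], the test function is the bump, on which no
    character with real parameter vanishes. *)
Lemma residue_nonzero g l : exists f, Cc_infty f /\ residue f g l <> 0.
Proof.
exists (fun x => bump (SL2_mul (SL2_inv g) x)). split; [apply Cc_infty_translate, bump_Cc|].
unfold residue, char_conv.
assert (E : (fun x => bump (SL2_mul (SL2_inv g) (SL2_mul g x))) = bump).
{ apply functional_extensionality. intros x. rewrite <- SL2_mul_assoc, SL2_mul_inv_l, SL2_mul_1_l. reflexivity. }
rewrite E. apply Cmult_integral_contr; [apply Cmult_integral_contr|].
- intros Q. apply (f_equal Im) in Q. unfold Im in Q; simpl in Q. lra.
- apply RtoC_neq. destruct l; simpl; lra.
- apply (bump_character mu Hmu (delta_of (Z.of_nat l)) (INR l)), HTheta.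
Qed.

Lemma shifted_formula_holomorphic n y f g p : Cc_infty f -> (INR n < y < INR n + 1)%R -> (- y < Im p)%R ->
  (forall l, p <> pole l) -> holomorphic_at (shifted_formula Theta y f g) p.
Proof.
intros Hf Hy Hp Hn.
apply (polar_sum_holomorphic y (S n) _ (line_part f g y) (residue f g)); auto.
- intros; apply shifted_formula_split, Hy.
- intros; apply (line_part_diff n); auto.
Qed.

Lemma shifted_formula_pole n y f g l : Cc_infty f -> (INR n < y < INR n + 1)%R -> (INR l < y)%R ->
  exists H : C -> C, holomorphic_at H (pole l) /\ H (pole l) = residue f g l /\
    locally (pole l) (fun w : C => w <> pole l ->
      shifted_formula Theta y f g w = H w / (w - pole l) ^ 1).
Proof.
intros Hf Hy Hl.
apply (polar_sum_pole y (S n) _ (line_part f g y) (residue f g)).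
- intros; apply shifted_formula_split, Hy.
- intros; apply (line_part_diff n); auto.
- lra.
- assert (Q : (INR l < INR (S n))%R) by (rewrite S_INR; lra). apply INR_lt, Q.
Qed.

(** ** The continuation to the whole surface *)

(** A height above [- Im ze] that is never an integer. *)
Definition depth (ze : C) : R := (INR (Z.to_nat (up (Rabs (Im ze)))) + / 2)%R.

Lemma depth_floor ze : (INR (Z.to_nat (up (Rabs (Im ze)))) < depth ze
  < INR (Z.to_nat (up (Rabs (Im ze)))) + 1)%R.
Proof. unfold depth. lra. Qed.

Lemma depth_below ze : (- depth ze < Im ze)%R.
Proof.
unfold depth. destruct (archimed (Rabs (Im ze))) as [H _]. assert (H0 := Rabs_pos (Im ze)).
assert (H3 : (0 < up (Rabs (Im ze)))%Z) by (apply lt_IZR; lra).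
rewrite INR_IZR_INZ, Z2Nat.id by lia.
assert (H2 := Rle_abs (- Im ze)). rewrite Rabs_Ropp in H2. lra.
Qed.

(** The height of the contour may vary with the point, since the values of the
    shifted formulas agree where they are defined. *)
Definition continuation : surf_family := fun f g p => shifted_formula Theta (depth (snd p)) f g (snd p).

Lemma continuation_shifted n y f g ze : Cc_infty f -> (INR n < y < INR n + 1)%R -> (- y < Im ze)%R ->
  shifted_formula Theta (depth ze) f g ze = shifted_formula Theta y f g ze.
Proof.
intros Hf Hy Hz. apply (shifted_formula_indep _ n _ y f g ze Hf (depth_floor ze) Hy (depth_below ze) Hz).
Qed.

Lemma continuation_near f g p : Cc_infty f -> exists n y, (INR n < y < INR n + 1)%R /\ (- y < Im p)%R /\
  Cnear p (fun w => in_chart continuation f g w = shifted_formula Theta y f g w).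
Proof.
intros Hf. exists (Z.to_nat (up (Rabs (Im p)))), (depth p).
split; [apply depth_floor|]. split; [apply depth_below|].
refine (near_imp _ _ _ _ (locally_half_plane p (depth p) (depth_below p))).
intros w Hw. unfold in_chart, continuation, surf_chart. cbn [snd].
apply (continuation_shifted _ _ _ _ _ Hf (depth_floor p) Hw).
Qed.

Lemma continuation_holomorphic f g p : Cc_infty f -> (forall l, p <> pole l) ->
  holomorphic_at (in_chart continuation f g) p.
Proof.
intros Hf Hn. destruct (continuation_near f g p Hf) as (n & y & Hy & Hp & HL).
assert (H := shifted_formula_holomorphic n y f g p Hf Hy Hp Hn).
refine (near_imp _ _ _ _ (near_and _ _ _ (locally_locally _ _ HL) H)).
intros w [W1 [d W2]]. exists d. refine (is_Cderive_ext_loc _ _ _ _ _ W2).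
refine (near_imp _ _ _ _ W1). intros z Hz. symmetry. exact Hz.
Qed.

Lemma continuation_pole f g l : Cc_infty f ->
  exists H : C -> C, holomorphic_at H (pole l) /\ H (pole l) = residue f g l /\
    locally (pole l) (fun w : C => w <> pole l -> in_chart continuation f g w = H w / (w - pole l) ^ 1).
Proof.
intros Hf. destruct (continuation_near f g (pole l) Hf) as (n & y & Hy & Hp & HL).
rewrite Im_pole in Hp.
destruct (shifted_formula_pole n y f g l Hf Hy ltac:(lra)) as (H & H1 & H2 & H3).
exists H. split; [exact H1|]. split; [exact H2|].
refine (near_imp _ _ _ _ (near_and _ _ _ HL H3)). intros w [W1 W2] Hw. rewrite W1. auto.
Qed.

Lemma simple_pole_family (Phi : (SL2 -> C) -> SL2 -> C -> C) l :
  (forall f g, Cc_infty f -> exists H : C -> C, holomorphic_at H (pole l) /\ H (pole l) = residue f g l /\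
    locally (pole l) (fun w : C => w <> pole l -> Phi f g w = H w / (w - pole l) ^ 1)) ->
  family_simple_pole Phi (pole l).
Proof.
intros HP. split.
- intros f g Hf. destruct (HP f g Hf) as (H & H1 & H2 & H3). exists H. auto.
- intros g. destruct (residue_nonzero g l) as (f & Hf & Hr).
  destruct (HP f g Hf) as (H & H1 & H2 & H3). exists f. split; [exact Hf|].
  exists H. rewrite H2. auto.
Qed.

End Resolvent.

Lemma surf_pole p l : surf p -> snd p = pole l -> p = (1 - INR l ^ 2, - (Ci * INR l)).
Proof.
destruct p as [z ze]. unfold surf; simpl. intros -> ->. unfold pole.
apply (f_equal (fun a => (a, - (Ci * INR l)))).
replace (RtoC 1 - INR l * (INR l * 1)) with (1 + (Ci * Ci) * (INR l * INR l)); [ring|].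
replace (Ci * Ci) with (- (1)); [ring|]. apply Ceq; unfold Re, Im; simpl; ring.
Qed.

Lemma pole_surf p l : p = (1 - INR l ^ 2, - (Ci * INR l)) -> surf p /\ snd p = pole l.
Proof.
intros ->. split; [|reflexivity]. unfold surf; cbn [fst snd].
replace (1 - INR l ^ 2) with (1 + (Ci * Ci) * (INR l * INR l)).
- ring.
- replace (Ci * Ci) with (- (1)); [ring|]. apply Ceq; unfold Re, Im; simpl; ring.
Qed.

Theorem proposition3p2 (mu : (SL2 -> R) -> R) (Hmu : is_haar mu)
  (Theta : Mhat -> C -> (SL2 -> C) -> C)
  (HTheta : forall (delta : Mhat) (s : C),
     is_character mu delta s (Theta delta s)) :
  (forall (y : R) (Hy : (0 < y)%R) (HyZ : forall k : Z, y <> IZR k),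
    (forall (f : SL2 -> C) (g : SL2) (zeta : C),
      Cc_infty f -> (0 < Im zeta)%R ->
      ex_RInt_half_line (resolvent_integrand0 Theta f g zeta) /\
      ex_RInt_half_line (resolvent_integrand1 Theta f g zeta) /\
      resolvent Theta f g zeta = shifted_formula Theta y f g zeta) /\
    (forall (f : SL2 -> C) (g : SL2) (zeta : C),
      Cc_infty f -> (- y < Im zeta)%R ->
      ex_int_line y (contour_integrand0 Theta f g zeta) /\
      ex_int_line y (contour_integrand1 Theta f g zeta)) /\
    meromorphic_with_simple_poles (shifted_formula Theta y)
      (fun zeta => (- y < Im zeta)%R)
      (fun zeta => exists l : nat, (INR l < y)%R /\ zeta = - (Ci * INR l))) /\
  (exists Rt : (SL2 -> C) -> SL2 -> C * C -> C,
    (forall (f : SL2 -> C) (g : SL2) (p : C * C),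
      Cc_infty f -> surf_plus p -> Rt f g p = resolvent Theta f g (snd p)) /\
    (forall (y : R) (Hy : (0 < y)%R) (HyZ : forall k : Z, y <> IZR k)
       (f : SL2 -> C) (g : SL2) (p : C * C),
      Cc_infty f -> surf p -> (- y < Im (snd p))%R ->
      (forall l : nat, snd p <> - (Ci * INR l)) ->
      Rt f g p = shifted_formula Theta y f g (snd p)) /\
    surf_meromorphic_with_simple_poles Rt
      (fun p => exists l : nat, p = (1 - INR l ^ 2, - (Ci * INR l))) /\
    (forall p : C * C,
      is_resonance Rt p <->
      exists l : nat, p = (1 - INR l ^ 2, - (Ci * INR l)))).
Proof.
assert (Rpole : forall l, family_simple_pole (in_chart (continuation Theta)) (pole l)).
{ intros l. apply (simple_pole_family mu Hmu Theta HTheta). intros f g Hf.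
  apply (continuation_pole mu Hmu Theta HTheta f g l Hf). }
assert (Rhol : forall f g p, Cc_infty f -> (forall l, p <> pole l) ->
  holomorphic_at (in_chart (continuation Theta) f g) p).
{ intros f g p. apply (continuation_holomorphic mu Hmu Theta HTheta). }
split; [|exists (continuation Theta); split; [|split; [|split]]].
- intros y Hy HyZ. destruct (nonint_floor y Hy HyZ) as [n Hn]. split; [|split].
  + intros f g ze Hf Hz. apply (resolvent_shifted mu Hmu Theta HTheta n y f g ze Hf Hn Hz).
  + intros f g ze Hf Hz. split.
    * apply (contour_integrable mu Hmu Theta HTheta n y f g ze Hf Hn Hz).
    * apply (contour_integrable mu Hmu Theta HTheta n y f g ze Hf Hn Hz).
  + intros p Hp. split.
    * intros (l & Hl & ->). apply (simple_pole_family mu Hmu Theta HTheta). intros f g Hf.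
      apply (shifted_formula_pole mu Hmu Theta HTheta n y f g l Hf Hn Hl).
    * intros HnP f g Hf. apply (shifted_formula_holomorphic mu Hmu Theta HTheta n y f g p Hf Hn Hp).
      intros l ->. apply HnP. exists l. split; [|reflexivity]. rewrite Im_pole in Hp. lra.
- intros f g p Hf [Hs Hp]. symmetry. unfold continuation.
  apply (resolvent_shifted mu Hmu Theta HTheta _ _ f g (snd p) Hf (depth_floor (snd p)) Hp).
- intros y Hy HyZ f g p Hf Hs Hp _. destruct (nonint_floor y Hy HyZ) as [n Hn].
  apply (continuation_shifted mu Hmu Theta HTheta n y f g (snd p) Hf Hn Hp).
- intros p Hs. split.
  + intros (l & Hl). destruct (pole_surf p l Hl) as [_ ->]. apply Rpole.
  + intros HnP f g Hf. apply Rhol; auto. intros l Hl. apply HnP. exists l. apply surf_pole; auto.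
- intros p. split.
  + intros (Hs & f & g & n & Hf & Hn & Hpole). apply NNPP. intros HnP.
    apply (pole_not_holomorphic _ _ _ Hn Hpole). apply Rhol; auto.
    intros l Hl. apply HnP. exists l. apply surf_pole; auto.
  + intros (l & Hl). destruct (pole_surf p l Hl) as [Hs Es]. split; [exact Hs|].
    destruct (proj2 (Rpole l) (elt_m false)) as (f & Hf & Hp).
    exists f, (elt_m false), 1%nat. rewrite Es. auto.
Qed.
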